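(* Let $T\in(0,\infty)$, $\varrho\in(\frac18,\frac14)$, $\chi\in(0,\frac{\varrho}{2}-\frac1{16}]$, $H=L^2((0,1);\mathbb R)$, let $A\colon D(A)\subseteq H\to H$ be the Laplace operator with Dirichlet boundary conditions on $H$, let $(H_r,\langle\cdot,\cdot\rangle_{H_r},\|\cdot\|_{H_r})$, $r\in\mathbb R$, be a family of interpolation spaces associated to $-A$, let $\xi\in H_{1/2}$, let $F\colon H_{1/8}\to H_{-1/2}$, $(e_n)_{n\in\mathbb N}\colon\mathbb N\to H$, $(P_n)_{n\in\mathbb N}\colon\mathbb N\to L(H)$, and $(h_n)_{n\in\mathbb N}\colon\mathbb N\to(0,T]$ be functions which satisfy for all $v\in H_{1/8}$, $n\in\mathbb N$ that $F(v)=-\frac12(v^2)'$, $e_n=(\sqrt2\sin(n\pi x))_{x\in(0,1)}$, for all $v\in H$, $n\in\mathbb N$ that $P_n(v)=\sum_{k=1}^n\langle e_k,v\rangle_He_k$, and $\limsup_{m\to\infty}h_m=0$. Let $(\Omega,\mathcal F,\mathbb P)$ be a probability space, let $(W_t)_{t\in[0,T]}$ be an $\mathrm{Id}_H$-cylindrical $(\Omega,\mathcal F,\mathbb P)$-Wiener process, let $\mathcal X^n,\mathcal O^n\colon[0,T]\times\Omega\to P_n(H)$, $n\in\mathbb N$, be stochastic processes, and assume that for all $n\in\mathbb N$, $t\in[0,T]$ it holds $\mathbb P$-a.s. that $\mathcal O^n_t=\int_0^tP_n\,e^{(t-s)A}\,dW_s$ and $$\mathcal X^n_t=P_n e^{tA}\xi+\int_0^tP_n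 e^{(t-s)A}\,\mathbf 1_{\{\|\mathcal X^n_{\lfloor s\rfloor_{h_n}}\|_{H_\varrho}+\|\mathcal O^n_{\lfloor s\rfloor_{h_n}}+P_ne^{\lfloor s\rfloor_{h_n}A}\xi\|_{H_\varrho}\le|h_n|^{-\chi}\}}\,F\big(\mathcal X^n_{\lfloor s\rfloor_{h_n}}\big)\,ds+\mathcal O^n_t.$$ Then (i) there exists an up-to-indistinguishability unique stochastic process $X\colon[0,T]\times\Omega\to H_\varrho$ with continuous sample paths which satisfies that for all $t\in[0,T]$ it holds $\mathbb P$-a.s. that $X_t=e^{tA}\xi+\int_0^te^{(t-s)A}F(X_s)\,ds+\int_0^te^{(t-s)A}\,dW_s$, and (ii) it holds for all $p\in(0,\infty)$ that $\limsup_{n\to\infty}\sup_{t\in[0,T]}\mathbb E\big[\|X_t-\mathcal X^n_t\|_H^p\big]=0$.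
   Context: $\mathbb N=\{1,2,3,\dots\}$. For $h\in(0,\infty)$, $t\in\mathbb R$: $\lfloor t\rfloor_h=\max((-\infty,t]\cap\{0,h,-h,2h,-2h,\dots\})$. Interpolation spaces associated to $-A$: for $r\ge0$, $H_r=D((-A)^r)$ with $\langle v,w\rangle_{H_r}=\langle(-A)^rv,(-A)^rw\rangle_H$; for $r<0$, $H_r$ is the completion of $H$ with respect to $\|(-A)^r\cdot\|_H$; in particular $H_r\subseteq H_s$ for $r\ge s$, and $e^{tA}$, $(-A)^r$ act on these spaces by their continuous extensions. For $v\in H_{1/8}\subseteq L^4((0,1);\mathbb R)$ one has $v^2\in H$, and $(v^2)'\in H_{-1/2}$ denotes the distributional derivative ($\langle u',w\rangle=-\langle u,w'\rangle_H$ for $u\in H$, $w\in H_{1/2}$). $X$ is the mild solution of the stochastic Burgers equation with space-time white noise and Dirichlet boundary conditions. *)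

(* Defs.v *)
From HB Require Import structures.
From mathcomp Require Import all_boot all_order all_algebra.
From mathcomp Require Import all_classical all_reals all_analysis.
From mathcomp Require Import measurable_realfun.
Set Implicit Arguments.
Unset Strict Implicit.
Unset Printing Implicit Defensive.
Import Order.TTheory GRing.Theory Num.Theory.
Import numFieldNormedType.Exports.
Local Open Scope classical_set_scope.
Local Open Scope ring_scope.
Local Open Scope quotient_scope.

(* The Hilbert space L2 = L^2((0,1); R): square integrable functions on R for
   Lebesgue measure restricted to ]0,1[, modulo almost everywhere equality.
   The library has the vector space of functions (LfunType) but no vector space
   structure on its quotient. *)
Section L2.
Context (R : realType).

Definition leb01 : {measure set (measurableTypeR R) -> \bar R} :=
  mrestr lebesgue_measure (measurable_itv `]0%R : R, 1%R[).

Local Notation sqint := (LfunType leb01 (lee1n 2 : (1 <= 2%:R%:E :> \bar R)%E)).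

Definition aeq (f g : sqint) : bool := `[< {ae leb01, forall x, f x = g x} >].

Lemma aeq_refl : reflexive aeq.
Proof. by move=> f; apply/asboolP; exact: aeW. Qed.

Lemma aeq_sym : symmetric aeq.
Proof.
by move=> f g; apply/idP/idP => /asboolP h; apply/asboolP;
  move: h; apply: filterS => x ->.
Qed.

Lemma aeq_trans : transitive aeq.
Proof.
move=> f g h /asboolP gf /asboolP fh; apply/asboolP.
by move: gf fh; apply: filterS2 => x -> ->.
Qed.

Canonical aeq_canonical := EquivRel aeq aeq_refl aeq_sym aeq_trans.

Definition L2 : Type := {eq_quot aeq}.
HB.instance Definition _ := Choice.on L2.
HB.instance Definition _ := EqQuotient.on L2.

Definition L2add : L2 -> L2 -> L2 := lift_op2 L2 +%R.
Definition L2opp : L2 -> L2 := lift_op1 L2 -%R.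
Definition L2scale (a : R) : L2 -> L2 := lift_op1 L2 ( *:%R a).

Lemma repr_piL2 (f : sqint) : {ae leb01, forall x, f x = repr (\pi_L2 f) x}.
Proof. by apply/asboolP/(@eqquotP _ aeq L2); rewrite reprK. Qed.

Lemma piL2D (f g : sqint) : \pi_L2 (f + g) = L2add (\pi f) (\pi g).
Proof.
unlock L2add; apply/eqquotP/asboolP.
move: (repr_piL2 f) (repr_piL2 g); apply: filterS2 => x fE gE.
by rewrite -[LHS]/(f x + g x) fE gE.
Qed.

Lemma piL2N (f : sqint) : \pi_L2 (- f) = L2opp (\pi f).
Proof.
unlock L2opp; apply/eqquotP/asboolP.
by move: (repr_piL2 f); apply: filterS => x fE; rewrite -[LHS]/(- f x) fE.
Qed.

Lemma piL2Z a (f : sqint) : \pi_L2 (a *: f) = L2scale a (\pi f).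
Proof.
unlock L2scale; apply/eqquotP/asboolP.
by move: (repr_piL2 f); apply: filterS => x fE; rewrite -[LHS]/(a * f x) fE.
Qed.

Lemma L2addA : associative L2add.
Proof.
move=> u v w; rewrite -(reprK u) -(reprK v) -(reprK w).
by rewrite -!piL2D addrA.
Qed.

Lemma L2addC : commutative L2add.
Proof. by move=> u v; rewrite -(reprK u) -(reprK v) -!piL2D addrC. Qed.

Lemma L2add0 : left_id (\pi_L2 0) L2add.
Proof. by move=> u; rewrite -(reprK u) -!piL2D add0r. Qed.

Lemma L2addN : left_inverse (\pi_L2 0) L2opp L2add.
Proof. by move=> u; rewrite -(reprK u) -piL2N -!piL2D addNr. Qed.

HB.instance Definition _ :=
  GRing.isZmodule.Build L2 L2addA L2addC L2add0 L2addN.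

Lemma L2scaleA a b u : L2scale a (L2scale b u) = L2scale (a * b) u.
Proof. by rewrite -(reprK u) -!piL2Z scalerA. Qed.

Lemma L2scale1 : left_id 1 L2scale.
Proof. by move=> u; rewrite -(reprK u) -!piL2Z scale1r. Qed.

Lemma L2scaleDr : right_distributive L2scale +%R.
Proof.
move=> a u v; rewrite -(reprK u) -(reprK v).
by rewrite -[LHS]/(L2scale _ (L2add _ _)) -piL2D -!piL2Z scalerDr piL2D.
Qed.

Lemma L2scaleDl u : {morph L2scale ^~ u : a b / a + b}.
Proof. by move=> a b; rewrite -(reprK u) -!piL2Z scalerDl piL2D. Qed.

HB.instance Definition _ := GRing.Zmodule_isLmodule.Build R L2
  L2scaleA L2scale1 L2scaleDr L2scaleDl.

(* Class of f; the zero class if f is not square integrable on ]0,1[. *)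
Definition toL2 (f : R -> R) : L2 := \pi_L2 (insubd (0 : sqint) f).

Definition ip (u v : L2) : R := \int[leb01]_x (repr u x * repr v x).

Definition hnorm (u : L2) : R := Num.sqrt (ip u u).

Definition sqrL2 (v : L2) : L2 := toL2 (fun x => repr v x ^+ 2).

End L2.

Section Laplacian.
Context (R : realType).
Local Notation H := (L2 R).

Definition test_fun : set (R -> R) :=
  [set phi | (forall n x, derivable (derive1n n phi) x 1) /\
     exists a b : R, [/\ 0 < a, b < 1 & forall x, phi x != 0 -> a <= x <= b]].

Definition weak_deriv (u g : H) : Prop :=
  forall phi, test_fun phi -> ip u (toL2 (derive1 phi)) = - ip g (toL2 phi).

Definition wderiv (u : H) : H := xget 0 [set g | weak_deriv u g].

(* H^1_0((0,1)), the closure of the test functions for the H^1 norm. *)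
Definition H10 : set H := [set v | exists (g : H) (phi : nat -> R -> R),
  [/\ forall n, test_fun (phi n),
      hnorm (toL2 (phi n) - v) @[n --> \oo] --> (0 : R)
    & hnorm (toL2 (derive1 (phi n)) - g) @[n --> \oo] --> (0 : R)]].

(* Graph of the Dirichlet Laplacian A: v is in D(A), which is the intersection
   of H^1_0 and H^2, and A v = w. *)
Definition dirichlet_laplacian (v w : H) : Prop :=
  H10 v /\ exists2 g, weak_deriv v g & weak_deriv g w.

(* f(-A) v, for the functional calculus of the self-adjoint operator -A, whose
   eigenvectors span a dense subspace: f(-A) v is the vector w which satisfies
   <phi, w> = f(l) <phi, v> whenever -A phi = l phi; v is in D(f(-A)) if and
   only if there is such a vector. *)
Definition is_fcalc (f : R -> R) (v w : H) : Prop :=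
  forall l phi, dirichlet_laplacian phi (- (l *: phi)) ->
    ip phi w = f l * ip phi v.

Definition fcalc (f : R -> R) (v : H) : H := xget 0 [set w | is_fcalc f v w].

Definition semigroup (t : R) : H -> H := fcalc (fun l => expR (- (t * l))).

Definition npow (r : R) : H -> H := fcalc (fun l => l `^ r).

Definition Hdom (r : R) : set H :=
  [set v | exists w, is_fcalc (fun l => l `^ r) v w].

Definition Hnorm (r : R) (v : H) : R := hnorm (npow r v).

(* For r < 0, Hneg r with the map emb r is a completion of H for the norm
   Hnorm r.  For r >= 0, H_r is the subset Hdom r of H, normed by Hnorm r. *)
Definition negative_interpolation_spaces
    (Hneg : R -> completeNormedModType R)
    (emb : forall r, {linear H -> Hneg r}) : Prop :=
  forall r, r < 0 ->
    (forall v, `|emb r v| = Hnorm r v) /\ dense (range (emb r)).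

Section negative.
Context (Hneg : R -> completeNormedModType R).
Context (emb : forall r, {linear H -> Hneg r}).

(* Continuous extension of <., w>_H to H_r, r < 0, for w in H_{-r}. *)
Definition dual_pairing (r : R) (f : Hneg r) (w : H) : R :=
  xget 0 [set l | forall v : nat -> H,
    emb r (v n) @[n --> \oo] --> f -> ip (v n) w @[n --> \oo] --> l].

(* u' in H_{-1/2}, for u in H *)
Definition distr_deriv (u : H) : Hneg (- 2^-1) :=
  xget 0 [set f | forall w, Hdom 2^-1 w ->
    dual_pairing f w = - ip u (wderiv w)].

(* Continuous extension of e^{tA} to an operator from H_r, r < 0, to H; there
   is one for t > 0 only. *)
Definition semigroup_ext (r t : R) (f : Hneg r) : H :=
  xget 0 [set u | forall v : nat -> H, emb r (v n) @[n --> \oo] --> f ->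
    hnorm (semigroup t (v n) - u) @[n --> \oo] --> (0 : R)].

End negative.

(* max of the multiples of h in ]-oo, t] *)
Definition floor_grid (h t : R) : R :=
  sup [set x | x <= t /\ exists k : int, x = k%:~R * h].

End Laplacian.

Section Bochner.
Context (R : realType).
Local Notation H := (L2 R).
Local Notation leb := (@lebesgue_measure R).

Record simple_function := SimpleFunction {
  sf_size : nat;
  sf_set : nat -> set R;
  sf_val : nat -> H;
  sf_measurable : forall i, measurable (sf_set i) }.

Definition sf_fun (s : simple_function) (x : R) : H :=
  \sum_(i < sf_size s) \1_(sf_set s i) x *: sf_val s i.

Definition sf_integral (D : set R) (s : simple_function) : H :=
  \sum_(i < sf_size s) fine (leb (sf_set s i `&` D)) *: sf_val s i.

(* f is Bochner integrable on D, with integral I. *)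
Definition is_bochner_integral (D : set R) (f : R -> H) (I : H) : Prop :=
  exists s : nat -> simple_function,
    [/\ forall n, measurable_fun D (fun x => hnorm (f x - sf_fun (s n) x)),
        (\int[leb]_(x in D) (hnorm (f x - sf_fun (s n) x))%:E)%E
          @[n --> \oo] --> 0%E
      & hnorm (sf_integral D (s n) - I) @[n --> \oo] --> (0 : R)].

End Bochner.

Section Stochastic.
Context (R : realType) (d : measure_display) (Omega : measurableType d).
Context (P : probability Omega R).
Local Notation H := (L2 R).
Local Notation leb := (@lebesgue_measure R).

Definition norm_open (D : set H) (N : H -> R) (U : set H) : Prop :=
  U `<=` D /\ forall v, U v ->
    exists2 e : R, 0 < e & forall w, D w -> N (w - v) < e -> U w.

(* Y is measurable for the Borel sigma-algebra of the space D normed by N. *)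
Definition random_element (D : set H) (N : H -> R) (Y : Omega -> H) : Prop :=
  (forall w, D (Y w)) /\
  forall U, norm_open D N U -> measurable (Y @^-1` U).

(* An Id_H-cylindrical Wiener process on [0, T]; W t v stands for <W_t, v>. *)
Record cylindrical_wiener (T : R) (W : R -> H -> Omega -> R) : Prop := {
  cw_measurable : forall (t : R) (v : H), 0 <= t <= T ->
    measurable_fun [set: Omega] (W t v);
  cw_linear : forall (t a : R) (u v : H), 0 <= t <= T ->
    {ae P, forall w, W t (a *: u + v) w = a * W t u w + W t v w};
  cw_start : forall v : H, {ae P, forall w, W 0 v w = 0};
  cw_continuous : forall v : H,
    {ae P, forall w, {within `[0, T], continuous (fun t : R => W t v w)}};
  cw_gaussian : forall (s t : R) (v : H) (B : set R),
    0 <= s -> s < t -> t <= T -> v != 0 -> measurable B ->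
    P [set w | B (W t v w - W s v w)] =
      normal_prob 0 (Num.sqrt (t - s) * hnorm v) B;
  (* increments are independent of the past *)
  cw_independent : forall (s t : R) (m n : nat) (r : 'I_m -> R)
      (u : 'I_m -> H) (B : 'I_m -> set R) (v : 'I_n -> H) (C : 'I_n -> set R),
    0 <= s -> s <= t -> t <= T -> (forall i, 0 <= r i <= s) ->
    (forall i, measurable (B i)) -> (forall j, measurable (C j)) ->
    let past := [set w | forall i, B i (W (r i) (u i) w)] in
    let future := [set w | forall j, C j (W t (v j) w - W s (v j) w)] in
    P (past `&` future) = (P past * P future)%E }.

(* The deterministic operator-valued step functions
   sum_i 1_{]lo i, hi i]} <arg i, .> out i on [0, t]. *)
Record step_operator (t : R) := StepOperator {
  so_size : nat;
  so_lo : nat -> R;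
  so_hi : nat -> R;
  so_arg : nat -> H;
  so_out : nat -> H;
  so_bounds : forall i, 0 <= so_lo i /\ so_lo i <= so_hi i /\ so_hi i <= t }.

Definition so_op t (s : step_operator t) (x : R) (v : H) : H :=
  \sum_(i < so_size s)
    (\1_(`]so_lo s i, so_hi s i]) x * ip (so_arg s i) v) *: so_out s i.

Definition so_integral t (s : step_operator t) (W : R -> H -> Omega -> R)
    (w : Omega) : H :=
  \sum_(i < so_size s)
    (W (so_hi s i) (so_arg s i) w - W (so_lo s i) (so_arg s i) w)
      *: so_out s i.

(* Squared Hilbert-Schmidt norm; (e n), n >= 1, is an orthonormal basis. *)
Definition hs_norm2 (e : nat -> H) (L : H -> H) : \bar R :=
  (\sum_(1 <= k <oo) (hnorm (L (e k)) ^+ 2)%:E)%E.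

(* Y is a version of int_0^t Phi(x) dW_x: the L^2(P; H) limit of the integrals
   of step functions which converge to Phi in L^2([0, t]; HS(H)). *)
Definition is_stochastic_integral (e : nat -> H) (W : R -> H -> Omega -> R)
    (t : R) (Phi : R -> H -> H) (Y : Omega -> H) : Prop :=
  random_element setT (@hnorm R) Y /\
  exists s : nat -> step_operator t,
    let err n x := hs_norm2 e (fun v => Phi x v - so_op (s n) x v) in
    [/\ forall n, measurable_fun `[0, t] (err n),
        (\int[leb]_(x in `[0%R, t]) err n x)%E @[n --> \oo] --> 0%E
      & (\int[P]_w (hnorm (so_integral (s n) W w - Y w) ^+ 2)%:E)%E
          @[n --> \oo] --> 0%E].

(* X : [0, T] x Omega -> H_rho has continuous sample paths and
   X_t = e^{tA} xi + int_0^t e^{(t-s)A} F(X_s) ds + int_0^t e^{(t-s)A} dW_s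
   P-a.s. for all t in [0, T].  (The first integrand takes its values in H for
   s < t.) *)
Definition mild_solution (Hneg : R -> completeNormedModType R)
    (emb : forall r, {linear H -> Hneg r}) (e : nat -> H)
    (W : R -> H -> Omega -> R) (F : H -> Hneg (- 2^-1)) (T rho : R) (xi : H)
    (X : R -> Omega -> H) : Prop :=
  [/\ forall t, 0 <= t <= T ->
        random_element (@Hdom R rho) (@Hnorm R rho) (X t),
      forall w t, 0 <= t <= T ->
        Hnorm rho (X s w - X t w) @[s --> within `[0, T] (nbhs t)] --> (0 : R)
    & forall t, 0 <= t <= T ->
        exists2 Z, is_stochastic_integral e W t (fun s => semigroup (t - s)) Z
          & {ae P, forall w, exists2 I,
              is_bochner_integral `[0, t]
                (fun s => semigroup_ext emb (t - s) (F (X s w))) I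
              & X t w = semigroup t xi + I + Z w}].

End Stochastic.

(* Main.v *)
(** The argument is pathwise.  In the sine basis the equation and the scheme become systems of scalar Volterra
    equations, driven by Ornstein-Uhlenbeck integrals of the coordinates of W; partial integration makes sense of
    these for every Hoelder continuous path.  A chaining bound controls the Hoelder constants of all coordinates
    by one random variable K with finite moments, and every estimate depends on the path through K only.  Since
    <v, F(v)> = 0, an energy estimate for the scheme minus a strongly damped Ornstein-Uhlenbeck process bounds
    the scheme by a polynomial in K; so the truncation is inactive for small h_n.  The k-th coordinate of F is
    locally Lipschitz on H with constant O(k), and a Gronwall argument shows that the scheme is Cauchy in H,
    uniformly on [0, T] and on {K <= L}.  Its limit solves the equation, uniquely by the same Gronwall argument,
    and the polynomial bound in K upgrades the convergence to convergence of all moments. *)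

Require Import Defs.
From mathcomp Require Import all_boot all_order all_algebra.
From mathcomp Require Import all_classical all_reals all_analysis.
From mathcomp Require Import measurable_realfun.
From mathcomp Require Import ring lra zify.
Set Implicit Arguments.
Unset Strict Implicit.
Unset Printing Implicit Defensive.
Import Order.TTheory GRing.Theory Num.Theory.
Import numFieldNormedType.Exports.
Local Open Scope classical_set_scope.
Local Open Scope ring_scope.

Local Notation leb := lebesgue_measure.
Local Notation mu01 := (leb01 _).

(** Exponents: since lam k grows like k^2, the Hoelder constants of the coordinates of W (any order
    al < 1/2) become square summable after the weight lam k ^ (- ga) with ga > 1/4.
    Ornstein-Uhlenbeck paths then lie in H_r for r <= al - ga, which can approach 1/4; this is why
    rho < 1/4. The square of v is controlled through L^4, hence through H_bb with bb > 1/8. In a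
    grid cell the drift is frozen, and the energy argument pays for the increment of the path in
    H_bb, while the truncation only offers h^(- chi) in H_rho and h^(- 2 chi) for the drift.
    Smallness asks for 1/8 < bb < rho - chi and 2 chi < 1/4 - bb; a suitable bb exists because chi
    <= rho/2 - 1/16. Null sets are the second obstacle: the equations hold almost surely for each
    time separately, and the scheme is not assumed continuous. Paths are therefore rebuilt from
    their values at grid times, on one event that involves countably many times. Objects chosen by
    [xget] are handled by proving that a valid choice exists; afterwards everything is identified by
    its coordinates against the sines. *)

Lemma eq_ler (R : numDomainType) (x y : R) : x = y -> x <= y.
Proof. by move=> ->. Qed.

Lemma ge0_powR_le (R : realType) (r a b : R) : 0 <= r -> 0 <= a -> a <= b -> a `^ r <= b `^ r.
Proof. by move=> r0 a0 ab; apply: ge0_ler_powR => //; rewrite nnegrE (le_trans a0). Qed.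

Section AlmostEverywhere.
Context {d} {T : measurableType d} {R : realType} (mu : {measure set T -> \bar R}).

Lemma aeS (P Q : T -> Prop) : (forall x, P x -> Q x) ->
  {ae mu, forall x, P x} -> {ae mu, forall x, Q x}.
Proof. by move=> PQ; apply: filterS. Qed.

Lemma aeS2 (P1 P2 Q : T -> Prop) : (forall x, P1 x -> P2 x -> Q x) ->
  {ae mu, forall x, P1 x} -> {ae mu, forall x, P2 x} -> {ae mu, forall x, Q x}.
Proof. by move=> PQ; apply: filterS2. Qed.

Lemma aeI (P1 P2 : T -> Prop) : {ae mu, forall x, P1 x} -> {ae mu, forall x, P2 x} ->
  {ae mu, forall x, P1 x /\ P2 x}.
Proof. by apply: aeS2. Qed.

End AlmostEverywhere.

(** * Inner product, norm and representatives in L^2(0,1) *)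

Section L2basics.
Context {R : realType}.
Local Notation H := (L2 R).
Local Notation sqint := (LfunType mu01 (lee1n 2 : (1 <= 2%:R%:E :> \bar R)%E)).

Lemma integral_leb01 (f : R -> \bar R) :
  measurable_fun [set: R] f -> (forall x, 0 <= f x)%E ->
  (\int[mu01]_x f x = \int[leb]_(x in `]0%R, 1%R[) f x)%E.
Proof.
move=> mf f0.
rewrite -(setUv (`]0%R, 1%R[%classic : set R)) ge0_integral_setU//=; last 3 first.
- exact: measurableC.
- exact: measurable_funTS.
- by apply/disj_setPS; rewrite setICr.
rewrite [X in (_ + X)%E]null_set_integral //=; last 3 first.
- exact: measurableC.
- exact: measurable_funTS.
- by rewrite /leb01/= /mrestr setICl measure0.
rewrite adde0; apply: eq_measure_integral => A mA A01.
by rewrite /leb01/= /mrestr setIidl.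
Qed.

(** The end points are null; the closed interval is the form to which the fundamental theorem of
    calculus applies. *)
Lemma Rintegral_leb01 (f : R -> R) : measurable_fun [set: R] f ->
  \int[mu01]_x f x = \int[leb]_(x in `[0, 1]) f x.
Proof.
move=> mf; rewrite /Rintegral; congr fine.
have mE : measurable_fun [set: R] (EFin \o f) by exact/measurable_EFinP.
rewrite integralE [RHS]integralE.
have E (g : R -> \bar R) : measurable_fun [set: R] g -> (forall x, 0 <= g x)%E ->
  (\int[mu01]_x g x = \int[leb]_(x in `[0%R, 1%R]) g x)%E.
  move=> mg g0; rewrite integral_leb01//.
  rewrite integral_itv_bndo_bndc; last exact: measurable_funTS.
  by rewrite integral_itv_obnd_cbnd//; exact: measurable_funTS.
by rewrite !E//; [exact: measurable_funeneg|exact: measurable_funepos].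
Qed.

Lemma leb01_setT : mu01 [set: R] = 1%E.
Proof.
by rewrite /leb01/= /mrestr setTI lebesgue_measure_itv/= lte01 oppr0 adde0.
Qed.

(** These are the functions for which [toL2] does not fall back on its default, the zero class. *)
Definition sqi (f : R -> R) : Prop := f \in Lfun mu01 2%:E.

Lemma sqi_measurable f : sqi f -> measurable_fun [set: R] f.
Proof. by rewrite /sqi inE => /andP[/[!inE]]. Qed.

Lemma sqi_integrable f : sqi f -> mu01.-integrable [set: R] (EFin \o (fun x => f x ^+ 2)).
Proof. exact: Lfun2_integrable_sqr. Qed.

Lemma sqiP (f : R -> R) : measurable_fun [set: R] f ->
  (\int[mu01]_x (f x ^+ 2)%:E < +oo)%E -> sqi f.
Proof.
move=> mf foo; rewrite /sqi inE; apply/andP; split; rewrite inE//=.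
rewrite /finite_norm unlock /= poweR_lty//.
by under eq_integral => x _ do rewrite powR_mulrn// real_normK ?num_real//.
Qed.

Lemma integrable_mul f g : sqi f -> sqi g ->
  mu01.-integrable [set: R] (EFin \o (fun x => f x * g x)).
Proof. by move=> sf sg; apply/Lfun1_integrable; exact: Lfun2_mul_Lfun1. Qed.

Lemma sqiD f g : sqi f -> sqi g -> sqi (fun x => f x + g x).
Proof.
move=> sf sg.
pose f' : sqint := Lfun_Sub _ sf; pose g' : sqint := Lfun_Sub _ sg.
exact: (valP (f' + g')).
Qed.

Lemma sqiZ a f : sqi f -> sqi (fun x => a * f x).
Proof. by move=> sf; pose f' : sqint := Lfun_Sub _ sf; exact: (valP (a *: f')). Qed.

Lemma sqiN f : sqi f -> sqi (fun x => - f x).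
Proof. by move=> sf; pose f' : sqint := Lfun_Sub _ sf; exact: (valP (- f')). Qed.

Lemma sqiB f g : sqi f -> sqi g -> sqi (fun x => f x - g x).
Proof. by move=> sf sg; apply: sqiD => //; exact: sqiN. Qed.

Lemma sqi_bounded (f : R -> R) (M : R) : measurable_fun [set: R] f ->
  (forall x, 0 < x < 1 -> `|f x| <= M) -> sqi f.
Proof.
move=> mf fM; apply: sqiP => //.
have M0 : 0 <= M by apply: le_trans (fM 2^-1 _) => //; lra.
rewrite integral_leb01; last 2 first.
- by apply/measurable_EFinP; exact: measurable_funX.
- by move=> x; rewrite lee_fin sqr_ge0.
apply: (@le_lt_trans _ _ (\int[leb]_(x in `]0%R, 1%R[) (cst (M ^+ 2)%:E x))%E).
  apply: ge0_le_integral => //=.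
  - by move=> x _; rewrite lee_fin sqr_ge0.
  - by apply/measurable_EFinP; apply/measurable_funTS/measurable_funX.
  - move=> x; rewrite in_itv/= => /fM fx.
    by rewrite lee_fin -[leLHS]real_normK ?num_real// ler_sqr ?nnegrE.
by rewrite integral_cst//= lebesgue_measure_itv/= lte01 oppr0 adde0 mule1 ltry.
Qed.

Lemma continuous_sqi f : continuous f -> sqi f.
Proof.
move=> cf.
have mf : measurable_fun [set: R] f by exact: continuous_measurable_fun.
have cN : {within `[0, 1], continuous (fun x => `|f x| : R)}.
  apply: continuous_subspaceT => x.
  by apply: continuous_comp; [exact: cf|exact: norm_continuous].
have [c _ fc] := @EVT_max R _ 0 1 ler01 cN.
apply: (@sqi_bounded f `|f c|) => // x /andP[x0 x1].
by apply: fc; rewrite in_itv/= !ltW.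
Qed.

Lemma toL2K f : sqi f -> {ae mu01, forall x, repr (toL2 f) x = f x}.
Proof.
move=> sf; have := repr_piL2 (insubd (0 : sqint) f).
apply: filterS => x; rewrite -/(toL2 f) => <-.
have /= := @insubdK _ _ _ (0 : sqint) f sf.
by move=> E; rewrite -[in RHS]E.
Qed.

Lemma repr_sqi (u : H) : sqi (repr u).
Proof. exact: (valP (repr u : sqint)). Qed.

Lemma L2_ae_eq (u v : H) : {ae mu01, forall x, repr u x = repr v x} -> u = v.
Proof. by move=> uv; rewrite -(reprK u) -(reprK v); apply/eqquotP/asboolP. Qed.

Lemma toL2_repr (u : H) : toL2 (repr u) = u.
Proof. by apply: L2_ae_eq; exact: (toL2K (repr_sqi u)). Qed.

Lemma repr_add (u v : H) : {ae mu01, forall x, repr (u + v) x = repr u x + repr v x}.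
Proof.
have := repr_piL2 ((repr u : sqint) + (repr v : sqint)).
by rewrite piL2D !reprK; apply: filterS => x <-.
Qed.

Lemma repr_scale a (u : H) : {ae mu01, forall x, repr (a *: u) x = a * repr u x}.
Proof.
have := repr_piL2 (a *: (repr u : sqint)).
by rewrite piL2Z !reprK; apply: filterS => x <-.
Qed.

Lemma repr_0 : {ae mu01, forall x, repr (0 : H) x = 0}.
Proof. by have := repr_scale 0 0; apply: filterS => x; rewrite scale0r mul0r. Qed.

Lemma toL2D f g : sqi f -> sqi g -> toL2 (fun x => f x + g x) = toL2 f + toL2 g.
Proof.
move=> sf sg; apply: L2_ae_eq.
apply: aeS2 (aeI (toL2K sf) (toL2K sg)) (aeI (toL2K (sqiD sf sg)) (repr_add (toL2 f) (toL2 g))).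
by move=> x [<- <-] [-> ->].
Qed.

Lemma toL2Z a f : sqi f -> toL2 (fun x => a * f x) = a *: toL2 f.
Proof.
move=> sf; apply: L2_ae_eq.
move: (toL2K sf) (toL2K (sqiZ a sf)) (repr_scale a (toL2 f)).
by apply: filterS3 => x <- -> ->.
Qed.

Lemma toL2N f : sqi f -> toL2 (fun x => - f x) = - toL2 f.
Proof. by move=> sf; rewrite -scaleN1r -toL2Z//; congr toL2; apply/funext => x; rewrite mulN1r. Qed.

Lemma toL2B f g : sqi f -> sqi g -> toL2 (fun x => f x - g x) = toL2 f - toL2 g.
Proof. by move=> sf sg; rewrite toL2D ?toL2N//; exact: sqiN. Qed.

Lemma ae_eq_Rintegral01 (f g : R -> R) : measurable_fun [set: R] f -> measurable_fun [set: R] g ->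
  {ae mu01, forall x, f x = g x} -> \int[mu01]_x f x = \int[mu01]_x g x.
Proof.
move=> mf mg fg; rewrite /Rintegral; congr fine.
apply: ae_eq_integral => //; try exact/measurable_EFinP.
by apply: aeS fg => x -> _.
Qed.

Lemma ipE (f g : R -> R) (u v : H) : sqi f -> sqi g -> {ae mu01, forall x, repr u x = f x} ->
  {ae mu01, forall x, repr v x = g x} -> ip u v = \int[mu01]_x (f x * g x).
Proof.
move=> sf sg uf vg; apply: ae_eq_Rintegral01.
- by apply: measurable_funM; apply: sqi_measurable; exact: repr_sqi.
- by apply: measurable_funM; exact: sqi_measurable.
- by move: uf vg; apply: filterS2 => x -> ->.
Qed.

Lemma ip_toL2 f g : sqi f -> sqi g -> ip (toL2 f) (toL2 g) = \int[mu01]_x (f x * g x).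
Proof. by move=> sf sg; apply: ipE => //; exact: toL2K. Qed.

Lemma ipC (u v : H) : ip u v = ip v u.
Proof. by apply: eq_Rintegral => x _; rewrite mulrC. Qed.

Lemma ipDl (u v w : H) : ip (u + v) w = ip u w + ip v w.
Proof.
rewrite (ipE (sqiD (repr_sqi u) (repr_sqi v)) (repr_sqi w) (repr_add u v)); last exact: aeW.
rewrite -RintegralD//; try exact: integrable_mul (repr_sqi _) (repr_sqi _).
by apply: eq_Rintegral => x _; rewrite mulrDl.
Qed.

Lemma ipZl a (u w : H) : ip (a *: u) w = a * ip u w.
Proof.
rewrite (ipE (sqiZ a (repr_sqi u)) (repr_sqi w) (repr_scale a u)); last exact: aeW.
rewrite -RintegralZl//; try exact: integrable_mul (repr_sqi _) (repr_sqi _).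
by apply: eq_Rintegral => x _; rewrite mulrA.
Qed.

Lemma ipDr (u v w : H) : ip w (u + v) = ip w u + ip w v.
Proof. by rewrite ipC ipDl !(ipC w). Qed.
Lemma ipZr a (u w : H) : ip w (a *: u) = a * ip w u.
Proof. by rewrite ipC ipZl (ipC w). Qed.
Lemma ipNl (u w : H) : ip (- u) w = - ip u w.
Proof. by rewrite -scaleN1r ipZl mulN1r. Qed.
Lemma ipNr (u w : H) : ip w (- u) = - ip w u.
Proof. by rewrite ipC ipNl (ipC w). Qed.
Lemma ipBl (u v w : H) : ip (u - v) w = ip u w - ip v w.
Proof. by rewrite ipDl ipNl. Qed.
Lemma ipBr (u v w : H) : ip w (u - v) = ip w u - ip w v.
Proof. by rewrite ipDr ipNr. Qed.
Lemma ip0l (w : H) : ip 0 w = 0.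
Proof. by rewrite -(scale0r (0 : H)) ipZl mul0r. Qed.
Lemma ip0r (w : H) : ip w 0 = 0.
Proof. by rewrite ipC ip0l. Qed.
Lemma ip_suml I (r : seq I) (P : pred I) (F : I -> H) w :
  ip (\sum_(i <- r | P i) F i) w = \sum_(i <- r | P i) ip (F i) w.
Proof. by elim/big_ind2: _ => [|? ? ? ? <- <-|//]; [exact: ip0l|exact: ipDl]. Qed.
Lemma ip_sumr I (r : seq I) (P : pred I) (F : I -> H) w :
  ip w (\sum_(i <- r | P i) F i) = \sum_(i <- r | P i) ip w (F i).
Proof. by rewrite ipC ip_suml; apply: eq_bigr => i _; exact: ipC. Qed.

Lemma ip_ge0 (u : H) : 0 <= ip u u.
Proof. by apply: Rintegral_ge0 => x _; rewrite -expr2 sqr_ge0. Qed.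

Lemma hnorm2 (u : H) : hnorm u ^+ 2 = ip u u.
Proof. by rewrite sqr_sqrtr// ip_ge0. Qed.

Lemma hnorm_ge0 (u : H) : 0 <= hnorm u.
Proof. exact: sqrtr_ge0. Qed.
Lemma normr_hnorm_sub0 (u : H) : `|hnorm u - 0| = hnorm u.
Proof. by rewrite subr0 ger0_norm ?hnorm_ge0. Qed.
Hint Resolve hnorm_ge0 : core.

Lemma hnorm0 : hnorm (0 : H) = 0.
Proof. by rewrite /hnorm ip0l sqrtr0. Qed.

Lemma hnorm_eq0 (u : H) : hnorm u = 0 -> u = 0.
Proof.
move=> u0; have ipu : ip u u = 0 by rewrite -hnorm2 u0 expr0n.
apply: L2_ae_eq.
have mu : measurable_fun [set: R] (fun x => (repr u x * repr u x)%:E).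
  by apply/measurable_EFinP/measurable_funM; apply: sqi_measurable; exact: repr_sqi.
have : ae_eq mu01 setT (fun x => (repr u x * repr u x)%:E) (cst 0%E).
  apply/ae_eq_integral_abs => //.
  under eq_integral => x _ do rewrite /= ger0_norm -?expr2 ?sqr_ge0// expr2.
  rewrite -[LHS]fineK; first by congr EFin.
  exact: integrable_fin_num (integrable_mul (repr_sqi _) (repr_sqi _)).
move=> h; move: h repr_0; apply: filterS2 => x /(_ Logic.I)/= [] /eqP.
by rewrite mulf_eq0 orbb => /eqP -> ->.
Qed.

Lemma hnormZ a (u : H) : hnorm (a *: u) = `|a| * hnorm u.
Proof. by rewrite /hnorm ipZl ipZr mulrA -expr2 sqrtrM ?sqr_ge0// sqrtr_sqr. Qed.

Lemma hnormN (u : H) : hnorm (- u) = hnorm u.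
Proof. by rewrite -scaleN1r hnormZ normrN1 mul1r. Qed.

Lemma hnormBC (u v : H) : hnorm (u - v) = hnorm (v - u).
Proof. by rewrite -hnormN opprB. Qed.

Lemma ip_CS (u v : H) : `|ip u v| <= hnorm u * hnorm v.
Proof.
have [->|v0] := eqVneq v 0; first by rewrite ip0r hnorm0 normr0 mulr0.
have nv : 0 < hnorm v.
  by rewrite lt_neqAle hnorm_ge0 andbT eq_sym; apply: contra_neq v0; exact: hnorm_eq0.
have nv2 : 0 < ip v v by rewrite -hnorm2 exprn_gt0.
have := ip_ge0 (u - (ip u v / ip v v) *: v).
rewrite ipBl !ipBr !ipZl !ipZr (ipC v u) => h.
have {}h : ip u v ^+ 2 <= ip u u * ip v v.
  rewrite -ler_pdivrMr//; move: h.
  have -> : ip u u - ip u v / ip v v * ip u v - (ip u v / ip v v * ip u v -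
    ip u v / ip v v * (ip u v / ip v v * ip v v)) = ip u u - ip u v ^+ 2 / ip v v.
    by field; rewrite gt_eqF.
  by rewrite subr_ge0.
rewrite -ler_sqr ?nnegrE ?mulr_ge0// exprMn !hnorm2 real_normK ?num_real//.
Qed.

Lemma hnormD (u v : H) : hnorm (u + v) <= hnorm u + hnorm v.
Proof.
rewrite -ler_sqr ?nnegrE ?addr_ge0// hnorm2 ipDl !ipDr (ipC v u) sqrrD !hnorm2.
have := le_trans (ler_norm _) (ip_CS u v); lra.
Qed.

Lemma hnormB (u v : H) : hnorm (u - v) <= hnorm u + hnorm v.
Proof. by rewrite -(hnormN v) hnormD. Qed.

Lemma hnorm_dist (u v w : H) : hnorm (u - w) <= hnorm (u - v) + hnorm (v - w).
Proof. by rewrite -[u - w](_ : (u - v) + (v - w) = _) ?hnormD// addrA subrK. Qed.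

Lemma hnorm_tri_abs (u v : H) : `|hnorm u - hnorm v| <= hnorm (u - v).
Proof.
rewrite ler_norml; have := hnormD (u - v) v; have := hnormD (v - u) u.
rewrite !subrK (hnormBC v u); lra.
Qed.

End L2basics.

Lemma Rint_dominated d (T : measurableType d) (R : realType)
    (mu : {measure set T -> \bar R}) (D : set T) (f_ : nat -> T -> R) (f g : T -> R) :
  measurable D -> (forall n, measurable_fun D (f_ n)) -> measurable_fun D f ->
  {ae mu, forall x, D x -> f_ n x @[n --> \oo] --> f x} ->
  mu.-integrable D (EFin \o g) -> (forall n x, D x -> `|f_ n x| <= g x) ->
  \int[mu]_(x in D) f_ n x @[n --> \oo] --> \int[mu]_(x in D) f x.
Proof.
move=> mD mf_ mf aef ig fg.
have mE n : measurable_fun D (EFin \o f_ n) by exact/measurable_EFinP.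
have mfE : measurable_fun D (EFin \o f) by exact/measurable_EFinP.
have ae1 : {ae mu, forall x, D x -> (EFin \o f_ n) x @[n --> \oo] --> (EFin \o f) x}.
  apply: aeS aef => x h Dx; apply: cvg_EFin; first exact: nearW.
  exact: h.
have dom : {ae mu, forall x, forall n, D x -> (`|(EFin \o f_ n) x| <= (EFin \o g) x)%E}.
  by apply: aeW => x n Dx; rewrite lee_fin fg.
have [fi _ cv] := dominated_convergence mD mE mfE ae1 ig dom.
apply: fine_cvg; rewrite fineK; last exact: integrable_fin_num.
exact: cv.
Qed.

Section SequenceTools.
Context {R : realType}.

Lemma cvg_epsP (u : nat -> R) (l : R) :
  u @ \oo --> l <->
  (forall e, 0 < e -> exists N, forall n, (N <= n)%N -> `|u n - l| <= e).
Proof.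
split.
  move=> /cvgrPdist_le h e e0; have [N _ hN] := h _ e0; exists N => n Nn.
  by rewrite distrC; exact: hN.
move=> h; apply/cvgrPdist_le => e e0; have [N hN] := h _ e0.
by exists N => // n Nn; rewrite distrC; exact: hN.
Qed.

Lemma cvg0_squeeze (u v : nat -> R) : (forall n, 0 <= u n <= v n) ->
  v @ \oo --> (0 : R) -> u @ \oo --> (0 : R).
Proof.
move=> uv v0; apply: (@squeeze_cvgr _ _ _ _ (cst 0) v) => //; last exact: cvg_cst.
by near=> n; exact: uv.
Unshelve. all: by end_near. Qed.

Lemma half_exp_cvg0 (c : R) : (c * 2^-1 ^+ n)  @[n --> \oo] --> (0 : R).
Proof. by apply: cvg_geometric; rewrite ger0_norm; lra. Qed.

Lemma sum_half_exp (n : nat) : \sum_(0 <= k < n) 2^-1 ^+ k <= 2 :> R.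
Proof.
suff -> : \sum_(0 <= k < n) 2^-1 ^+ k = 2 - 2 * 2^-1 ^+ n :> R.
  by rewrite lerBlDr lerDl mulr_ge0// exprn_ge0.
elim: n => [|n IH]; first by rewrite big_geq// expr0; lra.
by rewrite big_nat_recr//= IH exprS; lra.
Qed.

(** The partial sums of the chosen thresholds dominate each of them and are monotone, which replaces
    a recursion on the previous index. *)
Lemma nat_dep_subseq (Q : nat -> nat -> Prop) : (forall n, exists N, forall m, (N <= m)%N -> Q n m) ->
  exists phi : nat -> nat, (forall n, (phi n <= phi n.+1)%N) /\ forall n m, (phi n <= m)%N -> Q n m.
Proof.
move=> /choice[f hf]; exists (fun n => \sum_(i < n.+1) f i)%N; split.
  by move=> n; rewrite [in leqRHS]big_ord_recr leq_addr.
by move=> n m h; apply: hf; rewrite (leq_trans _ h)// big_ord_recr leq_addl.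
Qed.

End SequenceTools.

(** * Completeness of L^2(0,1) *)

Section L2complete.
Context {R : realType}.
Local Notation H := (L2 R).

Lemma integrable_sqi1 (f : R -> R) : sqi f -> mu01.-integrable [set: R] (EFin \o f).
Proof.
move=> sf; have s1 : sqi (fun=> 1 : R).
  by apply: (@sqi_bounded _ _ 1) => // x _; rewrite normr1.
have := integrable_mul sf s1; congr (_.-integrable _ _).
by apply/funext => x /=; rewrite mulr1.
Qed.

Lemma sqi_norm (f : R -> R) : sqi f -> sqi (fun x => `|f x|).
Proof.
move=> sf; apply: sqiP; first by apply: measurableT_comp => //; exact: sqi_measurable.
under eq_integral do rewrite real_normK ?num_real//.
have /integrableP[_] := sqi_integrable sf.
rewrite (_ : (\int[mu01]_x `|(EFin \o (fun x0 : R => (f x0 ^+ 2)%R)) x| = \int[mu01]_x (f x ^+ 2)%:E)%E)//.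
by apply: eq_integral => x _; rewrite /= ger0_norm ?sqr_ge0.
Qed.

Lemma Rintegral_sqr_hnorm (f : R -> R) : sqi f -> (\int[mu01]_x (f x ^+ 2)%:E = (hnorm (toL2 f) ^+ 2)%:E)%E.
Proof.
move=> sf; rewrite hnorm2 ip_toL2// -[LHS]fineK; last exact: integrable_fin_num (sqi_integrable sf).
by congr EFin; apply: eq_Rintegral => x _; rewrite expr2.
Qed.

Lemma hnorm_toL2_1 : hnorm (toL2 (fun=> 1 : R)) = 1.
Proof.
rewrite /hnorm ip_toL2; try by apply: (@sqi_bounded _ _ 1) => // x _; rewrite normr1.
by rewrite mulr1 Rintegral_cst// leb01_setT/= mulr1 sqrtr1.
Qed.

Lemma integral_norm_le (f : R -> R) : sqi f -> (\int[mu01]_x `|f x|%:E <= (hnorm (toL2 f))%:E)%E.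
Proof.
move=> sf; have sn := sqi_norm sf.
have s1 : sqi (fun=> 1 : R) by apply: (@sqi_bounded _ _ 1) => // x _; rewrite normr1.
have -> : (\int[mu01]_x `|f x|%:E = (ip (toL2 (fun x => `|f x|)) (toL2 (fun=> 1 : R)))%:E)%E.
  rewrite ip_toL2// -[LHS]fineK; last exact: integrable_fin_num (integrable_sqi1 sn).
  by congr EFin; apply: eq_Rintegral => x _; rewrite mulr1.
rewrite lee_fin (le_trans (ler_norm _))// (le_trans (ip_CS _ _))// hnorm_toL2_1 mulr1.
rewrite -ler_sqr ?nnegrE ?hnorm_ge0// !hnorm2 !ip_toL2//.
by under eq_Rintegral do rewrite -expr2 real_normK ?num_real// expr2.
Qed.

(** The Riesz-Fischer argument: representatives of a geometrically fast sequence converge almost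
    everywhere, and Fatou's lemma identifies the limit in norm with the same rate. *)
Lemma L2_cauchy_fast (g : nat -> H) :
  (forall n m, (n <= m)%N -> hnorm (g m - g n) <= 2^-1 ^+ n) ->
  exists v, forall n, hnorm (g n - v) <= 2^-1 ^+ n.
Proof.
move=> gfast.
pose r n : R -> R := repr (g n).
have sr n : sqi (r n) by exact: repr_sqi.
have mr n : measurable_fun [set: R] (r n) by exact: sqi_measurable.
pose D n x := r n.+1 x - r n x.
have sD n : sqi (D n) by exact: sqiB.
have toD n : toL2 (D n) = g n.+1 - g n by rewrite toL2B// !toL2_repr.
(* The measure has mass 1, so the L^1 norm of an increment is at most its L^2 norm, and the series
   of the L^1 norms is geometric. *)
have intD : (\int[mu01]_x \big[+%E/0%E]_(0 <= n <oo) `|D n x|%:E < +oo)%E.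
  rewrite integral_nneseries//; last first.
    by move=> n; apply/measurable_EFinP/measurableT_comp => //; exact: sqi_measurable.
  apply: (@le_lt_trans _ _ 2%:E); last exact: ltry.
  apply: lime_le; first by apply: is_cvg_nneseries => n _ _; exact: integral_ge0.
  near=> n; apply: (@le_trans _ _ (\sum_(0 <= k < n) (2^-1 ^+ k)%:E)%E).
    apply: lee_sum => k _; apply: (le_trans (integral_norm_le (sD k))).
    by rewrite lee_fin toD gfast.
  by rewrite sumEFin lee_fin sum_half_exp.
have mS : measurable_fun [set: R] (fun x => \big[+%E/0%E]_(0 <= n <oo) `|D n x|%:E)%E.
  apply: ge0_emeasurable_sum => // n _; apply/measurable_EFinP/measurableT_comp => //.
  exact: sqi_measurable.
have aefin : {ae mu01, forall x, (\big[+%E/0%E]_(0 <= n <oo) `|D n x|%:E < +oo)%E}.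
  have iS : mu01.-integrable [set: R] (fun x => \big[+%E/0%E]_(0 <= n <oo) `|D n x|%:E)%E.
    apply/integrableP; split => //.
    by under eq_integral do rewrite gee0_abs ?nneseries_ge0//.
  have := integrable_ae measurableT iS; apply: aeS => x /(_ Logic.I).
  by rewrite ge0_fin_numE ?nneseries_ge0.
have cvgr : {ae mu01, forall x, cvgn (r^~ x)}.
  apply: aeS aefin => x Dx.
  have : cvgn [normed series (fun n => D n x)].
    apply: nondecreasing_is_cvgn.
      by apply: nondecreasing_series => i _ _; exact: normr_ge0.
    exists (fine (\big[+%E/0%E]_(0 <= n <oo) `|D n x|%:E)%E) => _ [n _ <-].
    rewrite -lee_fin fineK; last by rewrite ge0_fin_numE ?nneseries_ge0.
    rewrite /series/= -sumEFin; apply: nneseries_lim_ge => // i _ _.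
  move/normed_cvg => h.
  have -> : r^~ x = (fun n => r 0%N x + series (fun n => D n x) n).
    by apply/funext => n; rewrite {1}(eq_sum_telescope (r^~ x) n).
  by apply: is_cvgD => //; exact: is_cvg_cst.
(* The limes superior is measurable even where the sequence diverges, and equals the limit almost
   everywhere. *)
pose f x := fine (limn_esup (fun n => (r n x)%:E)).
have rf : {ae mu01, forall x, r n x @[n --> \oo] --> f x}.
  apply: aeS cvgr => x /cvg_ex[l rl]; rewrite /f.
  have h : (r n x)%:E @[n --> \oo] --> l%:E by apply: cvg_EFin; [exact: nearW|exact: rl].
  by rewrite (cvg_limn_einf_sup h).2.
have mf : measurable_fun [set: R] f.
  apply: measurableT_comp => //; apply: measurable_fun_limn_esup => n.
  exact/measurable_EFinP.
have Fat n : (\int[mu01]_x ((r n x - f x) ^+ 2)%:E <= ((2^-1 ^+ n) ^+ 2)%:E)%E.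
  have mq m : measurable_fun [set: R] (fun x => ((r n x - r m x) ^+ 2)%:E).
    by apply/measurable_EFinP/measurable_funX/measurable_funB.
  have -> : (\int[mu01]_x ((r n x - f x) ^+ 2)%:E =
      \int[mu01]_x limn_einf (fun m => ((r n x - r m x) ^+ 2)%:E))%E.
    apply: ae_eq_integral => //.
    - by apply/measurable_EFinP/measurable_funX/measurable_funB.
    - rewrite [X in measurable_fun _ X](_ : _ =
          (fun x => - limn_esup (-%E \o (fun m => ((r n x - r m x) ^+ 2)%:E)))%E); last first.
        by apply/funext => x; rewrite limn_esupN oppeK.
      apply: measurableT_comp => //; apply: measurable_fun_limn_esup => m.
      by apply: measurableT_comp => //; exact: mq.
    - apply: aeS rf => x rfx _; apply/esym.
      suff /cvg_limn_einf_sup[-> //] : ((r n x - r m x) ^+ 2)%:E @[m --> \oo] --> ((r n x - f x) ^+ 2)%:E.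
      apply: cvg_EFin; first exact: nearW.
      apply: (cvg_comp (fun m => r n x - r m x) (fun y => y ^+ 2) _ (@exprn_continuous R 2 _)).
      by apply: cvgB => //; exact: cvg_cst.
  apply: (le_trans (fatou mu01 measurableT mq _)).
    by move=> m x _; rewrite lee_fin sqr_ge0.
  rewrite limn_einf_lim; apply: lime_le; first exact: is_cvg_einfs.
  near=> m; apply: (@le_trans _ _ (\int[mu01]_x ((r n x - r m x) ^+ 2)%:E)%E).
    by apply: ereal_inf_lbound; exists m => /=.
  rewrite (Rintegral_sqr_hnorm (sqiB (sr n) (sr m))) lee_fin.
  rewrite ler_sqr ?nnegrE ?hnorm_ge0 ?exprn_ge0//.
  rewrite toL2B// !toL2_repr hnormBC; apply: gfast.
  by near: m; exact: nbhs_infty_ge.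
have sBf n : sqi (fun x => r n x - f x).
  apply: sqiP; first exact: measurable_funB.
  by apply: le_lt_trans (Fat n) _; exact: ltry.
have sf : sqi f.
  have := sqiB (sr 0%N) (sBf 0%N); congr (sqi _).
  by apply/funext => x; rewrite opprB addrCA subrr addr0.
exists (toL2 f) => n.
have := Fat n; rewrite Rintegral_sqr_hnorm// lee_fin toL2B// toL2_repr.
by rewrite ler_sqr ?nnegrE ?hnorm_ge0 ?exprn_ge0.
Unshelve. all: by end_near. Qed.

Lemma L2_complete (u : nat -> H) :
  (forall e, 0 < e -> exists N, forall m n, (N <= m)%N -> (N <= n)%N -> hnorm (u m - u n) <= e) ->
  exists v, hnorm (u n - v) @[n --> \oo] --> (0 : R).
Proof.
move=> uC.
have [phi [phiS phiP]] : exists phi : nat -> nat, (forall n, (phi n <= phi n.+1)%N) /\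
    forall n m, (phi n <= m)%N -> (forall k, (m <= k)%N -> hnorm (u k - u m) <= 2^-1 ^+ n).
  apply: nat_dep_subseq => n.
  have e0 : 0 < 2^-1 ^+ n :> R by rewrite exprn_gt0.
  have [N hN] := uC _ e0.
  by exists N => m Nm k mk; apply: hN => //; exact: leq_trans mk.
have [v hv] : exists v, forall n, hnorm (u (phi n) - v) <= 2^-1 ^+ n.
  apply: (L2_cauchy_fast (g := u \o phi)) => n m nm; apply: phiP => //.
  exact: (homo_leq leqnn leq_trans phiS).
exists v; apply/cvg_epsP => e e0.
have /cvg_epsP/(_ (e / 2) (divr_gt0 e0 (ltr0n _ 2)))[N2 hN2] := @half_exp_cvg0 R 2.
exists (phi N2) => n n2; rewrite normr_hnorm_sub0//.
apply: (le_trans (hnorm_dist _ (u (phi N2)) _)).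
apply: (le_trans (lerD (phiP _ _ (leqnn _) _ n2) (hv N2))).
have := hN2 _ (leqnn _); rewrite subr0 ger0_norm ?mulr_ge0 ?exprn_ge0//; lra.
Qed.

End L2complete.

(** * Sines, cosines and orthonormal sequences *)

Section Trig.
Context {R : realType}.
Local Notation H := (L2 R).
Implicit Types (x : R) (k : nat).

Lemma Rint_FTC2 (F f : R -> R) (a b : R) : a <= b ->
  (forall x, is_derive x 1 F (f x)) -> continuous f ->
  \int[leb]_(x in `[a, b]) f x = F b - F a.
Proof.
rewrite le_eqVlt => /predU1P[->|ab] dF cf.
  by rewrite set_itv1 Rintegral_set1 subrr.
have cF : continuous F.
  by move=> x; apply/differentiable_continuous/derivable1_diffP; case: (dF x).
rewrite /Rintegral (@continuous_FTC2 R f F a b)//.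
- exact: continuous_subspaceT.
- split.
  + by move=> x _; case: (dF x).
  + by apply: cvg_at_right_filter; exact: cF.
  + by apply: cvg_at_left_filter; exact: cF.
- by move=> x _; rewrite derive1E; apply: derive_val.
Qed.

Lemma is_derive_sinM (c x : R) : is_derive x 1 (fun x : R => sin (c * x)) (c * cos (c * x)).
Proof.
have h : is_derive x 1 (fun x : R => c * x) c.
  by have := @is_deriveZ R R R id c x 1 1 (is_derive_id x 1); rewrite /GRing.scale/= mulr1.
by apply: is_derive_eq; rewrite mulrC.
Qed.

Lemma is_derive_cosM (c x : R) : is_derive x 1 (fun x : R => cos (c * x)) (- (c * sin (c * x))).
Proof.
have h : is_derive x 1 (fun x : R => c * x) c.
  by have := @is_deriveZ R R R id c x 1 1 (is_derive_id x 1); rewrite /GRing.scale/= mulr1.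
by apply: is_derive_eq; rewrite mulNr mulrC.
Qed.

Lemma continuous_sinM (c : R) : continuous (fun x : R => sin (c * x)).
Proof.
move=> x; apply: continuous_comp; last exact: continuous_sin.
by apply: cvgMr; exact: cvg_id.
Qed.

Lemma continuous_cosM (c : R) : continuous (fun x : R => cos (c * x)).
Proof.
move=> x; apply: continuous_comp; last exact: continuous_cos.
by apply: cvgMr; exact: cvg_id.
Qed.

Lemma sin_natpi (m : nat) : sin (m%:R * pi) = 0 :> R.
Proof.
elim: m => [|m IH]; first by rewrite mul0r sin0.
by rewrite -natr1 mulrDl mul1r sinDpi IH oppr0.
Qed.

(** The only trigonometric integral that is computed: products of two sines or two cosines are sums
    of such cosines. *)
Lemma int_cos (m : nat) : \int[leb]_(x in `[0, 1]) cos (m%:R * pi * x) = (m == 0%N)%:R :> R.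
Proof.
have [->|m0] := eqVneq m 0%N.
  under eq_Rintegral do rewrite !mul0r cos0.
  by rewrite Rintegral_cst//= lebesgue_measure_itv/= lte01 oppr0 adde0/= mulr1.
have c0 : m%:R * pi != 0 :> R by rewrite mulf_neq0 ?pnatr_eq0// gt_eqF ?pi_gt0.
have d x : is_derive x 1 (fun x => (m%:R * pi)^-1 * sin (m%:R * pi * x)) (cos (m%:R * pi * x)).
  have h := is_derive_sinM (m%:R * pi) x.
  have := @is_deriveZ R R R _ (m%:R * pi)^-1 _ _ _ h.
  by rewrite /GRing.scale/= mulrA mulVf// mul1r.
rewrite (Rint_FTC2 ler01 d (@continuous_cosM _)).
by rewrite mulr1 mulr0 sin0 mulr0 sin_natpi mulr0 subrr.
Qed.

(** Modes are numbered from 0: index k belongs to the frequency k + 1, so [en k] is the vector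
    e_(k+1) of the theorem. *)
Definition sinf k x := Num.sqrt 2 * sin (k.+1%:R * pi * x).
Definition cosf k x := Num.sqrt 2 * cos (k.+1%:R * pi * x).
Definition en k : H := toL2 (sinf k).
Definition cn k : H := toL2 (cosf k).

Lemma continuous_sinf k : continuous (sinf k).
Proof. by move=> x; apply: cvgMr; exact: continuous_sinM. Qed.
Lemma continuous_cosf k : continuous (cosf k).
Proof. by move=> x; apply: cvgMr; exact: continuous_cosM. Qed.

Lemma ip_continuous (f g : R -> R) : continuous f -> continuous g ->
  ip (toL2 f) (toL2 g) = \int[leb]_(x in `[0, 1]) (f x * g x).
Proof.
move=> cf cg; rewrite ip_toL2; try exact: continuous_sqi.
by rewrite Rintegral_leb01//; apply: measurable_funM; exact: continuous_measurable_fun.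
Qed.

Lemma integrable_continuous (f : R -> R) (a b : R) : continuous f ->
  leb.-integrable `[a, b] (EFin \o f).
Proof.
move=> cf; apply: continuous_compact_integrable; first exact: segment_compact.
exact: continuous_subspaceT.
Qed.

Lemma sin_sin (a b : R) : 2 * (sin a * sin b) = cos (a - b) - cos (a + b).
Proof. rewrite cosB cosD; ring. Qed.
Lemma cos_cos (a b : R) : 2 * (cos a * cos b) = cos (a - b) + cos (a + b).
Proof. rewrite cosB cosD; ring. Qed.

Lemma sqr_sqrt2 : Num.sqrt 2 * Num.sqrt 2 = 2 :> R.
Proof. by rewrite -expr2 sqr_sqrtr. Qed.

Lemma cos_natB (i j : nat) x :
  cos (i%:R * pi * x - j%:R * pi * x) = cos ((maxn i j - minn i j)%N%:R * pi * x).
Proof.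
have [ij|ij] := leqP i j.
  by rewrite -cosN opprB natrB// !mulrBl.
by rewrite natrB ?(ltnW ij)// !mulrBl.
Qed.

Lemma sinf_sinf i j x : sinf i x * sinf j x =
  cos ((maxn i j - minn i j)%N%:R * pi * x) - cos ((i + j).+2%:R * pi * x).
Proof.
rewrite /sinf mulrACA sqr_sqrt2 sin_sin cos_natB maxnSS minnSS subSS.
by congr (_ - cos _); rewrite -!mulrDl -natrD addSn addnS.
Qed.

Lemma cosf_cosf i j x : cosf i x * cosf j x =
  cos ((maxn i j - minn i j)%N%:R * pi * x) + cos ((i + j).+2%:R * pi * x).
Proof.
rewrite /cosf mulrACA sqr_sqrt2 cos_cos cos_natB maxnSS minnSS subSS.
by congr (_ + cos _); rewrite -!mulrDl -natrD addSn addnS.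
Qed.

Lemma maxB_eq0 (i j : nat) : (maxn i j - minn i j == 0)%N = (i == j).
Proof. by apply/eqP/eqP; lia. Qed.

Lemma en_orth i j : ip (en i) (en j) = (i == j)%:R.
Proof.
rewrite ip_continuous; try exact: continuous_sinf.
under eq_Rintegral do rewrite sinf_sinf.
rewrite RintegralB//; try exact/integrable_continuous/continuous_cosM.
by rewrite !int_cos subr0 maxB_eq0.
Qed.

Lemma cn_orth i j : ip (cn i) (cn j) = (i == j)%:R.
Proof.
rewrite ip_continuous; try exact: continuous_cosf.
under eq_Rintegral do rewrite cosf_cosf.
rewrite RintegralD//; try exact/integrable_continuous/continuous_cosM.
by rewrite !int_cos addr0 maxB_eq0.
Qed.

End Trig.

Section Orthonormal.
Context {R : realType} (phi : nat -> L2 R).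
Hypothesis phi_orth : forall i j, ip (phi i) (phi j) = (i == j)%:R.
Local Notation H := (L2 R).

Lemma ip_orth_sum (N : nat) (c : nat -> R) k :
  ip (phi k) (\sum_(i < N) c i *: phi i) = if (k < N)%N then c k else 0.
Proof.
rewrite ip_sumr; under eq_bigr do rewrite ipZr phi_orth.
case: ifPn => kN; last first.
  rewrite big1// => i _; case: eqP => [ki|]; last by rewrite mulr0.
  by rewrite ki ltn_ord in kN.
rewrite (bigD1 (Ordinal kN))//= eqxx mulr1 big1 ?addr0// => i ik.
case: eqP => [ki|]; last by rewrite mulr0.
by case/eqP: ik; exact: val_inj.
Qed.

Lemma hnorm_orth_sum (N : nat) (c : nat -> R) :
  hnorm (\sum_(i < N) c i *: phi i) ^+ 2 = \sum_(i < N) c i ^+ 2.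
Proof.
rewrite hnorm2 ip_suml; apply: eq_bigr => i _.
by rewrite ipZl ip_orth_sum ltn_ord expr2.
Qed.

Lemma bessel (u : H) (N : nat) : \sum_(i < N) ip (phi i) u ^+ 2 <= hnorm u ^+ 2.
Proof.
have := ip_ge0 (u - \sum_(i < N) ip (phi i) u *: phi i).
rewrite ipBl !ipBr -!hnorm2 (hnorm_orth_sum _ (fun i => ip (phi i) u)) (ipC _ u) ip_sumr.
have -> : \sum_(i < N) ip u (ip (phi i) u *: phi i) = \sum_(i < N) ip (phi i) u ^+ 2.
  by apply: eq_bigr => i _; rewrite ipZr (ipC u) -expr2.
lra.
Qed.

(** Stated for any orthonormal sequence because it serves both the sines [en], which are complete,
    and the cosines [cn], which miss the constants. *)
Lemma riesz_fischer (c : nat -> R) (B : R) : (forall N, \sum_(i < N) c i ^+ 2 <= B) ->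
  exists u : H, (forall k, ip (phi k) u = c k) /\
    hnorm (\sum_(i < n) c i *: phi i - u) @[n --> \oo] --> (0 : R).
Proof.
move=> cB; pose S n := \sum_(i < n) c i *: phi i.
have S2 m n : (m <= n)%N -> hnorm (S n - S m) ^+ 2 = \sum_(i < n) c i ^+ 2 - \sum_(i < m) c i ^+ 2.
  move=> mn; rewrite hnorm2 ipBl !ipBr -!hnorm2 !hnorm_orth_sum (ipC (S n)).
  have -> : ip (S m) (S n) = \sum_(i < m) c i ^+ 2; last by ring.
  rewrite ip_suml; apply: eq_bigr => i _.
  by rewrite ipZl ip_orth_sum (leq_trans (ltn_ord i) mn) expr2.
have cvS : cvgn (fun n => \sum_(i < n) c i ^+ 2).
  apply: nondecreasing_is_cvgn; last by exists B => _ [n _ <-].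
  by move=> m n mn; rewrite -subr_ge0 -S2 ?sqr_ge0.
have [u Su] : exists v, hnorm (S n - v) @[n --> \oo] --> (0 : R).
  apply: L2_complete => e e0.
  move/cvg_ex: cvS => [l /cvg_epsP/(_ (e ^+ 2 / 2) _)[|N hN]].
    by rewrite divr_gt0// exprn_gt0.
  have key m n : (N <= m)%N -> (m <= n)%N -> hnorm (S n - S m) <= e.
    move=> Nm mn; rewrite -ler_sqr ?nnegrE ?hnorm_ge0 ?(ltW e0)// S2//.
    have := hN _ Nm; have := hN _ (leq_trans Nm mn); rewrite !ler_norml; lra.
  exists N => m n Nm Nn; have [mn|/ltnW nm] := leqP m n; last exact: key.
  by rewrite hnormBC key.
exists u; split=> // k.
have h : ip (phi k) (S n) @[n --> \oo] --> ip (phi k) u.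
  apply/cvg_epsP => e e0.
  have /cvg_epsP/(_ e e0)[N hN] := Su; exists N => n /hN; rewrite normr_hnorm_sub0// => h.
  rewrite -ipBr (le_trans (ip_CS _ _))// /hnorm phi_orth eqxx sqrtr1 mul1r.
  exact: h.
have h' : ip (phi k) (S n) @[n --> \oo] --> c k.
  by apply: cvg_near_cst; exists k.+1 => // n /= kn; rewrite ip_orth_sum kn.
exact: (cvg_unique _ h h').
Qed.

End Orthonormal.

(** * Completeness of the sine system *)

Section StepPolynomials.
Context {R : realType}.

Lemma bernoulli_ge (t : R) (N : nat) : 0 <= t <= 1 -> 1 - N%:R * t <= (1 - t) ^+ N.
Proof.
move=> /andP[t0 t1]; elim: N => [|N IH]; first by rewrite mul0r subr0 expr0.
rewrite exprS -natr1; apply: (@le_trans _ _ ((1 - t) * (1 - N%:R * t))).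
  have : 0 <= N%:R * t * t by rewrite !mulr_ge0.
  lra.
by rewrite ler_wpM2l// subr_ge0.
Qed.

(** Counterpart of Bernoulli's inequality from above: 1 + N t <= (1 + t)^N, and (1 - t)(1 + t) <=
    1. *)
Lemma bernoulli_le (t : R) (N : nat) : 0 <= t <= 1 -> (1 - t) ^+ N * (1 + N%:R * t) <= 1.
Proof.
move=> /andP[t0 t1]; apply: (@le_trans _ _ ((1 - t) ^+ N * (1 + t) ^+ N)).
  rewrite ler_wpM2l ?exprn_ge0 ?subr_ge0//.
  elim: N => [|N IH]; first by rewrite mul0r addr0 expr0.
  rewrite exprS -natr1; apply: (@le_trans _ _ ((1 + t) * (1 + N%:R * t))).
    have : 0 <= N%:R * t * t by rewrite !mulr_ge0.
    lra.
  by rewrite ler_wpM2l// addr_ge0.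
rewrite -exprMn exprn_ile1//; last first.
  have : 0 <= t * t by rewrite mulr_ge0.
  lra.
by apply: mulr_ge0; lra.
Qed.

(* Bounded by 1 on the unit interval, these polynomials converge to the
   indicator of [0, 1/2[ away from 1/2. *)
Definition steppoly (y : R) (n : nat) : R := (1 - y ^+ n) ^+ (2 ^ n).

Lemma steppoly_bound y n : 0 <= y <= 1 -> 0 <= steppoly y n <= 1.
Proof.
move=> /andP[y0 y1]; have yn : 0 <= y ^+ n <= 1 by rewrite exprn_ge0// exprn_ile1.
by apply/andP; split; [apply: exprn_ge0|apply: exprn_ile1]; lra.
Qed.

(** Bernoulli's inequalities with t = y^n and exponent 2^n: the product (2 y)^n tends to 0 below 1/2
    and to infinity above 1/2, which gives this limit and the next one. *)
Lemma steppoly_lt y : 0 <= y < 2^-1 -> steppoly y n @[n --> \oo] --> (1 : R).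
Proof.
move=> /andP[y0 y1].
apply: (@squeeze_cvgr _ _ _ _ (fun n => 1 - (2 * y) ^+ n) (cst 1)); last exact: cvg_cst.
- near=> n; have yn : 0 <= y ^+ n <= 1 by rewrite exprn_ge0// exprn_ile1//; lra.
  have /andP[_ ->] : 0 <= steppoly y n <= 1 by apply: steppoly_bound; lra.
  rewrite andbT; have := bernoulli_ge (2 ^ n) yn.
  by rewrite natrX -exprMn.
- rewrite -[X in _ --> X]subr0; apply: cvgB; first exact: cvg_cst.
  by apply: cvg_expr; rewrite ger0_norm; lra.
Unshelve. all: by end_near. Qed.

Lemma steppoly_gt y : 2^-1 < y <= 1 -> steppoly y n @[n --> \oo] --> (0 : R).
Proof.
move=> /andP[y0 y1].
apply: (@cvg0_squeeze _ _ (fun n => (2 * y)^-1 ^+ n)); last first.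
  apply: cvg_expr; rewrite ger0_norm ?invr_ge0; last lra.
  by rewrite invf_lt1; lra.
move=> n; have yn : 0 <= y ^+ n <= 1 by rewrite exprn_ge0 ?exprn_ile1//; lra.
have /andP[-> _]/= : 0 <= steppoly y n <= 1 by apply: steppoly_bound; lra.
have p0 : 0 < (2 * y) ^+ n by rewrite exprn_gt0//; lra.
rewrite exprVn -[leRHS]mul1r ler_pdivlMr//.
apply: le_trans (bernoulli_le (2 ^ n) yn).
rewrite ler_wpM2l ?natrX -?exprMn ?lerDr//.
by apply: exprn_ge0; lra.
Unshelve. all: by end_near. Qed.

End StepPolynomials.

Section SineComplete.
Context {R : realType}.
Local Notation H := (L2 R).

Lemma toL2_sum (n : nat) (F : nat -> R -> R) : (forall i, sqi (F i)) ->
  sqi (fun x => \sum_(i < n) F i x) /\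
  toL2 (fun x => \sum_(i < n) F i x) = \sum_(i < n) toL2 (F i) :> H.
Proof.
move=> sF; elim: n => [|n [IH1 IH2]].
  have E : (fun x : R => \sum_(i < 0) F i x) = (fun x => 0 * F 0%N x).
    by apply/funext => x; rewrite big_ord0 mul0r.
  by rewrite E; split; [exact: sqiZ|rewrite toL2Z// scale0r big_ord0].
have E : (fun x : R => \sum_(i < n.+1) F i x) = (fun x => \sum_(i < n) F i x + F n x).
  by apply/funext => x; rewrite big_ord_recr.
by rewrite E; split; [exact: sqiD|rewrite toL2D// IH2 big_ord_recr].
Qed.

Lemma ae_leb01 (P : R -> Prop) : {ae leb, forall x, 0 < x < 1 -> P x} -> {ae mu01, forall x, P x}.
Proof.
move=> [N [mN N0 NP]].
exists (N `|` ~` `]0, 1[%classic); split.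
- by apply: measurableU => //; exact: measurableC.
- apply/eqP; rewrite /leb01/= /mrestr setIUl setICl setU0 -measure_le0.
  by rewrite -N0 le_measure ?inE//; apply: measurableI.
- move=> x /= nPx; have [x01|x01] := pselect (`]0, 1[%classic x); last by right.
  by left; apply: NP => /= h; apply: nPx; apply: h; move: x01; rewrite /= in_itv.
Qed.

Lemma continuous_sincos (k m : nat) :
  continuous (fun x : R => sin (k.+1%:R * pi * x) * cos (1%:R * pi * x) ^+ m).
Proof.
move=> x; apply: cvgM; first exact: continuous_sinM.
apply: (cvg_comp (fun y : R => cos (1%:R * pi * y)) (fun y => y ^+ m) _ (@exprn_continuous R m _)).
exact: continuous_cosM.
Qed.

Section Orthogonal.
Variable g : H.
Hypothesis g_orth : forall k, ip (en k) g = 0.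

(** Multiplication by cos(pi x) turns a sine into half the sum of its two neighbours, so
    orthogonality to all sines survives multiplication by powers of the cosine. *)
Lemma sincos_orth m k :
  ip (toL2 (fun x : R => sin (k.+1%:R * pi * x) * cos (1%:R * pi * x) ^+ m)) g = 0.
Proof.
elim: m k => [k|m IH k].
  have -> : (fun x : R => sin (k.+1%:R * pi * x) * cos (1%:R * pi * x) ^+ 0) =
      (fun x => (Num.sqrt 2)^-1 * sinf k x).
    by apply/funext => x; rewrite expr0 mulr1 /sinf mulrA mulVf ?mul1r// gt_eqF// sqrtr_gt0.
  by rewrite toL2Z ?ipZl ?[ip _ _]g_orth ?mulr0//; exact/continuous_sqi/continuous_sinf.
have prod (x : R) : sin (k.+1%:R * pi * x) * cos (1%:R * pi * x) =
    2^-1 * sin (k.+2%:R * pi * x) + 2^-1 * sin (k%:R * pi * x).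
  have -> : k.+2%:R * pi * x = k.+1%:R * pi * x + 1%:R * pi * x :> R by rewrite -natr1; ring.
  have -> : k%:R * pi * x = k.+1%:R * pi * x - 1%:R * pi * x :> R by rewrite -natr1; ring.
  rewrite sinD sinB; lra.
have cs j n := continuous_sqi (@continuous_sincos j n).
case: k prod => [|k] prod.
  have -> : (fun x : R => sin (1%:R * pi * x) * cos (1%:R * pi * x) ^+ m.+1) =
      (fun x => 2^-1 * (sin (2%:R * pi * x) * cos (1%:R * pi * x) ^+ m)).
    by apply/funext => x; rewrite exprS mulrA prod !mul0r sin0 mulr0 addr0 mulrA.
  by rewrite toL2Z// ipZl IH mulr0.
have -> : (fun x : R => sin (k.+2%:R * pi * x) * cos (1%:R * pi * x) ^+ m.+1) =
    (fun x => 2^-1 * (sin (k.+3%:R * pi * x) * cos (1%:R * pi * x) ^+ m)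
            + 2^-1 * (sin (k.+1%:R * pi * x) * cos (1%:R * pi * x) ^+ m)).
  by apply/funext => x; rewrite exprS mulrA prod mulrDl !mulrA.
rewrite toL2D ?toL2Z//; try exact: sqiZ.
by rewrite ipDl !ipZl !IH !mulr0 addr0.
Qed.

Lemma sinpoly_orth (p : {poly R}) :
  ip (toL2 (fun x : R => sin (1%:R * pi * x) * p.[cos (1%:R * pi * x)])) g = 0.
Proof.
pose F i (x : R) := p`_i * (sin (1%:R * pi * x) * cos (1%:R * pi * x) ^+ i).
have -> : (fun x : R => sin (1%:R * pi * x) * p.[cos (1%:R * pi * x)]) =
    (fun x => \sum_(i < size p) F i x).
  apply/funext => x; rewrite horner_coef mulr_sumr; apply: eq_bigr => i _.
  by rewrite /F mulrCA.
have cs i := continuous_sqi (@continuous_sincos 0%N i).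
have sF i : sqi (F i) by exact/sqiZ/cs.
rewrite (toL2_sum _ sF).2 ip_suml big1// => i _.
by rewrite toL2Z ?ipZl ?sincos_orth ?mulr0//; exact: cs.
Qed.

Let G (x : R) := repr g x * sin (1%:R * pi * x).

Let sG_cont : continuous (fun x : R => sin (1%:R * pi * x)).
Proof. exact: continuous_sinM. Qed.

Let iG : mu01.-integrable [set: R] (EFin \o G).
Proof. by apply: integrable_mul; [exact: repr_sqi|exact: continuous_sqi]. Qed.

Let mG : measurable_fun [set: R] G.
Proof.
apply: measurable_funM; first by apply: sqi_measurable; exact: repr_sqi.
exact: continuous_measurable_fun.
Qed.

(** As cos(pi x) decreases on [0, 1], a polynomial in it can imitate the indicator of x > a. The
    step polynomials do so boundedly, and dominated convergence passes to the limit. *)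
Lemma tail_orth (a : R) : 0 < a < 1 -> \int[mu01]_x (G \_ `]a, +oo[%classic) x = 0.
Proof.
move=> /andP[a0 a1].
pose u0 := cos (1%:R * pi * a) : R.
(* Affine map of [-1, 1] into the unit interval that sends the cut value u0 to 1/2, the jump of the
   step polynomials. *)
pose y (u : R) := 2^-1 + (u - u0) / 4.
pose q (n : nat) : {poly R} := (1 - ((2^-1 - u0 / 4)%:P + (4^-1)%:P * 'X) ^+ n) ^+ (2 ^ n).
have qE n u : (q n).[u] = steppoly (y u) n.
  rewrite /q /steppoly !hornerE; congr ((1 - _ ^+ n) ^+ _); rewrite /y; lra.
have y01 (x : R) : 0 <= y (cos x) <= 1.
  by have := cos_le1 x; have := cos_geN1 x; have := cos_le1 (1%:R * pi * a);
  have := cos_geN1 (1%:R * pi * a); rewrite /y /u0; lra.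
pose f n (x : R) := G x * (q n).[cos (1%:R * pi * x)].
have f0 n : \int[mu01]_x f n x = 0.
  rewrite -[RHS](sinpoly_orth (q n)).
  pose s (x : R) := sin (1%:R * pi * x) * (q n).[cos (1%:R * pi * x)].
  have cs : continuous s.
    move=> x; apply: cvgM; first exact: sG_cont.
    apply: (cvg_comp (fun y : R => cos (1%:R * pi * y)) (horner (q n)) _ (@continuous_horner R (q n) _)).
    exact: continuous_cosM.
  have ss := continuous_sqi cs.
  rewrite (ipE ss (repr_sqi g) (toL2K ss) (aeW _ (fun x => erefl (repr g x)))).
  by apply: eq_Rintegral => x _; rewrite /f /G /s; ring.
have mf n : measurable_fun [set: R] (f n).
  apply: measurable_funM => //; apply: continuous_measurable_fun => x.
  apply: (cvg_comp (fun y : R => cos (1%:R * pi * y)) (horner (q n)) _ (@continuous_horner R (q n) _)).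
  exact: continuous_cosM.
have mGa : measurable_fun [set: R] (G \_ `]a, +oo[%classic).
  by apply/(measurable_restrictT _ _).1 => //; exact: measurable_funTS.
have aelim : {ae mu01, forall x, f n x @[n --> \oo] --> (G \_ `]a, +oo[%classic) x}.
  apply: ae_leb01; exists [set a]; split; first exact: measurable_set1.
    exact: lebesgue_measure_set1.
  move=> x /= /not_implyP[/andP[x0 x1]] nl; apply: contrapT => xa; apply: nl.
  have pi0 := pi_gt0 R.
  have ix : 1%:R * pi * x \in `[0, pi].
    by rewrite in_itv/= mul1r mulr_ge0 ?(ltW pi0) ?(ltW x0)//= -[leRHS]mulr1 ler_pM2l// ltW.
  have ia : 1%:R * pi * a \in `[0, pi].
    by rewrite in_itv/= mul1r mulr_ge0 ?(ltW pi0) ?(ltW a0)//= -[leRHS]mulr1 ler_pM2l// ltW.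
  rewrite patchE; case: ifPn => xa'.
    rewrite -[X in _ --> X]mulr1 /f; apply: cvgM; first exact: cvg_cst.
    under eq_cvg do rewrite qE.
    apply: steppoly_lt; have /andP[-> _]/= := y01 (1%:R * pi * x).
    have : cos (1%:R * pi * x) < u0.
      by rewrite ltr_cos// mul1r ltr_pM2l//; move: xa'; rewrite inE/= in_itv/= andbT.
    by rewrite /y; lra.
  rewrite (_ : point = G x * 0); last by rewrite mulr0.
  rewrite /f; apply: cvgM; first exact: cvg_cst.
  under eq_cvg do rewrite qE.
  apply: steppoly_gt; have /andP[_ ->] := y01 (1%:R * pi * x); rewrite andbT.
  have : u0 < cos (1%:R * pi * x).
    rewrite ltr_cos// mul1r ltr_pM2l// lt_neqAle; apply/andP; split; first exact/eqP.
    by rewrite leNgt; apply: contra xa' => xa'; rewrite inE/= in_itv/= andbT.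
  by rewrite /y; lra.
have fG n x : `|f n x| <= `|G x|.
  rewrite /f normrM -[leRHS]mulr1 ler_wpM2l// qE.
  have /andP[p0 p1] := steppoly_bound n (y01 (1%:R * pi * x)).
  by rewrite ger0_norm.
have aelim' : {ae mu01, forall x, setT x -> f n x @[n --> \oo] --> (G \_ `]a, +oo[%classic) x}.
  by apply: aeS aelim.
have := @Rint_dominated _ _ _ mu01 setT f (G \_ `]a, +oo[%classic) (fun x => `|G x|)
  measurableT mf mGa aelim' (integrable_abse iG) (fun n x _ => fG n x).
under eq_cvg do rewrite f0.
by move=> h; exact: (cvg_unique _ h (cvg_cst _)).
Qed.

End Orthogonal.

(** The function G = g sin(pi x) has integral zero over every tail, so its indefinite integral is
    constant on ]0, 1[ and Lebesgue differentiation gives G = 0 almost everywhere. There sin(pi x) >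
    0 can be cancelled. *)
Theorem sine_complete (g : H) : (forall k, ip (en k) g = 0) -> g = 0.
Proof.
move=> go.
pose G (x : R) := repr g x * sin (1%:R * pi * x).
have iG : mu01.-integrable [set: R] (EFin \o G).
  by apply: integrable_mul; [exact: repr_sqi|exact/continuous_sqi/continuous_sinM].
have mG : measurable_fun [set: R] G.
  apply: measurable_funM; first by apply: sqi_measurable; exact: repr_sqi.
  by apply: continuous_measurable_fun; exact: continuous_sinM.
have iGleb : leb.-integrable `[0, 1] (EFin \o G).
  apply/integrableP; split; first exact/measurable_funTS/measurable_EFinP.
  rewrite -integral_itv_bndo_bndc; last exact/measurable_funTS/measurableT_comp/measurable_EFinP.
  rewrite -integral_itv_obnd_cbnd; last exact/measurable_funTS/measurableT_comp/measurable_EFinP.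
  rewrite -integral_leb01//; last exact/measurableT_comp/measurable_EFinP.
  by move/integrableP: iG => [].
pose f := G \_ `[0, 1].
have fint y : leb.-integrable [set` `]-oo, y]] (EFin \o f).
  rewrite /f -restrict_EFin; apply: (@integrableS _ _ _ _ setT) => //.
  by apply/integrable_restrict => //=; rewrite setTI.
have floc : locally_integrable [set: R] f by exact: integrable_locally.
have := FTC1Ny fint floc; set F := fun x => _ => aeF.
have Fc (x : R) : 0 < x < 1 -> F x = \int[mu01]_x G x.
  move=> x01; have x01' := x01; move/andP: x01' => [x0 x1].
  have -> : \int[mu01]_x G x = \int[mu01]_y (G \_ `]-oo, x]%classic) y
      + \int[mu01]_y (G \_ `]x, +oo[%classic) y.
    have ir (A : set R) : measurable A -> mu01.-integrable [set: R] (EFin \o (G \_ A)).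
      move=> mA; apply: (le_integrable measurableT _ _ iG).
        apply/measurable_EFinP; apply/(measurable_restrictT _ _).1 => //.
        exact: measurable_funTS.
      by move=> y _; rewrite lee_fin patchE; case: ifP => //; rewrite normr0.
    rewrite -RintegralD//; try exact: ir.
    apply: eq_Rintegral => y _; rewrite !patchE !mem_setE !in_itv/= andbT.
    by case: ltP; rewrite ?addr0 ?add0r.
  rewrite tail_orth// addr0 Rintegral_leb01; last first.
    by apply/(measurable_restrictT _ _).1 => //; exact: measurable_funTS.
  by rewrite -Rintegral_mkcondr /F /f -Rintegral_mkcondr setIC.
have G0 : {ae mu01, forall x, G x = 0}.
  apply: ae_leb01; apply: aeS aeF => x h x01; have /andP[x0 x1] := x01.
  have := h.2.
  rewrite /f patchE mem_set/=; last by rewrite in_itv/= !ltW.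
  move=> <-; rewrite derive1E -[RHS](derive_cst (\int[mu01]_x G x : R) (x : R) (1 : R)).
  apply: near_eq_derive.
  near=> z; apply: Fc; apply/andP; split.
    by near: z; exact: lt_nbhsr.
  by near: z; exact: lt_nbhsl.
apply: L2_ae_eq.
apply: aeS2 (aeI G0 repr_0) (_ : {ae mu01, forall x, 0 < x < 1}).
  move=> x [Gx ->] /andP[x0 x1]; move/eqP: Gx; rewrite mulf_eq0 => /orP[/eqP //|].
  by rewrite mul1r gt_eqF// sin_gt0_pi// mulr_gt0 ?pi_gt0//= -[ltRHS]mulr1 ltr_pM2l ?pi_gt0.
by apply: ae_leb01; exact: aeW.
Unshelve. all: by end_near. Qed.

End SineComplete.

(** * Smooth cut-off functions *)

Section Smooth.
Context {R : realType}.
Implicit Types f g : R -> R.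

(** The recursion peels off the innermost derivative, which makes closure under sums, products and
    affine substitutions a plain induction; [smooth_derive1n] returns to the iterates used by
    [test_fun]. *)
Fixpoint times_derivable (n : nat) f : Prop :=
  if n is m.+1 then (forall x, derivable f x 1) /\ times_derivable m (derive1 f) else True.

Definition smooth f := forall n, times_derivable n f.

Lemma smooth_derive1n f : smooth f -> forall n x, derivable (derive1n n f) x 1.
Proof.
move=> sf n; elim: n f sf => [|n IH] f sf x.
  by rewrite derive1n0; have [+ _] := sf 1%N; apply.
by rewrite derive1Sn; apply: IH => m; have [] := sf m.+1.
Qed.

Lemma times_derivableW n f : times_derivable n.+1 f -> times_derivable n f.
Proof. by elim: n f => [//|n IH] f [df hf]; split=> //; exact: IH. Qed.

Lemma times_derivableS n f (df : R -> R) : (forall x : R, is_derive x (1 : R) f (df x)) ->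
  times_derivable n df -> times_derivable n.+1 f.
Proof.
move=> h hd; split=> [x|]; first by case: (h x).
suff -> : derive1 f = df by [].
by apply/funext => x; rewrite derive1E; case: (h x).
Qed.

Lemma times_derivableP n f : times_derivable n.+1 f ->
  (forall x : R, is_derive x (1 : R) f (derive1 f x)) /\ times_derivable n (derive1 f).
Proof. by move=> [h ?]; split => // x; rewrite derive1E; exact/derivableP/h. Qed.

Lemma times_derivableD n f g : times_derivable n f -> times_derivable n g ->
  times_derivable n (fun x => f x + g x).
Proof.
elim: n f g => [//|n IH] f g /times_derivableP[df hf] /times_derivableP[dg hg].
apply: (@times_derivableS _ _ (fun x => derive1 f x + derive1 g x)).
exact: IH.
Qed.

Lemma times_derivableM n f g : times_derivable n f -> times_derivable n g ->
  times_derivable n (fun x => f x * g x).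
Proof.
elim: n f g => [//|n IH] f g hf hg.
have [df hf'] := times_derivableP hf; have [dg hg'] := times_derivableP hg.
apply: (@times_derivableS _ _ (fun x => f x * derive1 g x + g x * derive1 f x)).
by apply: times_derivableD; apply: IH => //; exact: times_derivableW.
Qed.

Lemma is_derive_affine (a b x : R) : is_derive x (1 : R) (fun x : R => a * x + b) a.
Proof.
have h : is_derive x 1 (fun x : R => a * x) a.
  by have := @is_deriveZ R R R id a x 1 1 (is_derive_id x 1); rewrite /GRing.scale/= mulr1.
by have := @is_deriveD R R R (fun x => a * x) (cst b) x 1 a 0 h (is_derive_cst _ _ _); rewrite addr0.
Qed.

Lemma is_derive_scale (f : R -> R) (c df x : R) : is_derive x (1 : R) f df ->
  is_derive x (1 : R) (fun x : R => c * f x) (c * df).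
Proof. by move=> h; have := @is_deriveZ R R R f c x 1 _ h; rewrite /GRing.scale/=. Qed.

Lemma times_derivable_affine n f (a b c : R) : times_derivable n f ->
  times_derivable n (fun x => c * f (a * x + b)).
Proof.
elim: n f c => [//|n IH] f c /times_derivableP[df hf].
apply: (@times_derivableS _ _ (fun x => (c * a) * derive1 f (a * x + b))); last exact: IH.
move=> x; rewrite -mulrA; apply: is_derive_scale; rewrite mulrC.
exact: (@is_derive1_comp R f (fun x => a * x + b) x _ _ (df _) (is_derive_affine _ _ _)).
Qed.

Lemma smooth_trig (c : R) n a : times_derivable n (fun x : R => a * sin (c * x)) /\
  times_derivable n (fun x : R => a * cos (c * x)).
Proof.
elim: n a => [//|n IH] a; split.
- apply: (@times_derivableS _ _ (fun x => (a * c) * cos (c * x))); last exact: (IH _).2.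
  by move=> x; rewrite -mulrA; apply: is_derive_scale; exact: is_derive_sinM.
- apply: (@times_derivableS _ _ (fun x => (- (a * c)) * sin (c * x))); last exact: (IH _).1.
  move=> x; rewrite mulNr -mulrA -mulrN; apply: is_derive_scale; exact: is_derive_cosM.
Qed.

(** The functions x^(-m) exp(-1/x), extended by zero. All derivatives of the classical exp(-1/x) are
    linear combinations of them. *)
Definition flat (m : nat) (x : R) : R :=
  if 0 < x then x^-1 ^+ m * expR (- x^-1) else 0.

Lemma powexp_le (m : nat) (s : R) : 0 <= s -> s ^+ m.+1 * expR (- s) <= (m.+1)`!%:R.
Proof.
move=> s0; rewrite expRN -ler_pdivlMr ?invr_gt0 ?expR_gt0// invrK.
have := expR_ge1Dxn m s0; rewrite -ler_pdivrMl ?ltr0n ?fact_gt0// mulrC; lra.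
Qed.

Lemma flat_ge0 m x : 0 <= flat m x.
Proof.
rewrite /flat; case: ifP => // x0.
by rewrite mulr_ge0 ?expR_ge0// exprn_ge0// invr_ge0 ltW.
Qed.

Lemma flat_le m x : `|flat m x| <= m.+2`!%:R * x ^+ 2.
Proof.
rewrite ger0_norm ?flat_ge0// /flat; case: ifP => x0; last by rewrite mulr_ge0 ?sqr_ge0.
have := @powexp_le m.+1 x^-1; rewrite invr_ge0 (ltW x0) => /(_ isT).
rewrite -ler_pdivrMr ?exprn_gt0// -exprVn => h; apply: le_trans h.
by rewrite mulrAC -exprD addn2.
Qed.

Lemma is_derive_eqr (f : R -> R) (x a b : R) : is_derive x (1 : R) f a -> a = b -> is_derive x (1 : R) f b.
Proof. by move=> h <-. Qed.

Lemma is_derive_mul (f g : R -> R) (df dg x : R) : is_derive x (1 : R) f df -> is_derive x (1 : R) g dg ->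
  is_derive x (1 : R) (fun x => f x * g x) (df * g x + f x * dg).
Proof.
move=> hf hg; apply: (is_derive_eqr (@is_deriveM R R f g x 1 _ _ hf hg)).
by rewrite /GRing.scale/=; ring.
Qed.

Lemma is_derive_expr (f : R -> R) (m : nat) (df x : R) : is_derive x (1 : R) f df ->
  is_derive x (1 : R) (fun x : R => f x ^+ m) (m%:R * f x ^+ m.-1 * df).
Proof.
move=> hf; elim: m => [|m IH].
  rewrite !mul0r (_ : (fun x0 : R => f x0 ^+ 0) = cst 1); first exact: is_derive_cst.
  by apply/funext => y; rewrite expr0.
have -> : (fun x : R => f x ^+ m.+1) = (fun x => f x * f x ^+ m).
  by apply/funext => y; rewrite exprS.
apply: (is_derive_eqr (is_derive_mul hf IH)).
case: m {IH} => [|m]; first by rewrite !expr0 !mul0r mulr0 addr0 mulr1 !mul1r.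
by rewrite /= -(natr1 m.+1) exprS; ring.
Qed.

Lemma is_derive0_flat f (C : R) : (forall x, `|f x| <= C * x ^+ 2) -> is_derive (0 : R) (1 : R) f 0.
Proof.
move=> fC.
have C0 : 0 <= C by have := fC 1; rewrite expr1n mulr1; exact: le_trans.
have f0 : f 0 = 0 by apply/eqP; have := fC 0; rewrite expr0n/= mulr0 normr_le0.
have h : (fun h : R => h^-1 *: ((f \o shift 0) (h *: 1) - f 0)) @ 0^' --> (0 : R).
  apply/cvgrPdist_le => e e0; near=> t.
  rewrite sub0r normrN /= addr0 f0 subr0 /GRing.scale/= mulr1 normrM normfV.
  have t0 : 0 < `|t| by rewrite normr_gt0; near: t; exact: nbhs_dnbhs_neq.
  rewrite ler_pdivrMl// (le_trans (fC t))// -real_normK ?num_real// expr2 mulrA mulrC ler_wpM2l//.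
  have : `|t| <= e / (C + 1).
    by near: t; apply: dnbhs0_le; rewrite divr_gt0// ltr_wpDl.
  rewrite ler_pdivlMr ?ltr_wpDl// => h; apply: le_trans h.
  by rewrite mulrC ler_wpM2l// lerDl.
by apply: DeriveDef; [exact: cvgP h|exact: cvg_lim h].
Unshelve. all: by end_near. Qed.

(** The family is closed under differentiation, so smoothness follows by induction. At the origin
    the quadratic bound [flat_le] yields the derivative 0. *)
Lemma is_derive_flat m a (x : R) :
  is_derive x (1 : R) (fun x => a * flat m x) (a * flat m.+2 x + (- (a * m%:R)) * flat m.+1 x).
Proof.
have [x0|x0|->] := ltgtP x 0.
- rewrite /flat ltNge (ltW x0)/= !mulr0 addr0.
  apply: (near_eq_is_derive (f := cst 0)).
  near=> z; rewrite /= ltNge ltW ?mulr0//.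
  by near: z; exact: lt_nbhsl.
- have xn : x != 0 by rewrite gt_eqF.
  rewrite (_ : _ + _ = a * (flat m.+2 x - m%:R * flat m.+1 x)); last by ring.
  apply: is_derive_scale; rewrite /flat x0.
  have d1 : is_derive x (1 : R) (fun x : R => x^-1) (- x ^- 2).
    have := @is_deriveV R id x 1 1 xn (is_derive_id x 1).
    by rewrite /GRing.scale/= mulr1.
  have d2 : is_derive x (1 : R) (fun x : R => expR (- x^-1)) (expR (- x^-1) * x ^- 2).
    have d3 := @is_deriveN R R R _ x 1 _ d1; rewrite opprK in d3.
    exact: (@is_derive1_comp R expR _ x _ _ (is_derive_expR _) d3).
  have d4 : is_derive x (1 : R) (fun x : R => x^-1 ^+ m) (m%:R * x^-1 ^+ m.-1 * (- x ^- 2)).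
    exact: is_derive_expr.
  have d5 := is_derive_mul d4 d2.
  apply: (near_eq_is_derive _ (is_derive_eqr d5 _)).
    near=> z; rewrite ifT//.
    by near: z; exact: lt_nbhsr.
  case: m {d4 d5} => [|m]; first by rewrite !expr0 !mul0r subr0 add0r mul1r exprVn mulrC.
  by rewrite /= -!exprVn !exprS; ring.
- rewrite (_ : _ + _ = 0); last by rewrite /flat ltxx !mulr0 addr0.
  apply: (@is_derive0_flat _ (`|a| * m.+2`!%:R)) => y.
  by rewrite normrM -mulrA ler_wpM2l// flat_le.
Unshelve. all: by end_near. Qed.

Lemma smooth_flat n m a : times_derivable n (fun x => a * flat m x).
Proof.
elim: n m a => [//|n IH] m a.
apply: (times_derivableS (is_derive_flat m a)).
by apply: times_derivableD; exact: IH.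
Qed.

Lemma flat_neg m x : x <= 0 -> flat m x = 0.
Proof. by move=> x0; rewrite /flat ltNge x0. Qed.

Lemma flat0_le1 x : flat 0 x <= 1.
Proof.
rewrite /flat; case: ifP => x0; last exact: ler01.
by rewrite expr0 mul1r -expR0 ler_expR oppr_le0 invr_ge0 ltW.
Qed.

Lemma flat2_le x : flat 2 x <= 2.
Proof.
rewrite /flat; case: ifP => x0; last lra.
by have := @powexp_le 1 x^-1; rewrite invr_ge0 (ltW x0) => /(_ isT).
Qed.

Lemma xflat2_le x : x * flat 2 x <= 1.
Proof.
rewrite /flat; case: ifP => x0; last by rewrite mulr0 ler01.
have := @powexp_le 0 x^-1; rewrite invr_ge0 (ltW x0) => /(_ isT).
by rewrite expr2 !mulrA divff ?gt_eqF// mul1r expr1.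
Qed.

Lemma flat0_ge x : 0 < x -> 1 - x^-1 <= flat 0 x.
Proof. by move=> x0; rewrite /flat x0 expr0 mul1r; exact: expR_ge1Dx. Qed.

Lemma flat2_le_inv x : 0 < x -> flat 2 x <= x^-1 ^+ 2.
Proof.
move=> x0; rewrite /flat x0 -[leRHS]mulr1 ler_wpM2l ?exprn_ge0 ?invr_ge0 ?(ltW x0)//.
by rewrite -expR0 ler_expR oppr_le0 invr_ge0 ltW.
Qed.

(** Vanishes outside [1/n, 1 - 1/n]; on ]0, 1[ both arguments tend to infinity with n, where
    [flat 0] tends to 1. *)
Definition cutoff (n : nat) (x : R) : R :=
  flat 0 (n%:R * x - 1) * flat 0 (- n%:R * x + (n%:R - 1)).

Definition dcutoff (n : nat) (x : R) : R :=
  n%:R * (flat 2 (n%:R * x - 1) * flat 0 (- n%:R * x + (n%:R - 1)) -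
  flat 0 (n%:R * x - 1) * flat 2 (- n%:R * x + (n%:R - 1))).

Lemma smooth_cutoff n m : times_derivable m (cutoff n).
Proof.
apply: times_derivableM.
  have := @times_derivable_affine m _ n%:R (-1) 1 (@smooth_flat m 0%N 1).
  by under eq_fun do rewrite !mul1r.
have := @times_derivable_affine m _ (- n%:R) (n%:R - 1) 1 (@smooth_flat m 0%N 1).
by under eq_fun do rewrite !mul1r.
Qed.

Lemma is_derive_flat0 (x : R) : is_derive x (1 : R) (flat 0) (flat 2 x).
Proof.
have := is_derive_flat 0 1 x; under eq_fun do rewrite mul1r.
by rewrite mul1r mul1r oppr0 mul0r addr0.
Qed.

Lemma is_derive_cutoff n (x : R) : is_derive x (1 : R) (cutoff n) (dcutoff n x).
Proof.
have h1 : is_derive x (1 : R) (fun x => flat 0 (n%:R * x - 1)) (flat 2 (n%:R * x - 1) * n%:R).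
  exact: (@is_derive1_comp R (flat 0) (fun x => n%:R * x - 1) x _ _ (is_derive_flat0 _) (is_derive_affine _ _ _)).
have h2 : is_derive x (1 : R) (fun x => flat 0 (- n%:R * x + (n%:R - 1)))
    (flat 2 (- n%:R * x + (n%:R - 1)) * - n%:R).
  exact: (@is_derive1_comp R (flat 0) (fun x => - n%:R * x + (n%:R - 1)) x _ _ (is_derive_flat0 _) (is_derive_affine _ _ _)).
by apply: (is_derive_eqr (is_derive_mul h1 h2)); rewrite /dcutoff; ring.
Qed.

Lemma cutoff_support n x : (0 < n)%N -> cutoff n x != 0 -> n%:R^-1 <= x <= 1 - n%:R^-1.
Proof.
move=> n0; rewrite /cutoff mulf_eq0 negb_or => /andP[h1 h2].
have nR : 0 < n%:R :> R by rewrite ltr0n.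
have a1 : 0 < n%:R * x - 1 by rewrite ltNge; apply: contra h1 => /(flat_neg 0) ->.
have a2 : 0 < - n%:R * x + (n%:R - 1) by rewrite ltNge; apply: contra h2 => /(flat_neg 0) ->.
have e1 : n%:R * n%:R^-1 = 1 :> R by rewrite divff// gt_eqF.
apply/andP; split; rewrite -(ler_pM2l nR) ?mulrBr e1; lra.
Qed.

Lemma cutoff_bound n x : 0 <= cutoff n x <= 1.
Proof.
apply/andP; split; first by rewrite mulr_ge0 ?flat_ge0.
by apply: mulr_ile1; rewrite ?flat_ge0 ?flat0_le1.
Qed.

Lemma cvg_cutoff x : 0 < x < 1 -> cutoff n x @[n --> \oo] --> (1 : R).
Proof.
move=> /andP[x0 x1]; rewrite -[X in _ --> X]mulr1.
have key (f : nat -> R) : (forall c, exists N, forall n, (N <= n)%N -> c <= f n) ->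
    flat 0 (f n) @[n --> \oo] --> (1 : R).
  move=> hf; apply/cvg_epsP => e e0.
  have [N hN] := hf (e^-1 + 1); exists N => n /hN h.
  have f0 : 0 < f n by apply: lt_le_trans h; rewrite ltr_wpDl ?invr_ge0 ?ltW.
  rewrite ler_norml; have := flat0_le1 (f n); have := flat0_ge f0.
  have : (f n)^-1 <= e by rewrite invf_ple//; lra.
  lra.
have big (a c : R) : 0 < a -> exists N, forall n, (N <= n)%N -> c <= n%:R * a.
  move=> a0; exists (Num.bound `|c / a|) => n hn; rewrite -ler_pdivrMr//.
  rewrite (le_trans (ler_norm _))// ltW// (lt_le_trans (archi_boundP _))//.
  by rewrite ler_nat.
apply: cvgM; apply: key => c.
  by have [N hN] := big x (c + 1) x0; exists N => n /hN; lra.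
have y0 : 0 < 1 - x by lra.
by have [N hN] := big (1 - x) (c + 1) y0; exists N => n /hN; lra.
Qed.

Lemma continuous_is_derive (f df : R -> R) : (forall x : R, is_derive x (1 : R) f (df x)) -> continuous f.
Proof. by move=> h x; apply/differentiable_continuous/derivable1_diffP; case: (h x). Qed.

End Smooth.

(** * Spectrum of the Dirichlet Laplacian *)

Section Laplace.
Context {R : realType}.
Local Notation H := (L2 R).
Implicit Types k : nat.

Lemma sin_le_abs (x : R) : `|sin x| <= `|x|.
Proof.
have pos (y : R) : 0 <= y -> `|sin y| <= y.
  rewrite le_eqVlt => /predU1P[<-|y0]; first by rewrite sin0 normr0.
  have [c _] := @MVT R sin cos 0 y y0 (fun x _ => is_derive_sin x)
    (continuous_subspaceT (@continuous_sin R)).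
  rewrite sin0 !subr0 => ->; rewrite normrM [X in _ * X]ger0_norm ?(ltW y0)//.
  by rewrite -[leRHS]mul1r ler_wpM2r ?(ltW y0)// ler_norml cos_geN1 cos_le1.
have [x0|x0] := leP 0 x; first by rewrite [leRHS]ger0_norm// pos.
by rewrite -normrN -sinN [leRHS]ler0_norm ?pos ?oppr_ge0 ?ltW.
Qed.

Definition kp k : R := k.+1%:R * pi.
Definition lam k : R := kp k ^+ 2.

Lemma kp_gt0 k : 0 < kp k. Proof. by rewrite mulr_gt0 ?pi_gt0. Qed.
Lemma lam_gt0 k : 0 < lam k. Proof. by rewrite exprn_gt0 ?kp_gt0. Qed.
Lemma sinfE k x : sinf k x = Num.sqrt 2 * sin (kp k * x). Proof. by []. Qed.
Lemma cosfE k x : cosf k x = Num.sqrt 2 * cos (kp k * x). Proof. by []. Qed.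

Lemma is_derive_sinf k (x : R) : is_derive x (1 : R) (sinf k) (kp k * cosf k x).
Proof. by rewrite cosfE mulrCA; apply: is_derive_scale; exact: is_derive_sinM. Qed.

Lemma is_derive_cosf k (x : R) : is_derive x (1 : R) (cosf k) (- (kp k * sinf k x)).
Proof. by rewrite sinfE mulrCA -mulrN; apply: is_derive_scale; exact: is_derive_cosM. Qed.

Lemma test_smooth (eta : R -> R) : test_fun eta ->
  [/\ continuous eta, continuous (derive1 eta), (forall x : R, is_derive x (1 : R) eta (derive1 eta x)),
    eta 0 = 0 & eta 1 = 0].
Proof.
move=> [sm [a [b [a0 b1 supp]]]].
have d0 (x : R) : is_derive x (1 : R) eta (derive1 eta x).
  by rewrite derive1E; apply/derivableP; have := sm 0%N x; rewrite derive1n0.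
split.
- exact: continuous_is_derive d0.
- by move=> x; apply/differentiable_continuous/derivable1_diffP; have := sm 1%N x; rewrite derive1n1.
- exact: d0.
- by apply/eqP/negPn/negP => /supp; lra.
- by apply/eqP/negPn/negP => /supp; lra.
Qed.

Lemma test_parts (f df eta : R -> R) : (forall x : R, is_derive x (1 : R) f (df x)) -> continuous df ->
  test_fun eta -> ip (toL2 f) (toL2 (derive1 eta)) = - ip (toL2 df) (toL2 eta).
Proof.
move=> hf cdf /test_smooth[ce cde he e0 e1].
have cf := continuous_is_derive hf.
have h x := is_derive_mul (hf x) (he x).
have c1 : continuous (fun x => df x * eta x) by move=> x; apply: cvgM; [exact: cdf|exact: ce].
have c2 : continuous (fun x => f x * derive1 eta x) by move=> x; apply: cvgM; [exact: cf|exact: cde].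
have c12 : continuous (fun x => df x * eta x + f x * derive1 eta x).
  by move=> x; apply: cvgD; [exact: c1|exact: c2].
have := Rint_FTC2 ler01 h c12.
rewrite e0 e1 !mulr0 subr0 RintegralD//; try exact: integrable_continuous.
by rewrite !ip_continuous// => /eqP; rewrite addrC addr_eq0 => /eqP.
Qed.

Lemma weak_deriv_en k : weak_deriv (en k) (kp k *: cn k).
Proof.
move=> phi tp; rewrite (test_parts (is_derive_sinf k) _ tp).
  by rewrite toL2Z//; exact/continuous_sqi/continuous_cosf.
by move=> x; apply: cvgMr; exact: continuous_cosf.
Qed.

Lemma weak_deriv_cn k : weak_deriv (cn k) (- kp k *: en k).
Proof.
move=> phi tp; rewrite (test_parts (is_derive_cosf k) _ tp); last first.
  by move=> x; apply: cvgN; apply: cvgMr; exact: continuous_sinf.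
congr (- ip _ _); rewrite -toL2Z; last exact/continuous_sqi/continuous_sinf.
by congr toL2; apply/funext => x; rewrite mulNr.
Qed.

Lemma weak_derivZ a u g : weak_deriv u g -> weak_deriv (a *: u : H) (a *: g).
Proof. by move=> h phi tp; rewrite !ipZl h// mulrN. Qed.

Lemma hnorm_cvg0 (u : nat -> H) : ip (u n) (u n) @[n --> \oo] --> (0 : R) ->
  hnorm (u n) @[n --> \oo] --> (0 : R).
Proof.
move=> /cvg_epsP h; apply/cvg_epsP => e e0.
have [N hN] := h (e ^+ 2) (exprn_gt0 2 e0); exists N => n /hN.
rewrite !subr0 -hnorm2 !ger0_norm ?hnorm_ge0 ?sqr_ge0//.
by rewrite ler_sqr ?nnegrE ?hnorm_ge0 ?(ltW e0).
Qed.

Lemma hnorm_dominated (f_ : nat -> R -> R) (f : R -> R) (M : R) :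
  (forall n, continuous (f_ n)) -> continuous f -> (forall n x, `|f_ n x| <= M) ->
  (forall x, `|f x| <= M) ->
  (forall x, 0 < x < 1 -> f_ n x @[n --> \oo] --> f x) ->
  hnorm (toL2 (f_ n) - toL2 f) @[n --> \oo] --> (0 : R).
Proof.
move=> cf_ cf fM fM' cvf; apply: hnorm_cvg0.
have cd n : continuous (fun x => f_ n x - f x).
  by move=> x; apply: cvgB; [exact: cf_|exact: cf].
have E n : ip (toL2 (f_ n) - toL2 f) (toL2 (f_ n) - toL2 f) =
    \int[mu01]_x ((f_ n x - f x) * (f_ n x - f x)).
  by rewrite -toL2B ?ip_toL2//; exact: continuous_sqi.
have -> : (fun n => ip (toL2 (f_ n) - toL2 f) (toL2 (f_ n) - toL2 f)) =
    (fun n => \int[mu01]_x ((f_ n x - f x) * (f_ n x - f x))) by apply/funext.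
have i0 : \int[mu01]_x (0 : R) = 0 by rewrite Rintegral_cst// mul0r.
rewrite -[X in _ --> X]i0.
apply: (@Rint_dominated _ _ _ mu01 setT (fun n x => (f_ n x - f x) * (f_ n x - f x)) (fun=> 0)
  (fun=> (2 * M) ^+ 2)) => //.
- move=> n; apply: continuous_measurable_fun => x.
  by apply: cvgM; exact: cd.
- apply: aeS (_ : {ae mu01, forall x, 0 < x < 1}); last by apply: ae_leb01; exact: aeW.
  move=> x x01 _; rewrite -[X in _ --> X](mul0r (0 : R)).
  have h : f_ n x - f x @[n --> \oo] --> (0 : R).
    by rewrite -[X in _ --> X](subrr (f x)); apply: cvgB; [exact: cvf|exact: cvg_cst].
  by apply: cvgM; exact: h.
- have : sqi (fun=> (2 * M) ^+ 2 : R).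
    by apply: (@sqi_bounded _ _ `|(2 * M) ^+ 2|) => // x _.
  exact: integrable_sqi1.
- move=> n x _; rewrite -expr2 normrX ler_sqr ?nnegrE//; last first.
    by rewrite mulr_ge0// (le_trans _ (fM n x)).
  by rewrite (le_trans (ler_normB _ _))// mulr2n mulrDl mul1r lerD.
Qed.

(** Test functions that approximate the k-th sine in the H^1 norm and witness [H10 (en k)]. The
    shift to n + 1 keeps the support inside ]0, 1[ for n = 0. *)
Definition cutsin n k (x : R) := cutoff n.+1 x * sinf k x.

Lemma test_cutsin n k : test_fun (cutsin n k).
Proof.
split.
  apply: smooth_derive1n => m; apply: times_derivableM; first exact: smooth_cutoff.
  exact: (smooth_trig _ _ _).1.
exists n.+1%:R^-1, (1 - n.+1%:R^-1); split; first by rewrite invr_gt0.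
- by rewrite gtrBl invr_gt0.
- by move=> x; rewrite mulf_eq0 negb_or => /andP[+ _]; exact: cutoff_support.
Qed.

Lemma sqrt2_le : Num.sqrt 2 <= 2 :> R.
Proof. by rewrite -[leRHS]ger0_norm// -sqrtr_sqr ler_sqrt; lra. Qed.

Lemma sinf_bound k (x : R) : `|sinf k x| <= 2.
Proof.
rewrite sinfE normrM ger0_norm// -[leRHS]mulr1 ler_pM ?sqrtr_ge0 ?sqrt2_le//.
by rewrite ler_norml sin_geN1 sin_le1.
Qed.

Lemma cosf_bound k (x : R) : `|cosf k x| <= 2.
Proof.
rewrite cosfE normrM ger0_norm// -[leRHS]mulr1 ler_pM ?sqrtr_ge0 ?sqrt2_le//.
by rewrite ler_norml cos_geN1 cos_le1.
Qed.

Lemma cvg_cutsin k : hnorm (toL2 (cutsin n k) - en k) @[n --> \oo] --> (0 : R).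
Proof.
apply: (@hnorm_dominated _ _ 2).
- move=> n x; apply: cvgM; last exact: continuous_sinf.
  exact: (continuous_is_derive (is_derive_cutoff n.+1)).
- exact: continuous_sinf.
- move=> n x; rewrite normrM -[leRHS]mul1r ler_pM ?sinf_bound//.
  by have /andP[? ?] := cutoff_bound n.+1 x; rewrite ger0_norm.
- exact: sinf_bound.
- move=> x x01; rewrite -[X in _ --> X]mul1r; apply: cvgM; last exact: cvg_cst.
  by rewrite (cvg_shiftS (fun n => cutoff n x)); exact: cvg_cutoff.
Qed.

(** The cut-off sines converge to the sines in L^2, so completeness of the sines carries over to
    test functions. *)
Lemma test_total (g : H) : (forall eta, test_fun eta -> ip g (toL2 eta) = 0) -> g = 0.
Proof.
move=> h; apply: sine_complete => k.
have c : ip g (toL2 (cutsin n k)) @[n --> \oo] --> ip g (en k).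
  apply/cvg_epsP => e e0.
  have /cvg_epsP/(_ (e / (hnorm g + 1)))[|N hN] := cvg_cutsin k.
    by rewrite divr_gt0// ltr_wpDl ?hnorm_ge0.
  exists N => n /hN; rewrite normr_hnorm_sub0// => h1.
  rewrite -ipBr (le_trans (ip_CS _ _))//.
  rewrite ler_pdivlMr ?ltr_wpDl ?hnorm_ge0// in h1; apply: le_trans h1.
  by rewrite mulrC ler_wpM2l ?hnorm_ge0// lerDl.
rewrite ipC; apply: (cvg_unique _ c) => //.
by apply: cvg_near_cst; near=> n; apply: h; exact: test_cutsin.
Unshelve. all: by end_near. Qed.

Lemma weak_deriv_unique (u g g' : H) : weak_deriv u g -> weak_deriv u g' -> g = g'.
Proof.
move=> h h'; apply/eqP; rewrite -subr_eq0; apply/eqP; apply: test_total => eta te.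
by rewrite ipBl -[ip g _]opprK -[ip g' _]opprK -h// -h'// subrr.
Qed.

Lemma ip_cvg (u : H) (v : nat -> H) : hnorm (v n - u) @[n --> \oo] --> (0 : R) ->
  forall w, ip w (v n) @[n --> \oo] --> ip w u.
Proof.
move=> /cvg_epsP h w; apply/cvg_epsP => e e0.
have [|N hN] := h (e / (hnorm w + 1)); first by rewrite divr_gt0// ltr_wpDl ?hnorm_ge0.
exists N => n /hN; rewrite normr_hnorm_sub0// => h1.
rewrite -ipBr (le_trans (ip_CS _ _))//.
rewrite ler_pdivlMr ?ltr_wpDl ?hnorm_ge0// in h1; apply: le_trans h1.
by rewrite mulrC ler_wpM2l ?hnorm_ge0// lerDl.
Qed.

Arguments ip_cvg {u v} _ _.

Lemma cvg0_norm (u : nat -> R) : `|u n| @[n --> \oo] --> (0 : R) -> u n @[n --> \oo] --> (0 : R).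
Proof.
move=> /cvg_epsP h; apply/cvg_epsP => e /h[N hN]; exists N => n /hN.
by rewrite !subr0 normr_id.
Qed.

Lemma dcutsin n k (x : R) : is_derive x (1 : R) (cutsin n k)
  (dcutoff n.+1 x * sinf k x + cutoff n.+1 x * (kp k * cosf k x)).
Proof. exact: is_derive_mul (is_derive_cutoff _ _) (is_derive_sinf _ _). Qed.

Lemma sinf_le_abs k (x : R) : `|sinf k x| <= 2 * kp k * `|x|.
Proof.
rewrite sinfE normrM ger0_norm// -mulrA ler_pM ?sqrtr_ge0 ?sqrt2_le//.
by rewrite (le_trans (sin_le_abs _))// normrM ger0_norm ?(ltW (kp_gt0 k)).
Qed.

Lemma sinf_sym k (x : R) : `|sinf k x| = `|sinf k (1 - x)|.
Proof.
rewrite !sinfE !normrM; congr (_ * _).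
rewrite mulrBr mulr1 sinB /kp sin_natpi mul0r sub0r normrN normrM.
suff -> : `|cos (k.+1%:R * pi : R)| = 1 by rewrite mul1r.
apply/eqP; rewrite -(@eqrXn2 _ 2)// expr1n real_normK ?num_real//.
by have := cos2Dsin2 (k.+1%:R * pi : R); rewrite sin_natpi expr0n/= addr0 => ->.
Qed.

Lemma flat2_scaled_le n (x : R) : n%:R * flat 2 (n%:R * x - 1) * `|x| <= 3.
Proof.
have [h|h] := leP (n%:R * x - 1) 0; first by rewrite (flat_neg _ h) mulr0 mul0r.
have nx : 0 < n%:R * x by lra.
have x0 : 0 < x by move: nx; rewrite pmulr_rgt0// ltr0n lt0n; apply: contraTneq h => ->; rewrite mul0r; lra.
rewrite ger0_norm ?(ltW x0)//.
have := xflat2_le (n%:R * x - 1); have := flat2_le (n%:R * x - 1); lra.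
Qed.

(** The derivative of the cut-off has size n near the end points, but at distance about 1/n from
    them, where the sine is of size 1/n. The bound, uniform in n, is what lets dominated convergence
    put the sines into H^1_0. *)
Lemma dcutoff_sinf_bound n k (x : R) : `|dcutoff n x * sinf k x| <= 12 * kp k.
Proof.
have k0 := kp_gt0 k.
rewrite /dcutoff; set a := n%:R * x - 1; set b := - n%:R * x + (n%:R - 1).
have bE : b = n%:R * (1 - x) - 1 by rewrite /b; ring.
have h1 : `|n%:R * (flat 2 a * flat 0 b) * sinf k x| <= 6 * kp k.
  have f2 := flat_ge0 2 a; have f0 := flat_ge0 0 b.
  rewrite normrM [X in X * _]ger0_norm ?mulr_ge0//.
  apply: (@le_trans _ _ (n%:R * (flat 2 a * 1) * (2 * kp k * `|x|))).
    by rewrite ler_pM ?mulr_ge0 ?sinf_le_abs// ler_wpM2l// ler_wpM2l// flat0_le1.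
  have := flat2_scaled_le n x; rewrite -/a -(ler_pM2r k0); lra.
have h2 : `|n%:R * (flat 0 a * flat 2 b) * sinf k x| <= 6 * kp k.
  have f2 := flat_ge0 2 b; have f0 := flat_ge0 0 a.
  rewrite normrM [X in X * _]ger0_norm ?mulr_ge0// sinf_sym.
  apply: (@le_trans _ _ (n%:R * (1 * flat 2 b) * (2 * kp k * `|1 - x|))).
    by rewrite ler_pM ?mulr_ge0 ?sinf_le_abs// ler_wpM2l// ler_wpM2r// flat0_le1.
  have := flat2_scaled_le n (1 - x); rewrite -bE -(ler_pM2r k0); lra.
rewrite mulrBr mulrBl; apply: (le_trans (ler_normB _ _)); lra.
Qed.

Lemma flat2_scaled_cvg (x : R) : 0 < x -> n%:R * flat 2 (n%:R * x - 1) @[n --> \oo] --> (0 : R).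
Proof.
move=> x0; apply/cvg_epsP => e e0.
(* The first summand gives n x >= 2, hence n x - 1 >= n x / 2; the second makes the resulting bound
   4 / (n x^2) at most e. *)
exists (Num.bound (2 / x + 4 / (e * x ^+ 2))) => n hn.
have hn' : 2 / x + 4 / (e * x ^+ 2) <= n%:R.
  apply: ltW; apply: lt_le_trans (archi_boundP _) _; last by rewrite ler_nat.
  by rewrite addr_ge0 ?divr_ge0 ?mulr_ge0 ?sqr_ge0 ?ltW.
have p4 : 0 <= 4 / (e * x ^+ 2) by rewrite divr_ge0 ?mulr_ge0 ?ltW.
have p2 : 0 <= 2 / x by rewrite divr_ge0 ?ltW.
have n1 : 2 <= n%:R * x by rewrite -ler_pdivrMr//; lra.
have n0 : 0 < n%:R :> R by move: n1; have [->|] := posnP n; rewrite ?ltr0n//; lra.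
have n2 : 4 <= n%:R * (e * x ^+ 2).
  by rewrite -ler_pdivrMr ?mulr_gt0 ?exprn_gt0//; lra.
rewrite subr0 ger0_norm ?mulr_ge0 ?flat_ge0//.
have t0 : 0 < n%:R * x - 1 by lra.
have h := flat2_le_inv t0.
apply: (@le_trans _ _ (n%:R * (n%:R * x / 2)^-1 ^+ 2)).
  rewrite ler_wpM2l// (le_trans h)// !exprVn lef_pV2 ?posrE ?exprn_gt0//; last lra.
  rewrite ler_sqr ?nnegrE; lra.
rewrite (_ : n%:R * _ = 4 / (n%:R * x ^+ 2)); last by field; rewrite !gt_eqF.
by rewrite ler_pdivrMr ?mulr_gt0 ?exprn_gt0//; lra.
Qed.

Lemma cvg_dcutoff (x : R) : 0 < x < 1 -> dcutoff n x @[n --> \oo] --> (0 : R).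
Proof.
move=> /andP[x0 x1].
apply: cvg0_norm.
have y0 : 0 < 1 - x by lra.
apply: (@cvg0_squeeze _ _ (fun n => n%:R * flat 2 (n%:R * x - 1) + n%:R * flat 2 (n%:R * (1 - x) - 1))).
  move=> n; rewrite normr_ge0/= /dcutoff.
  have -> : - n%:R * x + (n%:R - 1) = n%:R * (1 - x) - 1 by ring.
  rewrite normrM ger0_norm// -mulrDr ler_wpM2l// (le_trans (ler_normB _ _))// lerD//.
    by rewrite ger0_norm ?mulr_ge0 ?flat_ge0// -[leRHS]mulr1 ler_wpM2l ?flat_ge0 ?flat0_le1.
  by rewrite ger0_norm ?mulr_ge0 ?flat_ge0// -[leRHS]mul1r ler_wpM2r ?flat_ge0 ?flat0_le1.
by rewrite -[X in _ --> X]addr0; apply: cvgD; exact: flat2_scaled_cvg.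
Qed.

Lemma continuous_dcutsin n k : continuous (fun x : R => dcutoff n.+1 x * sinf k x + cutoff n.+1 x * (kp k * cosf k x)).
Proof.
have [_ c _ _ _] := test_smooth (test_cutsin n k).
suff <- : derive1 (cutsin n k) = (fun x : R => dcutoff n.+1 x * sinf k x + cutoff n.+1 x * (kp k * cosf k x)) by [].
by apply/funext => x; rewrite derive1E; case: (dcutsin n k x).
Qed.

Lemma cvg_dcutsin k : hnorm (toL2 (derive1 (cutsin n k)) - kp k *: cn k) @[n --> \oo] --> (0 : R).
Proof.
- have k0 := kp_gt0 k.
  have E n : derive1 (cutsin n k) = (fun x : R => dcutoff n.+1 x * sinf k x + cutoff n.+1 x * (kp k * cosf k x)).
    by apply/funext => x; rewrite derive1E; case: (dcutsin n k x).
  rewrite (_ : (fun n => _) = (fun n => hnorm (toL2 (fun x : R => dcutoff n.+1 x * sinf k x + cutoff n.+1 x * (kp k * cosf k x))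
      - toL2 (fun x => kp k * cosf k x)))); last first.
    by apply/funext => n; rewrite E toL2Z//; exact/continuous_sqi/continuous_cosf.
  have cb (x : R) : `|kp k * cosf k x| <= 2 * kp k.
    by rewrite normrM ger0_norm ?(ltW k0)// mulrC ler_wpM2r ?cosf_bound ?(ltW k0).
  apply: (@hnorm_dominated _ _ (14 * kp k)).
  + by move=> n; exact: continuous_dcutsin.
  + by move=> x; apply: cvgMr; exact: continuous_cosf.
  + move=> n x; apply: (le_trans (ler_normD _ _)).
    rewrite (_ : 14 * kp k = 12 * kp k + 2 * kp k); last by ring.
    apply: lerD; first exact: dcutoff_sinf_bound.
    rewrite normrM -[leRHS]mul1r ler_pM//.
    by have /andP[? ?] := cutoff_bound n.+1 x; rewrite ger0_norm.
  + by move=> x; apply: (le_trans (cb x)); rewrite ler_wpM2r//; lra.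
  + move=> x x01; rewrite -[X in _ --> X]add0r; apply: cvgD.
      rewrite -[X in _ --> X](mul0r (sinf k x)); apply: cvgM; last exact: cvg_cst.
      by rewrite (cvg_shiftS (fun n => dcutoff n x)); exact: cvg_dcutoff.
    rewrite -[X in _ --> X]mul1r; apply: cvgM; last exact: cvg_cst.
    by rewrite (cvg_shiftS (fun n => cutoff n x)); exact: cvg_cutoff.
Qed.

Lemma H10_en k : H10 (en k : H).
Proof.
exists (kp k *: cn k), (fun n => cutsin n k); split.
- by move=> n; exact: test_cutsin.
- exact: cvg_cutsin.
- exact: cvg_dcutsin.
Qed.

Lemma dirichlet_en k : dirichlet_laplacian (en k) (- (lam k *: en k)).
Proof.
split; first exact: H10_en.
exists (kp k *: cn k); first exact: weak_deriv_en.
have := weak_derivZ (kp k) (weak_deriv_cn k).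
by rewrite scalerA mulrN -expr2 scaleNr.
Qed.

(** Symmetry of A, by computing <phi', (en k)'> twice: once with the sine approximated by test
    functions and the equation for phi, once with phi approximated by test functions and the
    equation for the sine. *)
Lemma eigen_coord (l : R) (phi : H) k : dirichlet_laplacian phi (- (l *: phi)) ->
  l * ip (en k) phi = lam k * ip (en k) phi.
Proof.
move=> [[g2 [psi [tpsi cpsi cdpsi]]] [g wg wgg]].
(* The derivative that comes with membership in [H10] and the one in the graph of A are introduced
   independently; uniqueness of weak derivatives identifies them. *)
have wg2 : weak_deriv phi g2.
  move=> eta te.
  have [_ c1 he _ _] := test_smooth te.
  have e1 n : ip (toL2 (psi n)) (toL2 (derive1 eta)) = - ip (toL2 (derive1 (psi n))) (toL2 eta).
    by have [_ c2 hp _ _] := test_smooth (tpsi n); exact: (test_parts hp c2 te).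
  have l1 := ip_cvg cpsi (toL2 (derive1 eta)).
  have l2 := ip_cvg cdpsi (toL2 eta).
  have l3 : ip (toL2 (derive1 eta)) (toL2 (psi n)) @[n --> \oo] --> - ip (toL2 eta) g2.
    rewrite (_ : (fun n => _) = (fun n => - ip (toL2 eta) (toL2 (derive1 (psi n))))); last first.
      by apply/funext => n; rewrite ipC e1 ipC.
    exact: cvgN.
  by rewrite (ipC phi) (ipC g2); exact: (cvg_unique _ l1 l3).
have {wg2}gg2 := weak_deriv_unique wg wg2.
have a1 : ip g (kp k *: cn k) = l * ip (en k) phi.
  have l1 := ip_cvg (cvg_cutsin k) phi.
  have l2 : ip g (toL2 (derive1 (cutsin n k))) @[n --> \oo] --> l * ip phi (en k).
    rewrite (_ : (fun n => _) = (fun n => l * ip phi (toL2 (cutsin n k)))); last first.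
      by apply/funext => n; rewrite (wgg _ (test_cutsin n k)) ipNl ipZl opprK.
    by apply: cvgMr.
  by rewrite (ipC (en k)); exact: (cvg_unique _ (ip_cvg (cvg_dcutsin k) g) l2).
have a2 : ip (kp k *: cn k) g = lam k * ip (en k) phi.
  have l1 := ip_cvg cpsi (en k).
  have l2 := ip_cvg cdpsi (kp k *: cn k).
  have l3 : ip (kp k *: cn k) (toL2 (derive1 (psi n))) @[n --> \oo] --> lam k * ip (en k) phi.
    rewrite (_ : (fun n => _) = (fun n => lam k * ip (en k) (toL2 (psi n)))); last first.
      apply/funext => n.
      have [_ wl] := dirichlet_en k.
      have wl2 := weak_derivZ (kp k) (weak_deriv_cn k).
      by rewrite (wl2 _ (tpsi n)) scalerA mulrN ipZl -expr2 mulNr opprK.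
    by apply: cvgMr.
  by rewrite gg2; exact: (cvg_unique _ l2 l3).
by rewrite -a1 -a2 ipC.
Qed.

Lemma L2_coord_eq (u v : H) : (forall k, ip (en k) u = ip (en k) v) -> u = v.
Proof.
move=> h; apply/eqP; rewrite -subr_eq0; apply/eqP; apply: sine_complete => k.
by rewrite ipBr h subrr.
Qed.

Lemma kp_inj i j : lam i = lam j -> i = j.
Proof.
move/eqP; rewrite /lam eqrXn2//; try exact: (ltW (kp_gt0 _)).
move/eqP => h; have : (i.+1%:R : R) = j.+1%:R.
  by apply: (mulIf (lt0r_neq0 (pi_gt0 R))); exact: h.
by move/eqP; rewrite eqr_nat => /eqP [].

Qed.

(** A nonzero k-th coordinate forces l = lam k, and the numbers lam k are distinct; so an
    eigenvector has one nonzero coordinate at most. *)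
Lemma eigen_form (l : R) (phi : H) : dirichlet_laplacian phi (- (l *: phi)) ->
  phi = 0 \/ exists k, l = lam k /\ phi = ip (en k) phi *: en k.
Proof.
move=> dphi.
have [[k hk]|h] := pselect (exists k, ip (en k) phi != 0); last first.
  left; apply: sine_complete => k; apply/eqP/negPn/negP => hk; apply: h.
  by exists k.
have lk : l = lam k by apply: (mulIf hk); exact: eigen_coord.
right; exists k; split=> //; apply: L2_coord_eq => j.
rewrite ipZr en_orth; case: eqP => [->|jk]; first by rewrite mulr1.
rewrite mulr0; apply/eqP/negPn/negP => hj; apply: jk; apply: kp_inj.
by rewrite -lk; apply/esym/(mulIf hj); exact: eigen_coord.
Qed.

(** Passage from the functional calculus of the statement to coordinates: as every eigenvector is a
    multiple of one sine, the condition over all eigenvectors is decided on the sines. *)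
Lemma is_fcalcP (f : R -> R) (v w : H) :
  is_fcalc f v w <-> forall k, ip (en k) w = f (lam k) * ip (en k) v.
Proof.
split=> [h k|h l phi]; first exact/h/dirichlet_en.
move=> /eigen_form[->|[k [-> ->]]]; first by rewrite !ip0l mulr0.
by rewrite !ipZl h mulrCA.
Qed.

Lemma fcalc_coord (f : R -> R) (v w : H) :
  (forall k, ip (en k) w = f (lam k) * ip (en k) v) -> fcalc f v = w.
Proof.
move=> h; rewrite /fcalc.
have h' : is_fcalc f v w by apply/is_fcalcP.
have := xgetPex 0 (ex_intro (fun w => is_fcalc f v w) w h') => /is_fcalcP h2.
by apply: L2_coord_eq => k; rewrite h2 h.
Qed.

Definition sqsum_le (c : nat -> R) (B : R) := forall N, \sum_(i < N) c i ^+ 2 <= B.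

Lemma parseval_cvg (u : H) : hnorm (\sum_(i < n) ip (en i) u *: en i - u) @[n --> \oo] --> (0 : R).
Proof.
have [v [hv cv]] := @riesz_fischer _ en (@en_orth R) (fun k => ip (en k) u) _ (bessel (@en_orth R) u).
have vu : v = u by exact: L2_coord_eq.
by move: cv; rewrite vu.
Qed.

Lemma L2_of_coord (c : nat -> R) (B : R) : sqsum_le c B -> exists u : H, forall k, ip (en k) u = c k.
Proof.
move=> cB; have [v [hv _]] := @riesz_fischer _ en (@en_orth R) c B cB.
by exists v.
Qed.

Lemma hnorm_le_coord (u : H) (B : R) : 0 <= B ->
  sqsum_le (fun k => ip (en k) u) (B ^+ 2) -> hnorm u <= B.
Proof.
move=> B0 h; apply/ler_addgt0Pr => e e0.
have /cvg_epsP/(_ e e0)[N hN] := parseval_cvg u.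
have := hN N (leqnn _); rewrite normr_hnorm_sub0// => h1.
set S := \sum_(i < N) _ in h1.
have : hnorm S <= B.
  rewrite -ler_sqr ?nnegrE ?hnorm_ge0// /S (hnorm_orth_sum (@en_orth R) N (fun k => ip (en k) u)).
  exact: h.
have := hnormD (u - S) S; rewrite subrK (hnormBC u S); lra.
Qed.

(** A bounded multiplier preserves square summability, so the choice made by [fcalc] is not the
    default. *)
Lemma semigroup_exists (f : R -> R) (v : H) (B : R) : (forall k, `|f (lam k)| <= B) ->
  forall k, ip (en k) (fcalc f v) = f (lam k) * ip (en k) v.
Proof.
move=> fB.
have [w hw] : exists w : H, forall k, ip (en k) w = f (lam k) * ip (en k) v.
  apply: (@L2_of_coord _ (B ^+ 2 * hnorm v ^+ 2)) => N.
  apply: le_trans (ler_wpM2l (sqr_ge0 _) (bessel (@en_orth R) v N)).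
  rewrite mulr_sumr; apply: ler_sum => i _; rewrite exprMn ler_wpM2r ?sqr_ge0//.
  by rewrite -real_normK ?num_real// ler_sqr ?nnegrE// (le_trans _ (fB i)).
by move=> k; rewrite (fcalc_coord hw).
Qed.

Lemma semigroup_coord (t : R) (v : H) k : 0 <= t ->
  ip (en k) (semigroup t v) = expR (- (t * lam k)) * ip (en k) v.
Proof.
move=> t0; apply: (@semigroup_exists (fun l => expR (- (t * l))) v 1) => j.
by rewrite ger0_norm ?expR_ge0// -expR0 ler_expR oppr_le0 mulr_ge0 ?(ltW (lam_gt0 _)).
Qed.

Lemma HdomP (r : R) (v : H) :
  Hdom r v <-> exists B, sqsum_le (fun k => lam k `^ r * ip (en k) v) B.
Proof.
split=> [[w /is_fcalcP hw]|[B hB]].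
  exists (hnorm w ^+ 2) => N; under eq_bigr do rewrite -hw.
  exact: bessel (@en_orth R) w N.
by have [w hw] := L2_of_coord hB; exists w; apply/is_fcalcP.
Qed.

Lemma npow_coord (r : R) (v : H) k : Hdom r v -> ip (en k) (npow r v) = lam k `^ r * ip (en k) v.
Proof. by move=> [w /is_fcalcP hw]; rewrite /npow (fcalc_coord hw). Qed.

Lemma HnormP (r : R) (v : H) (B : R) : Hdom r v -> 0 <= B ->
  (Hnorm r v <= B <-> sqsum_le (fun k => lam k `^ r * ip (en k) v) (B ^+ 2)).
Proof.
move=> dv B0; split=> h.
  move=> N; under eq_bigr do rewrite -npow_coord//.
  apply: (le_trans (bessel (@en_orth R) _ N)).
  by rewrite ler_sqr ?nnegrE ?hnorm_ge0.
by apply: hnorm_le_coord => // N; under eq_bigr do rewrite npow_coord//; exact: h.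
Qed.

End Laplace.

(** * Summation estimates and the growth of the eigenvalues *)

Section SumTools.
Context {R : realType}.

Lemma sum_CS (I : finType) (a b : I -> R) :
  (\sum_i a i * b i) ^+ 2 <= (\sum_i a i ^+ 2) * (\sum_i b i ^+ 2).
Proof.
set X := \sum_i a i ^+ 2; set Y := \sum_i a i * b i; set Z := \sum_i b i ^+ 2.
have X0 : 0 <= X by apply: sumr_ge0 => i _; exact: sqr_ge0.
have [X00|Xn0] := eqVneq X 0.
  suff -> : Y = 0 by rewrite expr0n/= X00 mul0r.
  rewrite /Y big1// => i _.
  have /eqP : a i ^+ 2 = 0 by apply: (psumr_eq0P _ X00) => // j _; exact: sqr_ge0.
  by rewrite sqrf_eq0 => /eqP ->; rewrite mul0r.
have : 0 <= \sum_i (X * b i - Y * a i) ^+ 2 by apply: sumr_ge0 => i _; exact: sqr_ge0.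
have -> : \sum_i (X * b i - Y * a i) ^+ 2 = X * (X * Z - Y ^+ 2).
  rewrite (eq_bigr (fun i => X ^+ 2 * b i ^+ 2 + ((- (2 * X * Y)) * (a i * b i) + Y ^+ 2 * a i ^+ 2))).
    2: by move=> i _; ring.
  by rewrite !big_split/= -!mulr_sumr -/X -/Y -/Z; ring.
by rewrite pmulr_rge0 ?lt_def ?Xn0//; lra.
Qed.

Lemma sum_CS_sqrt (I : finType) (a b : I -> R) :
  `|\sum_i a i * b i| <= Num.sqrt (\sum_i a i ^+ 2) * Num.sqrt (\sum_i b i ^+ 2).
Proof.
have p (f : I -> R) : 0 <= \sum_i f i ^+ 2 by apply: sumr_ge0 => i _; exact: sqr_ge0.
by rewrite -sqrtrM// -sqrtr_sqr ler_wsqrtr// sum_CS.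
Qed.

(** Discrete form of q x^(-q-1) = - (x^(-q))', from 1/(n+2) <= ln (n+2) - ln (n+1) and exp u >= 1 +
    u. It lets the series telescope. *)
Lemma pseries_step (q : R) (n : nat) : 0 < q ->
  q * n.+2%:R `^ (- (q + 1)) <= n.+1%:R `^ (- q) - n.+2%:R `^ (- q).
Proof.
move=> q0.
have x0 : 0 < n.+1%:R :> R by [].
have y0 : 0 < n.+2%:R :> R by [].
have e1 : n.+2%:R `^ (- (q + 1)) = n.+2%:R `^ (- q) / n.+2%:R :> R.
  by rewrite opprD powRD ?powR_inv1 ?(ltW y0)//; apply/implyP => _; rewrite gt_eqF.
have e2 : n.+1%:R `^ (- q) = n.+2%:R `^ (- q) * expR (q * (ln n.+2%:R - ln n.+1%:R)) :> R.
  rewrite /powR !gt_eqF// -expRD; congr expR; ring.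
rewrite e1 e2.
have h : n.+2%:R^-1 <= ln n.+2%:R - ln n.+1%:R :> R.
  rewrite -ln_div// -[leRHS]opprK lerNr -lnV ?posrE// invf_div.
  rewrite (_ : n.+1%:R / n.+2%:R = 1 + (- n.+2%:R^-1)).
    apply: le_ln1Dx; rewrite ltrN2 invf_lt1// ltr1n.
    by [].
  rewrite -(natr1 n.+1); move: x0; set a : R := n.+1%:R => x0.
  by field; apply: lt0r_neq0; lra.
have h2 := expR_ge1Dx (q * (ln n.+2%:R - ln n.+1%:R) : R).
have p0 : 0 <= n.+2%:R `^ (- q) :> R by exact: powR_ge0.
have h3 : q * n.+2%:R^-1 <= expR (q * (ln n.+2%:R - ln n.+1%:R)) - 1 :> R.
  apply: (le_trans (ler_wpM2l (ltW q0) h)); rewrite lerBrDl; exact: h2.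
rewrite mulrCA; apply: (le_trans (ler_wpM2l p0 h3)).
by rewrite mulrBr mulr1.
Qed.

Lemma pseries_bound (p : R) : 1 < p -> exists2 C, 0 < C & forall n, \sum_(i < n) i.+1%:R `^ (- p) <= C.
Proof.
move=> p1; have [q qE] : exists q, q = p - 1 by exists (p - 1).
have q0 : 0 < q by rewrite qE; lra.
exists (1 + q^-1); first by rewrite addr_gt0 ?invr_gt0.
have qi0 : 0 <= q^-1 by rewrite invr_ge0 ltW.
have h n : \sum_(i < n.+1) i.+1%:R `^ (- p) <= 1 + q^-1 * (1 - n.+1%:R `^ (- q)); last first.
  case=> [|n]; first by rewrite big_ord0 addr_ge0.
  apply: (le_trans (h n)); rewrite lerD2l -[leRHS]mulr1.
  by apply: ler_wpM2l => //; rewrite lerBlDr lerDl powR_ge0.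
elim: n => [|n IH]; first by rewrite big_ord_recr big_ord0/= !powR1 subrr mulr0; lra.
have qp : q + 1 = p by rewrite qE subrK.
rewrite big_ord_recr/=; have := pseries_step n q0; rewrite qp.
rewrite -(ler_pM2l (_ : 0 < q^-1)) ?invr_gt0// mulrA mulVf ?gt_eqF// mul1r.
rewrite mulrBr; move: IH; rewrite !mulrBr !mulr1; lra.
Qed.

Lemma lam_powR (i : nat) (r : R) : lam i `^ r = kp i `^ (2 * r) :> R.
Proof. by rewrite /lam -powR_mulrn ?(ltW (kp_gt0 _))// -powRrM. Qed.

Lemma kp_ge (i : nat) : i.+1%:R <= kp i :> R.
Proof. rewrite /kp -[leLHS]mulr1 ler_wpM2l//; have := @pi_ge2 R; lra. Qed.

Lemma lam_ge1 (i : nat) : 1 <= lam i :> R.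
Proof. by rewrite /lam exprn_ege1// (le_trans _ (kp_ge i))// ler1n. Qed.

(** As lam k >= (k + 1)^2, the critical exponent is half that of the p-series. All restrictions to
    orders below 1/4 come from squaring terms of this kind. *)
Lemma lam_series (r : R) : r < - 2^-1 -> exists2 C, 0 < C & forall n, \sum_(i < n) lam i `^ r <= C.
Proof.
move=> r1; have [s sE] : exists s, s = - (2 * r) by exists (- (2 * r)).
have s1 : 1 < s by rewrite sE; lra.
have [C C0 hC] := pseries_bound s1.
exists C => // n; apply: le_trans (hC n); apply: ler_sum => i _.
rewrite lam_powR (_ : 2 * r = - s); last by rewrite sE opprK.
rewrite !powRN lef_pV2 ?posrE ?powR_gt0 ?kp_gt0//.
apply: ge0_powR_le; rewrite ?(ltW (kp_gt0 _)) ?kp_ge//; lra.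
Qed.

End SumTools.

(** * Embedding into L^4 and the quadratic nonlinearity *)

Section Multiplication.
Context {R : realType}.
Local Notation H := (L2 R).

Definition bddm (M : R) (g : R -> R) := measurable_fun [set: R] g /\ forall x, `|g x| <= M.

Definition mulb (g : R -> R) (v : H) : H := toL2 (fun x => g x * repr v x).

Lemma sqi_mulb M g (f : R -> R) : bddm M g -> sqi f -> sqi (fun x => g x * f x).
Proof.
move=> [mg gM] sf; have mf := sqi_measurable sf.
apply: sqiP; first exact: measurable_funM.
have iM : (\int[mu01]_x ((M ^+ 2) * f x ^+ 2)%:E < +oo)%E.
  have sM := sqiZ M sf.
  rewrite (_ : (fun x : R => (M ^+ 2 * f x ^+ 2)%:E) = (fun x : R => ((M * f x) ^+ 2)%:E)).
    by rewrite Rintegral_sqr_hnorm// ltry.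
  by apply/funext => x; rewrite exprMn.
apply: le_lt_trans iM; apply: ge0_le_integral => //.
- by move=> x _; rewrite lee_fin sqr_ge0.
- by apply/measurable_EFinP/measurable_funX/measurable_funM.
- by apply/measurable_EFinP; apply: measurable_funM => //; exact: measurable_funX.
- move=> x _; rewrite lee_fin exprMn ler_wpM2r ?sqr_ge0//.
  by rewrite -real_normK ?num_real// ler_sqr ?nnegrE// (le_trans _ (gM x)).
Qed.

Lemma repr_mulb M g (v : H) : bddm M g -> {ae mu01, forall x, repr (mulb g v) x = g x * repr v x}.
Proof. by move=> gM; apply: toL2K; exact: sqi_mulb gM (repr_sqi v). Qed.

Lemma ip_mulb M g (u v : H) : bddm M g ->
  ip u (mulb g v) = \int[mu01]_x (repr u x * (g x * repr v x)).
Proof.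
move=> gM; apply: ipE; [exact: repr_sqi|exact: sqi_mulb gM (repr_sqi v)|exact: aeW|exact: repr_mulb gM].
Qed.

Lemma ip_mulbC M g (u v : H) : bddm M g -> ip u (mulb g v) = ip v (mulb g u).
Proof. by move=> gM; rewrite !(ip_mulb _ _ gM); apply: eq_Rintegral => x _; ring. Qed.

Lemma hnorm_mulb M g (v : H) : bddm M g -> hnorm (mulb g v) <= M * hnorm v.
Proof.
move=> gM; have M0 : 0 <= M by apply: le_trans (gM.2 0).
rewrite -ler_sqr ?nnegrE ?mulr_ge0 ?hnorm_ge0// -lee_fin -Rintegral_sqr_hnorm; last exact: sqi_mulb gM (repr_sqi v).
rewrite -[X in M * hnorm X]toL2_repr.
have -> : M * hnorm (toL2 (repr v)) = hnorm (toL2 (fun x => M * repr v x)).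
  by rewrite toL2Z ?hnormZ ?ger0_norm//; exact: repr_sqi.
have sv := repr_sqi v.
rewrite -Rintegral_sqr_hnorm; last exact: sqiZ.
apply: ge0_le_integral => //.
- by move=> x _; rewrite lee_fin sqr_ge0.
- by apply/measurable_EFinP/measurable_funX/measurable_funM => //; exact: gM.1.
- by apply/measurable_EFinP/measurable_funX/measurable_funM.
- move=> x _; rewrite lee_fin !exprMn ler_wpM2r ?sqr_ge0//.
  by rewrite -real_normK ?num_real// ler_sqr ?nnegrE// (gM.2 x).
Qed.

(** By symmetry of the multiplication the difference of the two quadratic forms is <u - v, g (u +
    v)>. *)
Lemma mulb_quadratic_le M g (u v : H) : bddm M g ->
  `|ip u (mulb g u) - ip v (mulb g v)| <= M * hnorm (u - v) * (hnorm u + hnorm v).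
Proof.
move=> gM.
have -> : ip u (mulb g u) - ip v (mulb g v) = ip (u - v) (mulb g u) + ip (u - v) (mulb g v).
  by rewrite !ipBl (ip_mulbC v u gM); ring.
apply: (le_trans (ler_normD _ _)); rewrite mulrDr; apply: lerD.
  rewrite (le_trans (ip_CS _ _))// mulrC (mulrC M) -mulrA [leRHS]mulrC mulrC.
  by rewrite [leRHS]mulrC ler_wpM2l ?hnorm_ge0 ?hnorm_mulb.
rewrite (le_trans (ip_CS _ _))// (mulrC M) -mulrA.
by rewrite ler_wpM2l ?hnorm_ge0 ?hnorm_mulb.
Qed.

End Multiplication.

Section Sobolev.
Context {R : realType}.
Local Notation H := (L2 R).

(** Cosines including frequency 0 and without the factor sqrt 2: exactly the terms of a product of
    two sines. Unrelated to the truncation exponent of the same name. *)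
Definition chi (m : nat) (x : R) : R := cos (m%:R * pi * x).

Lemma continuous_chi m : continuous (chi m). Proof. exact: continuous_cosM. Qed.

(** Together with the constant 1 the normalised cosines are orthonormal; dropping the factor sqrt 2
    only decreases the sum. *)
Lemma chi_bessel (g : H) N : \sum_(m < N) ip (toL2 (chi m)) g ^+ 2 <= hnorm g ^+ 2.
Proof.
pose psi m := if m is k.+1 then cn k else toL2 (fun=> 1 : R).
have c1 : continuous (fun _ : R => 1 : R) by exact: cst_continuous.
have one_cn k : ip (toL2 (fun=> 1 : R)) (cn k) = 0.
  rewrite ip_continuous//; last exact: continuous_cosf.
  under eq_Rintegral do rewrite mul1r /cosf.
  rewrite RintegralZl//; last exact/integrable_continuous/continuous_cosM.
  by rewrite int_cos mulr0.
have orth i j : ip (psi i) (psi j) = (i == j)%:R.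
  case: i j => [|i] [|j] /=.
  - by rewrite -hnorm2 hnorm_toL2_1 expr1n.
  - exact: one_cn.
  - by rewrite ipC one_cn.
  - by rewrite cn_orth.
apply: le_trans (bessel orth g N); apply: ler_sum => -[[|k] hk] _ /=.
  rewrite (_ : chi 0 = (fun=> 1))//; apply/funext => x.
  by rewrite /chi !mul0r cos0.
have -> : chi k.+1 = (fun x => (Num.sqrt 2)^-1 * cosf k x).
  apply/funext => x; rewrite /chi /cosf mulrA mulVf ?mul1r// gt_eqF// sqrtr_gt0//.
rewrite toL2Z; last exact/continuous_sqi/continuous_cosf.
rewrite ipZl exprMn exprVn sqr_sqrtr// -[leRHS]mul1r ler_wpM2r ?sqr_ge0//; lra.
Qed.

Definition tp (n : nat) (c : nat -> R) (x : R) : R := \sum_(i < n) c i * sinf i x.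

Lemma continuous_sum (n : nat) (F : nat -> R -> R) : (forall i, continuous (F i)) ->
  continuous (fun x => \sum_(i < n) F i x).
Proof.
move=> cF; elim: n => [|n IH] x.
  by under eq_fun do rewrite big_ord0; exact: cvg_cst.
by under eq_fun do rewrite big_ord_recr; apply: cvgD; [exact: IH|exact: cF].
Qed.

Lemma continuous_tp n c : continuous (tp n c).
Proof.
apply: (continuous_sum (F := fun i x => c i * sinf i x)) => i x.
by apply: cvgMr; exact: continuous_sinf.
Qed.

Lemma continuous_tp2 n c : continuous (fun x => tp n c x ^+ 2).
Proof. by move=> x; under eq_fun do rewrite expr2; apply: cvgM; exact: continuous_tp. Qed.

Lemma toL2_tp n c : toL2 (tp n c) = \sum_(i < n) c i *: en i :> H.
Proof.
have cs i : sqi (fun x : R => c i * sinf i x) by exact/sqiZ/continuous_sqi/continuous_sinf.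
rewrite (toL2_sum n cs).2; apply: eq_bigr => i _.
by rewrite toL2Z//; exact/continuous_sqi/continuous_sinf.
Qed.

Lemma sum_shift_le (n : nat) (G : nat -> R) (B : R) : (forall N, \sum_(m < N) G m ^+ 2 <= B) ->
  forall a, \sum_(j < n) G (a + j)%N ^+ 2 <= B.
Proof.
move=> GB a; apply: le_trans (GB (a + n)%N); rewrite big_split_ord/=.
by rewrite lerDr; apply: sumr_ge0 => i _; exact: sqr_ge0.
Qed.

(** The index here is the distance between a and j, and each distance occurs at most twice. *)
Lemma sum_dist_le (n : nat) (G : nat -> R) (B : R) : (forall N, \sum_(m < N) G m ^+ 2 <= B) ->
  forall a, \sum_(j < n) G (maxn a j - minn a j)%N ^+ 2 <= 2 * B.
Proof.
move=> GB; suff h a : \sum_(j < n) G (maxn a j - minn a j)%N ^+ 2 <= 2 * B by [].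
have lo : forall N a, (N <= a)%N -> \sum_(j < N) G (maxn a j - minn a j)%N ^+ 2 <= B.
  move=> N b Nb; apply: le_trans (sum_shift_le N GB (b.+1 - N)%N).
  rewrite (reindex_inj rev_ord_inj)/=; apply: ler_sum => j _.
  suff -> : (maxn b (N - j.+1) - minn b (N - j.+1) = b.+1 - N + j)%N by [].
  have := ltn_ord j; lia.
have [na|an] := leqP n a.
  apply: (le_trans (lo _ _ na)).
  have : 0 <= B by have := GB 0%N; rewrite big_ord0.
  lra.
rewrite -(subnKC (ltnW an)) big_split_ord/= mulr2n mulrDl mul1r lerD//; first exact: lo.
apply: le_trans (sum_shift_le (n - a) GB 0); apply: ler_sum => j _.
suff -> : (maxn a (a + j) - minn a (a + j) = 0 + j)%N by [].
lia.
Qed.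

(* Cauchy-Schwarz with the weights lam i `^ b reduces the quadratic form to
   the sums of G (i + j.+2) ^+ 2 / lam i `^ (4 * b), finite as 4 * b > 1/2. *)
Lemma convolution_bound (b : R) : 8^-1 < b -> exists2 C, 0 < C &
  forall (n : nat) (c : nat -> R) (G : nat -> R) (B : R), 0 <= B ->
  (forall N, \sum_(m < N) G m ^+ 2 <= B ^+ 2) ->
  `|\sum_(i < n) \sum_(j < n) c i * c j * (G (maxn i j - minn i j)%N - G (i + j).+2)|
    <= C * (\sum_(i < n) (lam i `^ b * c i) ^+ 2) * B.
Proof.
move=> hb; have hb4 : - (4 * b) < - 2^-1 by lra.
have [Z Z0 hZ] := @lam_series R _ hb4.
pose K := Num.sqrt (6 * Z); have K0 : 0 < K by rewrite sqrtr_gt0 mulr_gt0.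
exists K => // n c G B B0 GB.
pose w i := lam i `^ b : R.
have w0 i : 0 < w i by rewrite powR_gt0 ?lam_gt0.
have w4 i : (w i)^-1 ^+ 4 = lam i `^ (- (4 * b)).
  by rewrite exprVn -powR_mulrn ?powR_ge0// -powRrM mulrC powRN.
pose D i j := G (maxn i j - minn i j)%N - G (i + j).+2.
pose A := \sum_(i < n) (w i * c i) ^+ 2.
have A0 : 0 <= A by apply: sumr_ge0 => i _; exact: sqr_ge0.
rewrite pair_big/=.
rewrite (eq_bigr (fun p : 'I_n * 'I_n => ((w p.1 * c p.1) * (w p.2 * c p.2)) *
    ((w p.1)^-1 * (w p.2)^-1 * D p.1 p.2))); last first.
  by move=> [i j] _ /=; rewrite /D; field; rewrite !gt_eqF.
apply: (le_trans (sum_CS_sqrt _ _)).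
have -> : \sum_(p : 'I_n * 'I_n) ((w p.1 * c p.1) * (w p.2 * c p.2)) ^+ 2 = A ^+ 2.
  rewrite expr2 /A mulr_suml; under [RHS]eq_bigr do rewrite mulr_sumr.
  by rewrite [RHS]pair_big/=; apply: eq_bigr => p _; rewrite exprMn.
rewrite sqrtr_sqr (ger0_norm A0) -mulrA (mulrC K) -mulrA ler_wpM2l//.
rewrite -(ger0_norm B0) -sqrtr_sqr /K -sqrtrM ?sqr_ge0// ler_wsqrtr//.
rewrite mulrC.
(* Rows are bounded uniformly in i: with (p - q)^2 <= 2 p^2 + 2 q^2, the distances contribute 2
   times 2 B^2 and the shifted indices 2 B^2. *)
have rowb i : \sum_(j < n) D i j ^+ 2 <= 6 * B ^+ 2.
  apply: (@le_trans _ _ (\sum_(j < n) (2 * G (maxn i j - minn i j)%N ^+ 2 + 2 * G (i + j).+2 ^+ 2))).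
    by apply: ler_sum => j _; rewrite /D; have := sqr_ge0 (G (maxn i j - minn i j)%N + G (i + j).+2); lra.
  rewrite big_split/= -!mulr_sumr.
  have := sum_dist_le n GB i.
  have := sum_shift_le n GB i.+2.
  rewrite (_ : \sum_(j < n) G (i.+2 + j)%N ^+ 2 = \sum_(j < n) G (i + j).+2 ^+ 2); last first.
    by apply: eq_bigr => j _; rewrite !addSn.
  lra.
have Dsym i j : D i j = D j i by rewrite /D maxnC minnC addnC.
(* Young's inequality splits the product of the two weights, so that each half carries a weight in
   one index only and can be summed along rows. *)
apply: (@le_trans _ _ (\sum_(p : 'I_n * 'I_n) (2^-1 * ((w p.1)^-1 ^+ 4 * D p.1 p.2 ^+ 2) +
    2^-1 * ((w p.2)^-1 ^+ 4 * D p.2 p.1 ^+ 2)))).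
  apply: ler_sum => -[i j] _ /=; rewrite (Dsym j i).
  have := mulr_ge0 (sqr_ge0 ((w i)^-1 ^+ 2 - (w j)^-1 ^+ 2)) (sqr_ge0 (D i j)); lra.
rewrite big_split/= -!mulr_sumr.
have half : \sum_(p : 'I_n * 'I_n) (w p.1)^-1 ^+ 4 * D p.1 p.2 ^+ 2 <= Z * (6 * B ^+ 2).
  rewrite -(pair_big xpredT xpredT (fun i j : 'I_n => (w i)^-1 ^+ 4 * D i j ^+ 2))/=.
  apply: (@le_trans _ _ (\sum_(i < n) (w i)^-1 ^+ 4 * (6 * B ^+ 2))).
    apply: ler_sum => i _; rewrite -mulr_sumr ler_wpM2l ?rowb//.
    by rewrite exprn_ge0// invr_ge0 ltW.
  rewrite -mulr_suml ler_wpM2r ?mulr_ge0//.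
  by under eq_bigr do rewrite w4; exact: hZ.
have -> : \sum_(p : 'I_n * 'I_n) (w p.2)^-1 ^+ 4 * D p.2 p.1 ^+ 2 =
    \sum_(p : 'I_n * 'I_n) (w p.1)^-1 ^+ 4 * D p.1 p.2 ^+ 2.
  rewrite -(pair_big xpredT xpredT (fun i j : 'I_n => (w j)^-1 ^+ 4 * D j i ^+ 2))/=.
  by rewrite exchange_big/= pair_big.
lra.
Qed.

Lemma tp_sq n c (x : R) : tp n c x ^+ 2 =
  \sum_(p : 'I_n * 'I_n) c p.1 * c p.2 * (chi (maxn p.1 p.2 - minn p.1 p.2)%N x - chi (p.1 + p.2).+2 x).
Proof.
rewrite expr2 /tp mulr_suml; under eq_bigr do rewrite mulr_sumr.
rewrite pair_big/=; apply: eq_bigr => -[i j] _ /=.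
by rewrite mulrACA sinf_sinf.
Qed.

Lemma toL2_fin_sum (I : finType) (F : I -> R -> R) : (forall i, continuous (F i)) ->
  toL2 (fun x => \sum_i F i x) = \sum_i toL2 (F i) :> H.
Proof.
move=> cF.
suff : forall s : seq I, continuous (fun x => \sum_(i <- s) F i x) /\
    toL2 (fun x => \sum_(i <- s) F i x) = \sum_(i <- s) toL2 (F i) :> H.
  by move=> /(_ (index_enum I))[].
elim=> [|i s [IH1 IH2]].
  have -> : (fun x : R => \sum_(i <- [::]) F i x) = (fun x => 0 * (fun=> 0) x).
    by apply/funext => x; rewrite big_nil mul0r.
  split; first by under eq_fun do rewrite mul0r; exact: cst_continuous.
  by rewrite big_nil toL2Z ?scale0r//; apply: continuous_sqi; exact: cst_continuous.
have -> : (fun x : R => \sum_(j <- i :: s) F j x) = (fun x => F i x + \sum_(j <- s) F j x).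
  by apply/funext => x; rewrite big_cons.
split; first by move=> x; apply: cvgD; [exact: cF|exact: IH1].
by rewrite big_cons -IH2 toL2D//; exact: continuous_sqi.
Qed.

Lemma L4_trig (b : R) : 8^-1 < b -> exists2 C, 0 < C &
  forall (n : nat) (c : nat -> R) (g : H),
    `|ip (toL2 (fun x => tp n c x ^+ 2)) g| <= C * (\sum_(i < n) (lam i `^ b * c i) ^+ 2) * hnorm g.
Proof.
move=> /convolution_bound[C C0 hC]; exists C => // n c g.
have cF (p : 'I_n * 'I_n) : continuous (fun x : R => c p.1 * c p.2 *
    (chi (maxn p.1 p.2 - minn p.1 p.2)%N x - chi (p.1 + p.2).+2 x)).
  by move=> x; apply: cvgMr; apply: cvgB; exact: continuous_chi.
under eq_fun do rewrite tp_sq.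
rewrite (toL2_fin_sum cF) ip_suml.
under eq_bigr => p _.
  rewrite toL2Z; last by apply: sqiB; exact/continuous_sqi/continuous_chi.
  rewrite toL2B; try exact/continuous_sqi/continuous_chi.
  rewrite ipZl ipBl.
  over.
rewrite -(pair_big xpredT xpredT (fun i j : 'I_n => c i * c j * (ip (toL2 (chi (maxn i j - minn i j)%N)) g - ip (toL2 (chi (i + j).+2)) g)))/=.
by apply: (hC n c (fun m => ip (toL2 (chi m)) g)); [exact: hnorm_ge0|exact: chi_bessel].
Qed.

End Sobolev.

Section Nonlinearity.
Context {R : realType}.
Local Notation H := (L2 R).

Lemma cvgn_le (u : nat -> R) (l c : R) : u @ \oo --> l -> (forall n, u n <= c) -> l <= c.
Proof.
move=> /cvg_epsP h uc; apply/ler_addgt0Pr => e e0; have [N hN] := h e e0.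
by have := hN N (leqnn _); have := uc N; rewrite ler_norml; lra.
Qed.

Lemma bddm_cosf k : bddm 2 (@cosf R k).
Proof. split=> [|x]; last exact: cosf_bound.
by apply: continuous_measurable_fun; exact: continuous_cosf. Qed.

Definition proj (n : nat) (v : H) : H := toL2 (tp n (fun k => ip (en k) v)).

Lemma projE n v : proj n v = \sum_(i < n) ip (en i) v *: en i.
Proof. exact: toL2_tp. Qed.

Lemma proj_cvg v : hnorm (proj n v - v) @[n --> \oo] --> (0 : R).
Proof. by under eq_fun do rewrite projE; exact: parseval_cvg. Qed.

Lemma hnorm_proj_le n v : hnorm (proj n v) <= hnorm v.
Proof.
rewrite -ler_sqr ?nnegrE ?hnorm_ge0// projE (hnorm_orth_sum (@en_orth R) n (fun i => ip (en i) v)).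
exact: bessel (@en_orth R) v n.
Qed.

(* The weight g is the truncated function v^2, against which v^2 integrates
   to the squared norm of g. *)
Lemma L4_embedding (b : R) : 8^-1 < b -> exists2 C, 0 < C & forall (v : H) (B : R),
  sqsum_le (fun k => lam k `^ b * ip (en k) v) B ->
  sqi (fun x => repr v x ^+ 2) /\ hnorm (sqrL2 v) <= C * B.
Proof.
move=> /L4_trig[C C0 hC]; exists C => // v B vB.
have B0 : 0 <= B by have := vB 0%N; rewrite big_ord0.
have CB0 : 0 <= C * B by rewrite mulr_ge0 ?(ltW C0).
have mv : measurable_fun [set: R] (repr v) by apply: sqi_measurable; exact: repr_sqi.
pose g (m : nat) (x : R) := if repr v x ^+ 2 <= m%:R then repr v x ^+ 2 else 0.
have gb m : bddm m%:R (g m).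
  split.
    have -> : g m = (fun x => repr v x ^+ 2) \_ [set x | repr v x ^+ 2 <= m%:R].
      by apply/funext => x; rewrite patchE mem_setE /= /g; case: ifP.
    apply/(measurable_restrictT _ _).1; last exact/measurable_funTS/measurable_funX.
    have := @measurable_funX _ _ _ setT (repr v) 2 mv measurableT _ (measurable_itv (Interval -oo%O (BRight m%:R))).
    by rewrite setTI; congr (measurable _); apply/seteqP; split => x /=; rewrite in_itv.
  by move=> x; rewrite /g; case: ifP => h; rewrite ?normr0// ger0_norm ?sqr_ge0.
have sg m : sqi (g m) by apply: (@sqi_bounded _ _ m%:R) => [|x _]; [exact: (gb m).1|exact: (gb m).2].
have gg m : ip v (mulb (g m) v) = hnorm (toL2 (g m)) ^+ 2.
  rewrite (ip_mulb _ _ (gb m)) hnorm2 ip_toL2//; apply: eq_Rintegral => x _.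
  by rewrite /g; case: ifP => _; ring.
have gn m : hnorm (toL2 (g m)) <= C * B.
  (* The truncated weight is bounded, so this quadratic form is continuous on H; the estimate for
     trigonometric polynomials therefore passes to v although v^2 is not yet known to lie in H. *)
  have lim : ip (proj n v) (mulb (g m) (proj n v)) @[n --> \oo] --> ip v (mulb (g m) v).
    apply/cvg_epsP => e e0.
    pose K := m%:R * (2 * hnorm v) + 1 : R.
    have K0 : 0 < K by rewrite ltr_wpDl ?mulr_ge0 ?hnorm_ge0.
    have /cvg_epsP/(_ (e / K) (divr_gt0 e0 K0))[N hN] := proj_cvg v.
    exists N => n /hN; rewrite normr_hnorm_sub0// => h.
    apply: (le_trans (mulb_quadratic_le _ _ (gb m))).
    rewrite ler_pdivlMr// in h; apply: le_trans h.
    have h0 := hnorm_ge0 (proj n v - v); have hp := hnorm_proj_le n v.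
    apply: (@le_trans _ _ (m%:R * hnorm (proj n v - v) * (2 * hnorm v))).
      by rewrite ler_wpM2l ?mulr_ge0//; lra.
    rewrite /K; lra.
  have up n : ip (proj n v) (mulb (g m) (proj n v)) <= C * B * hnorm (toL2 (g m)).
    apply: (@le_trans _ _ (C * (\sum_(i < n) (lam i `^ b * ip (en i) v) ^+ 2) * hnorm (toL2 (g m)))); last first.
      by rewrite ler_wpM2r ?hnorm_ge0// ler_wpM2l ?(ltW C0).
    apply: le_trans (hC n (fun k => ip (en k) v) (toL2 (g m))).
    apply: le_trans (ler_norm _); rewrite (ip_mulb _ _ (gb m)).
    have st := continuous_sqi (@continuous_tp R n (fun k => ip (en k) v)).
    rewrite ip_toL2//; last exact/continuous_sqi/continuous_tp2.
    apply: eq_ler.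
    apply: ae_eq_Rintegral01.
    - apply: measurable_funM; first by apply: sqi_measurable; exact: repr_sqi.
      apply: measurable_funM; first exact: (gb m).1.
      by apply: sqi_measurable; exact: repr_sqi.
    - apply: measurable_funM; last exact: (gb m).1.
      by apply: continuous_measurable_fun; exact: continuous_tp2.
    - by apply: aeS (toL2K st) => x ->; rewrite /=; ring.
  (* The limit of the forms is the square of the norm of the weight; one factor cancels and leaves a
     bound that does not depend on m. *)
  have : hnorm (toL2 (g m)) ^+ 2 <= C * B * hnorm (toL2 (g m)).
    by rewrite -gg; exact: cvgn_le lim up.
  have [->|hn] := eqVneq (hnorm (toL2 (g m))) 0; first by [].
  by rewrite expr2 ler_pM2r// lt_def hn hnorm_ge0.
have s2 : (\int[mu01]_x ((repr v x ^+ 2) ^+ 2)%:E <= ((C * B) ^+ 2)%:E)%E.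
  have mg m : measurable_fun [set: R] (fun x => (g m x ^+ 2)%:E).
    by apply/measurable_EFinP/measurable_funX; exact: (gb m).1.
  have -> : (\int[mu01]_x ((repr v x ^+ 2) ^+ 2)%:E = \int[mu01]_x limn_einf (fun m => (g m x ^+ 2)%:E))%E.
    apply: eq_integral => x _; apply/esym.
    suff h : (g m x ^+ 2)%:E @[m --> \oo] --> ((repr v x ^+ 2) ^+ 2)%:E by rewrite (cvg_limn_einf_sup h).1.
    apply: cvg_near_cst; exists (Num.bound (repr v x ^+ 2)) => // m /= hm.
    rewrite /g ifT//; apply: ltW; apply: lt_le_trans (archi_boundP (sqr_ge0 _)) _.
    by rewrite ler_nat.
  apply: (le_trans (fatou mu01 measurableT mg _)); first by move=> m x _; rewrite lee_fin sqr_ge0.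
  rewrite limn_einf_lim; apply: lime_le; first exact: is_cvg_einfs.
  near=> m; apply: (@le_trans _ _ (\int[mu01]_x (g m x ^+ 2)%:E)%E).
    by apply: ereal_inf_lbound; exists m => /=.
  by rewrite Rintegral_sqr_hnorm// lee_fin ler_sqr ?nnegrE ?hnorm_ge0.
have sv2 : sqi (fun x => repr v x ^+ 2).
  by apply: sqiP; [exact: measurable_funX|exact: le_lt_trans s2 (ltry _)].
split=> //.
by move: s2; rewrite Rintegral_sqr_hnorm// lee_fin ler_sqr ?nnegrE ?hnorm_ge0.
Unshelve. all: by end_near. Qed.

(* Coordinates of F(v) = -(v^2)'/2, by duality. *)
Definition Bq k (v : H) : R := 2^-1 * kp k * ip v (mulb (cosf k) v).

Lemma Bq_sqrL2 k (v : H) : sqi (fun x => repr v x ^+ 2) ->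
  Bq k v = 2^-1 * kp k * ip (sqrL2 v) (cn k).
Proof.
move=> sv; congr (_ * _); rewrite (ip_mulb _ _ (bddm_cosf k)) ip_toL2//; last first.
  exact/continuous_sqi/continuous_cosf.
by apply: eq_Rintegral => x _; ring.
Qed.

Lemma Bq_lip k (u v : H) : `|Bq k u - Bq k v| <= kp k * (hnorm (u - v) * (hnorm u + hnorm v)).
Proof.
have k0 := @kp_gt0 R k; have hk : (0 : R) <= 2^-1 * kp k by apply: mulr_ge0; [|exact: ltW].
rewrite /Bq -mulrBr normrM ger0_norm//.
have := mulb_quadratic_le u v (bddm_cosf k).
rewrite -(ler_pM2l (_ : 0 < 2^-1 * kp k)); last by rewrite mulr_gt0.
lra.
Qed.

Lemma Bq0 k : Bq k 0 = 0.
Proof. by rewrite /Bq ip0l mulr0. Qed.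

Lemma Bq_le k (v : H) : `|Bq k v| <= kp k * hnorm v ^+ 2.
Proof. by have := Bq_lip k v 0; rewrite Bq0 !subr0 hnorm0 addr0 expr2. Qed.

Definition dtp (n : nat) (c : nat -> R) (x : R) : R := \sum_(i < n) c i * (kp i * cosf i x).

Lemma continuous_dtp n c : continuous (dtp n c).
Proof.
apply: (continuous_sum (F := fun i x => c i * (kp i * cosf i x))) => i x.
by apply: cvgMr; apply: cvgMr; exact: continuous_cosf.
Qed.

Lemma is_derive_tp n c (x : R) : is_derive x (1 : R) (tp n c) (dtp n c x).
Proof.
elim: n => [|n IH].
  rewrite /dtp big_ord0 (_ : tp 0 c = cst 0); first exact: is_derive_cst.
  by apply/funext => y; rewrite /tp big_ord0.
have -> : tp n.+1 c = (fun x => tp n c x + c n * sinf n x).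
  by apply/funext => y; rewrite /tp big_ord_recr.
rewrite /dtp big_ord_recr/=.
have h : is_derive x (1 : R) (fun x => c n * sinf n x) (c n * (kp n * cosf n x)).
  by apply: is_derive_scale; exact: is_derive_sinf.
exact: (@is_deriveD R R R (tp n c) (fun x => c n * sinf n x) x 1 _ _ IH h).
Qed.

Lemma tp01 n c : tp n c 0 = 0 /\ tp n c 1 = 0 :> R.
Proof.
split; rewrite /tp big1// => i _; rewrite sinfE.
  by rewrite mulr0 sin0 !mulr0.
by rewrite mulr1 /kp sin_natpi !mulr0.
Qed.

Lemma hnorm_dtp n c : hnorm (toL2 (dtp n c)) = Num.sqrt (\sum_(i < n) lam i * c i ^+ 2).
Proof.
have -> : toL2 (dtp n c) = \sum_(i < n) (c i * kp i) *: cn i.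
  have cs i : sqi (fun x : R => c i * (kp i * cosf i x)) by exact/sqiZ/sqiZ/continuous_sqi/continuous_cosf.
  rewrite (toL2_sum n cs).2; apply: eq_bigr => i _.
  rewrite -toL2Z; last exact/continuous_sqi/continuous_cosf.
  by congr toL2; apply/funext => x; rewrite mulrA.
rewrite -[LHS]ger0_norm ?hnorm_ge0// -sqrtr_sqr (hnorm_orth_sum (@cn_orth R) n (fun i => c i * kp i)).
by congr Num.sqrt; apply: eq_bigr => i _; rewrite exprMn mulrC.
Qed.

(** Cauchy-Schwarz against the summable series of 1 / lam i: the supremum is controlled by the L^2
    norm of the derivative. The factor 2 bounds the sines. *)
Lemma sup_tp : exists2 C, 0 < C & forall n c (x : R), `|tp n c x| <= C * Num.sqrt (\sum_(i < n) lam i * c i ^+ 2).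
Proof.
have [C C0 hC] := @lam_series R (-1) ltac:(lra).
exists (2 * Num.sqrt C); first by rewrite mulr_gt0 ?sqrtr_gt0.
move=> n c x; rewrite /tp.
have -> : \sum_(i < n) c i * sinf i x = \sum_(i < n) (kp i * c i) * ((kp i)^-1 * sinf i x).
  by apply: eq_bigr => i _; field; rewrite gt_eqF ?kp_gt0.
apply: (le_trans (sum_CS_sqrt _ _)); rewrite mulrC.
have -> : \sum_(i < n) (kp i * c i) ^+ 2 = \sum_(i < n) lam i * c i ^+ 2.
  by apply: eq_bigr => i _; rewrite exprMn.
rewrite ler_wpM2r// -[2]ger0_norm// -sqrtr_sqr -sqrtrM// ler_wsqrtr//.
apply: (@le_trans _ _ (2 ^+ 2 * \sum_(i < n) lam i `^ (-1))); last by rewrite ler_wpM2l ?sqr_ge0.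
rewrite mulr_sumr; apply: ler_sum => i _.
rewrite exprMn mulrC exprVn powRN powRr1 ?(ltW (lam_gt0 _))// ler_wpM2r ?invr_ge0 ?(ltW (lam_gt0 _))//.
by rewrite -real_normK ?num_real// ler_sqr ?nnegrE ?sinf_bound.
Qed.

(** With Y and Z the polynomials of y and z, the sum is half the integral of (Y + Z)^2 Y'. The
    integral of Y^2 Y' vanishes since Y is zero at both ends. The mixed term uses the supremum of Y,
    at most a multiple of G, and the term Z^2 Y' uses [L4_trig]; G is the norm of Y'. *)
Lemma energy_bound (b : R) : 8^-1 < b -> exists2 C, 0 < C & forall n (y z : nat -> R) (G : R),
  G = Num.sqrt (\sum_(i < n) lam i * y i ^+ 2) ->
  `|\sum_(i < n) y i * Bq i (\sum_(j < n) (y j + z j) *: en j)| <=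
  C * (Num.sqrt (\sum_(i < n) z i ^+ 2) * G ^+ 2 + (\sum_(i < n) (lam i `^ b * z i) ^+ 2) * G).
Proof.
move=> /L4_trig[C C0 hC]; have [D D0 hD] := sup_tp.
exists (D + C); first exact: addr_gt0.
move=> n y z G GE.
have G0 : 0 <= G by rewrite GE sqrtr_ge0.
pose Y := tp n y; pose Z := tp n z; pose dY := dtp n y.
have cY : continuous Y by exact: continuous_tp.
have cZ : continuous Z by exact: continuous_tp.
have cdY : continuous dY by exact: continuous_dtp.
have cM (f g : R -> R) : continuous f -> continuous g -> continuous (fun x => f x * g x).
  by move=> cf cg x; apply: cvgM; [exact: cf|exact: cg].
have sc (f : R -> R) : continuous f -> sqi f by exact: continuous_sqi.
pose U := tp n (fun j => y j + z j).
have UE x : U x = Y x + Z x.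
  by rewrite /U /Y /Z /tp -big_split/=; apply: eq_bigr => i _; rewrite mulrDl.
have cU : continuous U by exact: continuous_tp.
have E1 : \sum_(i < n) y i * Bq i (\sum_(j < n) (y j + z j) *: en j) =
    2^-1 * \int[mu01]_x (U x ^+ 2 * dY x).
  rewrite -(toL2_tp n (fun j => y j + z j)) -/U.
  have Bi i : Bq i (toL2 U) = 2^-1 * kp i * ip (toL2 (fun x => U x ^+ 2)) (cn i).
    congr (_ * _); rewrite (ip_mulb _ _ (bddm_cosf i)) ip_toL2; last 2 first.
    - exact/sc/continuous_tp2.
    - exact/sc/continuous_cosf.
    apply: ae_eq_Rintegral01.
    + apply: measurable_funM; first by apply: sqi_measurable; exact: repr_sqi.
      apply: measurable_funM; first exact: (bddm_cosf i).1.
      by apply: sqi_measurable; exact: repr_sqi.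
    + apply: measurable_funM; first by apply: continuous_measurable_fun; exact: continuous_tp2.
      exact: (bddm_cosf i).1.
    + by apply: aeS (toL2K (sc _ cU)) => x ->; ring.
  under eq_bigr do rewrite Bi.
  rewrite -ip_toL2; [|exact/sc/continuous_tp2|exact: sc].
  have -> : toL2 dY = \sum_(i < n) (y i * kp i) *: cn i.
    have cs i : sqi (fun x : R => y i * (kp i * cosf i x)) by exact/sqiZ/sqiZ/continuous_sqi/continuous_cosf.
    rewrite (toL2_sum n cs).2; apply: eq_bigr => i _.
    rewrite -toL2Z; last exact/continuous_sqi/continuous_cosf.
    by congr toL2; apply/funext => x; rewrite mulrA.
  rewrite ip_sumr mulr_sumr; apply: eq_bigr => i _; rewrite ipZr; ring.
have c2 (f : R -> R) : continuous f -> continuous (fun x => f x ^+ 2).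
  by move=> cf; under eq_fun do rewrite expr2; exact: cM.
have int0 : \int[mu01]_x (Y x ^+ 2 * dY x) = 0.
  have cYd : continuous (fun x => Y x ^+ 2 * dY x) by apply: cM => //; exact: c2.
  rewrite Rintegral_leb01; last exact: continuous_measurable_fun.
  have d x : is_derive x (1 : R) (fun x => 3^-1 * Y x ^+ 3) (Y x ^+ 2 * dY x).
    have h := is_derive_expr 3 (is_derive_tp n y x).
    by apply: (is_derive_eqr (is_derive_scale 3^-1 h)) => /=; rewrite -/Y -/dY; field.
  rewrite (Rint_FTC2 ler01 d cYd) /Y (tp01 n y).1 (tp01 n y).2.
  by rewrite expr0n/= !mulr0 subrr.
have iC (f : R -> R) : continuous f -> mu01.-integrable [set: R] (EFin \o f).
  by move=> cf; apply: integrable_sqi1; exact: sc.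
have E2 : \int[mu01]_x (U x ^+ 2 * dY x) =
    2 * \int[mu01]_x (Y x * Z x * dY x) + \int[mu01]_x (Z x ^+ 2 * dY x).
  have e : \int[mu01]_x (U x ^+ 2 * dY x) = \int[mu01]_x ((Y x ^+ 2 * dY x + 2 * (Y x * Z x * dY x)) + Z x ^+ 2 * dY x).
    by apply: eq_Rintegral => x _; rewrite UE; ring.
  have k1 := cM _ _ (c2 _ cY) cdY.
  have k2 := cM _ _ (cM _ _ cY cZ) cdY.
  have k3 := cM _ _ (c2 _ cZ) cdY.
  have k2' : continuous (fun x => 2 * (Y x * Z x * dY x)) by move=> x; apply: cvgMr; exact: k2.
  have k12 : continuous (fun x => Y x ^+ 2 * dY x + 2 * (Y x * Z x * dY x)).
    by move=> x; apply: cvgD; [exact: k1|exact: k2'].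
  rewrite e RintegralD//; [|exact: iC|exact: iC].
  rewrite RintegralD//; [|exact: iC|exact: iC].
  by rewrite int0 add0r RintegralZl//; exact: iC.
rewrite E1 E2 mulrDr mulrA mulVf// mul1r.
have hZ : hnorm (toL2 Z) = Num.sqrt (\sum_(i < n) z i ^+ 2).
  rewrite -[LHS]ger0_norm ?hnorm_ge0// -sqrtr_sqr toL2_tp.
  by rewrite (hnorm_orth_sum (@en_orth R) n z).
have hdY : hnorm (toL2 dY) = G by rewrite GE; exact: hnorm_dtp.
have t1 : `|\int[mu01]_x (Y x * Z x * dY x)| <= D * (Num.sqrt (\sum_(i < n) z i ^+ 2) * G ^+ 2).
  have -> : \int[mu01]_x (Y x * Z x * dY x) = ip (mulb Y (toL2 Z)) (toL2 dY).
    have Yb : bddm (D * G) Y by split; [exact: continuous_measurable_fun|move=> x; rewrite GE; exact: hD].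
    apply/esym; apply: ipE; [exact/sc/cM|exact: sc| |exact/toL2K/sc].
    apply: aeS2 (repr_mulb (toL2 Z) Yb) (toL2K (sc _ cZ)) => x -> ->.
    by [].
  have Yb : bddm (D * G) Y by split; [exact: continuous_measurable_fun|move=> x; rewrite GE; exact: hD].
  apply: (le_trans (ip_CS _ _)); rewrite hdY expr2.
  apply: (le_trans (ler_wpM2r G0 (hnorm_mulb (toL2 Z) Yb))).
  by rewrite hZ; lra.
have t2 : `|\int[mu01]_x (Z x ^+ 2 * dY x)| <= C * (\sum_(i < n) (lam i `^ b * z i) ^+ 2) * G.
  rewrite -ip_toL2; [|exact/sc/c2|exact: sc].
  by rewrite -hdY; exact: hC.
apply: (le_trans (ler_normD _ _)).
have S0 : 0 <= \sum_(i < n) (lam i `^ b * z i) ^+ 2 by apply: sumr_ge0 => i _; exact: sqr_ge0.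
have p1 : 0 <= C * (Num.sqrt (\sum_(i < n) z i ^+ 2) * G ^+ 2).
  by rewrite !mulr_ge0 ?sqrtr_ge0 ?sqr_ge0 ?(ltW C0).
have p2 : 0 <= D * ((\sum_(i < n) (lam i `^ b * z i) ^+ 2) * G) by rewrite !mulr_ge0 ?(ltW D0).
have p3 : 0 <= C * ((\sum_(i < n) (lam i `^ b * z i) ^+ 2) * G) by rewrite !mulr_ge0 ?(ltW C0).
rewrite normrM (ger0_norm (_ : 0 <= 2^-1)) ?invr_ge0//; lra.
Qed.

End Nonlinearity.

Lemma cauchy_eps_cvg (R : realType) (V : completeNormedModType R) (u : nat -> V) :
  (forall e, 0 < e -> exists N, forall m n, (N <= m)%N -> (N <= n)%N -> `|u m - u n| <= e) ->
  exists l : V, u n @[n --> \oo] --> l.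
Proof.
move=> h; suff : cvgn u by move/cvg_ex.
apply/cauchy_cvgP; apply: cauchy_exP => e e0.
have [N hN] := h _ (divr_gt0 e0 (ltr0n _ 2)); exists (u N), N => // n Nn.
rewrite -ball_normE/=; apply: le_lt_trans (hN _ _ (leqnn N) Nn) _; lra.
Qed.

(** * The completion H_(-1/2), duality and the extended semigroup *)

Section NegativeSpaces.
Context {R : realType}.
Local Notation H := (L2 R).
Context (Hneg : R -> completeNormedModType R) (emb : forall r, {linear H -> Hneg r}).
Hypothesis HnegP : negative_interpolation_spaces emb.

Local Notation r12 := (- 2^-1 : R).

Let r12_lt0 : r12 < 0. Proof. by rewrite oppr_lt0 invr_gt0. Qed.

Lemma lam_powR_half k : lam k `^ 2^-1 = kp k :> R.
Proof. by rewrite lam_powR mulfV// powRr1// ltW// kp_gt0. Qed.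

Lemma lam_powR_mhalf k : lam k `^ r12 = (kp k)^-1.
Proof. by rewrite powRN lam_powR_half. Qed.

Lemma Hdom_neg (v : H) : Hdom r12 v.
Proof.
apply/HdomP; exists (hnorm v ^+ 2) => N; apply: le_trans (bessel (@en_orth R) v N).
apply: ler_sum => i _; rewrite exprMn -[leRHS]mul1r ler_wpM2r ?sqr_ge0//.
rewrite lam_powR_mhalf exprVn invf_le1 ?exprn_gt0 ?kp_gt0//.
exact: lam_ge1.
Qed.

Lemma emb_norm (v : H) : `|emb r12 v| = Hnorm r12 v.
Proof. by have [h _] := HnegP r12_lt0; exact: h. Qed.

(** Coordinatewise the claim is lam exp(-2 t lam) <= 1/t, which follows from exp(t lam) >= 1 + t
    lam. *)
Lemma semigroup_emb_le (t : R) (v : H) : 0 < t ->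
  hnorm (semigroup t v) <= t `^ r12 * `|emb r12 v|.
Proof.
move=> t0; rewrite emb_norm.
have p0 : 0 <= t `^ r12 * Hnorm r12 v by rewrite mulr_ge0 ?powR_ge0 ?hnorm_ge0.
apply: hnorm_le_coord => // N.
rewrite exprMn; apply: le_trans (ler_wpM2l (sqr_ge0 _) (bessel (@en_orth R) (npow r12 v) N)).
rewrite mulr_sumr; apply: ler_sum => i _.
rewrite semigroup_coord ?(ltW t0)// npow_coord; last exact: Hdom_neg.
rewrite [(expR _ * _) ^+ 2]exprMn [(_ `^ _ * ip _ _) ^+ 2]exprMn [leRHS]mulrA ler_wpM2r ?sqr_ge0// lam_powR_mhalf.
have -> : (t `^ r12) ^+ 2 = t^-1.
  by rewrite powRN exprVn powR12_sqrt ?(ltW t0)// sqr_sqrtr ?(ltW t0).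
rewrite exprVn -invfM -/(lam i).
have h := expR_ge1Dx (t * lam i : R).
have tl : 0 < t * lam i by rewrite mulr_gt0 ?lam_gt0.
rewrite expRN exprVn lef_pV2 ?posrE ?exprn_gt0 ?expR_gt0//.
by rewrite expr2; nra.
Qed.

Lemma emb_approx (f : Hneg r12) : exists v : nat -> H, emb r12 (v n) @[n --> \oo] --> f.
Proof.
have [_ dn] := HnegP r12_lt0.
have h n : exists v, `|f - emb r12 v| < n.+1%:R^-1.
  have [|g [bg [v _ vg]]] := dn (ball f n.+1%:R^-1) _ (ball_open _ _).
    by exists f; apply: ballxx; rewrite invr_gt0.
  by exists v; rewrite vg; move: bg; rewrite -ball_normE.
have [v hv] := choice h; exists v.
apply/cvgrPdist_lt => e e0.
exists (Num.bound e^-1) => // n /= hn; apply: lt_le_trans (hv n) _.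
rewrite invf_ple ?posrE//; apply: ltW.
apply: lt_le_trans (archi_boundP _) _; first by rewrite invr_ge0 ltW.
by rewrite ler_nat (leq_trans hn).
Qed.

Lemma emb_cauchy (f : Hneg r12) (v : nat -> H) : emb r12 (v n) @[n --> \oo] --> f ->
  forall e, 0 < e -> exists N, forall m n, (N <= m)%N -> (N <= n)%N -> `|emb r12 (v m - v n)| <= e.
Proof.
move=> /cvgrPdist_le h e e0; have [N _ hN] := h _ (divr_gt0 e0 (ltr0n _ 2)).
exists N => m n Nm Nn; rewrite linearB/=.
have -> : emb r12 (v m) - emb r12 (v n) = (f - emb r12 (v n)) - (f - emb r12 (v m)).
  by rewrite opprB [RHS]addrC addrA subrK.
apply: (le_trans (ler_normB _ _)).
have := hN m Nm; have := hN n Nn; rewrite /=; lra.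
Qed.

Lemma dist_emb_cvg0 (f : Hneg r12) (u v : nat -> H) : emb r12 (u n) @[n --> \oo] --> f ->
  emb r12 (v n) @[n --> \oo] --> f -> `|emb r12 (u n - v n)| @[n --> \oo] --> (0 : R).
Proof.
move=> hu hv; have h : emb r12 (u n) - emb r12 (v n) @[n --> \oo] --> (0 : Hneg r12).
  by rewrite -(subrr f); exact: cvgB.
rewrite (_ : (fun n => _) = (fun n => `|emb r12 (u n) - emb r12 (v n)|)); last first.
  by apply/funext => n; rewrite linearB.
by rewrite -[X in _ --> X](normr0 (Hneg r12)); exact: cvg_norm.
Qed.

Lemma semigroup_additive (t : R) (u v : H) : 0 <= t -> semigroup t u - semigroup t v = semigroup t (u - v).
Proof.
move=> t0; apply: L2_coord_eq => k.
by rewrite ipBr !semigroup_coord// ipBr mulrBr.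
Qed.

(** The choice in [semigroup_ext] is inhabited: the smoothing bound makes images of approximating
    sequences Cauchy in H, and any two of them have the same limit. *)
Lemma semigroup_extP (t : R) (f : Hneg r12) : 0 < t ->
  forall v : nat -> H, emb r12 (v n) @[n --> \oo] --> f ->
    hnorm (semigroup t (v n) - semigroup_ext emb t f) @[n --> \oo] --> (0 : R).
Proof.
move=> t0; apply: (@xgetPex _ 0 [set u | forall v : nat -> H, emb r12 (v n) @[n --> \oo] --> f ->
    hnorm (semigroup t (v n) - u) @[n --> \oo] --> (0 : R)]).
have tp : 0 < t `^ r12 by rewrite powR_gt0.
have [v hv] := emb_approx f.
have [u hu] : exists u, hnorm (semigroup t (v n) - u) @[n --> \oo] --> (0 : R).
  apply: L2_complete => e e0.
  have [N hN] := emb_cauchy hv (divr_gt0 e0 tp).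
  exists N => m n Nm Nn; rewrite semigroup_additive ?(ltW t0)//.
  apply: (le_trans (semigroup_emb_le _ t0)).
  by rewrite mulrC -ler_pdivlMr ?hN.
exists u => w hw.
have h1 := dist_emb_cvg0 hw hv.
apply: (@cvg0_squeeze _ _ (fun n => t `^ r12 * `|emb r12 (w n - v n)| + hnorm (semigroup t (v n) - u))).
  move=> n; rewrite hnorm_ge0/= (le_trans (hnorm_dist _ (semigroup t (v n)) _))// lerD2r.
  by rewrite semigroup_additive ?(ltW t0)// semigroup_emb_le.
rewrite -[X in _ --> X](addr0 (0 : R)); apply: cvgD => //.
by rewrite -[X in _ --> X](mulr0 (t `^ r12)); apply: cvgM; [exact: cvg_cst|exact: h1].
Qed.

(** The weights of H_(1/2) and H_(-1/2) cancel in each coordinate; Cauchy-Schwarz is applied to the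
    projections and the limit is taken. *)
Lemma ip_emb_le (w v : H) : Hdom 2^-1 w -> `|ip w v| <= Hnorm 2^-1 w * `|emb r12 v|.
Proof.
move=> dw; have lim : `|ip w (proj n v)| @[n --> \oo] --> `|ip w v|.
  exact: cvg_norm (@ip_cvg R _ _ (proj_cvg v) w).
apply: (cvgn_le lim) => n; rewrite projE ip_sumr.
under eq_bigr => i _ do rewrite ipZr (ipC w).
rewrite (eq_bigr (fun i : 'I_n => ip (en i) (npow 2^-1 w) * ip (en i) (npow r12 v))); last first.
  move=> i _; rewrite !npow_coord//; last exact: Hdom_neg.
  by rewrite lam_powR_mhalf lam_powR_half; field; rewrite gt_eqF ?kp_gt0.
apply: (le_trans (sum_CS_sqrt _ _)); rewrite emb_norm.
apply: ler_pM; rewrite ?sqrtr_ge0//.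
  by rewrite -[leRHS]ger0_norm ?hnorm_ge0// -sqrtr_sqr ler_wsqrtr// bessel//; exact: en_orth.
by rewrite -[leRHS]ger0_norm ?hnorm_ge0// -sqrtr_sqr ler_wsqrtr// bessel//; exact: en_orth.
Qed.

Lemma dual_pairing_cvg (f : Hneg r12) (w : H) : Hdom 2^-1 w ->
  forall v : nat -> H, emb r12 (v n) @[n --> \oo] --> f ->
    ip (v n) w @[n --> \oo] --> dual_pairing emb f w.
Proof.
move=> dw.
apply: (@xgetPex _ 0 [set l | forall v : nat -> H, emb r12 (v n) @[n --> \oo] --> f ->
    ip (v n) w @[n --> \oo] --> l]).
have [v hv] := emb_approx f.
have W0 : 0 < Hnorm 2^-1 w + 1 by rewrite ltr_wpDl ?hnorm_ge0.
have le1 (x : H) : `|ip w x| <= (Hnorm 2^-1 w + 1) * `|emb r12 x|.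
  by apply: (le_trans (ip_emb_le x dw)); rewrite ler_wpM2r// lerDl.
have [l hl] : exists l : R, ip (v n) w @[n --> \oo] --> l.
  apply: cauchy_eps_cvg => e e0.
  have [N hN] := emb_cauchy hv (divr_gt0 e0 W0); exists N => m n Nm Nn.
  rewrite -ipBl ipC (le_trans (le1 _))// mulrC -ler_pdivlMr//; exact: hN.
exists l => u hu.
have h1 := dist_emb_cvg0 hu hv.
have -> : (fun n => ip (u n) w) = (fun n => ip w (u n - v n) + ip (v n) w).
  by apply/funext => n; rewrite ipBr (ipC (u n)) (ipC (v n)) subrK.
rewrite -[X in _ --> X]add0r; apply: cvgD => //.
apply: cvg0_norm; apply: (@cvg0_squeeze _ _ (fun n => (Hnorm 2^-1 w + 1) * `|emb r12 (u n - v n)|)).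
  by move=> n; rewrite normr_ge0/= le1.
by rewrite -[X in _ --> X](mulr0 (Hnorm 2^-1 w + 1)); apply: cvgM; [exact: cvg_cst|exact: h1].
Qed.

(** The sine series may be differentiated term by term: membership in H_(1/2) says that the
    differentiated cosine series converges in H, and its sum is the weak derivative by testing. *)
Lemma wderiv_half (w : H) : Hdom 2^-1 w ->
  hnorm (\sum_(k < n) (kp k * ip (en k) w) *: cn k - wderiv w) @[n --> \oo] --> (0 : R).
Proof.
move=> /HdomP[B hB].
have hB' N : \sum_(i < N) (kp i * ip (en i) w) ^+ 2 <= B.
  by apply: le_trans (hB N); apply: ler_sum => i _; rewrite lam_powR_half.
have [g [_ hg]] := @riesz_fischer R _ (@cn_orth R) (fun i => kp i * ip (en i) w) B hB'.
suff -> : wderiv w = g by [].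
have wg : weak_deriv w g.
  move=> eta te; have l1 := @ip_cvg R _ _ (proj_cvg w) (toL2 (derive1 eta)).
  rewrite ipC (ipC g); apply: (cvg_unique _ l1) => //.
  rewrite (_ : (fun n => _) = (fun n => - ip (toL2 eta) (\sum_(i < n) (kp i * ip (en i) w) *: cn i))).
    exact: cvgN (@ip_cvg R _ _ hg (toL2 eta)).
  apply/funext => n; rewrite projE !ip_sumr -sumrN; apply: eq_bigr => i _.
  by rewrite !ipZr (ipC _ (en i)) (weak_deriv_en _ te) ipZl (ipC (toL2 eta)); ring.
by apply: (weak_deriv_unique (u := w)) => //; exact: (xgetPex 0 (ex_intro _ g wg)).
Qed.

(** The distributional derivative is built as the termwise derivative of the cosine series of u. The
    factor kp k is undone by the H_(-1/2) norm, so the partial sums are Cauchy; the mean of u drops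
    out, as derivatives of elements of H_(1/2) are limits of cosine sums. *)
Lemma distr_derivP (u : H) (w : H) : Hdom 2^-1 w ->
  dual_pairing emb (distr_deriv emb u) w = - ip u (wderiv w).
Proof.
move: w; apply: (@xgetPex _ 0 [set f | forall w, Hdom 2^-1 w -> dual_pairing emb f w = - ip u (wderiv w)]).
pose c n k := if (k < n)%N then ip (cn k) u else 0.
pose g n := \sum_(k < n) ip (cn k) u *: cn k.
pose v n := \sum_(k < n) (- (kp k * ip (cn k) u)) *: en k.
have gc n k : ip (cn k) (g n) = c n k.
  by rewrite (ip_orth_sum (@cn_orth R) n (fun k => ip (cn k) u)).
have vc n k : ip (en k) (v n) = - (kp k * c n k).
  rewrite (ip_orth_sum (@en_orth R) n (fun k => - (kp k * ip (cn k) u))) /c.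
  by case: ifP; rewrite ?mulr0 ?oppr0.
have [G [_ hG]] := @riesz_fischer R _ (@cn_orth R) (fun i => ip (cn i) u) _ (bessel (@cn_orth R) u).
have vle m n : `|emb r12 (v m - v n)| <= hnorm (g m - g n).
  rewrite emb_norm; apply: hnorm_le_coord; first exact: hnorm_ge0.
  move=> N; apply: le_trans (bessel (@cn_orth R) (g m - g n) N); apply: ler_sum => i _.
  rewrite npow_coord; last exact: Hdom_neg.
  rewrite !ipBr !vc !gc lam_powR_mhalf.
  rewrite (_ : _^-1 * _ = - (c m i - c n i)) ?sqrrN//.
  by field; rewrite gt_eqF ?kp_gt0.
have [f hf] : exists f : Hneg r12, emb r12 (v n) @[n --> \oo] --> f.
  apply: cauchy_eps_cvg => e e0.
  have /cvg_epsP/(_ _ (divr_gt0 e0 (ltr0n _ 2)))[N hN] := hG.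
  exists N => m n /hN; rewrite normr_hnorm_sub0// => h1 /hN.
  rewrite normr_hnorm_sub0// => h2.
  rewrite -linearB; apply: (le_trans (vle m n)); apply: (le_trans (hnorm_dist _ G _)).
  rewrite (hnormBC G); move: h1 h2; rewrite -/(g m) -/(g n); lra.
exists f => w dw.
have l1 := dual_pairing_cvg dw hf.
apply: (cvg_unique _ l1) => //.
rewrite (_ : (fun n => _) = (fun n => - ip u (\sum_(i < n) (kp i * ip (en i) w) *: cn i))).
  exact: cvgN (@ip_cvg R _ _ (wderiv_half dw) u).
apply/funext => n; rewrite ip_sumr ip_suml -sumrN; apply: eq_bigr => i _.
by rewrite ipZl ipZr (ipC u); ring.
Qed.

Lemma Hdom_en (r : R) k : Hdom r (en k).
Proof.
apply/HdomP; exists ((lam k `^ r) ^+ 2) => N.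
apply: (@le_trans _ _ (\sum_(i < N) (if i == k :> nat then (lam k `^ r) ^+ 2 else 0))).
  apply: ler_sum => i _; rewrite en_orth; case: eqP => [->|_]; first by rewrite mulr1.
  by rewrite mulr0 expr0n.
rewrite -big_mkcond/=; have [kN|Nk] := ltnP k N.
  by rewrite (big_pred1 (Ordinal kN))// => i; rewrite -val_eqE.
by rewrite big1 ?sqr_ge0// => i /eqP ik; move: (ltn_ord i); rewrite ik ltnNge Nk.
Qed.

Lemma wderiv_en k : wderiv (en k : H) = kp k *: cn k.
Proof.
have h := @weak_deriv_en R k.
by apply: (weak_deriv_unique (u := (en k : H))) => //; exact: (xgetPex 0 (ex_intro _ _ h)).
Qed.

(** This connects the drift of the statement, defined by completion and duality, with the scalar
    expression [Bq]: distributional derivative, pairing with a sine, and extended semigroup are all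
    evaluated along one approximating sequence. *)
Lemma semigroup_ext_F (t : R) (v : H) k : 0 < t -> sqi (fun x => repr v x ^+ 2) ->
  ip (en k) (semigroup_ext emb t (- (2^-1 *: distr_deriv emb (sqrL2 v)))) = expR (- (t * lam k)) * Bq k v.
Proof.
move=> t0 sv; set f := distr_deriv emb (sqrL2 v).
have [w hw] := emb_approx f.
have hu : emb r12 (- (2^-1 *: w n)) @[n --> \oo] --> - (2^-1 *: f).
  under eq_fun do rewrite linearN linearZ.
  by apply: cvgN; apply: cvgZr.
have l1 := @ip_cvg R _ _ (semigroup_extP t0 hu) (en k).
have l2 : ip (en k) (semigroup t (- (2^-1 *: w n))) @[n --> \oo] --> expR (- (t * lam k)) * Bq k v.
  have -> : (fun n => ip (en k) (semigroup t (- (2^-1 *: w n)))) =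
      (fun n => expR (- (t * lam k)) * (- (2^-1 * ip (w n) (en k)))).
    by apply/funext => n; rewrite semigroup_coord ?(ltW t0)// ipNr ipZr (ipC (en k)).
  apply: cvgM; first exact: cvg_cst.
  rewrite Bq_sqrL2// (_ : 2^-1 * kp k * _ = - (2^-1 * dual_pairing emb f (en k))); last first.
    by rewrite distr_derivP ?wderiv_en ?ipZr; [ring|exact: Hdom_en].
  apply: cvgN; apply: cvgMr; exact: dual_pairing_cvg (Hdom_en _ _) _ hw.
exact: (cvg_unique _ l1 l2).
Qed.

End NegativeSpaces.

(** * Square summable coordinate sequences *)

Section SquareSummable.
Context {R : realType}.
Implicit Types (a b : nat -> R) (A B : R).

(** A bound on the l^2 norm that never forms the infinite sum. Nonnegativity of the bound is
    included, so that every such estimate supplies it. *)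
Definition l2le a A := 0 <= A /\ sqsum_le a (A ^+ 2).

Lemma l2le_ge0 a A : l2le a A -> 0 <= A. Proof. by case. Qed.

Lemma l2le_mono a b A : (forall k, `|a k| <= `|b k|) -> l2le b A -> l2le a A.
Proof.
move=> ab [A0 hb]; split=> // N; apply: le_trans (hb N); apply: ler_sum => i _.
by rewrite -[a i ^+ 2]real_normK ?num_real// -[b i ^+ 2]real_normK ?num_real// ler_sqr ?nnegrE ?ab.
Qed.

Lemma l2le_wid a A B : A <= B -> l2le a A -> l2le a B.
Proof.
move=> AB [A0 h]; split; first exact: le_trans AB.
by move=> N; apply: (le_trans (h N)); rewrite ler_sqr ?nnegrE// (le_trans A0).
Qed.

Lemma l2leD a b A B : l2le a A -> l2le b B -> l2le (fun k => a k + b k) (A + B).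
Proof.
move=> [A0 ha] [B0 hb]; split; first exact: addr_ge0.
move=> N; under eq_bigr do rewrite sqrrD.
rewrite 2!big_split/= sumrMnl.
have h : \sum_(i < N) a i * b i <= A * B.
  apply: (le_trans (ler_norm _)); apply: (le_trans (sum_CS_sqrt _ _)).
  apply: ler_pM; rewrite ?sqrtr_ge0//.
    by rewrite -[A]ger0_norm// -sqrtr_sqr ler_wsqrtr.
  by rewrite -[B]ger0_norm// -sqrtr_sqr ler_wsqrtr.
have := ha N; have := hb N; lra.
Qed.

Lemma l2leZ a A (c : R) : l2le a A -> l2le (fun k => c * a k) (`|c| * A).
Proof.
move=> [A0 ha]; split; first exact: mulr_ge0.
move=> N; under eq_bigr do rewrite exprMn.
by rewrite -mulr_sumr exprMn real_normK ?num_real// ler_wpM2l ?sqr_ge0.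
Qed.

Lemma l2le0 : l2le (fun _ => 0 : R) 0.
Proof. by split=> // N; rewrite big1 ?expr0n// => i _; rewrite expr0n. Qed.

Lemma l2le_le a A k : l2le a A -> `|a k| <= A.
Proof.
move=> [A0 ha]; rewrite -ler_sqr// real_normK ?num_real//.
apply: le_trans (ha k.+1); rewrite big_ord_recr/= lerDr.
by apply: sumr_ge0 => i _; exact: sqr_ge0.
Qed.

Lemma l2le_hnorm (v : L2 R) A : l2le (fun k => ip (en k) v) A -> hnorm v <= A.
Proof. by move=> [A0 h]; exact: hnorm_le_coord. Qed.

Lemma hnorm_l2le (v : L2 R) : l2le (fun k => ip (en k) v) (hnorm v).
Proof. by split; [exact: hnorm_ge0|exact: bessel (@en_orth R) v]. Qed.

Lemma l2le_Hnorm r (v : L2 R) A : l2le (fun k => lam k `^ r * ip (en k) v) A ->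
  Hdom r v /\ Hnorm r v <= A.
Proof.
move=> [A0 h]; have dv : Hdom r v by apply/HdomP; exists (A ^+ 2).
by split=> //; apply/HnormP.
Qed.

Lemma Hnorm_l2le r (v : L2 R) A : Hdom r v -> Hnorm r v <= A -> l2le (fun k => lam k `^ r * ip (en k) v) A.
Proof.
move=> dv h; have A0 : 0 <= A by apply: le_trans h; exact: hnorm_ge0.
by split=> //; apply/HnormP.
Qed.

Lemma L2_of_l2le a A : l2le a A -> exists u : L2 R, forall k, ip (en k) u = a k.
Proof. by move=> [_ h]; exact: L2_of_coord h. Qed.

Lemma lam_powR_incr r s k : r <= s -> lam k `^ r <= lam k `^ s :> R.
Proof. by move=> rs; rewrite ler_powR// lam_ge1. Qed.

Lemma l2le_tail r a A n : 0 <= r -> l2le (fun k => lam k `^ r * a k) A ->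
  l2le (fun k => if (n <= k)%N then a k else 0) (lam n `^ (- r) * A).
Proof.
move=> r0 h; rewrite -(ger0_norm (powR_ge0 _ _)).
apply: l2le_mono (l2leZ (lam n `^ (- r)) h) => k.
case: ifP => [nk|_]; last by rewrite normr0.
rewrite mulrA normrM -[leLHS]mul1r ler_wpM2r//.
rewrite ger0_norm ?mulr_ge0 ?powR_ge0// powRN mulrC ler_pdivlMr ?powR_gt0 ?lam_gt0// mul1r.
apply: ge0_ler_powR => //; rewrite ?nnegrE ?(ltW (lam_gt0 _))//.
by rewrite /lam /kp ler_sqr ?nnegrE ?mulr_ge0 ?pi_ge0// ler_wpM2r ?pi_ge0// ler_nat.
Qed.

Lemma lam_powR_cvg0 r : 0 < r -> lam n `^ (- r) @[n --> \oo] --> (0 : R).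
Proof.
move=> r0; apply/cvg_epsP => e e0.
have [N hN] : exists N : nat, e `^ (- r^-1) <= N%:R.
  by exists (Num.bound (e `^ (- r^-1))); apply/ltW/archi_boundP/powR_ge0.
exists N => n Nn; rewrite subr0 ger0_norm ?powR_ge0//.
have h : e `^ (- r^-1) <= lam n.
  apply: (le_trans hN); apply: (@le_trans _ _ (kp n)).
    by apply: le_trans (kp_ge n); rewrite ler_nat (leq_trans Nn).
  rewrite /lam expr2 ler_peMr ?(ltW (kp_gt0 _))//.
  by apply: le_trans (kp_ge n); rewrite ler1n.
rewrite powRN -[e]invrK lef_pV2 ?posrE ?powR_gt0 ?lam_gt0 ?invr_gt0//.
rewrite (_ : e^-1 = (e `^ (- r^-1)) `^ r).
  by apply: ge0_powR_le; rewrite ?powR_ge0 ?(ltW r0) ?(ltW (lam_gt0 _)).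
by rewrite -powRrM mulNr mulVf ?gt_eqF// powRN powRr1// ltW.
Qed.

End SquareSummable.

(** * Scalar Volterra integrals and Ornstein-Uhlenbeck paths *)

Section Convolution.
Context {R : realType}.
Implicit Types (f g : R -> R) (l t : R).

Definition Vint (l : R) (f : R -> R) (a t : R) : R :=
  \int[leb]_(s in `[a, t]) (expR (- (l * (t - s))) * f s).

Lemma continuous_expRM (a b : R) : continuous (fun s : R => expR (a * s + b)).
Proof.
move=> s; apply: (@continuous_comp _ _ _ (fun s : R => a * s + b) expR); last exact: continuous_expR.
by apply: cvgD; [apply: cvgM; [exact: cvg_cst|exact: cvg_id]|exact: cvg_cst].
Qed.

Lemma is_derive_expRM (a b x : R) : is_derive x (1 : R) (fun s : R => expR (a * s + b)) (a * expR (a * x + b)).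
Proof.
have := @is_derive1_comp R expR (fun s : R => a * s + b) x _ _ (is_derive_expR _) (is_derive_affine a b x).
by rewrite mulrC.
Qed.

Lemma expRV_affine l t : (fun s : R => expR (- (l * (t - s)))) = (fun s => expR (l * s + - (l * t))).
Proof. by apply/funext => s; congr expR; ring. Qed.

Lemma continuous_expRV l t : continuous (fun s : R => expR (- (l * (t - s)))).
Proof. by rewrite expRV_affine; exact: continuous_expRM. Qed.

Lemma integrable_bdd (a b M : R) f : measurable_fun `[a, b] f -> (forall s, a <= s <= b -> `|f s| <= M) ->
  leb.-integrable `[a, b] (EFin \o f).
Proof.
move=> mf fM; apply: measurable_bounded_integrable => //.
- have [ab|ba] := leP a b; last by rewrite set_itv_ge ?measure0// -leNgt bnd_simp.
  by apply: compact_finite_measure; exact: segment_compact.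
- exists M; split; first exact: num_real.
  by move=> x Mx s /=; rewrite in_itv/= => /fM h; rewrite (le_trans h)// ltW.
Qed.

Lemma continuous_measurable_itv (a b : R) f : continuous f -> measurable_fun `[a, b] f.
Proof. by move=> cf; apply: measurable_funTS; exact: continuous_measurable_fun. Qed.

Lemma integrable_expM l t (a b M : R) f : measurable_fun `[a, b] f ->
  (forall s, a <= s <= b -> `|f s| <= M) ->
  leb.-integrable `[a, b] (EFin \o (fun s => expR (- (l * (t - s))) * f s)).
Proof.
move=> mf fM.
have [N hN] : exists N, forall s, a <= s <= b -> expR (- (l * (t - s))) <= N.
  exists (expR (- (l * (t - a))) + expR (- (l * (t - b)))) => s /andP[as_ sb].
  have [l0|l0] := leP 0 l.
    by apply: ler_wpDl; rewrite ?expR_ge0// ler_expR; nra.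
  by apply: ler_wpDr; rewrite ?expR_ge0// ler_expR; nra.
apply: (@integrable_bdd _ _ (N * M)).
  by apply: measurable_funM => //; apply: continuous_measurable_itv; exact: continuous_expRV.
move=> s sab; rewrite normrM ger0_norm ?expR_ge0// ler_pM ?expR_ge0 ?fM//; exact: hN.
Qed.

Lemma normr_Rint_le (a b : R) f g : leb.-integrable `[a, b] (EFin \o f) -> leb.-integrable `[a, b] (EFin \o g) ->
  (forall s, a <= s <= b -> `|f s| <= g s) ->
  `|\int[leb]_(s in `[a, b]) f s| <= \int[leb]_(s in `[a, b]) g s.
Proof.
move=> fi gi fg.
apply: (@le_trans _ _ (\int[leb]_(s in `[a, b]) `|f s|)).
  exact: le_normr_Rintegral.
apply: le_Rintegral => //; first exact: integrable_norm.
Qed.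

Lemma normr_Vint_le (l : R) (f g : R -> R) (a t M : R) : measurable_fun `[a, t] f -> continuous g ->
  (forall s, a <= s <= t -> `|f s| <= g s) -> (forall s, a <= s <= t -> g s <= M) ->
  `|Vint l f a t| <= Vint l g a t.
Proof.
move=> mf cg fg gM.
apply: normr_Rint_le.
- by apply: integrable_expM => // s st; apply: (le_trans (fg _ st)); exact: gM st.
- apply: integrable_continuous => s; apply: cvgM; [exact: continuous_expRV|exact: cg].
- by move=> s st; rewrite normrM ger0_norm// ler_wpM2l ?fg.
Qed.

Lemma Vint_expR (l c m a t : R) : a <= t -> 0 < l + m ->
  Vint l (fun s => c * expR (m * s)) a t = c * (expR (m * t) - expR (m * a - l * (t - a))) / (l + m).
Proof.
move=> t0 lm; have lm0 : l + m != 0 by rewrite gt_eqF.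
pose F (s : R) : R := (c / (l + m)) * expR ((l + m) * s + - (l * t)).
have dF (s : R) : is_derive s 1 F (c * expR ((l + m) * s + - (l * t))).
  apply: (is_derive_eqr (is_derive_scale _ (is_derive_expRM (l + m) (- (l * t)) s))).
  by field.
rewrite /Vint (_ : (fun s => _) = (fun s => c * expR ((l + m) * s + - (l * t)))); last first.
  by apply/funext => s; rewrite mulrCA -expRD; congr (_ * expR _); ring.
rewrite (@Rint_FTC2 R F _ a t t0 dF) /F.
  rewrite (_ : (l + m) * t + - (l * t) = m * t); last by ring.
  rewrite (_ : (l + m) * a + - (l * t) = m * a - l * (t - a)); last by ring.
  by field.
by move=> s; apply: cvgM; [exact: cvg_cst|exact: continuous_expRM].
Qed.

Lemma Vint_cst (l c a t : R) : a <= t -> 0 < l -> Vint l (fun _ => c) a t = c * (1 - expR (- (l * (t - a)))) / l.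
Proof.
move=> t0 l0; have := @Vint_expR l c 0 a t t0; rewrite addr0 => /(_ l0).
rewrite !mul0r expR0 add0r => <-; congr Vint; apply/funext => s.
by rewrite mul0r expR0 mulr1.
Qed.

Lemma Vint_expR_le (l c m a t : R) : 0 <= c -> a <= t -> 0 < l + m ->
  Vint l (fun s => c * expR (m * s)) a t <= c * expR (m * t) / (l + m).
Proof.
move=> c0 t0 lm; rewrite Vint_expR//.
by rewrite ler_wpM2r ?invr_ge0 ?(ltW lm)// ler_wpM2l// gerBl expR_ge0.
Qed.

Lemma Vint_ext (l : R) (f g : R -> R) (a t : R) : (forall s, a <= s <= t -> f s = g s) -> Vint l f a t = Vint l g a t.
Proof.
move=> fg; apply: eq_Rintegral => s; rewrite inE/= in_itv/= => st.
by rewrite fg.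
Qed.

(** The right end is exempt because frozen drifts are constant on cells which are open on the
    right. *)
Lemma Vint_ext_ho (l : R) (f g : R -> R) (a t A B : R) :
  measurable_fun `[a, t] f -> measurable_fun `[a, t] g ->
  (forall s, a <= s <= t -> `|f s| <= A) -> (forall s, a <= s <= t -> `|g s| <= B) ->
  (forall s, a <= s < t -> f s = g s) -> Vint l f a t = Vint l g a t.
Proof.
move=> mf mg fA gB fg; have sub : `[a, t[ `<=` `[a, t]%classic by apply: subset_itvl; rewrite bnd_simp.
rewrite /Vint -!Rintegral_itv_bndo_bndc; last 2 first.
- by apply: integrableS (integrable_expM l t mg gB).
- by apply: integrableS (integrable_expM l t mf fA).
by apply: eq_Rintegral => s; rewrite inE/= in_itv/= => st; rewrite fg.
Qed.

Lemma Vint0 (l a t : R) : Vint l (fun _ => 0) a t = 0.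
Proof.
rewrite /Vint /Rintegral (eq_integral (fun _ => 0%E)) ?integral0//.
by move=> s _; rewrite mulr0.
Qed.

Lemma VintB (l : R) (f g : R -> R) (a t : R) (A B : R) :
  measurable_fun `[a, t] f -> measurable_fun `[a, t] g ->
  (forall s, a <= s <= t -> `|f s| <= A) -> (forall s, a <= s <= t -> `|g s| <= B) ->
  Vint l (fun s => f s - g s) a t = Vint l f a t - Vint l g a t.
Proof.
move=> mf mg fA gB; rewrite /Vint -RintegralB//; last 2 first.
- exact: integrable_expM fA.
- exact: integrable_expM gB.
by apply: eq_Rintegral => s _; rewrite mulrBr.
Qed.

Lemma Vint_shift (l : R) (f : R -> R) (a s t M : R) : a <= s <= t -> measurable_fun `[a, t] f ->
  (forall u, a <= u <= t -> `|f u| <= M) ->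
  Vint l f a t = expR (- (l * (t - s))) * Vint l f a s + Vint l f s t.
Proof.
move=> /andP[as_ st] mf fM.
have i0 := integrable_expM l t mf fM.
have isub : `[a, s] `<=` `[a, t]%classic by apply: subset_itvl; rewrite bnd_simp.
have -> : expR (- (l * (t - s))) * Vint l f a s = \int[leb]_(u in `[a, s]) (expR (- (l * (t - u))) * f u).
  rewrite /Vint -RintegralZl//; last first.
    apply: (@integrable_expM _ _ _ _ M) => [|u /andP[au us]]; first exact: measurable_funS mf.
    by apply: fM; rewrite au (le_trans us).
  apply: eq_Rintegral => u _; rewrite mulrA -expRD; congr (expR _ * _); ring.
rewrite addrC; apply/eqP; rewrite -subr_eq; apply/eqP.
rewrite {1}/Vint (@Rintegral_itvB R _ (BLeft a) (BRight t) s)//=.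
rewrite /Vint Rintegral_itv_obnd_cbnd//.
by apply: integrableS i0 => //; apply: subset_itv; rewrite bnd_simp.
Qed.

Lemma is_derive_Vint (l : R) (f : R -> R) (a t : R) : continuous f -> a < t ->
  is_derive t 1 (Vint l f a) (- l * Vint l f a t + f t).
Proof.
move=> cf at_.
pose W (t : R) := \int[leb]_(s in `[a, t]) (expR (l * s) * f s).
have cW : continuous (fun s : R => expR (l * s) * f s).
  move=> s; apply: cvgM; last exact: cf.
  apply: (@continuous_comp _ _ _ (fun s : R => l * s) expR); last exact: continuous_expR.
  by apply: cvgM; [exact: cvg_cst|exact: cvg_id].
have VE : Vint l f a = (fun t => expR (- l * t + 0) * W t).
  apply/funext => u; rewrite /W -RintegralZl//; last exact: integrable_continuous.
  by apply: eq_Rintegral => s _; rewrite mulrA -expRD; congr (expR _ * _); ring.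
have [dW W'] : derivable W t 1 /\ derive1 W t = expR (l * t) * f t.
  apply: (@continuous_FTC1 R _ (BLeft a) t (t + 1)) => //.
  - by rewrite ltrDl.
  - exact: integrable_continuous.
  - exact: cW.
have iW : is_derive t 1 W (expR (l * t) * f t) by split; [exact: dW|rewrite -derive1E; exact: W'].
rewrite VE; apply: (is_derive_eqr (is_derive_mul (is_derive_expRM (- l) 0 t) iW)).
rewrite addr0 mulrA -expRD (_ : - l * t + l * t = 0) ?expR0; first by ring.
by ring.
Qed.

Lemma powR_le1D (x a : R) : 0 <= x -> 0 <= a <= 1 -> x `^ a <= 1 + x.
Proof.
move=> x0 /andP[a0 a1]; have [x1|/ltW x1] := leP x 1.
  apply: (@le_trans _ _ 1); last by rewrite lerDl.
  by rewrite -[leRHS](congr1 (fun g => g a) (@powR1 R)); apply: ge0_powR_le.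
apply: (@le_trans _ _ x); last by rewrite lerDr.
by rewrite -[leRHS]powRr1//; apply: ler_powR.
Qed.

(** Partial integration of the convolution of exp(- l t) with db. The lower limit -1 changes nothing
    for paths that vanish at negative times, and makes t = 0 an interior point for derivatives. *)
Definition ou (l : R) (b : R -> R) (t : R) : R := b t - l * Vint l b (- 1) t.

Lemma Vint_moment (l s t : R) : s <= t -> 0 < l ->
  l * Vint l (fun u => 1 + l * (t - u)) s t <= 2.
Proof.
move=> st l0.
(* An antiderivative of the integrand, equal to 2 at t and nonnegative at s. *)
pose G (u : R) : R := expR (l * u + - (l * t)) * ((- l) * u + (2 + l * t)).
have dG (u : R) : is_derive u 1 G (l * (expR (- (l * (t - u))) * (1 + l * (t - u)))).
  apply: (is_derive_eqr (is_derive_mul (is_derive_expRM l (- (l * t)) u) (is_derive_affine (- l) (2 + l * t) u))).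
  by rewrite (_ : l * u + - (l * t) = - (l * (t - u))); ring.
have cg : continuous (fun u : R => expR (- (l * (t - u))) * (1 + l * (t - u))).
  move=> u; apply: cvgM; first exact: continuous_expRV.
  apply: cvgD; first exact: cvg_cst.
  by apply: cvgM; [exact: cvg_cst|apply: cvgB; [exact: cvg_cst|exact: cvg_id]].
rewrite /Vint -RintegralZl//; last exact: integrable_continuous.
rewrite (@Rint_FTC2 R G _ s t st dG); last by move=> u; apply: cvgM; [exact: cvg_cst|exact: cg].
rewrite /G (_ : l * t + - (l * t) = 0) ?expR0; last by ring.
have : 0 <= expR (l * s + - (l * t)) * ((- l) * s + (2 + l * t)).
  by apply: mulr_ge0; rewrite ?expR_ge0//; have := ler_wpM2l (ltW l0) st; lra.
lra.
Qed.

Section Hoelder.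
Context (b : R -> R) (M al : R) (al01 : 0 < al <= 1) (b0 : forall t, t <= 0 -> b t = 0)
  (bH : forall s t, `|b t - b s| <= M * `|t - s| `^ al).

Lemma hoelder_continuous : continuous b.
Proof.
have /andP[a0 _] := al01.
move=> x; apply/cvgrPdist_le => e e0.
have M0 : 0 <= M.
  by have := bH 0 1; rewrite subr0 normr1 (congr1 (fun g => g al) (@powR1 R)) mulr1; apply: le_trans.
near=> y.
apply: (le_trans (bH _ _)).
have h : `|x - y| <= (e / (M + 1)) `^ al^-1.
  near: y; apply: cvgr_dist_le; first exact: cvg_id.
  by rewrite powR_gt0// divr_gt0// ltr_wpDl.
apply: (@le_trans _ _ ((M + 1) * (e / (M + 1)))); last first.
  by rewrite mulrCA mulfV ?mulr1// gt_eqF// ltr_wpDl.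
apply: ler_pM => //; rewrite ?powR_ge0// ?lerDl//.
apply: (@le_trans _ _ (((e / (M + 1)) `^ al^-1) `^ al)).
  by apply: ge0_powR_le; rewrite ?powR_ge0// ltW.
by rewrite -powRrM mulVf ?gt_eqF// powRr1// divr_ge0 ?(ltW e0)// addr_ge0.
Unshelve. all: by end_near.
Qed.

(** Restarts the process at s. Adding and subtracting the constant b t under the integral leaves
    only increments of b, on which the Hoelder bound acts. *)
Lemma ou_step (l s t : R) : 0 <= s -> s <= t -> 0 < l ->
  ou l b t - expR (- (l * (t - s))) * ou l b s =
  expR (- (l * (t - s))) * (b t - b s) + l * Vint l (fun u => b t - b u) s t.
Proof.
move=> s0 st l0.
have cb := hoelder_continuous.
have s1 : - 1 <= s <= t by rewrite st andbT (le_trans _ s0)// oppr_le0.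
have [B hB] : exists B, forall u, - 1 <= u <= t -> `|b u| <= B.
  exists (`|b t| + M * (`|t| + 1) `^ al) => u /andP[u1 ut].
  rewrite -[b u](subrK (b t)) addrC (le_trans (ler_normD _ _))// lerD2l.
  apply: (le_trans (bH _ _)).
  have M0 : 0 <= M.
    by have := bH 0 1; rewrite subr0 normr1 (congr1 (fun g => g al) (@powR1 R)) mulr1; apply: le_trans.
  rewrite ler_wpM2l//; apply: ge0_powR_le => //.
    by case/andP: al01 => /ltW.
  rewrite distrC ger0_norm ?subr_ge0// (le_trans (lerD (ler_norm t) (_ : - u <= 1)))//; lra.
rewrite /ou (@Vint_shift l b (- 1) s t B)//; last exact: continuous_measurable_itv.
rewrite (@VintB l (fun _ => b t) b s t `|b t| B)//; last 2 first.
- exact: continuous_measurable_itv.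
- by move=> u /andP[su ut]; apply: hB; rewrite ut andbT (le_trans _ su)//; case/andP: s1.
by rewrite Vint_cst//; field; rewrite gt_eqF.
Qed.

(** Splits the Hoelder order: (t - u)^al is at most (t - s)^p l^(-(al - p)) times 1 + l (t - u),
    trading time regularity p for decay al - p in l. The boundary term costs 1 and the integral, by
    [Vint_moment], costs 2. *)
Lemma ou_incr (l s t p : R) : 0 <= s -> s <= t -> 0 < l -> 0 <= p <= al ->
  `|ou l b t - expR (- (l * (t - s))) * ou l b s| <= 3 * M * l `^ (- (al - p)) * (t - s) `^ p.
Proof.
move=> s0 st l0 /andP[p0 pa].
have cb := hoelder_continuous.
have /andP[a0 a1] := al01.
have M0 : 0 <= M.
  by have := bH 0 1; rewrite subr0 normr1 (congr1 (fun g => g al) (@powR1 R)) mulr1; apply: le_trans.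
have key u : s <= u <= t -> `|b t - b u| <= M * (t - s) `^ p * l `^ (- (al - p)) * (1 + l * (t - u)).
  move=> /andP[su ut]; have tu0 : 0 <= t - u by rewrite subr_ge0.
  apply: (le_trans (bH _ _)); rewrite -!mulrA ler_wpM2l// ger0_norm//.
  have -> : (t - u) `^ al = (t - u) `^ p * (t - u) `^ (al - p).
    have pE : p + (al - p) = al by ring.
    by rewrite -powRD pE// gt_eqF.
  apply: ler_pM; rewrite ?powR_ge0//.
    by apply: ge0_powR_le; rewrite ?subr_ge0 ?lerD2l ?lerN2.
  rewrite powRN mulrC ler_pdivlMr ?powR_gt0// mulrC -powRM ?(ltW l0)//.
  by apply: powR_le1D; [rewrite mulr_ge0 ?(ltW l0)|lra].
set C := M * _ * _ in key.
have C0 : 0 <= C by rewrite !mulr_ge0 ?powR_ge0.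
rewrite ou_step// (le_trans (ler_normD _ _))//.
rewrite (_ : 3 * M * l `^ (- (al - p)) * (t - s) `^ p = C + 2 * C); last by rewrite /C; ring.
apply: lerD.
  rewrite normrM ger0_norm ?expR_ge0//.
  apply: (@le_trans _ _ (expR (- (l * (t - s))) * (C * (1 + l * (t - s))))).
    by rewrite ler_wpM2l ?expR_ge0// key// lexx.
  rewrite mulrCA ler_piMr// expRN mulrC ler_pdivrMr ?expR_gt0// mul1r.
  exact: expR_ge1Dx.
rewrite normrM gtr0_norm//.
have cg (k : R) : continuous (fun u : R => k * (1 + l * (t - u))).
  move=> u; apply: cvgM; first exact: cvg_cst.
  apply: cvgD; first exact: cvg_cst.
  by apply: cvgM; [exact: cvg_cst|apply: cvgB; [exact: cvg_cst|exact: cvg_id]].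
apply: (@le_trans _ _ (l * Vint l (fun u => C * (1 + l * (t - u))) s t)).
  rewrite ler_wpM2l ?(ltW l0)//; apply: (@normr_Vint_le l _ _ s t (C * (1 + l * (t - s)))) => //.
    apply: continuous_measurable_itv => u; apply: cvgB; [exact: cvg_cst|exact: cb].
  move=> u /andP[su ut]; rewrite ler_wpM2l// lerD2l ler_wpM2l ?(ltW l0)//.
  by rewrite lerD2l lerN2.
have -> : Vint l (fun u => C * (1 + l * (t - u))) s t = C * Vint l (fun u => 1 + l * (t - u)) s t.
  rewrite /Vint -RintegralZl//; last first.
    apply: integrable_continuous => u; apply: cvgM; first exact: continuous_expRV.
    apply: cvgD; first exact: cvg_cst.
    by apply: cvgM; [exact: cvg_cst|apply: cvgB; [exact: cvg_cst|exact: cvg_id]].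
  by apply: eq_Rintegral => u _; rewrite mulrCA.
by rewrite mulrCA [leRHS]mulrC ler_wpM2l// Vint_moment.
Qed.

Lemma ou0 (l : R) : ou l b 0 = 0.
Proof.
rewrite /ou b0// (@Vint_ext l b (fun _ => 0)) ?Vint0 ?mulr0 ?subr0//.
by move=> s /andP[_ s0]; exact: b0.
Qed.

Lemma ou_le (l t : R) : 0 <= t -> 0 < l -> `|ou l b t| <= 3 * M * l `^ (- al).
Proof.
move=> t0 l0; have := @ou_incr l 0 t 0 (lexx _) t0 l0.
rewrite ou0 mulr0 !subr0 powRr0 mulr1; apply.
by rewrite lexx ltW//; case/andP: al01.
Qed.

(** Neither process is differentiable, but the rough path cancels in the difference of two dampings.
    This makes the energy method available. *)
Lemma is_derive_ouB (l h t : R) : 0 <= t ->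
  is_derive t 1 (fun t => ou l b t - ou (l + h) b t)
    (- l * (ou l b t - ou (l + h) b t) + h * ou (l + h) b t).
Proof.
move=> t0; have cb := hoelder_continuous.
have t1 : - 1 < t by apply: lt_le_trans t0; rewrite oppr_lt0.
rewrite (_ : (fun t => _) = (fun t => (l + h) * Vint (l + h) b (- 1) t + (- l) * Vint l b (- 1) t)); last first.
  by apply/funext => u; rewrite /ou; ring.
apply: (is_derive_eqr (@is_deriveD R R R _ _ t 1 _ _ (is_derive_scale (l + h) (is_derive_Vint (l + h) cb t1)) (is_derive_scale (- l) (is_derive_Vint l cb t1)))).
by rewrite /ou; ring.
Qed.

End Hoelder.

End Convolution.

Lemma powRDp (R : realType) (x r s : R) : 0 < x -> x `^ (r + s) = x `^ r * x `^ s.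
Proof. by move=> x0; rewrite powRD//; apply/implyP => _; rewrite gt_eqF. Qed.

(** * Noise paths and their convolutions in interpolation norms *)

Section Noise.
Context {R : realType}.

(** A Hoelder condition in H_(-ga) in a strong form: each coordinate has its own constant, and it is
    the weighted sequence of constants that is square summable with norm at most K. *)
Definition noise (al ga K : R) (b : nat -> R -> R) := exists M : nat -> R,
  [/\ forall k t, t <= 0 -> b k t = 0,
      forall k s t, `|b k t - b k s| <= M k * `|t - s| `^ al
    & l2le (fun k => M k * lam k `^ (- ga)) K].

Lemma hoelder_cst_ge0 (f : R -> R) (M al : R) : (forall s t, `|f t - f s| <= M * `|t - s| `^ al) -> 0 <= M.
Proof.
move=> h; have := h 0 1; rewrite subr0 normr1 (congr1 (fun g => g al) (@powR1 R)) mulr1.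
exact: le_trans.
Qed.

Lemma noise_ou_incr (al ga K r p s t : R) b : 0 < al <= 1 -> 0 <= p <= al -> r + p <= al - ga ->
  noise al ga K b -> 0 <= s -> s <= t ->
  l2le (fun k => lam k `^ r * (ou (lam k) (b k) t - expR (- (lam k * (t - s))) * ou (lam k) (b k) s))
    (3 * (t - s) `^ p * K).
Proof.
move=> al01 pa rp [M [b0 bH hM]] s0 st.
rewrite (_ : 3 * _ = `|3 * (t - s) `^ p|); last by rewrite ger0_norm// mulr_ge0 ?powR_ge0.
apply: l2le_mono (l2leZ _ hM) => k; have M0 := hoelder_cst_ge0 (bH k).
rewrite normrM ger0_norm ?powR_ge0// [leRHS]ger0_norm ?mulr_ge0 ?powR_ge0//.
apply: (le_trans (ler_wpM2l (powR_ge0 _ _) (ou_incr al01 (bH k) s0 st (lam_gt0 k) pa))).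
rewrite [leLHS](_ : _ = (3 * (t - s) `^ p * M k) * (lam k `^ r * lam k `^ (- (al - p)))); last by ring.
rewrite [leRHS]mulrA ler_wpM2l ?mulr_ge0 ?powR_ge0//.
rewrite -powRDp ?lam_gt0//.
by apply: lam_powR_incr; move: rp; clear; lra.
Qed.

Lemma noise_ou_le (al ga K r t : R) b : 0 < al <= 1 -> r <= al - ga ->
  noise al ga K b -> 0 <= t -> l2le (fun k => lam k `^ r * ou (lam k) (b k) t) (3 * K).
Proof.
move=> al01 ra nb t0; have /andP[a0 _] := al01.
have h := @noise_ou_incr al ga K r 0 0 t b al01 _ _ nb (lexx _) t0.
have := h _ _; rewrite powRr0 mulr1 lexx (ltW a0) addr0 => /(_ isT ra).
apply: l2le_mono => k; case: nb => M [b0 bH _].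
by rewrite (ou0 (b0 k)) mulr0 subr0.
Qed.

(** Extra damping eta makes the process small in H_r: the factor (lam + eta)^(-al) is split into a
    part that pays for the weights and a part at most eta^(-(al - ga - r)). *)
Lemma noise_ou_shift (al ga K r eta t : R) b : 0 < al <= 1 -> 0 <= r + ga -> r <= al - ga -> 0 < eta ->
  noise al ga K b -> 0 <= t ->
  l2le (fun k => lam k `^ r * ou (lam k + eta) (b k) t) (3 * eta `^ (- (al - ga - r)) * K).
Proof.
move=> al01 r0 ra e0 [M [b0 bH hM]] t0.
rewrite (_ : 3 * _ = `|3 * eta `^ (- (al - ga - r))|); last by rewrite ger0_norm// mulr_ge0 ?powR_ge0.
apply: l2le_mono (l2leZ _ hM) => k; have M0 := hoelder_cst_ge0 (bH k).
have l0 := @lam_gt0 R k.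
have le0 : 0 < lam k + eta by rewrite addr_gt0.
rewrite normrM ger0_norm ?powR_ge0// [leRHS]ger0_norm ?mulr_ge0 ?powR_ge0//.
apply: (le_trans (ler_wpM2l (powR_ge0 _ _) (ou_le al01 (b0 k) (bH k) t0 le0))).
rewrite [leLHS](_ : _ = (3 * M k) * (lam k `^ r * (lam k + eta) `^ (- al))); last by ring.
rewrite [leRHS](_ : _ = (3 * M k) * (eta `^ (- (al - ga - r)) * lam k `^ (- ga))); last by ring.
rewrite ler_wpM2l ?mulr_ge0//.
have -> : (lam k + eta) `^ (- al) = (lam k + eta) `^ (- (r + ga)) * (lam k + eta) `^ (- (al - ga - r)).
  by rewrite -powRDp//; congr (_ `^ _); ring.
have -> : lam k `^ r = lam k `^ (r + ga) * lam k `^ (- ga) :> R.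
  by rewrite -powRDp//; congr (_ `^ _); ring.
rewrite [leLHS](_ : _ = (lam k `^ (r + ga) * (lam k + eta) `^ (- (r + ga))) *
  ((lam k + eta) `^ (- (al - ga - r)) * lam k `^ (- ga))); last by ring.
rewrite -[leRHS]mul1r; apply: ler_pM; rewrite ?mulr_ge0 ?powR_ge0//.
  rewrite powRN ler_pdivrMr ?powR_gt0// mul1r.
  by apply: ge0_powR_le; rewrite ?(ltW l0) ?(ltW le0)// lerDl ltW.
rewrite ler_wpM2r ?powR_ge0// !powRN lef_pV2 ?posrE ?powR_gt0//.
apply: ge0_powR_le; rewrite ?(ltW e0) ?(ltW le0)//; last by rewrite lerDr ltW.
by move: ra; clear; lra.
Qed.

Lemma one_sub_expN_le (x p : R) : 0 <= x -> 0 <= p <= 1 -> 0 <= 1 - expR (- x) <= x `^ p.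
Proof.
move=> x0 /andP[p0 p1].
have h0 : 0 <= 1 - expR (- x) by rewrite subr_ge0 -expR0 ler_expR oppr_le0.
rewrite h0/=; have [x1|/ltW x1] := leP x 1.
  apply: (@le_trans _ _ x); first by have := expR_ge1Dx (- x); lra.
  rewrite le_eqVlt in x0; case/orP: x0 => [/eqP <-|x0]; first exact: powR_ge0.
  have pE : p + (1 - p) = 1 by ring.
  rewrite -[leLHS]powRr1 ?(ltW x0)// -[in leLHS]pE powRD ?pE ?oner_eq0// ler_piMr ?powR_ge0//.
  rewrite -[leRHS](congr1 (fun g => g (1 - p)) (@powR1 R)).
  by apply: ge0_powR_le; rewrite ?subr_ge0// ltW.
apply: (@le_trans _ _ 1); first by rewrite gerBl expR_ge0.
by rewrite -[leLHS](powRr0 x); apply: ler_powR.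
Qed.

Lemma l2le_semigroup_sub (r p d A : R) (a : nat -> R) : 0 <= p <= 1 -> 0 <= d ->
  l2le (fun k => lam k `^ (r + p) * a k) A ->
  l2le (fun k => lam k `^ r * ((1 - expR (- (lam k * d))) * a k)) (d `^ p * A).
Proof.
move=> p01 d0 h; rewrite -[d `^ p]ger0_norm ?powR_ge0//.
apply: l2le_mono (l2leZ (d `^ p) h) => k.
have l0 := @lam_gt0 R k.
have /andP[e0 e1] := one_sub_expN_le (mulr_ge0 (ltW l0) d0) p01.
rewrite powRM ?(ltW l0)// in e1.
rewrite powRDp// 5!normrM [`|1 - _|]ger0_norm// ![`|_ `^ _|]ger0_norm ?powR_ge0//.
rewrite [leRHS](_ : _ = lam k `^ r * ((lam k `^ p * d `^ p) * `|a k|)); last by ring.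
by rewrite ler_wpM2l ?powR_ge0// ler_wpM2r.
Qed.

(** Drift coordinates grow like lam^(1/2) and the integration gains 1 / lam. Spending p on the time
    factor leaves lam^(r + p - 1/2), which is square summable precisely for r + p < 1/4. *)
Lemma l2le_drift_sub (r p : R) : 0 <= p <= 1 -> r + p < 4^-1 ->
  exists2 C, 0 < C & forall (d L : R) (c : nat -> R), 0 <= d -> (forall k, `|c k| <= kp k * L) ->
  l2le (fun k => lam k `^ r * (c k * (1 - expR (- (lam k * d))) / lam k)) (C * d `^ p * L).
Proof.
move=> p01 rp; have [|C C0 hC] := @lam_series R (2 * (r + p - 2^-1)); first by move: rp; clear; lra.
exists (Num.sqrt C); first by rewrite sqrtr_gt0.
move=> d L c d0 cL.
have L0 : 0 <= L by have := le_trans (normr_ge0 _) (cL 0%N); rewrite pmulr_rge0// kp_gt0.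
have h : l2le (fun k => lam k `^ (r + p - 2^-1) : R) (Num.sqrt C).
  split; first exact: sqrtr_ge0.
  move=> N; rewrite sqr_sqrtr ?(ltW C0)//; apply: le_trans (hC N); apply: ler_sum => i _.
  by rewrite mulrC powRrM powR_mulrn ?powR_ge0.
rewrite (_ : _ * L = `|d `^ p * L| * Num.sqrt C); last first.
  by rewrite ger0_norm ?mulr_ge0 ?powR_ge0//; ring.
apply: l2le_mono (l2leZ _ h) => k.
have l0 := @lam_gt0 R k; have k0 := @kp_gt0 R k.
have /andP[e0 e1] := one_sub_expN_le (mulr_ge0 (ltW l0) d0) p01.
rewrite powRM ?(ltW l0)// in e1.
rewrite 3!normrM [`|1 - _|]ger0_norm// [`|_^-1|]ger0_norm ?invr_ge0 ?(ltW l0)// [`|_ `^ r|]ger0_norm ?powR_ge0//.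
rewrite [leRHS]ger0_norm ?mulr_ge0 ?powR_ge0//.
have -> : lam k `^ (r + p - 2^-1) = lam k `^ r * lam k `^ p / kp k :> R.
  rewrite -lam_powR_half -powRN -!powRDp ?lam_gt0//.
have -> : (lam k)^-1 = (kp k)^-1 * (kp k)^-1 :> R by rewrite -invfM.
apply: (@le_trans _ _ (lam k `^ r * (kp k * L * (lam k `^ p * d `^ p) * ((kp k)^-1 * (kp k)^-1)))).
  rewrite ler_wpM2l ?powR_ge0// ler_wpM2r ?mulr_ge0 ?invr_ge0 ?(ltW k0)//.
  by apply: ler_pM.
by apply: eq_ler; field; rewrite gt_eqF.
Qed.

End Noise.

(** * The time grid and the scheme in coordinates *)

Section Grid.
Context {R : realType}.

(** Equal to [floor_grid] at nonnegative times; the natural index makes functions of it piecewise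
    constant on countably many cells, hence measurable. *)
Definition gfl (h s : R) : R := (Num.truncn (s / h))%:R * h.

Lemma gfl_cell (h s : R) i : 0 < h -> i%:R * h <= s < i.+1%:R * h -> gfl h s = i%:R * h.
Proof.
move=> h0 /andP[s1 s2]; congr (_%:R * _); apply: Num.Theory.truncn_def.
by rewrite ler_pdivlMr// s1/= ltr_pdivrMr.
Qed.

Lemma gfl_le (h s : R) : 0 < h -> 0 <= s -> exists i, [/\ gfl h s = i%:R * h, i%:R * h <= s & s < i.+1%:R * h].
Proof.
move=> h0 s0; exists (Num.truncn (s / h)); split=> //.
  by rewrite -ler_pdivlMr// Num.Theory.truncn_le divr_ge0// ltW.
by rewrite -ltr_pdivrMr//; exact: Num.Theory.truncnS_gt.
Qed.

Lemma measurable_gfl (phi : R -> R) (h : R) (D : set R) : 0 < h -> measurable D -> measurable_fun D (fun s => phi (gfl h s)).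
Proof.
move=> h0 mD; apply: measurable_funS (_ : measurable_fun [set: R] _) => //.
move=> _ B mB; rewrite setTI.
have -> : (fun s => phi (gfl h s)) @^-1` B =
    \bigcup_(i in [set i : nat | B (phi (i%:R * h))]) [set s | Num.truncn (s / h) = i].
  apply/seteqP; split => [s/= Bs|s [i /= Bi e]].
    by exists (Num.truncn (s / h)).
  by rewrite /gfl e.
apply: bigcup_measurable => i _.
have -> : [set s | Num.truncn (s / h) = i] =
    (if i is 0%N then [set` `]-oo, h[] else [set` `[i%:R * h, i.+1%:R * h[]).
  case: i => [|i]; apply/seteqP; split => s /=; rewrite in_itv/=.
  - by move=> e; have := Num.Theory.truncnS_gt (s / h); rewrite e ltr_pdivrMr// mul1r.
  - move=> sh; apply/eqP; rewrite -leqn0 Num.Theory.truncn_le_nat ltr_pdivrMr// mul1r//.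
  - move=> e; have s0 : 0 <= s / h.
      by move: e; rewrite Num.Theory.truncn_floor; case: ifP.
    by have := Num.Theory.truncn_itv s0; rewrite e ler_pdivlMr// ltr_pdivrMr.
  - move=> /andP[s1 s2]; apply: Num.Theory.truncn_def.
    by rewrite ler_pdivlMr// s1/= ltr_pdivrMr.
by case: i => [|i]; exact: measurable_itv.
Qed.

Lemma gfl_bounded (phi : R -> R) (h T : R) : 0 < h -> exists M, forall s, 0 <= s <= T -> `|phi (gfl h s)| <= M.
Proof.
move=> h0; exists (\sum_(i < (Num.truncn (T / h)).+1) `|phi (i%:R * h)|) => s /andP[s0 sT].
have i : (Num.truncn (s / h) < (Num.truncn (T / h)).+1)%N.
  by rewrite ltnS Num.Theory.le_truncn// ler_wpM2r// invr_ge0 ltW.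
by rewrite (bigD1 (Ordinal i))//= lerDl sumr_ge0.
Qed.

End Grid.

Section Scheme.
Context {R : realType}.
Local Notation H := (L2 R).

(** The truncation enters as a predicate on times, so that the estimates do not depend on the
    formula behind it. Only values of the path at grid times matter. *)
Definition drift (h : R) (ind : R -> bool) (x : R -> H) (k : nat) (s : R) : R :=
  if ind (gfl h s) then Bq k (x (gfl h s)) else 0.

(* [a] selects the modes kept by the Galerkin projection. *)
Definition mild_path (a : nat -> bool) (T : R) (xi : H) (b f : nat -> R -> R) (x : R -> H) :=
  forall t, 0 <= t <= T -> forall k, ip (en k) (x t) =
    if a k then expR (- (lam k * t)) * ip (en k) xi + Vint (lam k) (f k) 0 t + ou (lam k) (b k) t
    else 0.

Definition scheme (n : nat) (h T : R) (xi : H) (b : nat -> R -> R) (ind : R -> bool) (x : R -> H) :=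
  mild_path (fun k => (k < n)%N) T xi b (drift h ind x) x.

Lemma measurable_drift h ind x k (D : set R) : 0 < h -> measurable D -> measurable_fun D (drift h ind x k).
Proof. by move=> h0 mD; exact: (@measurable_gfl R (fun r => if ind r then Bq k (x r) else 0) h D h0 mD). Qed.

Lemma drift_bounded h ind x k (T : R) : 0 < h -> exists M, forall s, 0 <= s <= T -> `|drift h ind x k s| <= M.
Proof. exact: (@gfl_bounded R (fun r => if ind r then Bq k (x r) else 0)). Qed.

Context (n : nat) (h T : R) (xi : H) (b : nat -> R -> R) (ind : R -> bool) (x : R -> H)
  (h0 : 0 < h) (sx : scheme n h T xi b ind x).

Lemma scheme_zero k : (k < n)%N -> 0 <= T -> (forall t, t <= 0 -> b k t = 0) -> ip (en k) (x 0) = ip (en k) xi.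
Proof.
move=> kn T0 b0; rewrite sx ?lexx// kn ou0// mulr0 oppr0 expR0 mul1r addr0.
by rewrite /Vint set_itv1 Rintegral_set1 addr0.
Qed.

(** In a cell the drift is frozen, so the Volterra integral is explicit. The right end of the cell
    may be included since it is a single point of the integral. *)
Lemma scheme_step (i k : nat) (t : R) : (k < n)%N -> i%:R * h <= t <= i.+1%:R * h -> t <= T ->
  ip (en k) (x t) = expR (- (lam k * (t - i%:R * h))) * ip (en k) (x (i%:R * h)) +
    (if ind (i%:R * h) then Bq k (x (i%:R * h)) else 0) * (1 - expR (- (lam k * (t - i%:R * h)))) / lam k +
    (ou (lam k) (b k) t - expR (- (lam k * (t - i%:R * h))) * ou (lam k) (b k) (i%:R * h)).
Proof.
move=> kn /andP[t1 t2] tT; set s := i%:R * h in t1 *.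
have s0 : 0 <= s by rewrite mulr_ge0// ltW.
have [M hM] := drift_bounded ind x k t h0.
have md : measurable_fun `[0, t] (drift h ind x k) by exact: measurable_drift.
rewrite !sx ?kn ?s0 ?(le_trans s0 t1) ?(le_trans t1)//.
rewrite (@Vint_shift R (lam k) _ 0 s t M)// ?s0//.
rewrite [Vint _ _ s t](@Vint_ext_ho R _ _ (fun _ => if ind s then Bq k (x s) else 0) s t M `|if ind s then Bq k (x s) else 0|)//.
- rewrite Vint_cst ?lam_gt0//.
  rewrite (_ : expR (- (lam k * t)) = expR (- (lam k * (t - s))) * expR (- (lam k * s))); last first.
    by rewrite -expRD; congr expR; ring.
  ring.
- exact: measurable_drift.
- by move=> u /andP[su ut]; apply: hM; rewrite ut andbT (le_trans s0).
- move=> u /andP[su ut]; rewrite /drift (gfl_cell h0 (_ : i%:R * h <= u < i.+1%:R * h))//.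
  by rewrite su (lt_le_trans ut).
Qed.

Lemma drift_le (L : R) k s : 0 <= L -> 0 <= s <= T ->
  (forall i, i%:R * h <= T -> ind (i%:R * h) -> hnorm (x (i%:R * h)) ^+ 2 <= L) ->
  `|drift h ind x k s| <= kp k * L.
Proof.
move=> L0 /andP[s0 sT] hL; rewrite /drift; have [i [-> s1 s2]] := gfl_le h0 s0.
case: ifP => hi; last by rewrite normr0 mulr_ge0 ?(ltW (kp_gt0 _)).
by rewrite (le_trans (Bq_le _ _))// ler_wpM2l ?(ltW (kp_gt0 _))// hL// (le_trans s1).
Qed.

End Scheme.

Section SchemeBounds.
Context {R : realType}.
Local Notation H := (L2 R).

Lemma normr_Vint_cst (l c t : R) (f : R -> R) : 0 < l -> 0 <= t -> measurable_fun `[0, t] f ->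
  (forall s, 0 <= s <= t -> `|f s| <= c) -> `|Vint l f 0 t| <= c * (1 - expR (- (l * t))) / l.
Proof.
move=> l0 t0 mf fc; apply: (le_trans (@normr_Vint_le R l f (fun _ => c) 0 t c mf _ fc _)) => //.
  by move=> ?; exact: cvg_cst.
by rewrite Vint_cst// subr0.
Qed.

Lemma mild_bound (al ga r : R) : 0 < al <= 1 -> r <= al - ga -> r < 4^-1 ->
  exists2 C, 0 < C & forall a T (xi : H) b f x K A L, mild_path a T xi b f x ->
    (forall k, measurable_fun `[0, T] (f k)) -> (forall k s, 0 <= s <= T -> `|f k s| <= kp k * L) ->
    noise al ga K b -> l2le (fun k => lam k `^ r * ip (en k) xi) A -> 0 <= L ->
    forall t, 0 <= t <= T -> l2le (fun k => lam k `^ r * ip (en k) (x t)) (A + C * L + 3 * K).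
Proof.
move=> al01 ra r4; have [||C C0 hC] := @l2le_drift_sub R r 0; rewrite ?lexx ?ler01 ?addr0//.
exists C => // a T xi b f x K A L sx mf fL nb xiA L0 t /andP[t0 tT].
have h1 : l2le (fun k => lam k `^ r * ((kp k * L) * (1 - expR (- (lam k * t))) / lam k)) (C * L).
  have := hC t L (fun k => kp k * L) t0; rewrite powRr0 mulr1; apply.
  by move=> k; rewrite ger0_norm// mulr_ge0 ?(ltW (kp_gt0 _)).
have h2 := noise_ou_le al01 ra nb t0.
pose V k := Vint (lam k) (f k) 0 t.
have h3 : l2le (fun k => lam k `^ r * V k) (C * L).
  apply: l2le_mono h1 => k; have l0 := @lam_gt0 R k.
  rewrite !normrM ler_wpM2l// -!normrM [leRHS]ger0_norm; last first.
    rewrite mulr_ge0 ?invr_ge0 ?(ltW l0)// mulr_ge0//.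
      by rewrite mulr_ge0// ltW// kp_gt0.
    by rewrite subr_ge0 -expR0 ler_expR oppr_le0 mulr_ge0// ltW.
  apply: normr_Vint_cst => //.
    by apply: measurable_funS (mf k) => //; apply: subset_itvl; rewrite bnd_simp.
  move=> s /andP[s0 st]; apply: fL.
  by rewrite s0 (le_trans st).
have h4 : l2le (fun k => lam k `^ r * (expR (- (lam k * t)) * ip (en k) xi)) A.
  apply: l2le_mono xiA => k; rewrite mulrCA normrM ler_piMl// ger0_norm ?expR_ge0//.
  by rewrite -expR0 ler_expR oppr_le0 mulr_ge0// ltW// lam_gt0.
apply: l2le_mono (l2leD (l2leD h4 h3) h2) => k.
rewrite (sx t)// ?t0//; case: ifP => _; last by rewrite mulr0 normr0.
by rewrite -!mulrDr.
Qed.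

(** The semigroup part, the drift and the noise get separate Hoelder orders, because they are
    multiplied by bounds which blow up at different rates under the truncation. *)
Lemma mild_incr (al ga r p1 p2 p3 : R) : 0 < al <= 1 -> 0 <= p1 <= 1 -> 0 <= p2 <= 1 -> r + p2 < 4^-1 ->
  0 <= p3 <= al -> r + p3 <= al - ga ->
  exists2 C, 0 < C & forall a T (xi : H) b f x K A L s t h, mild_path a T xi b f x ->
    (forall k, measurable_fun `[0, T] (f k)) -> (forall k s, 0 <= s <= T -> `|f k s| <= kp k * L) ->
    noise al ga K b -> 0 <= s -> s <= t -> t <= T -> t - s <= h ->
    l2le (fun k => lam k `^ (r + p1) * ip (en k) (x s)) A ->
    l2le (fun k => lam k `^ r * (ip (en k) (x t) - ip (en k) (x s)))
      (h `^ p1 * A + C * h `^ p2 * L + 3 * h `^ p3 * K).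
Proof.
move=> al01 p11 p21 rp2 p3a rp3; have [C C0 hC] := l2le_drift_sub p21 rp2.
exists C => // a T xi b f x K A L s t h sx mf fL nb s0 st tT dh hA.
have d0 : 0 <= t - s by rewrite subr_ge0.
have h0 : 0 <= h by exact: le_trans dh.
have K0 : 0 <= K by case: nb => M [_ _ /l2le_ge0].
have A0 := l2le_ge0 hA.
have T0 : 0 <= (0 : R) <= T by rewrite lexx (le_trans s0)// (le_trans st).
have L0 : 0 <= L by have := le_trans (normr_ge0 _) (fL 0%N 0 T0); rewrite pmulr_rge0// kp_gt0.
have pw p : 0 <= p -> (t - s) `^ p <= h `^ p by move=> p0; apply: ge0_powR_le.
have g1 := l2le_semigroup_sub p11 d0 hA.
have g2 : l2le (fun k => lam k `^ r * ((kp k * L) * (1 - expR (- (lam k * (t - s)))) / lam k)) (C * (t - s) `^ p2 * L).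
  by apply: hC => // k; rewrite ger0_norm// mulr_ge0 ?(ltW (kp_gt0 _)).
have g2' : l2le (fun k => lam k `^ r * Vint (lam k) (f k) s t) (C * (t - s) `^ p2 * L).
  apply: l2le_mono g2 => k; have l0 := @lam_gt0 R k.
  rewrite !normrM ler_wpM2l// -!normrM [leRHS]ger0_norm; last first.
    rewrite mulr_ge0 ?invr_ge0 ?(ltW l0)// mulr_ge0//.
      by rewrite mulr_ge0// ltW// kp_gt0.
    by rewrite subr_ge0 -expR0 ler_expR oppr_le0 mulr_ge0// ltW.
  rewrite -Vint_cst//; apply: (@normr_Vint_le R (lam k) (f k) (fun _ => kp k * L) s t (kp k * L)) => //.
  - by apply: measurable_funS (mf k) => //; apply: subset_itv; rewrite bnd_simp.
  - by move=> ?; exact: cvg_cst.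
  - by move=> u /andP[su ut]; apply: fL; rewrite (le_trans s0)// (le_trans ut).
have g3 := noise_ou_incr al01 p3a rp3 nb s0 st.
have g4 : l2le (fun k => - 1 * (lam k `^ r * ((1 - expR (- (lam k * (t - s)))) * ip (en k) (x s)))) ((t - s) `^ p1 * A).
  by have := l2leZ (-1) g1; rewrite normrN1 mul1r.
apply: (@l2le_wid _ _ ((t - s) `^ p1 * A + C * (t - s) `^ p2 * L + 3 * (t - s) `^ p3 * K)).
  apply: lerD; first apply: lerD.
  - by rewrite ler_wpM2r// pw//; case/andP: p11.
  - by rewrite ler_wpM2r// ler_wpM2l ?(ltW C0)// pw//; case/andP: p21.
  - by rewrite ler_wpM2r// ler_wpM2l// pw//; case/andP: p3a.
apply: l2le_mono (l2leD (l2leD g4 g2') g3) => k.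
have st' : 0 <= s <= T by rewrite s0 (le_trans st).
have tt' : 0 <= t <= T by rewrite tT (le_trans s0).
case ak : (a k); last by rewrite !sx// ak subrr mulr0 normr0.
rewrite !sx// ak (@Vint_shift R (lam k) (f k) 0 s t (kp k * L)) ?s0//; last 2 first.
- by apply: measurable_funS (mf k) => //; apply: subset_itvl; rewrite bnd_simp.
- by move=> u /andP[u0 ut]; apply: fL; rewrite u0 (le_trans ut).
rewrite (_ : expR (- (lam k * t)) = expR (- (lam k * (t - s))) * expR (- (lam k * s))); last first.
  by rewrite -expRD; congr expR; ring.
by apply: eq_ler; congr `|_|; ring.
Qed.

End SchemeBounds.

(** * The energy estimate *)

Section Energy.
Context {R : realType}.
Local Notation H := (L2 R).

Lemma is_derive_bigsum n (f : nat -> R -> R) (df : nat -> R) (x : R) : (forall i, is_derive x (1 : R) (f i) (df i)) ->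
  is_derive x (1 : R) (fun x => \sum_(i < n) f i x) (\sum_(i < n) df i).
Proof.
move=> h; elim: n => [|n IH].
  rewrite big_ord0 (_ : (fun x => _) = cst 0); first exact: is_derive_cst.
  by apply/funext => y; rewrite big_ord0.
rewrite (_ : (fun x => _) = (fun x => \sum_(i < n) f i x + f n x)); last first.
  by apply/funext => y; rewrite big_ord_recr.
rewrite big_ord_recr/=.
exact: (@is_deriveD R R R _ _ x 1 _ _ IH (h n)).
Qed.

Lemma sqrt_le_l2 (n : nat) (a : nat -> R) A : l2le a A -> Num.sqrt (\sum_(i < n) a i ^+ 2) <= A.
Proof. by move=> [A0 h]; rewrite -[leRHS]ger0_norm// -sqrtr_sqr ler_wsqrtr. Qed.

Lemma derivative_bound (f df : R -> R) (a c M : R) : a <= c -> (forall u, a <= u -> is_derive u (1 : R) f (df u)) ->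
  (forall u, a <= u <= c -> df u <= M) -> f c <= f a + M * (c - a).
Proof.
move=> ac dfu dM.
have [| |u uac e] := @MVT_segment R f df a c ac.
- by move=> u; rewrite in_itv/= => /andP[/ltW au _]; exact: dfu.
- apply: continuous_in_subspaceT => v; rewrite inE/= in_itv/= => /andP[av _].
  by apply/differentiable_continuous/derivable1_diffP; case: (dfu v av).
- rewrite -lerBlDl e ler_wpM2r ?subr_ge0//; apply: dM.
  by move: uac; rewrite in_itv.
Qed.

Definition Yn (n : nat) (eta : R) (b : nat -> R -> R) (x : R -> H) (t : R) : R :=
  \sum_(k < n) (ip (en k) (x t) - ou (lam k + eta) (b k) t) ^+ 2.

(* Absorbs every term of the energy balance in the dissipation [- G ^+ 2]. *)
Lemma energy_arith (G eta N S zb C e F r : R) : 0 <= G -> 0 <= C -> 0 <= e -> e <= 1 -> C * e <= 8^-1 -> 0 <= eta ->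
  `|F| <= C * (N * G ^+ 2 + S * G) -> 0 <= N <= e -> 0 <= S <= e ^+ 2 -> r <= G ->
  2 * (- G ^+ 2 + F + eta * r) <= 2 * eta ^+ 2 + 1.
Proof.
move=> G0 C0 e0 e1 Ce eta0 hF /andP[N0 Ne] /andP[S0 Se] rG.
have F1 : F <= 8^-1 * (G ^+ 2 + G).
  apply: (le_trans (ler_norm _)); apply: (le_trans hF).
  rewrite !mulrDr; apply: lerD; rewrite mulrA ler_wpM2r ?sqr_ge0//; apply: le_trans Ce; rewrite ler_wpM2l//.
  by apply: (le_trans Se); rewrite expr2 ler_piMl.
have := sqr_ge0 (G - 2 * eta); have := sqr_ge0 (G - 1); nra.
Qed.

(** Subtracting the damped process gives a differentiable y with y' = - lam y + drift + eta ou. The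
    drift is evaluated at the left end of the cell, which equals y + z with z the damped process
    minus the increment since that end; [energy_bound] and the smallness e of z let dissipation
    win. *)
Lemma energy_cell (bb : R) : 8^-1 < bb -> exists2 C, 0 < C & forall (n : nat) (h T : R) (xi : H) b ind x al ga K eta e i t,
  0 < h -> scheme n h T xi b ind x -> 0 < al <= 1 -> noise al ga K b -> 0 < eta -> 0 <= e -> e <= 1 -> C * e <= 8^-1 ->
  i%:R * h <= t <= i.+1%:R * h -> t <= T ->
  (forall u, i%:R * h <= u <= t -> l2le (fun k => ou (lam k + eta) (b k) u) 1) ->
  (ind (i%:R * h) -> forall u, i%:R * h <= u <= t ->
     l2le (fun k => lam k `^ bb * (ou (lam k + eta) (b k) u + (ip (en k) (x (i%:R * h)) - ip (en k) (x u)))) e) ->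
  Yn n eta b x t <= Yn n eta b x (i%:R * h) + (2 * eta ^+ 2 + 1) * (t - i%:R * h).
Proof.
move=> bb8; have [C C0 hC] := energy_bound bb8; exists C => // n h T xi b ind x al ga K eta e i t.
move=> h0 sx al01 [M [b0 bH _]] eta0 e0 e1 Ce /andP[it t2] tT hr hz.
set s := i%:R * h in it hr hz *.
have s0 : 0 <= s by rewrite mulr_ge0// ltW.
pose c k := if ind s then Bq k (x s) else 0.
pose D k u := ou (lam k) (b k) u - ou (lam k + eta) (b k) u.
(* Defined by the explicit cell formula, hence differentiable at every u >= s from both sides; it
   equals the scheme minus the damped process only inside the cell. *)
pose y k u := (expR (- lam k * u + lam k * s)) * (ip (en k) (x s) - ou (lam k) (b k) s - c k / lam k) + c k / lam k + D k u.
have yE k u : (k < n)%N -> s <= u <= t -> y k u = ip (en k) (x u) - ou (lam k + eta) (b k) u.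
  move=> kn /andP[su ut]; rewrite (@scheme_step _ n h T xi b ind x h0 sx i k u) -/s//; last 2 first.
  - by rewrite su (le_trans ut).
  - exact: le_trans tT.
  rewrite -/(c k) /y (_ : - lam k * u + lam k * s = - (lam k * (u - s))); last by ring.
  rewrite /D; move: (expR _) (ou _ _ _) (ou _ _ u) (ou (lam k + eta) (b k) u) (ip _ _) (lam k)^-1 (c k) => v1 v2 v3 v4 v5 v6 v7.
  ring.
have YE u : s <= u <= t -> Yn n eta b x u = \sum_(k < n) y k u ^+ 2.
  by move=> su; apply: eq_bigr => k _; rewrite yE.
have dy k u : s <= u -> is_derive u (1 : R) (y k) (- lam k * y k u + c k + eta * ou (lam k + eta) (b k) u).
  move=> su; have u0 := le_trans s0 su.
  have d1 := is_derive_ouB al01 (bH k) (lam k) eta u0.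
  have d2 : is_derive u (1 : R) (fun u => (ip (en k) (x s) - ou (lam k) (b k) s - c k / lam k) * expR (- lam k * u + lam k * s) + c k / lam k)
     ((ip (en k) (x s) - ou (lam k) (b k) s - c k / lam k) * (- lam k * expR (- lam k * u + lam k * s)) + 0).
    exact: (@is_deriveD R R R _ _ u 1 _ _ (is_derive_scale _ (is_derive_expRM (- lam k) (lam k * s) u)) (is_derive_cst _ _ _)).
  have -> : y k = (fun u => ((ip (en k) (x s) - ou (lam k) (b k) s - c k / lam k) * expR (- lam k * u + lam k * s) + c k / lam k) + D k u).
    by apply/funext => v; rewrite /y; congr (_ + _ + _); rewrite mulrC.
  apply: (is_derive_eqr (@is_deriveD R R R _ _ u 1 _ _ d2 d1)).
  have := mulfVK (lt0r_neq0 (@lam_gt0 R k)) (c k); rewrite /y -/(D k u).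
  move: (c k / lam k) (expR _) (D k u) => q E Dk <-; ring.
rewrite (YE t) ?lexx ?it// (YE s) ?lexx//.
pose df u := \sum_(k < n) 2 * (y k u * (- lam k * y k u + c k + eta * ou (lam k + eta) (b k) u)).
apply: (@derivative_bound (fun u => \sum_(k < n) y k u ^+ 2) df) => //.
  move=> u su; apply: (@is_derive_bigsum n (fun k u => y k u ^+ 2) (fun k => 2 * (y k u * (- lam k * y k u + c k + eta * ou (lam k + eta) (b k) u))) u) => k.
  apply: (is_derive_eqr (is_derive_expr 2 (dy k u su))).
  by rewrite /= expr1; ring.
move=> u sut; have /andP[su ut] := sut.
have -> : df u = 2 * (- (\sum_(k < n) lam k * y k u ^+ 2) + \sum_(k < n) y k u * c k + eta * \sum_(k < n) y k u * ou (lam k + eta) (b k) u).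
  rewrite /df -mulr_sumr; congr (2 * _); rewrite mulr_sumr -sumrN -!big_split/=.
  by apply: eq_bigr => k _; ring.
have [G GE] : exists G, G = Num.sqrt (\sum_(k < n) lam k * y k u ^+ 2) by eexists.
have G20 : 0 <= \sum_(k < n) lam k * y k u ^+ 2.
  by apply: sumr_ge0 => k _; rewrite mulr_ge0 ?sqr_ge0// ltW// lam_gt0.
have G0 : 0 <= G by rewrite GE sqrtr_ge0.
have G2 : \sum_(k < n) lam k * y k u ^+ 2 = G ^+ 2 by rewrite GE sqr_sqrtr.
have rG : \sum_(k < n) y k u * ou (lam k + eta) (b k) u <= G.
  apply: (le_trans (ler_norm _)); apply: (le_trans (sum_CS_sqrt _ _)).
  rewrite -[leRHS]mulr1; apply: ler_pM; rewrite ?sqrtr_ge0 ?(sqrt_le_l2 _ (hr u sut))//.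
  rewrite GE ler_wsqrtr//; apply: ler_sum => k _; rewrite ler_peMl ?sqr_ge0//.
  exact: lam_ge1.
rewrite G2.
(* When the truncation switches the drift off, the balance is applied with all drift quantities
   zero. *)
case: (boolP (ind s)) => hi; last first.
  apply: (@energy_arith G eta 0 0 0 0 0 _ _ G0) => //; rewrite ?mul0r ?(ltW eta0) ?lexx//.
  - by rewrite big1 ?normr0// => k _; rewrite /c (negbTE hi) mulr0.
  - by rewrite expr0n/= lexx.
pose z k := ou (lam k + eta) (b k) u + (ip (en k) (x s) - ip (en k) (x u)).
have zb := hz hi u sut; rewrite -/(z _) in zb.
have xE : x s = \sum_(j < n) (y j u + z j) *: en j.
  apply: L2_coord_eq => k; rewrite (ip_orth_sum (@en_orth R) n (fun j => y j u + z j)).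
  case: ifP => kn; first by rewrite yE// /z; ring.
  by rewrite sx ?kn// s0 (le_trans it).
have cE : \sum_(k < n) y k u * c k = \sum_(k < n) y k u * Bq k (\sum_(j < n) (y j u + z j) *: en j).
  by apply: eq_bigr => k _; rewrite /c hi -xE.
apply: (@energy_arith G eta (Num.sqrt (\sum_(k < n) z k ^+ 2)) (\sum_(k < n) (lam k `^ bb * z k) ^+ 2) 0 C e _ _ G0) => //.
- exact: ltW.
- exact: ltW.
- by rewrite cE; exact: (hC n (fun k => y k u) z G GE).
- rewrite sqrtr_ge0/=; apply: sqrt_le_l2; apply: l2le_mono zb => k.
  rewrite normrM ler_peMl// ger0_norm ?powR_ge0// -[leLHS](powRr0 (lam k)) lam_powR_incr//.
  by apply: ltW; apply: lt_trans bb8; rewrite invr_gt0.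
- rewrite sumr_ge0/=; last by move=> k _; exact: sqr_ge0.
  by case: zb => _; exact.
Qed.

Lemma energy_global (bb : R) : 8^-1 < bb -> exists2 C, 0 < C & forall (n : nat) (h T : R) (xi : H) b ind x al ga K eta e,
  0 < h -> scheme n h T xi b ind x -> 0 < al <= 1 -> noise al ga K b -> 0 < eta -> 0 <= e -> e <= 1 -> C * e <= 8^-1 ->
  (forall u, 0 <= u <= T -> l2le (fun k => ou (lam k + eta) (b k) u) 1) ->
  (forall i u, ind (i%:R * h) -> i%:R * h <= u <= i.+1%:R * h -> u <= T ->
     l2le (fun k => lam k `^ bb * (ou (lam k + eta) (b k) u + (ip (en k) (x (i%:R * h)) - ip (en k) (x u)))) e) ->
  forall t, 0 <= t <= T -> hnorm (x t) <= Num.sqrt (hnorm xi ^+ 2 + (2 * eta ^+ 2 + 1) * T) + 1.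
Proof.
move=> bb8; have [C C0 hC] := energy_cell bb8; exists C => // n h T xi b ind x al ga K eta e.
move=> h0 sx al01 nb eta0 e0 e1 Ce hr hz.
have Q0 : 0 <= 2 * eta ^+ 2 + 1 by rewrite addr_ge0// mulr_ge0// sqr_ge0.
have [M [b0 bH _]] := nb.
have grid i t : i%:R * h <= t <= i.+1%:R * h -> t <= T -> Yn n eta b x t <= hnorm xi ^+ 2 + (2 * eta ^+ 2 + 1) * t.
  elim: i t => [|i IH] t.
    rewrite mul0r mul1r => /andP[t0 th] tT.
    have := hC n h T xi b ind x al ga K eta e 0%N t h0 sx al01 nb eta0 e0 e1 Ce.
    rewrite mul0r mul1r t0 th => /(_ isT tT) h1.
    apply: (le_trans (h1 _ _)).
    - by move=> u /andP[u0 ut]; apply: hr; rewrite u0 (le_trans ut).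
    - move=> i0 u /andP[u0 ut]; have := hz 0%N u; rewrite mul0r mul1r; apply => //; last exact: le_trans tT.
      by rewrite u0 (le_trans ut).
    rewrite subr0 lerD2r; apply: le_trans (bessel (@en_orth R) xi n).
    by apply: ler_sum => k _; rewrite (ou0 (b0 k)) subr0 (@scheme_zero _ n h T xi b ind x sx k (ltn_ord k) (le_trans t0 tT) (b0 k)).
  move=> /andP[it t2] tT.
  have s0 : 0 <= i.+1%:R * h by rewrite mulr_ge0// ltW.
  apply: (le_trans (hC n h T xi b ind x al ga K eta e i.+1 t h0 sx al01 nb eta0 e0 e1 Ce _ tT _ _)).
  - by rewrite it.
  - by move=> u /andP[su ut]; apply: hr; rewrite (le_trans s0 su) (le_trans ut).
  - move=> hi u /andP[su ut]; apply: hz => //; last exact: le_trans tT.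
    by rewrite su (le_trans ut).
  have := IH (i.+1%:R * h); rewrite lexx andbT ler_wpM2r ?ler_nat ?(ltW h0)// => /(_ isT (le_trans it tT)).
  lra.
move=> t t0T; have /andP[t0 tT] := t0T.
have [i [_ i1 /ltW i2]] := gfl_le h0 t0.
have Yt := grid i t; rewrite i1 i2 in Yt; have {}Yt := Yt isT tT.
set B := Num.sqrt _.
have yB : l2le (fun k => if (k < n)%N then ip (en k) (x t) - ou (lam k + eta) (b k) t else 0) B.
  split; first exact: sqrtr_ge0.
  move=> N; rewrite /B sqr_sqrtr; last by rewrite addr_ge0 ?sqr_ge0// mulr_ge0// (le_trans t0).
  apply: (@le_trans _ _ (Yn n eta b x t)); last first.
    by apply: (le_trans Yt); rewrite lerD2l ler_wpM2l.
  rewrite /Yn; have [Nn|/ltnW nN] := leqP N n.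
    rewrite (big_ord_widen n (fun k => (if (k < n)%N then ip (en k) (x t) - ou (lam k + eta) (b k) t else 0) ^+ 2) Nn).
    rewrite big_mkcond/=; apply: ler_sum => k _; rewrite ltn_ord; case: ifP => // _; exact: sqr_ge0.
  rewrite [leRHS](big_ord_widen N (fun k => (ip (en k) (x t) - ou (lam k + eta) (b k) t) ^+ 2) nN).
  rewrite [leRHS]big_mkcond/=; apply: ler_sum => k _; case: ifP => //; by rewrite expr0n.
apply: l2le_hnorm; apply: l2le_mono (l2leD yB (hr t t0T)) => k.
case: ifP => kn; first by rewrite subrK.
by rewrite sx// kn normr0.
Qed.

End Energy.

(** * The bound on the scheme that is polynomial in the noise *)

Section Apriori.
Context {R : realType}.
Local Notation H := (L2 R).

Lemma powR_neg_le (h h1 a : R) : 0 < h1 -> h1 <= h -> 0 <= a -> h `^ (- a) <= h1 `^ (- a).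
Proof.
move=> h10 hh a0; rewrite !powRN lef_pV2 ?posrE ?powR_gt0//; last exact: lt_le_trans hh.
by apply: ge0_powR_le; rewrite ?(ltW h10)// (le_trans (ltW h10)).
Qed.

Lemma powR_le1_decr (h a k : R) : 0 < h -> h <= 1 -> k <= a -> h `^ a <= h `^ k.
Proof.
move=> h0 h1 ka; have -> : a = k + (a - k) by ring.
rewrite powRDp// ler_piMr ?powR_ge0//.
rewrite -[leRHS](congr1 (fun g => g (a - k)) (@powR1 R)).
by apply: ge0_powR_le; rewrite ?subr_ge0// ltW.
Qed.

Lemma powR_root_le (h y k : R) : 0 < k -> 0 <= y -> 0 <= h -> h <= y `^ k^-1 -> h `^ k <= y.
Proof.
move=> k0 y0 h0 hy.
apply: (@le_trans _ _ ((y `^ k^-1) `^ k)).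
  by apply: ge0_powR_le; rewrite ?powR_ge0// ltW.
by rewrite -powRrM mulVf ?gt_eqF// powRr1.
Qed.

(* For small [h] the energy estimate applies to [x] minus the Ornstein-Uhlenbeck process with damping [eta];
   otherwise the truncation bounds the drift by a power of [h^-1]. Both are polynomial in [K]. *)
Lemma apriori (al ga rho chi bb p2 T : R) (xi : H) : 0 < al <= 1 -> 8^-1 < bb -> bb < rho - chi -> rho - bb <= 1 ->
  0 < chi -> 0 <= p2 <= 1 -> bb + p2 < 4^-1 -> 2 * chi < p2 -> bb < al - ga -> al - ga - bb <= al -> 0 <= bb + ga -> 0 < T ->
  exists C (q : nat), 0 < C /\ forall n h b ind x K, 0 < h -> scheme n h T xi b ind x -> noise al ga K b ->
    (forall i, i%:R * h <= T -> ind (i%:R * h) -> l2le (fun k => lam k `^ rho * ip (en k) (x (i%:R * h))) (h `^ (- chi))) ->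
    forall t, 0 <= t <= T -> hnorm (x t) <= C * (1 + K) ^+ q.
Proof.
move=> al01 bb8 bbr rb1 chi0 p201 bp2 chip2 bag baga bg0 T0.
have [Ce Ce0 hen] := energy_global bb8.
have [e [e0 e1 Cee]] : exists e : R, [/\ 0 < e, e <= 1 & Ce * e <= 8^-1].
  exists (Num.min 1 (Ce^-1 * 8^-1)); split.
  - by rewrite lt_min ltr01 mulr_gt0 ?invr_gt0.
  - by rewrite ge_min lexx.
  - by rewrite -ler_pdivlMl// ge_min lexx orbT.
(* Room between H_bb and the regularity of the noise. It is the power gained both by damping
   (eta^(-th)) and by the noise part of an increment (h^th). *)
have [th thE] : exists th, th = al - ga - bb by eexists.
have th0 : 0 < th by rewrite thE subr_gt0.
have p1b : 0 <= rho - bb <= 1 by rewrite rb1 andbT; lra.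
have thb : 0 <= th <= al by rewrite (ltW th0) thE.
have bth : bb + th <= al - ga by rewrite thE; lra.
have [C1 C10 hinc] := mild_incr al01 p1b p201 bp2 thb bth.
have ag0 : 0 <= al - ga by clear -bb8 bag; lra.
have q0 : 0 < 4^-1 :> R by rewrite invr_gt0.
have [C2 C20 hbd] := @mild_bound R al ga 0 al01 ag0 q0.
(* A common power of h below the three contributions to an increment: semigroup part, drift and
   noise, after the blow-up allowed by the truncation. *)
have [ka [ka0 k1 k2 k3]] : exists ka, [/\ 0 < ka, ka <= rho - bb - chi, ka <= p2 - 2 * chi & ka <= th].
  exists (Num.min (Num.min (rho - bb - chi) (p2 - 2 * chi)) th); split.
  - by rewrite !lt_min th0 andbT; apply/andP; split; lra.
  - by rewrite !ge_min lexx.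
  - by rewrite !ge_min lexx orbT.
  - by rewrite !ge_min lexx orbT.
(* Chosen so that 3 K eta^(-th) <= e / 2 for the damping eta = (c1 (1 + K))^(1/th). *)
have [c1 [c11 c1E]] : exists c1 : R, 1 <= c1 /\ c1 = 6 / e.
  by exists (6 / e); split=> //; rewrite ler_pdivlMr// mul1r (le_trans e1)// ler1n.
(* Chosen so that increments within a cell are at most e / 2 in H_bb once h^ka <= 1 / (c2 (1 +
   K)). *)
have [c2 [c21 c2E]] : exists c2 : R, 1 <= c2 /\ c2 = 2 * (4 + C1) / e.
  by exists (2 * (4 + C1) / e); split=> //; rewrite ler_pdivlMr// mul1r; lra.
have [N1 hN1] : exists N1 : nat, forall K, 0 <= K -> (c1 * (1 + K)) `^ th^-1 <= c1 ^+ N1 * (1 + K) ^+ N1.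
  exists (Num.bound `|th^-1|) => K K0.
  rewrite -exprMn -powR_mulrn; last by rewrite mulr_ge0// ?addr_ge0// (le_trans _ c11).
  apply: ler_powR; last by apply: (le_trans (ler_norm _)); apply/ltW/archi_boundP.
  by rewrite -[leLHS]mulr1; apply: ler_pM => //; rewrite lerDl.
have [N2 hN2] : exists N2 : nat, forall K, 0 <= K -> (c2 * (1 + K)) `^ (ka^-1 * (2 * chi)) <= c2 ^+ N2 * (1 + K) ^+ N2.
  exists (Num.bound `|ka^-1 * (2 * chi)|) => K K0.
  rewrite -exprMn -powR_mulrn; last by rewrite mulr_ge0// ?addr_ge0// (le_trans _ c21).
  apply: ler_powR; last by apply: (le_trans (ler_norm _)); apply/ltW/archi_boundP.
  by rewrite -[leLHS]mulr1; apply: ler_pM => //; rewrite lerDl.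
have [q [q1 q2 q3]] : exists q : nat, [/\ (N1 * 2 <= q)%N, (N2 <= q)%N & (1 <= q)%N].
  by exists (N1 * 2 + N2 + 1)%N; split; clear; lia.
pose Ca := hnorm xi ^+ 2 + (2 * (c1 ^+ N1) ^+ 2 + 1) * T + 2.
pose Cb := hnorm xi + C2 * c2 ^+ N2 + 3.
have c1N : 0 <= c1 ^+ N1 by rewrite exprn_ge0// (le_trans _ c11).
have c2N : 0 <= c2 ^+ N2 by rewrite exprn_ge0// (le_trans _ c21).
have Ca0 : 0 < Ca by rewrite /Ca ltr_wpDl// addr_ge0 ?sqr_ge0// mulr_ge0 ?(ltW T0)// addr_ge0// mulr_ge0// sqr_ge0.
have Cb0 : 0 <= Cb by rewrite /Cb !addr_ge0 ?hnorm_ge0// mulr_ge0// ltW.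
exists (Ca + Cb), q; split; first by rewrite ltr_wpDr.
move=> n h b ind x K h0 sx nb hind t t0T.
have K0 : 0 <= K by case: nb => M [_ _ /l2le_ge0].
have [k0] : exists k0, k0 = 1 + K by eexists.
move=> k0E; have k01 : 1 <= k0 by rewrite k0E lerDl.
have kq m : (m <= q)%N -> k0 ^+ m <= k0 ^+ q by move=> mq; apply: ler_weXn2l.
rewrite -k0E.
have hr2 : h `^ (- (2 * chi)) = (h `^ (- chi)) ^+ 2.
  by rewrite -powR_mulrn ?powR_ge0// -powRrM; congr (_ `^ _); ring.
have L0 : 0 <= h `^ (- (2 * chi)) by exact: powR_ge0.
have hL i : i%:R * h <= T -> ind (i%:R * h) -> hnorm (x (i%:R * h)) ^+ 2 <= h `^ (- (2 * chi)).
  move=> iT /(hind i iT) hx; rewrite hr2 ler_sqr ?nnegrE ?hnorm_ge0 ?powR_ge0//.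
  apply: l2le_hnorm; apply: l2le_mono hx => k; rewrite normrM ler_peMl// ger0_norm ?powR_ge0//.
  by rewrite -[leLHS](powRr0 (lam k)) lam_powR_incr//; lra.
have fL k s : 0 <= s <= T -> `|drift h ind x k s| <= kp k * h `^ (- (2 * chi)).
  by move=> sT; apply: (@drift_le R h T).
have mf k : measurable_fun `[0, T] (drift h ind x k) by exact: measurable_drift.
have [h1 h1E] : exists h1, h1 = (c2 * (1 + K))^-1 `^ ka^-1 by eexists.
have c2K : 0 < c2 * (1 + K) by rewrite mulr_gt0 ?ltr_wpDr// (lt_le_trans _ c21).
have h10 : 0 < h1 by rewrite h1E powR_gt0 ?invr_gt0.
have h11 : h1 <= 1.
  rewrite h1E -[(c2 * (1 + K))^-1]powR_inv1 ?(ltW c2K)// -powRrM mulN1r -[leRHS](powRr0 (c2 * (1 + K))).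
  apply: ler_powR; last by rewrite oppr_le0 invr_ge0 ltW.
  by rewrite -[leLHS]mulr1; apply: ler_pM => //; rewrite lerDl.
(* For a large step nothing is small, but the truncated drift is of size h^(- 2 chi) <= h1^(- 2
   chi), and h1 is a fixed negative power of c2 (1 + K). *)
have [hh|/ltW hh] := leP h h1; last first.
  apply: (@le_trans _ _ (hnorm xi + C2 * h `^ (- (2 * chi)) + 3 * K)).
    have xi0 : l2le (fun k => lam k `^ 0 * ip (en k) xi) (hnorm xi).
      by under eq_fun do rewrite powRr0 mul1r; exact: hnorm_l2le.
    have := hbd _ _ _ _ _ _ _ _ _ sx mf fL nb xi0 L0 t t0T.
    under eq_fun do rewrite powRr0 mul1r.
    exact: l2le_hnorm.
  have h2 : h `^ (- (2 * chi)) <= c2 ^+ N2 * k0 ^+ q.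
    have chi2 : 0 <= 2 * chi by rewrite mulr_ge0// ltW.
    apply: (le_trans (powR_neg_le h10 hh chi2)).
    rewrite h1E -[(c2 * (1 + K))^-1]powR_inv1 ?(ltW c2K)// -2!powRrM mulN1r ?mulrN opprK.
    by apply: (le_trans (hN2 K K0)); rewrite -k0E ler_wpM2l// kq.
  have h3 : 1 <= k0 ^+ q by exact: exprn_ege1.
  have h4 : k0 <= k0 ^+ q by rewrite -[leLHS]expr1; exact: kq.
  have n0 := hnorm_ge0 xi.
  apply: (@le_trans _ _ (Cb * k0 ^+ q)); last by rewrite ler_wpM2r ?(le_trans ler01 h3)// lerDr ltW.
  rewrite /Cb [leRHS]mulrDl [X in _ <= X + _]mulrDl; apply: lerD; first apply: lerD.
  - by rewrite ler_peMr.
  - by rewrite -mulrA ler_wpM2l// ltW.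
  - by rewrite ler_wpM2l// (le_trans _ h4)// k0E lerDr.
(* For a small step: the damping depends on K polynomially, since 1/th is a fixed exponent, and so
   does the energy bound 2 eta^2 + 1. *)
have [eta etaE] : exists eta, eta = (c1 * (1 + K)) `^ th^-1 by eexists.
have c1K : 0 < c1 * (1 + K) by rewrite mulr_gt0 ?ltr_wpDr// (lt_le_trans _ c11).
have eta0 : 0 < eta by rewrite etaE powR_gt0.
have hr u : 0 <= u <= T -> l2le (fun k => lam k `^ bb * ou (lam k + eta) (b k) u) (e / 2).
  move=> /andP[u0 uT]; have := noise_ou_shift al01 bg0 (ltW bag) eta0 nb u0.
  apply: l2le_wid; rewrite -thE etaE -powRrM mulrN mulVf ?gt_eqF// powR_inv1 ?(ltW c1K)//.
  rewrite c1E invfM invf_div; rewrite (_ : _ * K = e / 2 * (K / (1 + K))); last by field; rewrite gt_eqF// ltr_wpDr.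
  by rewrite ler_piMr ?divr_ge0 ?(ltW e0)// ler_pdivrMr ?ltr_wpDr// mul1r lerDr.
have h_1 : h <= 1 by exact: le_trans hh h11.
have hka : h `^ ka <= (c2 * (1 + K))^-1.
  by apply: powR_root_le => //; [rewrite invr_ge0 ltW|exact: ltW|rewrite -h1E].
have hz i u : ind (i%:R * h) -> i%:R * h <= u <= i.+1%:R * h -> u <= T ->
    l2le (fun k => lam k `^ bb * (ou (lam k + eta) (b k) u + (ip (en k) (x (i%:R * h)) - ip (en k) (x u)))) e.
  move=> hi /andP[u1 u2] uT; set s := i%:R * h in hi u1 *.
  have s0 : 0 <= s by rewrite mulr_ge0// ltW.
  have dh : u - s <= h by move: u2; rewrite -natr1 mulrDl mul1r -/s addrC lerBlDr.
  have hA : l2le (fun k => lam k `^ (bb + (rho - bb)) * ip (en k) (x s)) (h `^ (- chi)).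
    by rewrite addrCA subrr addr0; apply: hind => //; exact: le_trans uT.
  have := hinc _ _ _ _ _ _ _ _ _ _ _ _ sx mf fL nb s0 u1 uT dh hA.
  move/(l2leZ (-1)); rewrite normrN1 mul1r => hi2.
  have u0T : 0 <= u <= T by rewrite uT (le_trans s0).
  have := l2leD (hr u u0T) hi2.
  move/(@l2le_wid _ _ _ e) => hw; apply: l2le_mono (hw _) => [k|].
    by apply: eq_ler; congr `|_|; ring.
  have b1 : h `^ (rho - bb) * h `^ (- chi) <= h `^ ka by rewrite -powRDp//; apply: powR_le1_decr.
  have b2 : h `^ p2 * h `^ (- (2 * chi)) <= h `^ ka by rewrite -powRDp//; apply: powR_le1_decr.
  have b3 : h `^ th <= h `^ ka by apply: powR_le1_decr.
  apply: (@le_trans _ _ (e / 2 + (4 + C1) * (1 + K) * h `^ ka)).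
    rewrite lerD2l.
    apply: (@le_trans _ _ (h `^ ka + C1 * h `^ ka + 3 * h `^ ka * K)).
      apply: lerD; first apply: lerD => //.
        by rewrite -mulrA ler_wpM2l// ltW.
      by rewrite ler_wpM2r// ler_wpM2l.
    have kp := powR_ge0 h ka; have := mulr_ge0 kp K0; have := mulr_ge0 (ltW C10) (mulr_ge0 kp K0).
    by clear -kp; nra.
  apply: (@le_trans _ _ (e / 2 + (4 + C1) * (1 + K) * (c2 * (1 + K))^-1)).
    rewrite lerD2l ler_wpM2l// mulr_ge0 ?addr_ge0// ltW//.
  rewrite c2E; apply: eq_ler; field.
  by apply/and3P; split; rewrite gt_eqF// ltr_wpDr// ltW.
have hr1 u : 0 <= u <= T -> l2le (fun k => ou (lam k + eta) (b k) u) 1.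
  move=> uT; apply: (l2le_wid (_ : e / 2 <= 1)); first by lra.
  apply: l2le_mono (hr u uT) => k; rewrite normrM ler_peMl// ger0_norm ?powR_ge0//.
  by rewrite -[leLHS](powRr0 (lam k)) lam_powR_incr//; lra.
apply: (le_trans (hen n h T xi b ind x al ga K eta e h0 sx al01 nb eta0 (ltW e0) e1 Cee hr1 hz t t0T)).
have etaq : eta ^+ 2 <= (c1 ^+ N1) ^+ 2 * k0 ^+ q.
  apply: (@le_trans _ _ ((c1 ^+ N1 * k0 ^+ N1) ^+ 2)).
    have k0N : 0 <= k0 ^+ N1 by rewrite exprn_ge0// (le_trans ler01).
    have p0 : 0 <= c1 ^+ N1 * k0 ^+ N1 by rewrite mulr_ge0.
    by rewrite ler_sqr ?nnegrE ?(ltW eta0)//; rewrite etaE k0E; exact: hN1.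
  by rewrite exprMn ler_wpM2l ?sqr_ge0// -exprM kq.
have h3 : 1 <= k0 ^+ q by exact: exprn_ege1.
have sq1 (y : R) : 0 <= y -> Num.sqrt y <= y + 1.
  move=> y0; rewrite -[leRHS]ger0_norm ?addr_ge0// -sqrtr_sqr ler_wsqrtr//.
  by rewrite sqrrD expr1n mulr1; have := sqr_ge0 y; lra.
have X0 : 0 <= hnorm xi ^+ 2 + (2 * eta ^+ 2 + 1) * T.
  by rewrite addr_ge0 ?sqr_ge0// mulr_ge0 ?(ltW T0)// addr_ge0// mulr_ge0// sqr_ge0.
apply: (@le_trans _ _ (Ca * k0 ^+ q)); last by rewrite ler_wpM2r ?(le_trans ler01 h3)// lerDl.
apply: (le_trans (lerD (sq1 _ X0) (lexx 1))).
rewrite /Ca -[leLHS]addrA [leRHS]mulrDl [X in _ <= X + _]mulrDl; apply: lerD; last by clear -h3; lra.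
apply: lerD; first by rewrite ler_peMr ?sqr_ge0.
rewrite [leRHS]mulrAC ler_wpM2r ?(ltW T0)//.
by move: etaq h3; clear; lra.
Qed.

End Apriori.

(** * A Gronwall estimate for the singular drift *)

Section Gronwall.
Context {R : realType}.
Local Notation H := (L2 R).

(** Iterating w -> w / 2 + c from any finite bound B drives the bound to the fixed point 2 c, which
    is independent of B. *)
Lemma halving (D : set R) (phi : R -> R) (B c : R) : 0 <= B -> 0 <= c -> (forall t, D t -> phi t <= B) ->
  (forall w, 0 <= w -> (forall t, D t -> phi t <= w) -> forall t, D t -> phi t <= w / 2 + c) ->
  forall t, D t -> phi t <= 2 * c.
Proof.
move=> B0 c0 hB hw.
have hn (n : nat) : forall t, D t -> phi t <= B * 2^-1 ^+ n + 2 * c.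
  elim: n => [|n IH] t Dt.
    by rewrite expr0 mulr1 (le_trans (hB t Dt))// lerDl mulr_ge0.
  have w0 : 0 <= B * 2^-1 ^+ n + 2 * c.
    by rewrite addr_ge0 ?mulr_ge0// exprn_ge0// invr_ge0.
  apply: (le_trans (hw _ w0 IH t Dt)); rewrite exprSr; lra.
move=> t Dt; apply/ler_addgt0Pr => e e0.
have /cvg_epsP/(_ (e / (B + 1)))[|N hN] := @half_exp_cvg0 R 1; first by rewrite divr_gt0// ltr_wpDl.
have := hN N (leqnn _); rewrite mul1r subr0 ger0_norm// => h.
apply: (le_trans (hn N t Dt)); rewrite addrC lerD2l.
apply: (@le_trans _ _ ((B + 1) * (e / (B + 1)))).
  by apply: ler_pM; rewrite ?exprn_ge0 ?invr_ge0// lerDl.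
by rewrite mulrCA mulfV ?mulr1// gt_eqF// ltr_wpDl.
Qed.

(** From lam + m >= lam^(7/8) m^(1/8) the terms are at most lam^(-3/8) m^(-1/8), and lam^(-3/4) is
    summable. The decay in m makes the drift a contraction in a weighted norm. *)
Lemma resolvent_l2 : exists2 S : R, 0 < S & forall m : R, 0 < m ->
  l2le (fun k => kp k / (lam k + m)) (S * m `^ (- 8^-1)).
Proof.
have [|C C0 hC] := @lam_series R (- (3 / 4)); first by lra.
exists (Num.sqrt C); first by rewrite sqrtr_gt0.
move=> m m0.
have h : l2le (fun k => lam k `^ (- (3 / 8)) : R) (Num.sqrt C).
  split; first exact: sqrtr_ge0.
  move=> N; rewrite sqr_sqrtr ?(ltW C0)//; apply: le_trans (hC N); apply: ler_sum => i _.
  by rewrite -powR_mulrn ?powR_ge0// -powRrM (_ : - (3 / 8) * 2 = - (3 / 4))//; field.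
rewrite mulrC -[m `^ _]ger0_norm ?powR_ge0//.
apply: l2le_mono (l2leZ _ h) => k.
have l0 := @lam_gt0 R k; have k0 := @kp_gt0 R k.
have lm0 : 0 < lam k + m by rewrite addr_gt0.
rewrite ger0_norm ?divr_ge0 ?(ltW k0) ?(ltW lm0)// ger0_norm ?mulr_ge0 ?powR_ge0//.
rewrite ler_pdivrMr//.
have e : lam k + m = (lam k + m) `^ (7 / 8) * (lam k + m) `^ (8^-1).
  by rewrite -powRDp// (_ : 7 / 8 + 8^-1 = 1) ?powRr1 ?(ltW lm0)//; field.
have a1 : lam k `^ (7 / 8) <= (lam k + m) `^ (7 / 8).
  by apply: ge0_powR_le; rewrite ?(ltW l0) ?(ltW lm0) ?lerDl ?(ltW m0).
have a2 : m `^ 8^-1 <= (lam k + m) `^ 8^-1.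
  by apply: ge0_powR_le; rewrite ?(ltW m0) ?(ltW lm0) ?lerDr ?(ltW l0).
rewrite [X in _ * X]e -lam_powR_half.
apply: (@le_trans _ _ (m `^ (- 8^-1) * lam k `^ (- (3 / 8)) * (lam k `^ (7 / 8) * m `^ 8^-1))); last first.
  by rewrite ler_wpM2l ?mulr_ge0 ?powR_ge0//; apply: ler_pM; rewrite ?powR_ge0.
rewrite (_ : _ * _ = (m `^ (- 8^-1) * m `^ 8^-1) * (lam k `^ (- (3 / 8)) * lam k `^ (7 / 8))); last by ring.
rewrite -!powRDp// addNr powRr0 mul1r (_ : - (3 / 8) + 7 / 8 = 2^-1)//; by field.
Qed.

(** In the norm weighted by exp(- m t), the Volterra operator with kernels kp k exp(- lam k (t - s))
    has size L S m^(-1/8); m is chosen to make it 1/2 and [halving] concludes. The error [om]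
    perturbs the Lipschitz bound; [tail] takes the modes where no equation is compared. *)
Lemma gronwall (T L : R) : 0 <= T -> 0 <= L -> exists2 C, 0 < C & forall (u : R -> H) (phi : nat -> R -> R) (tail : R -> nat -> R) (om tau B : R),
  0 <= om -> (forall t, 0 <= t <= T -> hnorm (u t) <= B) ->
  (forall k, measurable_fun `[0, T] (phi k)) ->
  (forall k s, 0 <= s <= T -> `|phi k s| <= kp k * (L * (hnorm (u s) + om))) ->
  (forall t, 0 <= t <= T -> forall k, `|ip (en k) (u t)| <= `|Vint (lam k) (phi k) 0 t| + `|tail t k|) ->
  (forall t, 0 <= t <= T -> l2le (tail t) tau) ->
  forall t, 0 <= t <= T -> hnorm (u t) <= C * (om + tau).
Proof.
move=> T0 L0; have [S S0 hS] := resolvent_l2.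
(* The eighth power compensates the exponent -1/8 and leaves L S / (2 (L S + 1)). *)
have [m [m0 hm]] : exists m : R, 0 < m /\ L * (S * m `^ (- 8^-1)) <= 2^-1.
  have q0 : 0 < 2 * (L * S + 1) by rewrite mulr_gt0// ltr_wpDl// mulr_ge0// ltW.
  exists ((2 * (L * S + 1)) `^ 8); split; first exact: powR_gt0.
  rewrite -powRrM mulrN mulfV// powR_inv1 ?(ltW q0)// mulrA ler_pdivrMr// mulKf//; lra.
exists (2 * expR (m * T)); first by rewrite mulr_gt0 ?expR_gt0.
move=> u phi tail om tau B om0 uB mphi phiL uV htail.
have T0T : 0 <= (0 : R) <= T by rewrite lexx.
have tau0 : 0 <= tau by exact: l2le_ge0 (htail 0 T0T).
have B0 : 0 <= B by apply: le_trans (uB 0 T0T); exact: hnorm_ge0.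
have em t : 0 <= t -> expR (- (m * t)) <= 1 by move=> t0; rewrite -expR0 ler_expR oppr_le0 mulr_ge0// ltW.
have step w : 0 <= w -> (forall t, 0 <= t <= T -> expR (- (m * t)) * hnorm (u t) <= w) ->
    forall t, 0 <= t <= T -> expR (- (m * t)) * hnorm (u t) <= w / 2 + (om / 2 + tau).
  move=> w0 hw t /andP[t0 tT].
  have tt : 0 <= t <= T by rewrite t0.
  have W0 : 0 <= L * (w + om) by rewrite mulr_ge0// addr_ge0.
  have bd k s : 0 <= s <= t -> `|phi k s| <= kp k * (L * (w + om)) * expR (m * s).
    move=> /andP[s0 st]; have sT : 0 <= s <= T by rewrite s0 (le_trans st).
    apply: (le_trans (phiL k s sT)); rewrite -[leRHS]mulrA ler_wpM2l ?(ltW (kp_gt0 _))// -[leRHS]mulrA ler_wpM2l//.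
    rewrite [leRHS]mulrDl lerD//.
      by have := hw s sT; rewrite expRN mulrC ler_pdivrMr ?expR_gt0.
    by rewrite ler_peMr// -expR0 ler_expR mulr_ge0// ltW.
  have vk k : `|Vint (lam k) (phi k) 0 t| <= kp k * (L * (w + om)) * expR (m * t) / (lam k + m).
    have l0 := @lam_gt0 R k.
    have c0 : 0 <= kp k * (L * (w + om)) by rewrite mulr_ge0// ltW// kp_gt0.
    apply: le_trans (Vint_expR_le c0 t0 (addr_gt0 l0 m0)).
    apply: (@normr_Vint_le _ _ _ _ 0 t (kp k * (L * (w + om)) * expR (m * t))).
    - by apply: measurable_funS (mphi k) => //; apply: subset_itvl; rewrite bnd_simp.
    - move=> s; apply: cvgM; first exact: cvg_cst.
      apply: (@continuous_comp _ _ _ (fun s : R => m * s) expR); last exact: continuous_expR.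
      by apply: cvgM; [exact: cvg_cst|exact: cvg_id].
    - exact: bd.
    - by move=> s /andP[s0 st]; rewrite ler_wpM2l// ler_expR ler_wpM2l// ltW.
  have g1 := l2leZ (L * (w + om) * expR (m * t)) (hS m m0).
  have g2 : l2le (fun k => `|tail t k|) tau.
    by apply: l2le_mono (htail t tt) => k; rewrite normr_id.
  have g3 : l2le (fun k => ip (en k) (u t)) (`|L * (w + om) * expR (m * t)| * (S * m `^ (- 8^-1)) + tau).
    apply: l2le_mono (l2leD g1 g2) => k; apply: (le_trans (uV t tt k)).
    apply: le_trans (ler_norm _); rewrite lerD2r; apply: (le_trans (vk k)).
    by apply: eq_ler; ring.
  have Q0 : 0 <= L * (w + om) * expR (m * t) by rewrite (mulr_ge0 W0)// expR_ge0.
  have := l2le_hnorm g3; rewrite (ger0_norm Q0) => g4.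
  apply: (le_trans (ler_wpM2l (expR_ge0 _) g4)); rewrite mulrDr addrA; apply: lerD; last first.
    by rewrite ler_piMl// em.
  have ee : expR (- (m * t)) * expR (m * t) = 1 by rewrite -expRD addNr expR0.
  rewrite [leLHS](_ : _ = (expR (- (m * t)) * expR (m * t)) * ((w + om) * (L * (S * m `^ (- 8^-1))))); last by ring.
  rewrite ee mul1r.
  by rewrite -mulrDl ler_wpM2l// addr_ge0.
move=> t tt; have /andP[t0 tT] := tt.
have c0 : 0 <= om / 2 + tau by rewrite addr_ge0// divr_ge0.
have := @halving [set t | 0 <= t <= T] (fun t => expR (- (m * t)) * hnorm (u t)) B (om / 2 + tau) B0 c0 _ step t tt.
move=> h; have {h} h : expR (- (m * t)) * hnorm (u t) <= 2 * (om / 2 + tau).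
  apply: h => s /= sT; apply: le_trans (uB s sT); rewrite ler_piMl ?hnorm_ge0// em//.
  by case/andP: sT.
apply: (@le_trans _ _ (2 * (om / 2 + tau) * expR (m * t))).
  by rewrite -ler_pdivrMr ?expR_gt0// mulrC -expRN.
have := ler_expR (m * t) (m * T); rewrite ler_wpM2l ?(ltW m0)// => e1.
have p1 := expR_gt0 (m * t).
apply: (@le_trans _ _ (2 * (om + tau) * expR (m * t))).
  by rewrite ler_wpM2r ?(ltW p1)//; lra.
by rewrite mulrAC ler_wpM2r ?addr_ge0// ler_wpM2l.
Qed.

End Gronwall.

Lemma addrBD3 (R : realType) (a v w o : R) : a + v + o - (a + w + o) = v - w.
Proof. by ring. Qed.

Lemma clampP (R : realType) (T : R) : 0 <= T -> forall t : R, 0 <= Num.min (Num.max t 0) T <= T.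
Proof. by move=> T0 t; rewrite le_min T0 le_max lexx orbT ge_min lexx orbT. Qed.

Lemma clamp_id (R : realType) (T t : R) : 0 <= t <= T -> Num.min (Num.max t 0) T = t.
Proof. by move=> /andP[t0 tT]; rewrite max_l// min_l. Qed.

Lemma clamp_lip (R : realType) (T s t : R) :
  `|Num.min (Num.max t 0) T - Num.min (Num.max s 0) T| <= `|t - s|.
Proof.
have h1 := ler_norm (t - s); have h2 := ler_norm (s - t); rewrite (distrC s t) in h2.
rewrite ler_norml /Num.min /Num.max.
case: (ltP t 0) => ?; case: (ltP s 0) => ?; do ?case: ltP => ?; apply/andP; split; lra.
Qed.

Lemma measurable_hoelder (R : realType) (T M a : R) (f : R -> R) : 0 <= T -> 0 < a <= 1 -> 0 <= M ->
  (forall s t, 0 <= s -> s <= t -> t <= T -> `|f t - f s| <= M * (t - s) `^ a) -> measurable_fun `[0, T] f.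
Proof.
move=> T0 a01 M0 hf; have /andP[a0 _] := a01.
have hf' s t : 0 <= s <= T -> 0 <= t <= T -> `|f t - f s| <= M * `|t - s| `^ a.
  move=> /andP[s0 sT] /andP[t0 tT]; have [st|/ltW ts] := leP s t.
    by rewrite [`|t - s|]ger0_norm ?subr_ge0//; exact: hf.
  by rewrite distrC [`|t - s|]distrC [`|s - t|]ger0_norm ?subr_ge0//; exact: hf.
pose g t := f (Num.min (Num.max t 0) T).
have cg : continuous g.
  apply: (hoelder_continuous (M := M) a01) => s t.
  apply: (le_trans (hf' _ _ (clampP T0 _) (clampP T0 _))); rewrite ler_wpM2l//.
  by apply: ge0_powR_le; rewrite ?(ltW a0)// clamp_lip.
have := @continuous_measurable_itv R 0 T g cg; apply: eq_measurable_fun => t.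
by rewrite inE/= in_itv/= => tT; rewrite /g clamp_id.
Qed.

(** * Convergence of the scheme along a fixed noise path *)

Section Limit.
Context {R : realType}.
Local Notation H := (L2 R).
Context (al ga rho chi bb p2 T Axi : R) (xi : H) (h : nat -> R)
  (al01 : 0 < al <= 1) (ga0 : 0 <= ga) (bb8 : 8^-1 < bb) (bbr : bb < rho - chi)
  (chi0 : 0 < chi) (p201 : 0 <= p2 <= 1) (bp2 : bb + p2 < 4^-1) (chip2 : 2 * chi < p2)
  (rho4 : rho < 4^-1) (rag : rho < al - ga) (T0 : 0 < T)
  (xiA : l2le (fun k => lam k `^ 2^-1 * ip (en k) xi) Axi) (h_gt0 : forall n, (0 < n)%N -> 0 < h n)
  (h_cvg : forall e, 0 < e -> exists N, forall n, (N <= n)%N -> h n <= e).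

Let rb1 : rho - bb <= 1. Proof. move: bb8 bbr chi0 rho4 rag ga0; lra. Qed.
Let bag : bb < al - ga. Proof. move: bb8 bbr chi0 rho4 rag ga0; lra. Qed.
Let baga : al - ga - bb <= al. Proof. move: bb8 bbr chi0 rho4 rag ga0; lra. Qed.
Let bg0 : 0 <= bb + ga. Proof. move: bb8 bbr chi0 rho4 rag ga0; lra. Qed.
Let al8 : 8^-1 < al. Proof. move: bb8 bbr chi0 rho4 rag ga0; lra. Qed.
Let ag8 : 8^-1 <= al - ga. Proof. move: bb8 bbr chi0 rho4 rag ga0; lra. Qed.

(** All that the limit uses of the truncation: where the drift is kept, the H_rho norm is bounded;
    and the drift is kept when B + 3 K + Axi is below the threshold, 3 K + Axi being the bound for
    the noise plus the evolved initial value. *)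
Definition good (b : nat -> R -> R) (n : nat) (ind : R -> bool) (x : R -> H) :=
  [/\ scheme n (h n) T xi b ind x,
      (forall i, i%:R * h n <= T -> ind (i%:R * h n) ->
         l2le (fun k => lam k `^ rho * ip (en k) (x (i%:R * h n))) (h n `^ (- chi)))
    & forall i B K, i%:R * h n <= T -> noise al ga K b ->
         l2le (fun k => lam k `^ rho * ip (en k) (x (i%:R * h n))) B ->
         B + 3 * K + Axi <= h n `^ (- chi) -> ind (i%:R * h n)].

Lemma xi_l2le r : r <= 2^-1 -> l2le (fun k => lam k `^ r * ip (en k) xi) Axi.
Proof.
move=> r2; apply: l2le_mono xiA => k; rewrite !normrM ler_wpM2r// !ger0_norm ?powR_ge0//.
exact: lam_powR_incr.
Qed.

Lemma good_bound_H : exists C (q : nat), 0 < C /\ forall b K n ind x, (0 < n)%N -> noise al ga K b ->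
  good b n ind x -> forall t, 0 <= t <= T -> hnorm (x t) <= C * (1 + K) ^+ q.
Proof.
have [C [q [C0 hC]]] := @apriori R al ga rho chi bb p2 T xi al01 bb8 bbr rb1 chi0 p201 bp2 chip2 bag baga bg0 T0.
by exists C, q; split=> // b K n ind x n0 nb [sx ht _]; exact: (hC n (h n) b ind x K (h_gt0 n0) sx nb ht).
Qed.

Lemma good_bound (K : R) : exists2 D, 0 < D & forall b n ind x, (0 < n)%N -> noise al ga K b -> good b n ind x ->
  (forall t, 0 <= t <= T -> hnorm (x t) <= D) /\
  (forall k s, 0 <= s <= T -> `|drift (h n) ind x k s| <= kp k * D ^+ 2).
Proof.
have [C [q [C0 hC]]] := good_bound_H.
have D0 : 0 < C * (1 + `|K|) ^+ q by rewrite mulr_gt0// exprn_gt0// ltr_wpDr.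
exists (C * (1 + `|K|) ^+ q) => // b n ind x n0 nb gx.
have K0 : 0 <= K by case: nb => M [_ _ /l2le_ge0].
have xD t : 0 <= t <= T -> hnorm (x t) <= C * (1 + `|K|) ^+ q.
  by move=> tT; rewrite (ger0_norm K0); exact: hC gx t tT.
split=> // k s sT; apply: (@drift_le R (h n) T) => //; rewrite ?sqr_ge0//; first exact: h_gt0.
move=> i iT _; rewrite ler_sqr ?nnegrE ?hnorm_ge0 ?(ltW D0)//; apply: xD.
by rewrite iT mulr_ge0// ltW// h_gt0.
Qed.

Lemma good_bound_r (r K : R) : r < 4^-1 -> r <= al - ga -> exists2 D, 0 < D &
  forall b n ind x, (0 < n)%N -> noise al ga K b -> good b n ind x ->
  forall t, 0 <= t <= T -> l2le (fun k => lam k `^ r * ip (en k) (x t)) D.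
Proof.
move=> r4 rag'; have [D D0 hD] := good_bound K; have [C C0 hC] := mild_bound al01 rag' r4.
exists (`|Axi + C * D ^+ 2 + 3 * K| + 1); first by rewrite ltr_wpDl.
move=> b n ind x n0 nb gx t tT; have [_ hd] := hD b n ind x n0 nb gx.
have r2 : r <= 2^-1 by rewrite (le_trans (ltW r4))// lef_pV2 ?posrE// ler_nat.
have [sx _ _] := gx.
have := hC _ _ _ _ _ _ _ _ _ sx (fun k => measurable_drift ind x k (h_gt0 n0) (measurable_itv _)) hd nb (xi_l2le r2) (sqr_ge0 _) t tT.
by apply: l2le_wid; rewrite (le_trans (ler_norm _))// lerDl.
Qed.

Lemma h_pow_cvg p e : 0 < p -> 0 < e -> exists N, forall n, (N <= n)%N -> (0 < n)%N -> h n `^ p <= e.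
Proof.
move=> p0 e0; have [N hN] := h_cvg (powR_gt0 p^-1 e0); exists N => n Nn n0.
by apply: powR_root_le => //; [exact: ltW|exact/ltW/h_gt0|exact: hN].
Qed.

Lemma good_active (K : R) : exists N, forall b n ind x, (N <= n)%N -> (0 < n)%N -> noise al ga K b -> good b n ind x ->
  forall k s, 0 <= s <= T -> drift (h n) ind x k s = Bq k (x (gfl (h n) s)).
Proof.
have [D D0 hD] := good_bound_r K rho4 (ltW rag).
have E0 : 0 < `|D + 3 * K + Axi| + 1 by rewrite ltr_wpDl.
have Ei : 0 < (`|D + 3 * K + Axi| + 1)^-1 by rewrite invr_gt0.
have [N hN] := h_pow_cvg chi0 Ei.
exists N => b n ind x Nn n0 nb gx k s /andP[s0 sT].
have [i [fE i1 i2]] := gfl_le (h_gt0 n0) s0; rewrite /drift fE.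
have [_ _ ha] := gx.
rewrite (ha i D K)//; first exact: le_trans sT.
  by apply: (hD b n ind x) => //; rewrite mulr_ge0 ?(ltW (h_gt0 n0))// (le_trans i1).
apply: (@le_trans _ _ (`|D + 3 * K + Axi| + 1)); first by rewrite (le_trans (ler_norm _))// lerDl.
rewrite powRN -[leLHS]invrK lef_pV2 ?posrE ?powR_gt0 ?h_gt0//; exact: hN.
Qed.

Lemma good_incr (r p K : R) : 0 < p -> p <= 8^-1 -> r + p < 4^-1 -> r + p <= al - ga -> 0 <= r -> exists2 D, 0 < D &
  forall b n ind x, (0 < n)%N -> noise al ga K b -> good b n ind x ->
  forall s t, 0 <= s -> s <= t -> t <= T ->
    l2le (fun k => lam k `^ r * (ip (en k) (x t) - ip (en k) (x s))) (D * (t - s) `^ p).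
Proof.
move=> p0 p8 rp4 rpa r0.
have p1 : 0 <= p <= 1 by rewrite (ltW p0)/= (le_trans p8)// invf_le1// ler1n.
have pa : 0 <= p <= al by rewrite (ltW p0)/= (le_trans p8)// ltW.
have [D D0 hD] := good_bound K; have [E E0 hE] := good_bound_r K rp4 rpa.
have [C C0 hC] := mild_incr al01 p1 p1 rp4 pa rpa.
exists (`|E + C * D ^+ 2 + 3 * K| + 1); first by rewrite ltr_wpDl.
move=> b n ind x n0 nb gx s t s0 st tT; have [_ hd] := hD b n ind x n0 nb gx.
have [sx _ _] := gx.
have sT : 0 <= s <= T by rewrite s0 (le_trans st).
have := hC _ _ _ _ _ _ _ _ _ s t (t - s) sx (fun k => measurable_drift ind x k (h_gt0 n0) (measurable_itv _)) hd nb s0 st tT (lexx _) (hE b n ind x n0 nb gx s sT).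
apply: l2le_wid; rewrite (_ : _ + _ = (E + C * D ^+ 2 + 3 * K) * (t - s) `^ p); last by ring.
by rewrite ler_wpM2r ?powR_ge0// (le_trans (ler_norm _))// lerDl.
Qed.

Lemma l2le_lam0 (a : nat -> R) A : l2le (fun k => lam k `^ 0 * a k) A -> l2le a A.
Proof. by apply: l2le_mono => k; rewrite powRr0 mul1r. Qed.

Lemma good_incr_H (K : R) : exists2 D, 0 < D & forall b n ind x, (0 < n)%N -> noise al ga K b -> good b n ind x ->
  forall s t, 0 <= s -> s <= t -> t <= T -> hnorm (x t - x s) <= D * (t - s) `^ 8^-1.
Proof.
have i8 : 0 < 8^-1 :> R by rewrite invr_gt0.
have z8 : 0 + 8^-1 < 4^-1 :> R by rewrite add0r ltf_pV2 ?posrE// ltr_nat.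
have y8 : 0 + 8^-1 <= al - ga by rewrite add0r.
have [D D0 hD] := @good_incr 0 8^-1 K i8 (lexx _) z8 y8 (lexx _).
exists D => // b n ind x n0 nb gx s t s0 st tT.
apply: l2le_hnorm; apply: l2le_mono (l2le_lam0 (hD b n ind x n0 nb gx s t s0 st tT)) => k.
by rewrite ipBr.
Qed.

Lemma gfl_itv (n : nat) s : (0 < n)%N -> 0 <= s <= T -> [/\ 0 <= gfl (h n) s, gfl (h n) s <= s & s - gfl (h n) s <= h n].
Proof.
move=> n0 /andP[s0 sT]; have [i [-> i1 i2]] := gfl_le (h_gt0 n0) s0; split=> //.
  by rewrite mulr_ge0// ltW// h_gt0.
by move: i2; rewrite -natr1 mulrDl mul1r -ltrBlDl => /ltW.
Qed.

Lemma good_floor (K : R) : exists2 D, 0 < D & forall b n ind x, (0 < n)%N -> noise al ga K b -> good b n ind x ->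
  forall s, 0 <= s <= T -> hnorm (x (gfl (h n) s) - x s) <= D * h n `^ 8^-1.
Proof.
have [D D0 hD] := good_incr_H K; exists D => // b n ind x n0 nb gx s sT.
have [f0 fs fh] := gfl_itv n0 sT; rewrite hnormBC.
apply: (le_trans (hD b n ind x n0 nb gx _ _ f0 fs _)); first by case/andP: sT.
rewrite ler_wpM2l ?(ltW D0)//; apply: ge0_powR_le; rewrite ?subr_ge0//.
Qed.

Lemma good_cauchy (K e : R) : 0 < e -> exists N, forall b n m ind ind' x x', (N <= n)%N -> (N <= m)%N ->
  (0 < n)%N -> (0 < m)%N -> noise al ga K b -> good b n ind x -> good b m ind' x' ->
  forall t, 0 <= t <= T -> hnorm (x t - x' t) <= e.
Proof.
move=> e0; have [D D0 hD] := good_bound K.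
have z8 : 8^-1 < 4^-1 :> R by rewrite ltf_pV2 ?posrE// ltr_nat.
have i8 : 0 < 8^-1 :> R by rewrite invr_gt0.
have [Dr Dr0 hDr] := good_bound_r K z8 ag8.
have [E E0 hE] := good_floor K; have [N1 hN1] := good_active K.
have L0 : 0 <= 2 * D by rewrite mulr_ge0// ltW.
have [C C0 hC] := gronwall (ltW T0) L0.
have q0 : 0 < e / (C * (2 * E + 2 * Dr) + 1).
  by rewrite divr_gt0// ltr_wpDl// mulr_ge0 ?addr_ge0 ?mulr_ge0// ltW.
have [N2 hN2] := h_pow_cvg i8 q0.
have /cvg_epsP/(_ _ q0)[N3 hN3] := lam_powR_cvg0 i8.
exists (maxn N1 (maxn N2 N3)) => b n m ind ind' x x'; rewrite !geq_max => /and3P[n1 n2 n3] /and3P[m1 m2 m3] n0 m0 nb gx gx'.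
have [xD dD] := hD b n ind x n0 nb gx; have [xD' dD'] := hD b m ind' x' m0 nb gx'.
(* Below M both schemes carry the mode and the noise cancels; from M on the difference is put into
   the tail. *)
pose M := minn n m.
have lM : lam M `^ (- 8^-1) <= e / (C * (2 * E + 2 * Dr) + 1).
  by have := hN3 M; rewrite leq_min n3 m3 => /(_ isT); rewrite subr0 ger0_norm ?powR_ge0.
have [sx _ _] := gx; have [sx' _ _] := gx'.
have h1 := hN2 n n2 n0; have h2 := hN2 m m2 m0.
set q := e / _ in q0 h1 h2 lM.
have tl t : 0 <= t <= T -> l2le (fun k => if (M <= k)%N then ip (en k) (x t) - ip (en k) (x' t) else 0) (q * (2 * Dr)).
  move=> tT; have d1 := hDr b n ind x n0 nb gx t tT; have d2 := hDr b m ind' x' m0 nb gx' t tT.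
  have d3 := l2leZ (-1) d2; rewrite normrN1 mul1r in d3.
  have d4 : l2le (fun k => lam k `^ 8^-1 * (ip (en k) (x t) - ip (en k) (x' t))) (2 * Dr).
    rewrite mulr_natl mulr2n; apply: l2le_mono (l2leD d1 d3) => k.
    by rewrite mulN1r -mulrBr.
  by apply: l2le_wid (l2le_tail M (ltW i8) d4); rewrite ler_wpM2r// mulr_ge0// ltW.
have key := hC (fun t => x t - x' t) (fun k s => Bq k (x (gfl (h n) s)) - Bq k (x' (gfl (h m) s)))
  (fun t k => if (M <= k)%N then ip (en k) (x t) - ip (en k) (x' t) else 0) (2 * E * q) (q * (2 * Dr)) (2 * D).
move=> t tT; apply: (le_trans (key _ _ _ _ _ _ t tT)).
- by rewrite mulr_ge0 ?(ltW q0)// mulr_ge0// ltW.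
- move=> s sT; apply: (le_trans (hnormB _ _)); have := xD s sT; have := xD' s sT; set u := hnorm _; set v := hnorm _; rewrite mulr_natl mulr2n => h3 h4; exact: lerD.
- move=> k; apply: measurable_funB.
    exact: (@measurable_gfl R (fun r => Bq k (x r)) (h n) _ (h_gt0 n0)).
  exact: (@measurable_gfl R (fun r => Bq k (x' r)) (h m) _ (h_gt0 m0)).
- move=> k s sT; apply: (le_trans (Bq_lip _ _ _)); rewrite ler_wpM2l ?(ltW (kp_gt0 _))//.
  have [f0 fs _] := gfl_itv n0 sT; have [f0' fs' _] := gfl_itv m0 sT; have /andP[_ sT'] := sT.
  rewrite mulrC; apply: ler_pM; rewrite ?addr_ge0 ?hnorm_ge0//.
    rewrite mulr_natl mulr2n lerD//; first by rewrite xD// f0 (le_trans fs).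
    by rewrite xD'// f0' (le_trans fs').
  have g1 := hE b n ind x n0 nb gx s sT; have g2 := hE b m ind' x' m0 nb gx' s sT.
  apply: (le_trans (hnorm_dist _ (x s) _)).
  rewrite [leRHS](_ : _ = E * q + (hnorm (x s - x' s) + E * q)); last by ring.
  apply: lerD; first by apply: (le_trans g1); rewrite ler_wpM2l// ltW.
  apply: (le_trans (hnorm_dist _ (x' s) _)); rewrite lerD2l hnormBC.
  by apply: (le_trans g2); rewrite ler_wpM2l// ltW.
- move=> s sT k; rewrite ipBr; case: (leqP M k) => Mk; first by rewrite lerDr.
  rewrite normr0 addr0; move: Mk; rewrite /M ltn_min => /andP[kn km].
  rewrite (sx s sT) (sx' s sT) kn km.
  have /andP[s0 sT'] := sT.
  have sub : `[0, s] `<=` `[0, T]%classic by apply: subset_itvl; rewrite bnd_simp.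
  apply: eq_ler; congr `|_|.
  rewrite (@VintB R (lam k) _ _ 0 s (kp k * D ^+ 2) (kp k * D ^+ 2)).
  + rewrite (@Vint_ext R _ (drift (h n) ind x k) (fun s => Bq k (x (gfl (h n) s)))); last first.
      by move=> u /andP[u0 us]; apply: (hN1 b n ind x) => //; rewrite u0 (le_trans us).
    rewrite (@Vint_ext R _ (drift (h m) ind' x' k) (fun s => Bq k (x' (gfl (h m) s)))); last first.
      by move=> u /andP[u0 us]; apply: (hN1 b m ind' x') => //; rewrite u0 (le_trans us).
    exact: addrBD3.
  + exact: (@measurable_gfl R (fun r => Bq k (x r)) (h n) _ (h_gt0 n0)).
  + exact: (@measurable_gfl R (fun r => Bq k (x' r)) (h m) _ (h_gt0 m0)).
  + by move=> u /andP[u0 us]; rewrite -(hN1 b n ind x)//; [apply: dD|]; rewrite u0 (le_trans us).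
  + by move=> u /andP[u0 us]; rewrite -(hN1 b m ind' x')//; [apply: dD'|]; rewrite u0 (le_trans us).
- exact: tl.
have -> : C * (2 * E * q + q * (2 * Dr)) = (C * (2 * E + 2 * Dr)) * q by ring.
apply: (@le_trans _ _ ((C * (2 * E + 2 * Dr) + 1) * q)); first by rewrite ler_wpM2r ?(ltW q0)// lerDl.
rewrite /q mulrCA mulfV ?mulr1// gt_eqF// ltr_wpDl// mulr_ge0 ?addr_ge0 ?mulr_ge0// ltW//.
Qed.

Lemma l2le_lim (a : nat -> nat -> R) (c : nat -> R) A : (forall n, (0 < n)%N -> l2le (a n) A) ->
  (forall k, a n k @[n --> \oo] --> c k) -> l2le c A.
Proof.
move=> ha hc; split; first by case: (ha 1%N isT).
move=> N; have l : \sum_(i < N) a n.+1 i ^+ 2 @[n --> \oo] --> \sum_(i < N) c i ^+ 2.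
  elim: N => [|N IH]; first by under eq_fun do rewrite big_ord0; rewrite big_ord0; exact: cvg_cst.
  rewrite big_ord_recr/=; under eq_fun do rewrite big_ord_recr/=.
  apply: cvgD => //; pose i := N.
  have h1 : a n.+1 i @[n --> \oo] --> c i by have := hc i; rewrite -cvg_shiftS.
  rewrite -/i expr2; under eq_fun do rewrite expr2; exact: cvgM.
by apply: (cvgn_le l) => n; case: (ha n.+1 isT).
Qed.

Definition limit_of (x : nat -> R -> H) (X : R -> H) :=
  forall t, 0 <= t <= T -> hnorm (x n t - X t) @[n --> \oo] --> (0 : R).

Definition goods (b : nat -> R -> R) (ind : nat -> R -> bool) (x : nat -> R -> H) :=
  forall n, (0 < n)%N -> good b n (ind n) (x n).

Lemma limit_exists (K : R) b ind x : noise al ga K b -> goods b ind x -> exists X, limit_of x X.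
Proof.
move=> nb gx; have h1 t : exists v, 0 <= t <= T -> hnorm (x n t - v) @[n --> \oo] --> (0 : R).
  have [tT|_] := boolP (0 <= t <= T); last by exists 0.
  have [v hv] : exists v, hnorm (x n t - v) @[n --> \oo] --> (0 : R).
    apply: L2_complete => e e0; have [N hN] := good_cauchy K e0.
    exists (maxn N 1) => m n; rewrite !geq_max => /andP[Nm m0] /andP[Nn n0].
    by apply: (hN b m n (ind m) (ind n) (x m) (x n)) => //; exact: gx.
  by exists v.
by have [X hX] := choice h1; exists X => t; exact: hX.
Qed.

(** The order of quantifiers is the point: one index serves all paths with noise bound K, so the
    convergence is uniform on the event where the noise is at most K. *)
Lemma limit_unif (K e : R) : 0 < e -> exists N, forall b ind x X, noise al ga K b -> goods b ind x -> limit_of x X ->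
  forall n, (N <= n)%N -> (0 < n)%N -> forall t, 0 <= t <= T -> hnorm (x n t - X t) <= e.
Proof.
move=> e0; have [N hN] := good_cauchy K e0.
exists N => b ind x X nb gx lx n Nn n0 t tT; apply/ler_addgt0Pr => d d0.
have /cvg_epsP/(_ _ d0)[M hM] := lx t tT; pose m := maxn (maxn N M) 1.
have mN : (N <= m)%N by rewrite /m !leq_max leqnn.
have mM : (M <= m)%N by rewrite /m !leq_max leqnn orbT.
have m0 : (0 < m)%N by rewrite /m leq_max orbT.
have := hM m mM; rewrite normr_hnorm_sub0// => h1.
apply: (le_trans (hnorm_dist _ (x m t) _)); apply: lerD => //.
by apply: (hN b n m (ind n) (ind m) (x n) (x m)) => //; exact: gx.
Qed.

Lemma limit_coord x X t k : limit_of x X -> 0 <= t <= T -> ip (en k) (x n t) @[n --> \oo] --> ip (en k) (X t).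
Proof. by move=> lx tT; exact: (@ip_cvg R _ _ (lx t tT) (en k)). Qed.

Lemma limit_bound_r (r K : R) : r < 4^-1 -> r <= al - ga -> exists2 D, 0 < D &
  forall b ind x X, noise al ga K b -> goods b ind x -> limit_of x X ->
  forall t, 0 <= t <= T -> l2le (fun k => lam k `^ r * ip (en k) (X t)) D.
Proof.
move=> r4 rag'; have [D D0 hD] := good_bound_r K r4 rag'; exists D => // b ind x X nb gx lx t tT.
apply: (@l2le_lim (fun n k => lam k `^ r * ip (en k) (x n t))) => [n n0|k].
  exact: (hD b n (ind n) (x n) n0 nb (gx n n0)).
by apply: cvgM; [exact: cvg_cst|exact: limit_coord].
Qed.

Lemma limit_incr (r p K : R) : 0 < p -> p <= 8^-1 -> r + p < 4^-1 -> r + p <= al - ga -> 0 <= r -> exists2 D, 0 < D &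
  forall b ind x X, noise al ga K b -> goods b ind x -> limit_of x X ->
  forall s t, 0 <= s -> s <= t -> t <= T ->
    l2le (fun k => lam k `^ r * (ip (en k) (X t) - ip (en k) (X s))) (D * (t - s) `^ p).
Proof.
move=> p0 p8 rp4 rpa r0; have [D D0 hD] := good_incr K p0 p8 rp4 rpa r0.
exists D => // b ind x X nb gx lx s t s0 st tT.
have sT : 0 <= s <= T by rewrite s0 (le_trans st).
have tT' : 0 <= t <= T by rewrite tT (le_trans s0).
apply: (@l2le_lim (fun n k => lam k `^ r * (ip (en k) (x n t) - ip (en k) (x n s)))) => [n n0|k].
  exact: (hD b n (ind n) (x n) n0 nb (gx n n0)).
by apply: cvgM; [exact: cvg_cst|apply: cvgB; exact: limit_coord].
Qed.

Lemma limit_bound_H : exists C (q : nat), 0 < C /\ forall b K ind x X, noise al ga K b -> goods b ind x -> limit_of x X ->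
  forall n t, (0 < n)%N -> 0 <= t <= T -> hnorm (x n t - X t) <= C * (1 + K) ^+ q.
Proof.
have [C [q [C0 hC]]] := good_bound_H; exists (2 * C), q; split; first exact: mulr_gt0.
move=> b K ind x X nb gx lx n t n0 tT.
have h1 m : (0 < m)%N -> hnorm (x m t) <= C * (1 + K) ^+ q.
  by move=> m0; apply: (hC b K m (ind m) (x m)) => //; exact: gx.
apply/ler_addgt0Pr => d d0; have /cvg_epsP/(_ _ d0)[M hM] := lx t tT.
have := hM (maxn M 1); rewrite leq_maxl subr0 ger0_norm ?hnorm_ge0// => /(_ isT) h2.
apply: (le_trans (hnorm_dist _ (x (maxn M 1) t) _)); apply: lerD => //.
apply: (le_trans (hnormB _ _)); rewrite -mulrA mulr_natl mulr2n; apply: lerD; first exact: h1.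
by apply: h1; rewrite leq_max orbT.
Qed.

Lemma limit_continuous (K : R) : exists2 D, 0 < D & forall b ind x X, noise al ga K b -> goods b ind x -> limit_of x X ->
  (forall t, 0 <= t <= T -> hnorm (X t) <= D) /\ (forall s t, 0 <= s -> s <= t -> t <= T -> hnorm (X t - X s) <= D * (t - s) `^ 8^-1).
Proof.
have i8 : 0 < 8^-1 :> R by rewrite invr_gt0.
have z8 : 0 + 8^-1 < 4^-1 :> R by rewrite add0r ltf_pV2 ?posrE// ltr_nat.
have y8 : 0 + 8^-1 <= al - ga by rewrite add0r.
have z4 : 0 < 4^-1 :> R by rewrite invr_gt0.
have [D D0 hD] := @limit_incr 0 8^-1 K i8 (lexx _) z8 y8 (lexx _).
have [E E0 hE] := @limit_bound_r 0 K z4 (le_trans (ltW i8) ag8).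
exists (D + E); first exact: addr_gt0.
move=> b ind x X nb gx lx; split=> [t tT|s t s0 st tT].
  apply: (@le_trans _ _ E); last by rewrite lerDr ltW.
  exact: l2le_hnorm (l2le_lam0 (hE b ind x X nb gx lx t tT)).
apply: (@le_trans _ _ (D * (t - s) `^ 8^-1)); last by rewrite ler_wpM2r ?powR_ge0// lerDl ltW.
apply: l2le_hnorm; apply: l2le_mono (l2le_lam0 (hD b ind x X nb gx lx s t s0 st tT)) => k.
by rewrite ipBr.
Qed.

Lemma Bq_measurable (D : R) (X : R -> H) k : 0 <= D -> (forall t, 0 <= t <= T -> hnorm (X t) <= D) ->
  (forall s t, 0 <= s -> s <= t -> t <= T -> hnorm (X t - X s) <= D * (t - s) `^ 8^-1) ->
  measurable_fun `[0, T] (fun s => Bq k (X s)).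
Proof.
move=> D0 hD hX; have a8 : 0 < (8^-1 : R) <= 1 by rewrite invr_gt0 ltr0n/= invf_le1// ler1n.
have k0 := @kp_gt0 R k.
apply: (@measurable_hoelder R T (kp k * (D * (2 * D))) 8^-1) => //; first exact: ltW.
  by rewrite (mulr_ge0 (ltW k0))// !mulr_ge0.
move=> s t s0 st tT; apply: (le_trans (Bq_lip _ _ _)).
rewrite [leRHS](_ : _ = kp k * ((D * (t - s) `^ 8^-1) * (2 * D))); last by ring.
rewrite ler_wpM2l ?(ltW k0)//; apply: ler_pM; rewrite ?addr_ge0 ?hnorm_ge0//; first exact: hX.
rewrite mulr_natl mulr2n lerD//; apply: hD; first by rewrite tT (le_trans s0).
by rewrite s0 (le_trans st).
Qed.

(** The equation for X is compared with that of a single scheme, of index above k and so large that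
    X, the grid lag and the truncation each cost a small multiple of q. *)
Lemma limit_mild (K : R) b ind x X : noise al ga K b -> goods b ind x -> limit_of x X ->
  mild_path xpredT T xi b (fun k s => Bq k (X s)) X.
Proof.
move=> nb gx lx t tT k /=; have /andP[t0 tT'] := tT.
have [D D0 hD] := limit_continuous K; have [XD Xc] := hD b ind x X nb gx lx.
have [E E0 hE] := good_bound K; have [G G0 hG] := good_floor K.
have [N1 hN1] := good_active K.
have k0 := @kp_gt0 R k; have l0 := @lam_gt0 R k.
set W := Vint _ _ 0 t.
apply/eqP; rewrite -subr_eq0 -normr_le0; apply/ler_addgt0Pr => e e0; rewrite add0r.
(* Bounds a Volterra integral of a difference of drifts per unit distance of the states: Lipschitz
   constant kp k (E + D), integrated kernel at most 1 / lam k. *)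
have [c c0 cE] : exists2 c, 0 < c & c = kp k * (E + D) / lam k.
  by exists (kp k * (E + D) / lam k) => //; rewrite divr_gt0// mulr_gt0// addr_gt0.
have q0 : 0 < e / (1 + c * (G + 1)) by rewrite divr_gt0// ltr_wpDr// mulr_ge0 ?addr_ge0 ?ltW.
set q := e / _ in q0.
have i8 : 0 < 8^-1 :> R by rewrite invr_gt0.
have [N2 hN2] := h_pow_cvg i8 q0.
have [N3 hN3] := limit_unif K q0.
pose n := maxn (maxn N1 N2) (maxn N3 k.+1).
have [n1 n2 n3 nk] : [/\ (N1 <= n)%N, (N2 <= n)%N, (N3 <= n)%N & (k < n)%N].
  by rewrite /n; split; rewrite !leq_max leqnn ?orbT.
have n0 : (0 < n)%N by exact: leq_trans nk.
have gn := gx n n0; have [sn _ _] := gn.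
have xX s : 0 <= s <= T -> hnorm (x n s - X s) <= q.
  exact: (hN3 b ind x X nb gx lx n n3 n0).
have [xE dE] := hE b n (ind n) (x n) n0 nb gn.
have -> : ip (en k) (X t) = ip (en k) (x n t) - ip (en k) (x n t - X t) by rewrite ipBr; ring.
rewrite (sn t tT) nk (_ : _ - _ = (Vint (lam k) (drift (h n) (ind n) (x n) k) 0 t - W) - ip (en k) (x n t - X t)); last by ring.
apply: (le_trans (ler_normB _ _)).
have e1 : `|ip (en k) (x n t - X t)| <= q.
  apply: (le_trans (ip_CS _ _)); rewrite {1}/hnorm en_orth eqxx sqrtr1 mul1r.
  exact: xX.
have bX s : 0 <= s <= t -> `|Bq k (X s)| <= kp k * D ^+ 2.
  move=> /andP[s0 st]; apply: (le_trans (Bq_le _ _)); rewrite ler_wpM2l ?(ltW k0)//.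
  by rewrite ler_sqr ?nnegrE ?hnorm_ge0 ?(ltW D0)// XD// s0 (le_trans st).
have bd s : 0 <= s <= t -> `|drift (h n) (ind n) (x n) k s| <= kp k * E ^+ 2.
  by move=> /andP[s0 st]; apply: dE; rewrite s0 (le_trans st).
have sub : `[0, t] `<=` `[0, T]%classic by apply: subset_itvl; rewrite bnd_simp.
have mX : measurable_fun `[0, t] (fun s => Bq k (X s)).
  by apply: measurable_funS (Bq_measurable k (ltW D0) XD Xc) => //; exact: measurable_itv.
have md : measurable_fun `[0, t] (drift (h n) (ind n) (x n) k).
  by apply: measurable_drift => //; exact: h_gt0.
have e2 : `|Vint (lam k) (drift (h n) (ind n) (x n) k) 0 t - W| <= c * (G + 1) * q.
  rewrite -(VintB _ md mX bd bX).
  apply: (@le_trans _ _ (kp k * ((E + D) * ((G + 1) * q)) * (1 - expR (- (lam k * t))) / lam k)).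
    apply: normr_Vint_cst => //; first exact: measurable_funB.
    move=> s /andP[s0 st]; have sT : 0 <= s <= T by rewrite s0 (le_trans st).
    rewrite (hN1 b n (ind n) (x n) n1 n0 nb gn k s sT).
    apply: (le_trans (Bq_lip _ _ _)); rewrite ler_wpM2l ?(ltW k0)// mulrC.
    have [f0 fs _] := gfl_itv n0 sT; have /andP[_ sT'] := sT.
    apply: ler_pM; rewrite ?addr_ge0 ?hnorm_ge0//.
      by apply: lerD; [rewrite xE// f0 (le_trans fs)|exact: XD].
    apply: (le_trans (hnorm_dist _ (x n s) _)); rewrite [leRHS]mulrDl mul1r; apply: lerD; last exact: xX.
    apply: (le_trans (hG b n (ind n) (x n) n0 nb gn s sT)); rewrite ler_wpM2l ?(ltW G0)//.
    exact: hN2.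
  rewrite cE [leRHS](_ : _ = kp k * ((E + D) * ((G + 1) * q)) / lam k); last by ring.
  rewrite ler_wpM2r ?invr_ge0 ?(ltW l0)// ler_piMr ?gerBl ?expR_ge0//.
  by apply: ltW; rewrite (mulr_gt0 k0)// mulr_gt0 ?addr_gt0// mulr_gt0// addr_gt0.
apply: (le_trans (lerD e2 e1)).
have -> : c * (G + 1) * q + q = (1 + c * (G + 1)) * q by ring.
rewrite /q mulrC divfK//.
by rewrite gt_eqF// ltr_wpDr// mulr_ge0 ?addr_ge0 ?ltW.
Qed.

Lemma mild_unique b (D : R) (X Y : R -> H) :
  mild_path xpredT T xi b (fun k s => Bq k (X s)) X -> mild_path xpredT T xi b (fun k s => Bq k (Y s)) Y ->
  (forall t, 0 <= t <= T -> hnorm (X t) <= D) -> (forall t, 0 <= t <= T -> hnorm (Y t) <= D) ->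
  (forall k, measurable_fun `[0, T] (fun s => Bq k (X s))) -> (forall k, measurable_fun `[0, T] (fun s => Bq k (Y s))) ->
  forall t, 0 <= t <= T -> X t = Y t.
Proof.
move=> mX mY XD YD msX msY t tT.
have D0 : 0 <= 2 * D by rewrite mulr_ge0// (le_trans (hnorm_ge0 (X t)))// XD.
have [C C0 hC] := gronwall (ltW T0) D0.
have := hC (fun t => X t - Y t) (fun k s => Bq k (X s) - Bq k (Y s)) (fun _ _ => 0) 0 0 (2 * D) (lexx _).
rewrite addr0 mulr0 => key; apply/subr0_eq/hnorm_eq0/le_anti.
rewrite hnorm_ge0 andbT; apply: key tT => //.
- by move=> s sT; apply: (le_trans (hnormB _ _)); rewrite mulr_natl mulr2n lerD ?XD ?YD.
- by move=> k; exact: measurable_funB.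
- move=> k s sT; apply: (le_trans (Bq_lip _ _ _)); rewrite ler_wpM2l ?(ltW (kp_gt0 _))// addr0 mulrC.
  by rewrite ler_wpM2r ?hnorm_ge0// mulr_natl mulr2n lerD ?XD ?YD.
- move=> s sT k; rewrite normr0 addr0 ipBr (mX s sT) (mY s sT) /=; have /andP[s0 sT'] := sT.
  have sub : `[0, s] `<=` `[0, T]%classic by apply: subset_itvl; rewrite bnd_simp.
  have bnd (Z : R -> H) : (forall t, 0 <= t <= T -> hnorm (Z t) <= D) -> forall u, 0 <= u <= s -> `|Bq k (Z u)| <= kp k * D ^+ 2.
    move=> ZD u /andP[u0 us]; apply: (le_trans (Bq_le _ _)); rewrite ler_wpM2l ?(ltW (kp_gt0 _))//.
    rewrite ler_sqr ?nnegrE ?hnorm_ge0 ?(le_trans (hnorm_ge0 (X s)) (XD s sT))//.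
    by apply: ZD; rewrite u0 (le_trans us).
  rewrite (@VintB R (lam k) _ _ 0 s (kp k * D ^+ 2) (kp k * D ^+ 2)).
  + by apply: eq_ler; congr `|_|; exact: addrBD3.
  + by apply: measurable_funS (msX k) => //; exact: measurable_itv.
  + by apply: measurable_funS (msY k) => //; exact: measurable_itv.
  + exact: bnd.
  + exact: bnd.
- by move=> s sT; exact: l2le0.
Qed.

End Limit.

(** * Square integrable random variables and Gaussian moments *)

Section L2P.
Context {R : realType} d (Omega : measurableType d) (P : probability Omega R).
Implicit Types f g : Omega -> R.

Definition l2P f := measurable_fun setT f /\ P.-integrable setT (EFin \o (fun w => f w ^+ 2)).

Lemma l2P_mul f g : l2P f -> l2P g -> P.-integrable setT (EFin \o (fun w => f w * g w)).
Proof.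
move=> [mf f2] [mg g2].
apply: (@le_integrable _ _ _ P setT _ _ (fun w => (f w ^+ 2 + g w ^+ 2)%:E)) => //.
- by apply/measurable_EFinP; exact: measurable_funM.
- move=> w _ /=; rewrite lee_fin normrM [leRHS]ger0_norm ?addr_ge0 ?sqr_ge0//.
  rewrite -[f w ^+ 2]real_normK ?num_real// -[g w ^+ 2]real_normK ?num_real//.
  have := sqr_ge0 (`|f w| - `|g w|); have := sqr_ge0 `|f w|; have := sqr_ge0 `|g w|; nra.
- exact: (integrableD _ f2 g2).
Qed.

Lemma integrable_cstP (c : R) : P.-integrable setT (EFin \o (fun _ => c)).
Proof. by apply/finite_measure_integrable_cst. Qed.

Lemma l2P_cst (c : R) : l2P (fun _ => c).
Proof. by split; [exact: measurable_cst|exact: integrable_cstP]. Qed.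

Lemma l2P_integrable f : l2P f -> P.-integrable setT (EFin \o f).
Proof.
move=> lf; have := l2P_mul lf (l2P_cst 1); rewrite (_ : (fun w => f w * 1) = f)//.
by apply/funext => w; rewrite mulr1.
Qed.

Lemma l2PD f g : l2P f -> l2P g -> l2P (fun w => f w + g w).
Proof.
move=> lf lg; have [mf f2] := lf; have [mg g2] := lg; split; first exact: measurable_funD.
rewrite (_ : (fun w => _) = (fun w => (f w ^+ 2 + g w ^+ 2) + (f w * g w + f w * g w))); last first.
  by apply/funext => w; ring.
have fg := l2P_mul lf lg.
exact: (integrableD _ (integrableD _ f2 g2) (integrableD _ fg fg)).
Qed.

Lemma l2PZ f (c : R) : l2P f -> l2P (fun w => c * f w).
Proof.
move=> [mf f2]; split; first exact: measurable_funM.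
rewrite (_ : EFin \o _ = (fun w => (c ^+ 2)%:E * (f w ^+ 2)%:E)%E); last first.
  by apply/funext => w; rewrite /= exprMn EFinM.
exact: integrableZl.
Qed.

Lemma l2PB f g : l2P f -> l2P g -> l2P (fun w => f w - g w).
Proof.
move=> lf lg; rewrite (_ : (fun w => _) = (fun w => f w + (-1) * g w)).
  by apply: l2PD => //; exact: l2PZ.
by apply/funext => w; rewrite mulN1r.
Qed.

Lemma l2P_moment f : measurable_fun setT f -> (\int[P]_w (f w ^+ 2)%:E < +oo)%E -> l2P f.
Proof.
move=> mf h; split=> //; apply/integrableP; split; first by apply/measurable_EFinP; exact: measurable_funX.
by under eq_integral => w _ do rewrite /= ger0_norm ?sqr_ge0//.
Qed.

Lemma ae_eq_RintP f g : measurable_fun setT f -> measurable_fun setT g ->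
  {ae P, forall w, f w = g w} -> \int[P]_w f w = \int[P]_w g w.
Proof.
move=> mf mg fg; rewrite /Rintegral; congr fine; apply: ae_eq_integral => //.
- exact/measurable_EFinP.
- exact/measurable_EFinP.
- by apply: aeS fg => w e _; rewrite e.
Qed.

Lemma l2P_ae f g : measurable_fun setT g -> l2P f -> {ae P, forall w, g w = f w} -> l2P g.
Proof.
move=> mg [mf f2] gf; apply: l2P_moment => //.
rewrite (@ge0_ae_eq_integral _ _ _ P setT _ (fun w => (f w ^+ 2)%:E))//.
- move/integrableP: f2 => [_]; apply: le_lt_trans; apply: ge0_le_integral => //.
  + by move=> w _; rewrite lee_fin sqr_ge0.
  + by apply/measurable_EFinP; exact: measurable_funX.
  + by apply: measurableT_comp => //; apply/measurable_EFinP; exact: measurable_funX.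
  + by move=> w _ /=; rewrite lee_fin ler_norm.
- by apply/measurable_EFinP; exact: measurable_funX.
- by apply/measurable_EFinP; exact: measurable_funX.
- by move=> w _; rewrite lee_fin sqr_ge0.
- by move=> w _; rewrite lee_fin sqr_ge0.
- by apply: aeS gf => w -> _.
Qed.

Lemma fineK_l2P f : l2P f -> (\int[P]_w (f w ^+ 2)%:E)%E = (\int[P]_w (f w ^+ 2))%:E.
Proof. by move=> [mf f2]; rewrite /Rintegral fineK//; exact: integrable_fin_num. Qed.

End L2P.

Section Law.
Context {R : realType} d (Omega : measurableType d) (P : probability Omega R).

Definition mfun_pack d' (T' : measurableType d') (X : Omega -> T') (mX : measurable_fun setT X) : {mfun Omega >-> T'} :=
  MeasurableFun.Pack (MeasurableFun.Class (isMeasurableFun.Build _ _ _ _ X mX)).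

Lemma law_integral (X : Omega -> R) (s : R) (f : R -> R) : measurable_fun setT X -> measurable_fun setT f ->
  (forall x, 0 <= f x) -> (forall B, measurable B -> P (X @^-1` B) = normal_prob 0 s B) ->
  (\int[P]_w (f (X w))%:E = \int[normal_prob 0 s]_x (f x)%:E)%E.
Proof.
move=> mX mf f0 lX.
rewrite -(@eq_measure_integral _ _ _ setT (normal_prob 0 s) (distribution P (@mfun_pack _ (measurableTypeR R) X mX))); last by move=> A mA _; exact: lX.
rewrite ge0_integral_pushforward//; first by apply/measurable_EFinP.
by move=> x _; rewrite lee_fin.
Qed.

(** Symmetry in place of a Gaussian integral: X and Y have the same law, hence the same mean, and
    opposite signs. *)
Lemma law_mean0 (X Y : Omega -> R) (s : R) : l2P P X -> l2P P Y ->
  (forall B, measurable B -> P (X @^-1` B) = normal_prob 0 s B) ->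
  (forall B, measurable B -> P (Y @^-1` B) = normal_prob 0 s B) ->
  {ae P, forall w, Y w = - X w} -> \int[P]_w X w = 0.
Proof.
move=> lX lY hX hY YX; have [mX _] := lX; have [mY _] := lY.
have iX := l2P_integrable lX; have iY := l2P_integrable lY.
have e (Z : Omega -> R) : measurable_fun setT Z -> P.-integrable setT (EFin \o Z) ->
    (forall B, measurable B -> P (Z @^-1` B) = normal_prob 0 s B) ->
    (\int[P]_w (Z w)%:E = \int[normal_prob 0 s]_x x%:E)%E.
  move=> mZ iZ hZ.
  rewrite -(@eq_measure_integral _ _ _ setT (normal_prob 0 s) (distribution P (@mfun_pack _ (measurableTypeR R) Z mZ))); last by move=> A mA _; exact: hZ.
  by rewrite integral_pushforward.
have e1 : \int[P]_w Y w = \int[P]_w X w by rewrite /Rintegral e// e.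
have e2 : \int[P]_w Y w = - \int[P]_w X w.
  rewrite -(mulN1r (\int[P]_w X w)) -RintegralZl//; apply: ae_eq_RintP => //; first exact: measurable_funM.
  by apply: aeS YX => w ->; rewrite mulN1r.
by move: e1; rewrite e2; lra.
Qed.

(** Independence identifies the joint law with the product measure; Fubini then integrates out the
    centred factor first. *)
Lemma independent_mean (X Y : Omega -> R) : l2P P X -> l2P P Y ->
  (forall B C, measurable B -> measurable C -> P ((X @^-1` B) `&` (Y @^-1` C)) = (P (X @^-1` B) * P (Y @^-1` C))%E) ->
  \int[P]_w X w = 0 -> \int[P]_w (X w * Y w) = 0.
Proof.
move=> lX lY ind X0; have [mX _] := lX; have [mY _] := lY.
have mZ : measurable_fun setT (fun w => (X w, Y w)) by exact: measurable_fun_pair.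
pose muX := distribution P (mfun_pack mX); pose muY := distribution P (mfun_pack mY).
pose muZ := distribution P (mfun_pack mZ).
have prod A : measurable A -> (muX \x muY)%E A = muZ A.
  by apply: product_measure_unique => B C mB mC; rewrite -[RHS]ind.
pose f (z : R * R) : \bar R := (z.1 * z.2)%:E.
have mf : measurable_fun setT f by apply/measurable_EFinP; exact: measurable_funM.
have mf' : measurable_fun setT (abse \o f) by exact: measurableT_comp.
have ifZ : (\int[muZ]_z `|f z| < +oo)%E.
  rewrite ge0_integral_pushforward//.
  by have /integrableP[_] := l2P_mul lX lY.
have if1 : (muX \x muY)%E.-integrable setT f.
  by apply/integrableP; split=> //; rewrite (@eq_measure_integral _ _ _ setT muZ)// => A mA _; exact: prod.
have e1 : (\int[P]_w (X w * Y w)%:E = \int[muX \x muY]_z f z)%E.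
  rewrite (@eq_measure_integral _ _ _ setT muZ); last by move=> A mA _; exact: prod.
  by rewrite integral_pushforward//; exact: l2P_mul.
have e2 : (\int[muX]_x x%:E = 0)%E.
  rewrite integral_pushforward//; last exact: l2P_integrable.
  rewrite -[LHS]fineK; first by congr EFin; exact: X0.
  exact: (integrable_fin_num measurableT (l2P_integrable lX)).
have e3 : (\int[P]_w (X w * Y w)%:E = 0)%E.
  rewrite e1 -(integral21_prod_meas1 if1) /fubini_G.
  rewrite (eq_integral (fun _ => 0%E)) ?integral0// => y _.
  rewrite /f /=; under eq_integral do rewrite mulrC EFinM.
  rewrite integralZl//; last first.
    by apply: integrable_pushforward => //; exact: l2P_integrable.
  by rewrite e2 mule0.
by rewrite /Rintegral e3.
Qed.

End Law.

Section NormalMoment.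
Context {R : realType}.

Lemma pow_le_expR (z : R) (m : nat) : 0 <= z -> z ^+ m <= m%:R ^+ m * expR z.
Proof.
move=> z0; case: m => [|m]; first by rewrite !expr0 mul1r -expR0 ler_expR.
have m0 : 0 < m.+1%:R :> R by rewrite ltr0n.
have h : z <= m.+1%:R * expR (z / m.+1%:R).
  rewrite -ler_pdivrMl// mulrC; apply: le_trans (expR_ge1Dx _).
  by rewrite lerDr.
rewrite (_ : expR z = expR (z / m.+1%:R) ^+ m.+1); last first.
  by rewrite -expRM_natl -mulr_natl mulrC divfK ?gt_eqF.
by rewrite -exprMn lerXn2r// nnegrE// mulr_ge0 ?expR_ge0// ltW.
Qed.

(** The power is absorbed into the exponential at the price of doubling the variance; the moment
    bound then reduces to the total mass of the wider density. *)
Lemma normal_pdf_pow_le (m : nat) (s x : R) : 0 < s ->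
  x ^+ (2 * m) * normal_pdf 0 s x <= (2 * (4 ^+ m * m%:R ^+ m)) * s ^+ (2 * m) * normal_pdf 0 (Num.sqrt 2 * s) x.
Proof.
move=> s0; have s20 : 0 < s ^+ 2 by rewrite exprn_gt0.
have s'0 : 0 < Num.sqrt 2 * s by rewrite mulr_gt0// sqrtr_gt0.
rewrite /normal_pdf !gt_eqF// /normal_fun !subr0.
have s'2 : (Num.sqrt 2 * s) ^+ 2 = 2 * s ^+ 2 by rewrite exprMn sqr_sqrtr.
have pk : normal_peak s <= 2 * normal_peak (Num.sqrt 2 * s).
  rewrite /normal_peak s'2.
  have p0 : 0 < s ^+ 2 * pi *+ 2 :> R by rewrite mulrn_wgt0// mulr_gt0// pi_gt0.
  have -> : (2 * s ^+ 2 * pi *+ 2 : R) = 2 * (s ^+ 2 * pi *+ 2) by rewrite -mulrA mulrnAr.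
  rewrite -[2 in leRHS]invrK -invfM lef_pV2 ?posrE ?mulr_gt0 ?invr_gt0 ?sqrtr_gt0 ?mulr_gt0//.
  rewrite mulrC ler_pdivrMr// -[X in _ <= _ * X](@ger0_norm _ 2)// -sqrtr_sqr -sqrtrM ?(ltW p0)//.
  by apply: ler_wsqrtr; nra.
have key : x ^+ (2 * m) * expR (- x ^+ 2 / (s ^+ 2 *+ 2)) <=
    4 ^+ m * m%:R ^+ m * s ^+ (2 * m) * expR (- x ^+ 2 / ((Num.sqrt 2 * s) ^+ 2 *+ 2)).
  have -> : - x ^+ 2 / ((Num.sqrt 2 * s) ^+ 2 *+ 2) = (x / s) ^+ 2 / 4 + - x ^+ 2 / (s ^+ 2 *+ 2).
    by rewrite s'2 exprMn exprVn; move: (s ^+ 2) (x ^+ 2) (gt_eqF s20) => u v u0; field; rewrite u0.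
  have -> : x ^+ (2 * m) = 4 ^+ m * s ^+ (2 * m) * ((x / s) ^+ 2 / 4) ^+ m.
    by rewrite !exprM -!exprMn; congr (_ ^+ m); field; rewrite gt_eqF.
  have z0 : 0 <= (x / s) ^+ 2 / 4 by rewrite divr_ge0// sqr_ge0.
  have c0 : 0 <= 4 ^+ m * s ^+ (2 * m) by rewrite mulr_ge0// exprn_ge0// ltW.
  rewrite expRD mulrA ler_wpM2r ?expR_ge0// [4 ^+ m * m%:R ^+ m * _]mulrAC -[leRHS]mulrA ler_wpM2l//.
  exact: pow_le_expR.
rewrite mulrCA; apply: (le_trans (ler_wpM2l (normal_peak_ge0 _) key)).
rewrite mulrC [leRHS](_ : _ = 4 ^+ m * m%:R ^+ m * s ^+ (2 * m) *
  expR (- x ^+ 2 / ((Num.sqrt 2 * s) ^+ 2 *+ 2)) * (2 * normal_peak (Num.sqrt 2 * s))); last by ring.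
by rewrite ler_wpM2l// !mulr_ge0 ?expR_ge0 ?exprn_ge0 ?(ltW s0).
Qed.

Lemma normal_prob_integral (s : R) (f : R -> R) : measurable_fun setT f -> (forall x, 0 <= f x) ->
  (\int[normal_prob 0 s]_x (f x)%:E = \int[leb]_x (f x * normal_pdf 0 s x)%:E)%E.
Proof.
move=> mf f0; have dom := @normal_prob_dominates R 0 s.
have mf' : measurable_fun setT (EFin \o f) by exact/measurable_EFinP.
have mp : measurable_fun setT (EFin \o normal_pdf 0 s) by apply/measurable_EFinP; exact: measurable_normal_pdf.
have iRN := Radon_Nikodym_SigmaFinite.f_integrable dom.
rewrite -(Radon_Nikodym_SigmaFinite.change_of_variables dom _ _ mf')//.
have e := integral_ae_eq measurableT iRN mp
  (fun E _ mE => esym (Radon_Nikodym_SigmaFinite.f_integral dom mE)).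
apply: ae_eq_integral => //.
- by apply: emeasurable_funM => //; exact: measurable_int iRN.
- by apply/measurable_EFinP/measurable_funM => //; exact: measurable_normal_pdf.
- by apply: aeS e => x + _ => /(_ I) ->; rewrite EFinM.
Qed.

Lemma normal_moment (m : nat) : exists2 C : R, 0 < C & forall d (T : measurableType d) (P : probability T R) (X : T -> R) (s : R),
  measurable_fun setT X -> 0 < s -> (forall B, measurable B -> P (X @^-1` B) = normal_prob 0 s B) ->
  (\int[P]_w (X w ^+ (2 * m))%:E <= (C * s ^+ (2 * m))%:E)%E.
Proof.
pose C : R := 2 * (4 ^+ m * m%:R ^+ m); exists (C + 1); first by rewrite ltr_wpDl// !mulr_ge0// exprn_ge0.
move=> d T P X s mX s0 lX; have s2m : 0 <= s ^+ (2 * m) by rewrite exprn_ge0// ltW.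
have C0 : 0 <= C * s ^+ (2 * m) by rewrite !mulr_ge0// exprn_ge0.
have x2m (x : R) : 0 <= x ^+ (2 * m) by rewrite exprM exprn_ge0// sqr_ge0.
have mx : measurable_fun [set: R] (fun x : R => x ^+ (2 * m)) by exact: measurable_funX.
rewrite (law_integral mX mx x2m lX) normal_prob_integral//.
apply: (@le_trans _ _ (\int[leb]_x ((C * s ^+ (2 * m))%:E * (normal_pdf 0 (Num.sqrt 2 * s) x)%:E))%E).
  apply: ge0_le_integral => //.
  - by move=> x _; rewrite lee_fin mulr_ge0// normal_pdf_ge0.
  - by apply/measurable_EFinP/measurable_funM => //; exact: measurable_normal_pdf.
  - by apply: measurable_funeM; apply/measurable_EFinP; exact: measurable_normal_pdf.
  - by move=> x _; rewrite -EFinM lee_fin; exact: normal_pdf_pow_le.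
rewrite ge0_integralZl_EFin//; last 2 first.
- by move=> x _; rewrite lee_fin normal_pdf_ge0.
- by apply/measurable_EFinP; exact: measurable_normal_pdf.
by rewrite integral_normal_pdf mule1 lee_fin ler_wpM2r// lerDl.
Qed.

End NormalMoment.

(** * Wiener integrals of step functions and their isometry *)

Section Isometry.
Context {R : realType} d (Omega : measurableType d) (P : probability Omega R).
Local Notation H := (L2 R).
Context (T : R) (W : R -> H -> Omega -> R) (T0 : 0 < T) (hW : cylindrical_wiener P T W).

(** The process starts at 0 only almost surely; subtracting the initial value makes it vanish at
    time 0 on every path. *)
Definition wie (t : R) (v : H) (w : Omega) : R := W t v w - W 0 v w.

Lemma tT_0 : 0 <= (0 : R) <= T. Proof. by rewrite lexx ltW. Qed.

Lemma wie_measurable t v : 0 <= t <= T -> measurable_fun setT (wie t v).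
Proof. by move=> tT; apply: measurable_funB; apply: (cw_measurable hW) => //; exact: tT_0. Qed.

Lemma wie_linear t a u v : 0 <= t <= T -> {ae P, forall w, wie t (a *: u + v) w = a * wie t u w + wie t v w}.
Proof.
move=> tT; apply: aeS2 (cw_linear hW a u v tT) (cw_linear hW a u v tT_0) => w h1 h2.
by rewrite /wie h1 h2; ring.
Qed.

Lemma wie_zero t : 0 <= t <= T -> {ae P, forall w, wie t 0 w = 0}.
Proof.
move=> tT; apply: aeS (wie_linear 1 0 0 tT) => w.
by rewrite scale1r addr0 mul1r -[X in X = _ -> _]addr0 => /addrI ->.
Qed.

Lemma wie_scale t a u : 0 <= t <= T -> {ae P, forall w, wie t (a *: u) w = a * wie t u w}.
Proof.
move=> tT; apply: aeS2 (wie_linear a u 0 tT) (wie_zero tT) => w.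
by rewrite addr0 => -> ->; rewrite addr0.
Qed.

Lemma wie_add t u v : 0 <= t <= T -> {ae P, forall w, wie t (u + v) w = wie t u w + wie t v w}.
Proof. by move=> tT; apply: aeS (wie_linear 1 u v tT) => w; rewrite scale1r mul1r. Qed.

Lemma wie_incr_law s t v B : 0 <= s -> s < t -> t <= T -> v != 0 -> measurable B ->
  P ((fun w => wie t v w - wie s v w) @^-1` B) = normal_prob 0 (Num.sqrt (t - s) * hnorm v) B.
Proof.
move=> s0 st tT v0 mB; rewrite -(cw_gaussian hW s0 st tT v0 mB); congr (P _).
by apply/seteqP; split => w /=; rewrite /wie opprB addrA subrK.
Qed.

Lemma hnorm_gt0 (v : H) : v != 0 -> 0 < hnorm v.
Proof. by move=> v0; rewrite lt_neqAle hnorm_ge0 andbT eq_sym; apply: contra_neq v0; exact: hnorm_eq0. Qed.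

Lemma wie_incr_measurable s t v : 0 <= s -> s <= t -> t <= T -> measurable_fun setT (fun w => wie t v w - wie s v w).
Proof.
move=> s0 st tT; apply: measurable_funB; apply: wie_measurable; first by rewrite tT (le_trans s0).
by rewrite s0 (le_trans st).
Qed.

Lemma wie_moment (m : nat) : exists2 C : R, 0 < C & forall s t v, 0 <= s -> s < t -> t <= T -> v != 0 ->
  (\int[P]_w ((wie t v w - wie s v w) ^+ (2 * m))%:E <= (C * ((t - s) * hnorm v ^+ 2) ^+ m)%:E)%E.
Proof.
have [C C0 hC] := @normal_moment R m; exists C => // s t v s0 st tT v0.
have ts : 0 < t - s by rewrite subr_gt0.
have := hC _ _ P (fun w => wie t v w - wie s v w) (Num.sqrt (t - s) * hnorm v).
rewrite [(_ * hnorm v) ^+ (2 * m)]exprM [(Num.sqrt _ * _) ^+ 2]exprMn sqr_sqrtr ?(ltW ts)//; apply.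
- by apply: wie_incr_measurable => //; exact: ltW.
- by apply: mulr_gt0; [rewrite sqrtr_gt0|exact: hnorm_gt0].
- by move=> B mB; apply: wie_incr_law.
Qed.

Lemma wie0 v w : wie 0 v w = 0. Proof. by rewrite /wie subrr. Qed.

Lemma wie_incr_l2P s t v : 0 <= s -> s <= t -> t <= T -> v != 0 -> l2P P (fun w => wie t v w - wie s v w).
Proof.
move=> s0; rewrite le_eqVlt => /predU1P[->|st] tT v0.
  by rewrite (_ : (fun _ => _) = (fun _ => 0)); [exact: l2P_cst|apply/funext => w; rewrite subrr].
apply: l2P_moment; first by apply: wie_incr_measurable => //; exact: ltW.
have [C C0 hC] := wie_moment 1; apply: le_lt_trans (hC s t v s0 st tT v0) _.
exact: ltry.
Qed.

Lemma wie_l2P t v : 0 <= t <= T -> l2P P (wie t v).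
Proof.
move=> tT; have /andP[t0 tT'] := tT; have [->|v0] := eqVneq v 0.
  by apply: l2P_ae (l2P_cst P 0) _; [exact: wie_measurable|apply: aeS (wie_zero tT) => w].
rewrite (_ : wie t v = (fun w => wie t v w - wie 0 v w)); last by apply/funext => w; rewrite wie0 subr0.
exact: wie_incr_l2P.
Qed.

(** Second moment of a unit direction per unit time, kept as a symbol: scaling of the Gaussian laws
    shows that every second moment is proportional to it. *)
Definition cwie : R := \int[P]_w (wie T (en 0) w ^+ 2) / T.

Lemma en_neq0 k : (en k : H) != 0.
Proof.
apply/eqP => h; have := @en_orth R k k; rewrite eqxx h ip0l => /eqP.
by rewrite eq_sym oner_eq0.
Qed.

Lemma wie_second s t v : 0 <= s -> s <= t -> t <= T ->
  \int[P]_w ((wie t v w - wie s v w) ^+ 2) = cwie * (t - s) * hnorm v ^+ 2.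
Proof.
move=> s0; rewrite le_eqVlt => /predU1P[->|st] tT.
  rewrite subrr mulr0 mul0r (_ : (fun w => _) = (fun _ => 0)); first by rewrite /Rintegral integral0.
  by apply/funext => w; rewrite subrr expr0n.
have tt : 0 <= t <= T by rewrite tT (le_trans s0 (ltW st)).
have ss : 0 <= s <= T by rewrite s0 (le_trans (ltW st)).
have [->|v0] := eqVneq v 0.
  rewrite hnorm0 expr0n mulr0 (ae_eq_RintP (g := fun _ => 0)).
  - by rewrite /Rintegral integral0.
  - by apply: measurable_funX; apply: wie_incr_measurable => //; exact: ltW.
  - exact: measurable_cst.
  - by apply: aeS2 (wie_zero tt) (wie_zero ss) => w -> ->; rewrite subrr expr0n.
have ts : 0 < t - s by rewrite subr_gt0.
(* Scale at which the variable at time T in direction [a *: en 0] has the same law as the given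
   increment. *)
pose a := Num.sqrt ((t - s) / T) * hnorm v.
have a0 : 0 < a by rewrite mulr_gt0 ?hnorm_gt0// sqrtr_gt0 divr_gt0.
have e1 : (\int[P]_w ((wie t v w - wie s v w) ^+ 2)%:E = \int[P]_w ((wie T (a *: en 0) w - wie 0 (a *: en 0) w) ^+ 2)%:E)%E.
  have mf : measurable_fun [set: R] (fun x : R => x ^+ 2) by exact: measurable_funX.
  rewrite (@law_integral _ _ _ P (fun w => wie t v w - wie s v w) (Num.sqrt (t - s) * hnorm v) (fun x => x ^+ 2))//; last 3 first.
  - by apply: wie_incr_measurable => //; exact: ltW.
  - by move=> x; exact: sqr_ge0.
  - by move=> B mB; apply: wie_incr_law.
  rewrite (@law_integral _ _ _ P (fun w => wie T (a *: en 0) w - wie 0 (a *: en 0) w) (Num.sqrt (t - s) * hnorm v) (fun x => x ^+ 2))//.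
  - by apply: wie_incr_measurable => //; exact: ltW.
  - by move=> x; exact: sqr_ge0.
  - have n1 : hnorm (en 0 : H) = 1 by rewrite /hnorm en_orth eqxx sqrtr1.
    have -> : Num.sqrt (t - s) * hnorm v = Num.sqrt (T - 0) * hnorm (a *: en 0 : H).
      rewrite hnormZ n1 mulr1 ger0_norm ?(ltW a0)// /a subr0 mulrA -sqrtrM ?(ltW T0)//.
      by have -> : T * ((t - s) / T) = t - s by field; rewrite gt_eqF.
    move=> B mB; apply: wie_incr_law => //.
    by rewrite scaler_eq0 negb_or gt_eqF//= en_neq0.
rewrite /Rintegral e1 -/(Rintegral P setT (fun w => (wie T (a *: en 0) w - wie 0 (a *: en 0) w) ^+ 2)).
have TT : 0 <= T <= T by rewrite lexx ltW.
rewrite (ae_eq_RintP (g := fun w => a ^+ 2 * wie T (en 0) w ^+ 2)); first last.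
- by apply: aeS (wie_scale a (en 0) TT) => w h; rewrite wie0 subr0 h exprMn.
- by apply: measurable_funM => //; apply: measurable_funX; exact: wie_measurable.
- by apply: measurable_funX; apply: wie_incr_measurable => //; exact: ltW.
rewrite RintegralZl//; last by have [] := wie_l2P (en 0) TT.
rewrite /cwie /a exprMn sqr_sqrtr ?divr_ge0 ?(ltW ts) ?(ltW T0)//.
by rewrite mulrC; field; rewrite gt_eqF.
Qed.

Lemma wie_mean0 t v : 0 <= t <= T -> \int[P]_w wie t v w = 0.
Proof.
move=> tT; have /andP[t0 tT'] := tT; have [->|v0] := eqVneq v 0.
  rewrite (ae_eq_RintP (g := fun _ => 0)); [by rewrite /Rintegral integral0|exact: wie_measurable|exact: measurable_cst|exact: wie_zero].
have [->|tn0] := eqVneq t 0; first by under eq_Rintegral do rewrite wie0; rewrite /Rintegral integral0.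
have tgt : 0 < t by rewrite lt_neqAle eq_sym tn0.
have L u : u != 0 -> hnorm u = hnorm v -> forall B, measurable B -> P (wie t u @^-1` B) = normal_prob 0 (Num.sqrt (t - 0) * hnorm v) B.
  move=> u0 <- B mB; rewrite -wie_incr_law//; congr (P _).
  by apply/seteqP; split => w /=; rewrite wie0 subr0.
apply: (@law_mean0 _ _ _ P (wie t v) (wie t (- v)) (Num.sqrt (t - 0) * hnorm v)).
- exact: wie_l2P.
- exact: wie_l2P.
- exact: L.
- by apply: L; rewrite ?oppr_eq0// hnormN.
- by apply: aeS (wie_scale (-1) v tT) => w; rewrite scaleN1r mulN1r.
Qed.

Lemma wie_cov_same t u v : 0 <= t <= T -> \int[P]_w (wie t u w * wie t v w) = cwie * t * ip u v.
Proof.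
move=> tT; have /andP[t0 tT'] := tT.
have lu := wie_l2P u tT; have lv := wie_l2P v tT; have luv := wie_l2P (u + v) tT.
have sec x : \int[P]_w (wie t x w ^+ 2) = cwie * t * hnorm x ^+ 2.
  rewrite -[t in RHS]subr0 -wie_second//; apply: eq_Rintegral => w _.
  by rewrite wie0 subr0.
have e : \int[P]_w (wie t (u + v) w ^+ 2) = \int[P]_w (wie t u w ^+ 2) + 2 * \int[P]_w (wie t u w * wie t v w) + \int[P]_w (wie t v w ^+ 2).
  rewrite (ae_eq_RintP (g := fun w => (wie t u w ^+ 2 + 2 * (wie t u w * wie t v w)) + wie t v w ^+ 2)); first last.
  - by apply: aeS (wie_add u v tT) => w ->; ring.
  - apply: measurable_funD; last by apply: measurable_funX; exact: wie_measurable.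
    apply: measurable_funD; first by apply: measurable_funX; exact: wie_measurable.
    by apply: measurable_funM => //; apply: measurable_funM; exact: wie_measurable.
  - by apply: measurable_funX; exact: wie_measurable.
  have i1 : P.-integrable setT (EFin \o (fun w => wie t u w ^+ 2)) by case: lu.
  have i2 : P.-integrable setT (EFin \o (fun w => wie t v w ^+ 2)) by case: lv.
  have i3 := l2P_mul lu lv.
  have i4 : P.-integrable setT (EFin \o (fun w => 2 * (wie t u w * wie t v w))).
    rewrite (_ : EFin \o _ = (fun w => 2%:E * (wie t u w * wie t v w)%:E)%E); first exact: integrableZl.
    by apply/funext => w; rewrite /= EFinM.
  rewrite RintegralD//; last exact: (integrableD _ i1 i4).
  by rewrite RintegralD// RintegralZl.
move: e; rewrite !sec !hnorm2 ipDl !ipDr (ipC v u); lra.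
Qed.

Lemma wie_cov_incr s t u v : 0 <= s -> s <= t -> t <= T -> \int[P]_w (wie s u w * (wie t v w - wie s v w)) = 0.
Proof.
move=> s0 st tT; have ss : 0 <= s <= T by rewrite s0 (le_trans st).
have tt : 0 <= t <= T by rewrite tT (le_trans s0).
have us : {ae P, forall w, W s u w = wie s u w}.
  by apply: aeS (cw_start hW u) => w h; rewrite /wie h subr0.
have lW : l2P P (W s u) by apply: l2P_ae (wie_l2P u ss) us; exact: (cw_measurable hW).
have lI : l2P P (fun w => wie t v w - wie s v w) by apply: l2PB; exact: wie_l2P.
rewrite (ae_eq_RintP (g := fun w => W s u w * (wie t v w - wie s v w))); first last.
- by apply: aeS us => w ->.
- by apply: measurable_funM; [case: lW|case: lI].
- by apply: measurable_funM; [exact: wie_measurable|case: lI].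
apply: independent_mean => //; last first.
  rewrite -[RHS](wie_mean0 u ss); apply: ae_eq_RintP us; last exact: wie_measurable.
  by case: lW.
move=> B C mB mC.
have := @cw_independent _ _ _ _ _ _ hW s t 1 1 (fun=> s) (fun=> u) (fun=> B) (fun=> v) (fun=> C) s0 st tT.
rewrite s0 lexx /= => /(_ (fun=> isT) (fun=> mB) (fun=> mC)).
rewrite (_ : [set w | forall i : 'I_1, B (W s u w)] = W s u @^-1` B); last first.
  by apply/seteqP; split => [w /(_ ord0)//|w h i].
rewrite (_ : [set w | forall j : 'I_1, C (W t v w - W s v w)] = (fun w => wie t v w - wie s v w) @^-1` C)//.
apply/seteqP; split => [w /(_ ord0) /=|w /= h j]; first by rewrite /wie opprB addrA subrK.
by move: h; rewrite /wie opprB addrA subrK.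
Qed.

Lemma wie_cov s t u v : 0 <= s <= T -> 0 <= t <= T -> \int[P]_w (wie s u w * wie t v w) = cwie * Num.min s t * ip u v.
Proof.
wlog st : s t u v / s <= t.
  move=> h ss tt; have [st|/ltW ts] := leP s t; first by rewrite h// min_l.
  by under eq_Rintegral do rewrite mulrC; rewrite h// min_l// ipC.
move=> /andP[s0 sT] /andP[t0 tT]; have ss : 0 <= s <= T by rewrite s0.
have tt : 0 <= t <= T by rewrite t0.
rewrite min_l// -(wie_cov_same u v ss) -[RHS]addr0 -(wie_cov_incr u v s0 st tT) -RintegralD//.
- by apply: eq_Rintegral => w _; ring.
- by apply: l2P_mul; exact: wie_l2P.
- by apply: l2P_mul; [exact: wie_l2P|apply: l2PB; exact: wie_l2P].
Qed.

(** A triple (c, s, v) encodes the variable c W_s v and, in [wfun], the integrand c v on x <= s.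
    Both have the same Gram matrix up to [cwie], since the covariance min(s, t) is the integral of
    the product of two such indicators. *)
Definition wsum (pts : seq (R * R * H)) (w : Omega) : R := \sum_(p <- pts) p.1.1 * wie p.1.2 p.2 w.

Definition wfun (pts : seq (R * R * H)) (x : R) : H := \sum_(p <- pts) (if x <= p.1.2 then p.1.1 else 0) *: p.2.

Definition pts_in (t : R) (pts : seq (R * R * H)) := forall p, p \in pts -> 0 <= p.1.2 <= t.

Lemma pts_in_cons t p pts : pts_in t (p :: pts) -> 0 <= p.1.2 <= t /\ pts_in t pts.
Proof.
by move=> h; split=> [|q qp]; apply: h; rewrite in_cons ?eqxx// qp orbT.
Qed.

Lemma wsum_l2P pts : pts_in T pts -> l2P P (wsum pts).
Proof.
elim: pts => [|p pts IH] h.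
  by rewrite (_ : wsum [::] = fun _ => 0); [exact: l2P_cst|apply/funext => w; rewrite /wsum big_nil].
have [hp hpts] := pts_in_cons h.
rewrite (_ : wsum (p :: pts) = fun w => p.1.1 * wie p.1.2 p.2 w + wsum pts w); last first.
  by apply/funext => w; rewrite /wsum big_cons.
by apply: l2PD; [apply: l2PZ; exact: wie_l2P|exact: IH].
Qed.

Lemma wsum_cov pts qts : pts_in T pts -> pts_in T qts -> \int[P]_w (wsum pts w * wsum qts w) =
  cwie * \sum_(p <- pts) \sum_(q <- qts) (p.1.1 * q.1.1 * Num.min p.1.2 q.1.2 * ip p.2 q.2).
Proof.
move=> hp hq; elim: pts hp => [|p pts IH] hp.
  rewrite big_nil mulr0 (_ : (fun w => _) = (fun _ => 0)); first by rewrite /Rintegral integral0.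
  by apply/funext => w; rewrite /wsum big_nil mul0r.
have [hp1 hp2] := pts_in_cons hp.
rewrite (_ : (fun w => wsum (p :: pts) w * wsum qts w) = (fun w => p.1.1 * (wie p.1.2 p.2 w * wsum qts w) + wsum pts w * wsum qts w)); last first.
  by apply/funext => w; rewrite {1}/wsum big_cons -/(wsum pts w); ring.
have i1 : P.-integrable setT (EFin \o (fun w => wie p.1.2 p.2 w * wsum qts w)).
  by apply: l2P_mul; [exact: wie_l2P|exact: wsum_l2P].
have i2 : P.-integrable setT (EFin \o (fun w => p.1.1 * (wie p.1.2 p.2 w * wsum qts w))).
  rewrite (_ : EFin \o _ = (fun w => (p.1.1)%:E * (wie p.1.2 p.2 w * wsum qts w)%:E)%E); first exact: integrableZl.
  by apply/funext => w; rewrite /= EFinM.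
rewrite RintegralD//; last by apply: l2P_mul; exact: wsum_l2P.
rewrite RintegralZl// IH// big_cons mulrDr; congr (_ + _).
elim: qts hq {IH i1 i2} => [|q qts IHq] hq.
  rewrite big_nil mulr0 (_ : (fun w => _) = (fun _ => 0)); first by rewrite /Rintegral integral0 mulr0.
  by apply/funext => w; rewrite /wsum big_nil mulr0.
have [hq1 hq2] := pts_in_cons hq.
rewrite (_ : (fun w => _) = (fun w => q.1.1 * (wie p.1.2 p.2 w * wie q.1.2 q.2 w) + wie p.1.2 p.2 w * wsum qts w)); last first.
  by apply/funext => w; rewrite {1}/wsum big_cons -/(wsum qts w); ring.
have j1 : P.-integrable setT (EFin \o (fun w => wie p.1.2 p.2 w * wie q.1.2 q.2 w)).
  by apply: l2P_mul; exact: wie_l2P.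
have j2 : P.-integrable setT (EFin \o (fun w => q.1.1 * (wie p.1.2 p.2 w * wie q.1.2 q.2 w))).
  rewrite (_ : EFin \o _ = (fun w => (q.1.1)%:E * (wie p.1.2 p.2 w * wie q.1.2 q.2 w)%:E)%E); first exact: integrableZl.
  by apply/funext => w; rewrite /= EFinM.
rewrite RintegralD//; last by apply: l2P_mul; [exact: wie_l2P|exact: wsum_l2P].
rewrite mulrDr IHq// big_cons mulrDr; congr (_ + _).
by rewrite RintegralZl// wie_cov//; ring.
Qed.

End Isometry.

Section IsometryR.
Context {R : realType}.

Lemma int_min (t a b : R) : 0 <= a <= t -> 0 <= b <= t ->
  \int[leb]_(x in `[0, t]) (((x <= a)%R)%:R * ((x <= b)%R)%:R) = Num.min a b.
Proof.
move=> /andP[a0 at_] /andP[b0 bt].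
have e : (fun x : R => ((x <= a)%R)%:R * ((x <= b)%R)%:R) = (\1_(`]-oo, Num.min a b]) : R -> R).
  by apply/funext => x; rewrite indicE -natrM mulnb; congr (_%:R); congr nat_of_bool; apply/idP/idP;
    rewrite inE/= in_itv/= le_min.
rewrite e /Rintegral integral_indic//= setIC.
rewrite (_ : `[0, t] `&` `]-oo, Num.min a b] = `[0, Num.min a b])%classic; last first.
  apply/seteqP; split => x /=; rewrite !in_itv/=; first by move=> [/andP[-> _] ->].
  move=> /andP[x0 xm]; rewrite x0 xm; split=> //; apply: (le_trans xm).
  by rewrite ge_min at_.
rewrite lebesgue_measure_itv/= lte_fin; case: ltP => h; first by rewrite oppr0 adde0.
by apply/eqP; rewrite eq_sym eq_le h le_min a0.
Qed.

End IsometryR.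

Section WfunIsometry.
Context {R : realType}.
Local Notation H := (L2 R).

Lemma Rint_sum d (T : measurableType d) (mu : {measure set T -> \bar R}) (D : set T) (I : Type) (r : seq I) (F : I -> T -> R) :
  measurable D -> (forall i, mu.-integrable D (EFin \o F i)) ->
  mu.-integrable D (EFin \o (fun w => \sum_(i <- r) F i w)) /\
  \int[mu]_(w in D) (\sum_(i <- r) F i w) = \sum_(i <- r) \int[mu]_(w in D) F i w.
Proof.
move=> mD iF; elim: r => [|i r [IH1 IH2]].
  rewrite big_nil; have e : (fun w : T => \sum_(i <- [::]) F i w) = (fun _ => 0) by apply/funext => w; rewrite big_nil.
  by rewrite e; split; [exact: integrable0|rewrite /Rintegral integral0].
have e : (fun w => \sum_(j <- i :: r) F j w) = (fun w => F i w + \sum_(j <- r) F j w).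
  by apply/funext => w; rewrite big_cons.
rewrite e big_cons -IH2 RintegralD//; split=> //.
exact: (integrableD _ (iF i) IH1).
Qed.

Lemma measurable_le (a : R) (D : set R) : measurable D -> measurable_fun D (fun x : R => ((x <= a)%R)%:R : R).
Proof.
move=> mD; rewrite (_ : (fun x => _) = (\1_(`]-oo, a]) : R -> R)); first exact: measurable_indic.
by apply/funext => x; rewrite indicE; congr (_%:R); congr nat_of_bool; apply/idP/idP; rewrite inE/= in_itv.
Qed.

Lemma hnorm_wfun (pts : seq (R * R * H)) (x : R) : hnorm (wfun pts x) ^+ 2 =
  \sum_(p <- pts) \sum_(q <- pts) (p.1.1 * q.1.1 * ip p.2 q.2 * (((x <= p.1.2)%R)%:R * ((x <= q.1.2)%R)%:R)).
Proof.
rewrite hnorm2 /wfun; have suml (r : seq (R * R * H)) (F : R * R * H -> H) v : ip (\sum_(p <- r) F p) v = \sum_(p <- r) ip (F p) v.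
  by elim: r => [|p r IH]; rewrite ?big_nil ?ip0l// !big_cons ipDl IH.
rewrite suml; apply: eq_bigr => p _; rewrite ipC suml; apply: eq_bigr => q _.
rewrite ipZl ipZr (ipC q.2); case: (x <= p.1.2); case: (x <= q.1.2); rewrite /= ?mulr1 ?mulr0 ?mul0r ?mul1r//; ring.
Qed.

Lemma integral_wfun (t : R) (pts : seq (R * R * H)) : pts_in t pts ->
  leb.-integrable `[0, t] (EFin \o (fun x => hnorm (wfun pts x) ^+ 2)) /\
  \int[leb]_(x in `[0, t]) (hnorm (wfun pts x) ^+ 2) =
  \sum_(p <- pts) \sum_(q <- pts) (p.1.1 * q.1.1 * Num.min p.1.2 q.1.2 * ip p.2 q.2).
Proof.
move=> hp.
have ii (p q : R * R * H) : leb.-integrable `[0, t] (EFin \o (fun x => p.1.1 * q.1.1 * ip p.2 q.2 * (((x <= p.1.2)%R)%:R * ((x <= q.1.2)%R)%:R))).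
  apply: (@integrable_bdd R 0 t `|p.1.1 * q.1.1 * ip p.2 q.2|).
    by apply: measurable_funM => //; apply: measurable_funM; exact: measurable_le.
  move=> s _; rewrite normrM ler_piMr// -natrM ger0_norm// -[X in _ <= X]/(1%:R) ler_nat.
  by case: (s <= p.1.2); case: (s <= q.1.2).
have inner p := @Rint_sum _ _ leb `[0, t]%classic _ pts (fun q x => p.1.1 * q.1.1 * ip p.2 q.2 * (((x <= p.1.2)%R)%:R * ((x <= q.1.2)%R)%:R)) (measurable_itv _) (ii p).
have outer := @Rint_sum _ _ leb `[0, t]%classic _ pts _ (measurable_itv _) (fun p => (inner p).1).
rewrite (_ : (fun x => hnorm (wfun pts x) ^+ 2) = (fun x => \sum_(p <- pts) \sum_(q <- pts) (p.1.1 * q.1.1 * ip p.2 q.2 * (((x <= p.1.2)%R)%:R * ((x <= q.1.2)%R)%:R)))); last first.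
  by apply/funext => x; exact: hnorm_wfun.
split; first exact: outer.1.
rewrite outer.2 big_seq [RHS]big_seq; apply: eq_bigr => p pp.
rewrite (inner p).2 big_seq [RHS]big_seq; apply: eq_bigr => q qq.
rewrite RintegralZl//; last first.
  apply: (@integrable_bdd R 0 t 1).
    by apply: measurable_funM; exact: measurable_le.
  move=> s _; rewrite -natrM ger0_norm// -[X in _ <= X]/(1%:R) ler_nat.
  by case: (s <= p.1.2); case: (s <= q.1.2).
by rewrite int_min; [ring|exact: hp|exact: hp].
Qed.

Lemma wsum_isometry d (Omega : measurableType d) (P : probability Omega R) (T t : R) (W : R -> H -> Omega -> R) pts :
  0 < T -> cylindrical_wiener P T W -> t <= T -> pts_in t pts ->
  \int[P]_w (wsum W pts w ^+ 2) = cwie P T W * \int[leb]_(x in `[0, t]) (hnorm (wfun pts x) ^+ 2).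
Proof.
move=> T0 hW tT hp; have hT : pts_in T pts.
  by move=> p /hp /andP[-> h]; rewrite (le_trans h).
by rewrite (integral_wfun hp).2 -(wsum_cov T0 hW hT hT).
Qed.

End WfunIsometry.

(** * Chaining over dyadic times *)

Section Chaining.
Context {R : realType}.

Let dy (T : R) n i : R := T * (i%:R / 2 ^+ n).

(** Each time is reached from its dyadic floor by a telescoping sum with ratio a = 2^(-al), which
    costs c = a / (1 - a); two such sums and one middle step give the factor 1 + 2 c. *)
Lemma chaining (al T : R) : 0 < al -> 0 < T -> exists2 C : R, 0 < C & forall (f : R -> R) (M : R),
  {within `[0, T], continuous f} -> 0 <= M ->
  (forall n i, (i < 2 ^ n)%N -> `|f (dy T n i.+1) - f (dy T n i)| <= M * (2^-1 `^ al) ^+ n) ->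
  forall s t, 0 <= s <= T -> 0 <= t <= T -> `|f t - f s| <= C * M * `|t - s| `^ al.
Proof.
move=> al0 T0; have [a aE] : exists a : R, a = 2^-1 `^ al by eexists.
have a0 : 0 < a by rewrite aE powR_gt0.
have a1 : a < 1.
  have h := congr1 (fun g => g al) (@powR1 R); rewrite aE -[ltRHS]h.
  by apply: gt0_ltr_powR; rewrite ?nnegrE ?invr_ge0// invf_lt1// ltr1n.
have q0 : 0 < 1 - a by rewrite subr_gt0.
pose c := a / (1 - a); have c0 : 0 < c by rewrite divr_gt0.
have cE : c * (1 - a) = a by rewrite divfK// gt_eqF.
exists ((1 + 2 * c) * (2 / T) `^ al); first by rewrite mulr_gt0 ?powR_gt0 ?divr_gt0// addr_gt0// mulr_gt0.
move=> f M cf M0 hf; rewrite -aE in hf.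
have p2 n : 0 < 2 ^+ n :> R by rewrite exprn_gt0.
pose ix n (t : R) := Num.truncn (2 ^+ n * (t / T)).
have ixP n (t : R) : 0 <= t -> (ix n t)%:R <= 2 ^+ n * (t / T) < (ix n t).+1%:R.
  by move=> t0; apply: Num.Theory.truncn_itv; rewrite mulr_ge0 ?divr_ge0// ltW.
have ix2 n (t : R) : 0 <= t <= T -> (ix n t <= 2 ^ n)%N.
  move=> /andP[t0 tT]; rewrite -(ler_nat R) natrX; have /andP[h _] := ixP n t t0.
  by apply: (le_trans h); rewrite ler_piMr ?(ltW (p2 n))// ler_pdivrMr// mul1r.
(* The dyadic floor at level n + 1 has index 2 i or 2 i + 1 when the one at level n has index i. *)
have step n (t : R) : 0 <= t <= T -> `|f (dy T n.+1 (ix n.+1 t)) - f (dy T n (ix n t))| <= M * a ^+ n.+1.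
  move=> tT; have /andP[t0 _] := tT.
  have /andP[h1 h2] := ixP n t t0; have /andP[h3 h4] := ixP n.+1 t t0.
  have g1 : ((ix n t).*2 <= ix n.+1 t)%N.
    rewrite Num.Theory.truncn_ge_nat; last by rewrite mulr_ge0 ?divr_ge0// ltW.
    by rewrite -muln2 natrM exprS; lra.
  have g2 : (ix n.+1 t < (ix n t).*2.+2)%N.
    rewrite Num.Theory.truncn_lt_nat; last by rewrite mulr_ge0 ?divr_ge0// ltW.
    by rewrite -doubleS -muln2 natrM exprS; lra.
  have dE : dy T n (ix n t) = dy T n.+1 (ix n t).*2.
    by rewrite /dy -muln2 natrM exprS; field; rewrite gt_eqF.
  rewrite dE; case: (ltngtP (ix n t).*2 (ix n.+1 t)) g1 => // [g3|e] _; last first.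
    by rewrite e subrr normr0 mulr_ge0// exprn_ge0// ltW.
  have e : ix n.+1 t = (ix n t).*2.+1 by apply/eqP; rewrite eqn_leq g3 -ltnS g2.
  by rewrite e; apply: hf; have := ix2 n.+1 t tT; rewrite e.
have tele n m (t : R) : 0 <= t <= T -> `|f (dy T (n + m)%N (ix (n + m)%N t)) - f (dy T n (ix n t))| <= M * c * (a ^+ n - a ^+ (n + m)%N).
  move=> tT; elim: m => [|m IH].
    by rewrite !addn0 !subrr normr0 mulr0.
  rewrite addnS; apply: (le_trans (ler_distD (f (dy T (n + m)%N (ix (n + m)%N t))) _ _)).
  apply: (le_trans (lerD (step _ _ tT) IH)).
  rewrite exprS; apply: eq_ler.
  rewrite -[X in M * (X * _)]cE; ring.
have lim n (t : R) : 0 <= t <= T -> `|f t - f (dy T n (ix n t))| <= M * c * a ^+ n.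
  move=> tT; have /andP[t0 tT'] := tT; apply/ler_addgt0Pr => e e0.
  have [d d0 hd] : exists2 d, 0 < d & forall u, 0 <= u <= T -> `|u - t| < d -> `|f t - f u| <= e.
    have tin : `[0, T]%classic t by rewrite /= in_itv/= tT.
    have /cvgrPdist_le/(_ e e0) := (subspace_continuousP _ _).1 cf t tin.
    rewrite near_withinE => /nbhs_ballP[d /= d0 hd].
    exists d => // u uT ud; apply: hd; last by rewrite in_itv.
    by rewrite -ball_normE/= distrC.
  have [m hm] : exists m : nat, T / d < 2 ^+ (n + m)%N.
    exists (Num.bound (T / d)); apply: lt_le_trans (archi_boundP _) _; first by rewrite divr_ge0// ltW.
    rewrite -natrX ler_nat; apply: (leq_trans (ltnW (ltn_expl _ (ltnSn 1)))).
    by rewrite leq_exp2l// leq_addl.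
  apply: (le_trans (ler_distD (f (dy T (n + m)%N (ix (n + m)%N t))) _ _)); rewrite addrC; apply: lerD.
    apply: (le_trans (tele n m t tT)); apply: ler_wpM2l; first by rewrite mulr_ge0// ltW.
    by rewrite gerBl exprn_ge0// ltW.
  have /andP[h1 h2] := ixP (n + m)%N t t0.
  have uE : dy T (n + m)%N (ix (n + m)%N t) * 2 ^+ (n + m)%N = T * (ix (n + m)%N t)%:R.
    by rewrite /dy; field; rewrite gt_eqF.
  have tE : T * (2 ^+ (n + m)%N * (t / T)) = t * 2 ^+ (n + m)%N by field; rewrite gt_eqF.
  have u0 : 0 <= dy T (n + m)%N (ix (n + m)%N t) by rewrite mulr_ge0 ?(ltW T0)// divr_ge0// ltW.
  have ut : dy T (n + m)%N (ix (n + m)%N t) <= t.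
    by rewrite -(ler_pM2r (p2 (n + m)%N)) uE -tE ler_wpM2l// ltW.
  apply: hd; first by rewrite u0 (le_trans ut).
  rewrite distrC ger0_norm ?subr_ge0// -(ltr_pM2r (p2 (n + m)%N)) mulrBl uE -tE -mulrBr.
  apply: (@lt_trans _ _ (T * 1)); first by rewrite ltr_pM2l// ltrBlDr addrC natr1.
  by rewrite mulr1 mulrC -ltr_pdivrMr.
have main (s t : R) : 0 <= s -> s < t -> t <= T -> `|f t - f s| <= (1 + 2 * c) * (2 / T) `^ al * M * (t - s) `^ al.
  move=> s0 st tT; have ts0 : 0 < t - s by rewrite subr_gt0.
  have sT : 0 <= s <= T by rewrite s0 (le_trans (ltW st)).
  have t0T : 0 <= t <= T by rewrite tT (le_trans s0 (ltW st)).
  (* The least such level satisfies t - s <= T / 2^n as well, so the dyadic floors of s and t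
     coincide or are adjacent, while 2^(-n) is at most 2 (t - s) / T. *)
  have ex : exists n, T / 2 ^+ n.+1 < t - s.
    exists (Num.bound (T / (t - s))); rewrite ltr_pdivrMr// -ltr_pdivrMl// mulrC.
    apply: lt_le_trans (archi_boundP _) _; first by rewrite divr_ge0// ltW.
    by rewrite -natrX ler_nat; apply: (leq_trans (ltnW (ltn_expl _ (ltnSn 1)))); rewrite leq_exp2l.
  case: (ex_minnP ex) => n hn hmin.
  have hn2 : t - s <= T / 2 ^+ n.
    case: n hn hmin => [|n] hn hmin; first by rewrite expr0 divr1; lra.
    by rewrite leNgt; apply/negP => /hmin; rewrite ltnn.
  have /andP[i1 i2] := ixP n s s0; have /andP[j1 j2] := ixP n t (le_trans s0 (ltW st)).
  have d1 : 2 ^+ n * (t / T) - 2 ^+ n * (s / T) <= 1.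
    rewrite -mulrBr -mulrBl mulrA ler_pdivrMr// mul1r mulrC -ler_pdivlMr//.
  have ij : (ix n s <= ix n t)%N.
    by apply: Num.Theory.le_truncn; rewrite ler_wpM2l ?(ltW (p2 n))// ler_wpM2r ?invr_ge0 ?(ltW T0)// ltW.
  have ji : (ix n t < (ix n s).+2)%N.
    rewrite -(ltr_nat R) -natr1; move: i2 j1 d1; rewrite -natr1; lra.
  have mid : `|f (dy T n (ix n t)) - f (dy T n (ix n s))| <= M * a ^+ n.
    case: (ltngtP (ix n s) (ix n t)) ij => // [g|e] _; last by rewrite e subrr normr0 mulr_ge0// exprn_ge0// ltW.
    have e : ix n t = (ix n s).+1 by apply/eqP; rewrite eqn_leq g -ltnS ji.
    by rewrite e; apply: hf; apply: leq_trans (ix2 n t t0T); rewrite e.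
  have an : a ^+ n <= (2 / T) `^ al * (t - s) `^ al.
    rewrite -powRM ?divr_ge0 ?(ltW T0) ?(ltW ts0)// aE -powR_mulrn// -powRrM mulrC powRrM.
    apply: ge0_powR_le; rewrite ?(ltW al0)//.
    rewrite powR_mulrn// exprVn.
    move: hn; rewrite exprS ltr_pdivrMr// => hn.
    rewrite -[leLHS]div1r ler_pdivrMr// -(ler_pM2l T0) mulr1.
    have -> : T * (2 / T * (t - s) * 2 ^+ n) = (t - s) * (2 * 2 ^+ n) by field; rewrite gt_eqF.
    exact: ltW.
  apply: (@le_trans _ _ (M * (1 + 2 * c) * a ^+ n)).
    apply: (le_trans (ler_distD (f (dy T n (ix n t))) _ _)).
    apply: (le_trans (lerD (lim n t t0T) (ler_distD (f (dy T n (ix n s))) _ _))).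
    have h : `|f (dy T n (ix n s)) - f s| <= M * c * a ^+ n by rewrite distrC; exact: lim.
    apply: (@le_trans _ _ (M * c * a ^+ n + (M * a ^+ n + M * c * a ^+ n))).
      by rewrite lerD2l; exact: lerD.
    by apply: eq_ler; ring.
  apply: (le_trans (ler_wpM2l _ an)); first by rewrite mulr_ge0// addr_ge0// mulr_ge0// ltW.
  by apply: eq_ler; ring.
move=> s t /andP[s0 sT] /andP[t0 tT]; case: (ltgtP s t) => [st|ts|->].
- by rewrite [`|t - s|]ger0_norm ?subr_ge0 ?(ltW st)//; exact: main.
- by rewrite distrC [`|t - s|]distrC [`|s - t|]ger0_norm ?subr_ge0 ?(ltW ts)//; exact: main.
- by rewrite !subrr normr0 mulr_ge0// mulr_ge0// mulr_ge0 ?powR_ge0// addr_ge0// mulr_ge0// ltW.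
Qed.

End Chaining.

Section Series.
Context {R : realType}.

Lemma nneseries_le_bound (u : nat -> \bar R) (B : \bar R) : (forall n, (0 <= u n)%E) ->
  (forall N, (\sum_(i < N) u i <= B)%E) -> (\sum_(i <oo) u i <= B)%E.
Proof.
move=> u0 h; apply: lime_le; first by apply: is_cvg_nneseries => n _ _; exact: u0.
by apply: nearW => N /=; rewrite big_mkord.
Qed.

Lemma nneseries_ge_term (u : nat -> \bar R) k : (forall n, (0 <= u n)%E) -> (u k <= \sum_(i <oo) u i)%E.
Proof.
move=> u0; apply: le_trans (nneseries_lim_ge (P := xpredT) (m := 0) k.+1 (fun n _ _ => u0 n)).
by rewrite big_mkord big_ord_recr/= leeDr// sume_ge0.
Qed.

Lemma measurable_nneseries d (T : measurableType d) (u : nat -> T -> \bar R) :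
  (forall n x, (0 <= u n x)%E) -> (forall n, measurable_fun setT (u n)) ->
  measurable_fun setT (fun x => \sum_(i <oo) u i x)%E.
Proof. by move=> u0 mu; exact: ge0_emeasurable_sum. Qed.

End Series.

(** * Moments of the noise bound *)

Section NoiseBound.
Context {R : realType} d (Omega : measurableType d) (P : probability Omega R).
Local Notation H := (L2 R).
Context (T : R) (W : R -> H -> Omega -> R) (al ga : R) (m : nat)
  (T0 : 0 < T) (hW : cylindrical_wiener P T W) (al0 : 0 < al) (ga4 : 4^-1 < ga)
  (m0 : (0 < m)%N) (mal : 2 <= m%:R * (1 - 2 * al)).

Let a : R := 2^-1 `^ al.
Let a0 : 0 < a. Proof. by rewrite powR_gt0. Qed.
Definition dyad n i : R := T * (i%:R / 2 ^+ n).

Definition dyad_incr k n i w := wie W (dyad n i.+1) (en k) w - wie W (dyad n i) (en k) w.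

Definition level k n w : \bar R := (\sum_(i < 2 ^ n) ((dyad_incr k n i w / a ^+ n) ^+ (2 * m))%:E)%E.

Definition rough k w : \bar R := (\sum_(n <oo) level k n w)%E.

(** Dominates the supremum of the normalised dyadic increments, over all levels and modes, by a
    weighted sum of their (2 m)-th powers, whose mean is computable term by term. The weight is
    summable since ga > 1/4. *)
Definition roughness w : \bar R := (\sum_(k <oo) ((lam k `^ (- (2 * ga)))%:E * rough k w))%E.

Lemma dyad_le n i : (i < 2 ^ n)%N -> [/\ 0 <= dyad n i, dyad n i < dyad n i.+1, dyad n i.+1 <= T & dyad n i.+1 - dyad n i = T / 2 ^+ n].
Proof.
move=> i2.
split.
- by rewrite mulr_ge0 ?(ltW T0)// divr_ge0// ltW.
- by rewrite ltr_pM2l// ltr_pM2r// ltr_nat.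
- by rewrite -[leRHS]mulr1 ler_wpM2l ?(ltW T0)// ler_pdivrMr// mul1r -natrX ler_nat.
- by rewrite /dyad -natr1 mulrDl mulrDr addrAC subrr add0r mul1r.
Qed.

Lemma even_ge0 (x : R) : 0 <= x ^+ (2 * m).
Proof. by rewrite exprM exprn_ge0// sqr_ge0. Qed.

Lemma dyad_incr_measurable k n i : (i < 2 ^ n)%N -> measurable_fun setT (dyad_incr k n i).
Proof. by move=> /dyad_le[h1 h2 h3 _]; apply: (wie_incr_measurable T0 hW) => //; exact: ltW. Qed.

Lemma level_ge0 k n w : (0 <= level k n w)%E.
Proof. by apply: sume_ge0 => i _; rewrite lee_fin even_ge0. Qed.

Lemma level_measurable k n : measurable_fun setT (level k n).
Proof.
apply: emeasurable_sum => i; apply/measurable_EFinP; apply: measurable_funX.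
by apply: measurable_funM => //; apply: dyad_incr_measurable.
Qed.

Lemma rough_ge0 k w : (0 <= rough k w)%E.
Proof. by apply: nneseries_ge0 => n _ _; exact: level_ge0. Qed.

Lemma rough_measurable k : measurable_fun setT (rough k).
Proof. by apply: measurable_nneseries => [n x|n]; [exact: level_ge0|exact: level_measurable]. Qed.

Lemma term_ge0 k w : (0 <= (lam k `^ (- (2 * ga)))%:E * rough k w)%E.
Proof. by rewrite mule_ge0 ?lee_fin ?powR_ge0 ?rough_ge0. Qed.

Lemma roughness_ge0 w : (0 <= roughness w)%E.
Proof. by apply: nneseries_ge0 => n _ _; exact: term_ge0. Qed.

Lemma roughness_measurable : measurable_fun setT roughness.
Proof.
apply: measurable_nneseries => [n x|n]; first exact: term_ge0.
apply: emeasurable_funM; [exact: measurable_cst|exact: rough_measurable].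
Qed.

(** Ratio of consecutive levels: twice as many increments, each with variance halved and
    normalisation changed by a factor a. The condition m (1 - 2 al) >= 2 makes it at most 1/2. *)
Lemma powR_half_le : 2 * 2^-1 ^+ m * (a ^- (2 * m)) <= 2^-1.
Proof.
have e : 2^-1 ^+ m * (a ^- (2 * m)) = 2^-1 `^ (m%:R * (1 - 2 * al)).
  rewrite mulrBr mulr1 powRB; last by apply/implyP => _; rewrite invr_eq0 pnatr_eq0.
  rewrite powR_mulrn//; congr (_ / _).
  by rewrite mulrA [X in _ `^ X]mulrC powRrM (mulrC m%:R) -natrM powR_mulrn// ltW.
rewrite -mulrA e.
have h : 2^-1 `^ (m%:R * (1 - 2 * al)) <= 2^-1 `^ 2 :> R.
  by apply: powR_le1_decr => //; rewrite ?invr_gt0 ?ltr0n//= invf_le1// ler1n.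
have e2 : 2^-1 `^ 2 = 2^-1 * 2^-1 :> R by rewrite -[2]/(2%:R) powR_mulrn// expr2.
by move: h; rewrite e2; lra.
Qed.

Lemma roughness_integral : exists B : R, (\int[P]_w roughness w <= B%:E)%E.
Proof.
have [C C0 hC] := wie_moment T0 hW m.
have lev k n : (\int[P]_w level k n w <= (C * T ^+ m * 2^-1 ^+ n)%:E)%E.
  rewrite ge0_integral_sum//; last 2 first.
  - move=> i; apply/measurable_EFinP; apply: measurable_funX.
    by apply: measurable_funM => //; apply: dyad_incr_measurable.
  - by move=> i w _; rewrite lee_fin even_ge0.
  have one (i : 'I_(2 ^ n)) : (\int[P]_w ((dyad_incr k n i w / a ^+ n) ^+ (2 * m))%:E <= ((a ^+ n) ^- (2 * m) * (C * (T / 2 ^+ n) ^+ m))%:E)%E.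
    have [h1 h2 h3 h4] := dyad_le (ltn_ord i).
    under eq_integral do rewrite exprMn exprVn mulrC EFinM.
    rewrite ge0_integralZl//; last 3 first.
    - by apply/measurable_EFinP; apply: measurable_funX; apply: dyad_incr_measurable.
    - by move=> w _; rewrite lee_fin even_ge0.
    - by rewrite lee_fin invr_ge0 even_ge0.
    rewrite EFinM lee_wpmul2l ?lee_fin ?invr_ge0 ?even_ge0//.
    have := hC _ _ (en k) h1 h2 h3 (en_neq0 k); rewrite h4 hnorm2 en_orth eqxx mulr1.
    exact.
  apply: (le_trans (lee_sum _ (fun i _ => one i))).
  rewrite sumEFin lee_fin sumr_const card_ord -[_ *+ (2 ^ n)%N]mulr_natl natrX.
  have -> : 2 ^+ n * ((a ^+ n) ^- (2 * m) * (C * (T / 2 ^+ n) ^+ m)) = C * T ^+ m * (2 * 2^-1 ^+ m * a ^- (2 * m)) ^+ n.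
    have e1 : (a ^+ n) ^+ (2 * m) = (a ^+ (2 * m)) ^+ n by rewrite -!exprM mulnC.
    have e2 : (T / 2 ^+ n) ^+ m = T ^+ m * (2^-1 ^+ m) ^+ n.
      by rewrite exprMn; congr (_ * _); rewrite -exprVn -!exprM mulnC.
    rewrite e1 e2; move: (2^-1 ^+ m) (a ^+ (2 * m)) (T ^+ m) => y z u.
    by rewrite !exprMn exprVn; move: (2 ^+ n) (y ^+ n) (z ^+ n)^-1 => x1 x2 x3; ring.
  rewrite ler_wpM2l ?mulr_ge0 ?(ltW C0) ?exprn_ge0 ?(ltW T0)//.
  by rewrite lerXn2r ?nnegrE ?invr_ge0 ?powR_half_le// !mulr_ge0 ?exprn_ge0 ?invr_ge0 ?exprn_ge0// ltW.
have ro k : (\int[P]_w rough k w <= (C * T ^+ m * 2)%:E)%E.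
  rewrite integral_nneseries//; last 2 first.
  - by move=> n; exact: level_measurable.
  - by move=> n w _; exact: level_ge0.
  apply: nneseries_le_bound => [n|N]; first by apply: integral_ge0 => w _; exact: level_ge0.
  apply: (@le_trans _ _ (\sum_(i < N) (C * T ^+ m * 2^-1 ^+ i)%:E)%E); first by apply: lee_sum => i _; exact: lev.
  rewrite sumEFin lee_fin -mulr_sumr ler_wpM2l ?mulr_ge0 ?(ltW C0) ?exprn_ge0 ?(ltW T0)//.
  suff -> : \sum_(i < N) 2^-1 ^+ i = 2 - 2 * 2^-1 ^+ N :> R by rewrite gerBl mulr_ge0 ?exprn_ge0 ?invr_ge0.
  elim: N => [|N IH]; first by rewrite big_ord0 expr0; lra.
  by rewrite big_ord_recr/= IH exprS; lra.
have [|L L0 hL] := @lam_series R (- (2 * ga)); first by move: ga4; lra.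
exists (L * (C * T ^+ m * 2)); rewrite integral_nneseries//; last 2 first.
- by move=> n; apply: emeasurable_funM; [exact: measurable_cst|exact: rough_measurable].
- by move=> n w _; exact: term_ge0.
apply: nneseries_le_bound => [n|N]; first by apply: integral_ge0 => w _; exact: term_ge0.
apply: (@le_trans _ _ (\sum_(k < N) (lam k `^ (- (2 * ga)) * (C * T ^+ m * 2))%:E)%E).
  apply: lee_sum => k _; rewrite ge0_integralZl//; last 3 first.
  - exact: rough_measurable.
  - by move=> w _; exact: rough_ge0.
  - by rewrite lee_fin powR_ge0.
  by rewrite EFinM lee_wpmul2l ?lee_fin ?powR_ge0.
rewrite sumEFin lee_fin -mulr_suml ler_wpM2r// !mulr_ge0 ?(ltW C0) ?exprn_ge0 ?(ltW T0)//.
Qed.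

Lemma roughness_fin : {ae P, forall w, roughness w < +oo}%E.
Proof.
have [B hB] := roughness_integral.
have : P.-integrable setT roughness.
  apply/integrableP; split; first exact: roughness_measurable.
  rewrite (eq_integral roughness); last by move=> w _; rewrite gee0_abs// roughness_ge0.
  by apply: le_lt_trans hB _; exact: ltry.
move=> /(integrable_ae measurableT); apply: aeS => w /(_ Logic.I).
by rewrite ge0_fin_numE ?roughness_ge0.
Qed.

(** Time is clamped to [0, T], so that the path is Hoelder continuous on the whole line and vanishes
    at negative times, as [noise] demands. *)
Definition bm (w : Omega) (k : nat) (t : R) : R := wie W (Num.min (Num.max t 0) T) (en k) w.

(* [x^2 <= S + x^(2m) / S^(m-1)] makes the Hoelder constants square summable against the weights. *)
Lemma bm_noise : exists C : R, 0 < C /\ forall w, (roughness w < +oo)%E ->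
  (forall k, {within `[0, T], continuous (fun t => W t (en k) w)}) ->
  exists K, [/\ 0 <= K, noise al ga K (bm w) & K ^+ (2 * m) <= C * (1 + fine (roughness w))].
Proof.
have [c c0 hc] := @chaining R al T al0 T0.
have [|L L0 hL] := @lam_series R (- (2 * ga)); first by move: ga4; lra.
exists ((c ^+ 2 * (L + 1)) ^+ m); split.
  by rewrite exprn_gt0// mulr_gt0 ?exprn_gt0// addr_gt0.
move=> w fw cw; set K := fine (roughness w).
have KE : roughness w = K%:E by rewrite fineK// ge0_fin_numE ?roughness_ge0.
have K0 : 0 <= K by rewrite fine_ge0// roughness_ge0.
have lp k : 0 < lam k `^ (- (2 * ga)) by rewrite powR_gt0 ?lam_gt0.
have rf k : (rough k w < +oo)%E.
  rewrite ltey; apply/eqP => e; have := nneseries_ge_term k (term_ge0^~ w).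
  by rewrite -/(roughness w) KE e gt0_muley ?lte_fin// leye_eq.
pose Q k := fine (rough k w).
have QE k : rough k w = (Q k)%:E by rewrite fineK// ge0_fin_numE ?rough_ge0.
have Q0 k : 0 <= Q k by rewrite fine_ge0// rough_ge0.
have sumQ N : \sum_(k < N) lam k `^ (- (2 * ga)) * Q k <= K.
  have := nneseries_lim_ge (P := xpredT) (m := 0) N (fun n _ _ => term_ge0 n w).
  rewrite -/(roughness w) KE big_mkord; under eq_bigr do rewrite QE -EFinM.
  by rewrite sumEFin lee_fin.
(* Balances the two parts of [M2]: their weighted sums are at most L S and K / S^(m-1) <= S. The (2
   m)-th power of the resulting noise bound is then linear in the roughness. *)
pose S := (1 + K) `^ (m%:R^-1); have S1 : 0 < S by rewrite powR_gt0// ltr_wpDr.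
have Sm : S ^+ m = 1 + K.
  by rewrite -powR_mulrn ?powR_ge0// -powRrM mulVf ?pnatr_eq0 -?lt0n// powRr1// addr_ge0.
have SmE : S ^+ m.-1 * S = 1 + K by rewrite -Sm -{2}(prednK m0) exprSr.
have Sp : 0 < S ^+ m.-1 by rewrite exprn_gt0.
pose M2 k := S + Q k / S ^+ m.-1.
have M20 k : 0 <= M2 k by rewrite addr_ge0 ?(ltW S1)// divr_ge0// ltW.
pose M k := Num.sqrt (M2 k).
have incr k n i : (i < 2 ^ n)%N -> `|wie W (dyad n i.+1) (en k) w - wie W (dyad n i) (en k) w| <= M k * a ^+ n.
  move=> i2; have an : 0 < a ^+ n by rewrite exprn_gt0.
  rewrite -ler_pdivrMr// -[a ^+ n]gtr0_norm// -normf_div -sqrtr_sqr; apply: ler_wsqrtr.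
  set x := _ / _; have xQ : x ^+ (2 * m) <= Q k.
    rewrite -lee_fin -QE; apply: le_trans (nneseries_ge_term n (level_ge0 k^~ w)).
    rewrite /level (bigD1 (Ordinal i2))//= leeDl//.
    by apply: sume_ge0 => j _; rewrite lee_fin even_ge0.
  have [xS|Sx] := leP (x ^+ 2) S; first by rewrite (le_trans xS)// lerDl divr_ge0// ltW.
  apply: (@le_trans _ _ (Q k / S ^+ m.-1)); last by rewrite lerDr ltW.
  rewrite ler_pdivlMr//; apply: le_trans xQ; rewrite exprM; move: Sx; move: (x ^+ 2) => y Sy; rewrite -[in leRHS](prednK m0) exprS.
  have y0 : 0 <= y by rewrite (le_trans (ltW S1))// ltW.
  by rewrite ler_wpM2l// lerXn2r ?nnegrE ?(ltW S1)// ltW.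
have cwie k : {within `[0, T], continuous (fun t => wie W t (en k) w)}.
  move=> t; apply: cvgB; [exact: cw|exact: cvg_cst].
have cl := clampP (ltW T0).
exists (c * Num.sqrt ((L + 1) * S)); split.
- by rewrite mulr_ge0 ?(ltW c0)// sqrtr_ge0.
- exists (fun k => c * M k); split.
  + move=> k t t0; rewrite /bm max_r// min_l ?(ltW T0)//; exact: wie0.
  + move=> k s t; apply: (le_trans (hc _ _ (cwie k) (sqrtr_ge0 _) (incr k) _ _ (cl s) (cl t))).
    rewrite ler_wpM2l ?mulr_ge0 ?(ltW c0)//.
    by apply: ge0_powR_le; rewrite ?(ltW al0)//; exact: clamp_lip.
  + split; first by rewrite mulr_ge0 ?(ltW c0)// sqrtr_ge0.
    move=> N; rewrite exprMn sqr_sqrtr ?mulr_ge0 ?(ltW S1) ?addr_ge0 ?(ltW L0)//.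
    have e k : (c * M k * lam k `^ (- ga)) ^+ 2 = c ^+ 2 * (S * lam k `^ (- (2 * ga)) + (S ^+ m.-1)^-1 * (lam k `^ (- (2 * ga)) * Q k)).
      rewrite 2!exprMn sqr_sqrtr// -[(lam k `^ _) ^+ 2]powR_mulrn ?powR_ge0// -powRrM mulNr [ga * _]mulrC /M2.
      by move: (lam k `^ _) (S ^+ m.-1)^-1 => x y; ring.
    under eq_bigr do rewrite e.
    rewrite -mulr_sumr ler_wpM2l ?sqr_ge0// big_split/= -!mulr_sumr [X in _ <= X]mulrDl mul1r; apply: lerD.
      by rewrite [leRHS]mulrC ler_wpM2l ?(ltW S1)//; exact: hL.
    rewrite [leLHS]mulrC ler_pdivrMr// [leRHS]mulrC SmE; apply: (le_trans (sumQ N)).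
    by rewrite lerDr.
- rewrite exprM [(c * _) ^+ 2]exprMn sqr_sqrtr ?mulr_ge0 ?(ltW S1) ?addr_ge0 ?(ltW L0)//.
  by rewrite mulrA exprMn Sm.
Qed.

End NoiseBound.

(** * Measurability through coordinates *)

Section Measurability.
Context {R : realType}.
Local Notation H := (L2 R).

Lemma hnorm_en k : hnorm (en k : H) = 1.
Proof.
apply/eqP; rewrite -(@eqrXn2 _ 2)// ?hnorm_ge0//.
by rewrite hnorm2 en_orth eqxx expr1n.
Qed.

Lemma hnorm_sum (n : nat) (F : nat -> H) : hnorm (\sum_(i < n) F i) <= \sum_(i < n) hnorm (F i).
Proof.
elim: n => [|n IH]; first by rewrite !big_ord0 hnorm0.
by rewrite !big_ord_recr/= (le_trans (hnormD _ _))// lerD2r.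
Qed.

Lemma parseval_hnorm (u : H) : \sum_(i < n) ip (en i) u ^+ 2 @[n --> \oo] --> hnorm u ^+ 2.
Proof.
have h : hnorm (proj n u) @[n --> \oo] --> hnorm u.
  apply/cvg_epsP => e e0; have /cvg_epsP/(_ e e0)[N hN] := @proj_cvg R u.
  exists N => n /hN; rewrite normr_hnorm_sub0//.
  by apply: le_trans; exact: hnorm_tri_abs.
rewrite (_ : (fun n => _) = (fun n => hnorm (proj n u) * hnorm (proj n u))); first by rewrite expr2; exact: cvgM.
by apply/funext => n; rewrite -expr2 projE (hnorm_orth_sum (@en_orth R) n (fun i => ip (en i) u)).
Qed.

Lemma hnorm_measurable d (X : measurableType d) (D : set X) (u : X -> H) : measurable D ->
  (forall k, measurable_fun D (fun x => ip (en k) (u x))) -> measurable_fun D (fun x => hnorm (u x)).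
Proof.
move=> mD mu; have m2 : measurable_fun D (fun x => hnorm (u x) ^+ 2).
  apply: (@measurable_fun_cvg _ _ _ D (fun n x => \sum_(i < n) ip (en i) (u x) ^+ 2)) => [n|x _].
    by apply: measurable_sum => i; apply: measurable_funX; exact: mu.
  exact: parseval_hnorm.
rewrite (_ : (fun x => _) = (fun x => Num.sqrt (hnorm (u x) ^+ 2))); last first.
  by apply/funext => x; rewrite sqrtr_sqr ger0_norm// hnorm_ge0.
apply: (measurableT_comp _ m2); apply: continuous_measurable_fun; exact: sqrt_continuous.
Qed.

Lemma Hnorm_measurable d (X : measurableType d) (D : set X) r (u : X -> H) : measurable D ->
  (forall x, D x -> Hdom r (u x)) ->
  (forall k, measurable_fun D (fun x => ip (en k) (u x))) -> measurable_fun D (fun x => Hnorm r (u x)).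
Proof.
move=> mD du mu; apply: hnorm_measurable => // k.
apply: (eq_measurable_fun (fun x => lam k `^ r * ip (en k) (u x))).
  by move=> x /set_mem Dx; rewrite npow_coord//; exact: du.
by apply: measurable_funM.
Qed.

Lemma Hnorm_dist r (u v w : H) : Hdom r (u - v) -> Hdom r (v - w) ->
  Hdom r (u - w) /\ Hnorm r (u - w) <= Hnorm r (u - v) + Hnorm r (v - w).
Proof.
move=> d1 d2; apply: l2le_Hnorm.
apply: l2le_mono (l2leD (Hnorm_l2le d1 (lexx _)) (Hnorm_l2le d2 (lexx _))) => k.
by rewrite -mulrDr -ipDr addrA subrK.
Qed.

Lemma Hdom_finite r n (c : nat -> R) : Hdom r (\sum_(i < n) c i *: en i).
Proof.
have h (i : 'I_n) : exists A : R, l2le (fun k => lam k `^ r * ip (en k) (c i *: en i)) A.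
  exists (`|lam i `^ r * c i|); split=> // N.
  apply: (@le_trans _ _ (\sum_(k < N) (if (k : nat) == i then (lam i `^ r * c i) ^+ 2 else 0))).
    apply: ler_sum => k _; rewrite ipZr en_orth.
    by case: eqP => [->|_]; rewrite ?mulr1// !mulr0 expr0n.
  rewrite real_normK ?num_real//.
  have [iN|Ni] := ltnP i N.
    rewrite (bigD1 (Ordinal iN))//= eqxx big1 ?addr0// => k kn.
    by rewrite ifF//; apply/negbTE; apply: contra kn => /eqP e; apply/eqP; apply: val_inj.
  rewrite big1 ?sqr_ge0// => k _; rewrite ifF//; apply/negbTE.
  by rewrite neq_ltn (leq_trans (ltn_ord k) Ni).
suff [A hA] : exists A, l2le (fun k => lam k `^ r * ip (en k) (\sum_(i < n) c i *: en i)) A.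
  by have [] := l2le_Hnorm hA.
elim: n h => [|n IH] h.
  exists 0; split=> // N; rewrite expr0n big1// => k _.
  by rewrite big_ord0 ip0r mulr0 expr0n.
have [|A hA] := IH; first by move=> i; exact: (h (widen_ord (leqnSn n) i)).
have [B hB] := h ord_max; exists (A + B); apply: l2le_mono (l2leD hA hB) => k.
by rewrite big_ord_recr/= ipDr mulrDr.
Qed.

Lemma Hdom_opp r (v : H) : Hdom r v -> Hdom r (- v).
Proof.
move=> dv; have := Hnorm_l2le dv (lexx _) => h.
have [] // := @l2le_Hnorm _ r (- v) (Hnorm r v).
by apply: l2le_mono h => k; rewrite ipNr mulrN normrN.
Qed.

Lemma Hdom_add r (u v : H) : Hdom r u -> Hdom r v -> Hdom r (u + v).
Proof.
move=> du dv; have [] // := @l2le_Hnorm _ r (u + v) (Hnorm r u + Hnorm r v).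
apply: l2le_mono (l2leD (Hnorm_l2le du (lexx _)) (Hnorm_l2le dv (lexx _))) => k.
by rewrite ipDr mulrDr.
Qed.

Lemma Hnorm_opp r (u v : H) : Hdom r (u - v) -> Hnorm r (v - u) <= Hnorm r (u - v).
Proof.
move=> dv; apply: (l2le_Hnorm _).2; apply: l2le_mono (Hnorm_l2le dv (lexx _)) => k.
by rewrite -opprB ipNr mulrN normrN.
Qed.

(** A countable set, dense in every H_r; it provides the centres of the balls that exhaust an open
    set. *)
Definition ratvec (q : seq rat) : H := \sum_(i < size q) ratr (q`_i) *: en i.

Lemma Hdom_ratvec r q : Hdom r (ratvec q).
Proof. exact: (Hdom_finite r (size q) (fun i => ratr q`_i)). Qed.

Lemma ratvec_dense r (v : H) e : Hdom r v -> 0 < e -> exists q, Hnorm r (v - ratvec q) < e.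
Proof.
move=> dv e0; have e4 : 0 < e / 4 by rewrite divr_gt0.
have /cvg_epsP/(_ _ e4)[N hN] := @proj_cvg R (npow r v).
have dl i : 0 < e / (4 * N.+1%:R) / lam i `^ r by rewrite !divr_gt0 ?powR_gt0 ?lam_gt0// mulr_gt0// ltr0n.
have /choice[f hf] : forall i, exists q : rat, `|ip (en i) v - ratr q| <= e / (4 * N.+1%:R) / lam i `^ r.
  move=> i; have [|q] := @rat_in_itvoo R (ip (en i) v - e / (4 * N.+1%:R) / lam i `^ r) (ip (en i) v).
    by rewrite ltrBlDr ltrDl.
  rewrite in_itv/= => /andP[q1 q2]; exists q; rewrite ger0_norm ?subr_ge0 ?(ltW q2)//.
  by rewrite lerBlDl -lerBlDr ltW.
exists (mkseq f N); rewrite /Hnorm.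
have dr := Hdom_finite r (size (mkseq f N)) (fun i => ratr (mkseq f N)`_i).
have dd := Hdom_add dv (Hdom_opp dr).
have E : npow r (v - ratvec (mkseq f N)) = (npow r v - proj N (npow r v)) +
    \sum_(i < N) (lam i `^ r * (ip (en i) v - ratr (f i))) *: en i.
  apply: L2_coord_eq => k; rewrite npow_coord// ipBr ipDr ipBr npow_coord// projE /ratvec size_mkseq !ip_sumr.
  have s1 (F : nat -> R) : \sum_(i < N) ip (en k) (F i *: en i) = (if (k < N)%N then F k else 0).
    have [kN|Nk] := ltnP k N; last first.
      by rewrite big1// => i _; rewrite ipZr en_orth gtn_eqF ?mulr0// (leq_trans (ltn_ord i) Nk).
    rewrite (bigD1 (Ordinal kN))//= ipZr en_orth eqxx mulr1 big1 ?addr0// => i ik.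
    rewrite ipZr en_orth; case: eqP => [e'|_]; rewrite ?mulr0//.
    by move: ik; rewrite -(inj_eq val_inj)/= e' eqxx.
  rewrite (s1 (fun i => ip (en i) (npow r v))) (s1 (fun i => lam i `^ r * (ip (en i) v - ratr (f i)))).
  rewrite (eq_bigr (fun i : 'I_N => ip (en k) (ratr (f i) *: en i))); last first.
    by move=> i _; rewrite nth_mkseq.
  rewrite (s1 (fun i => ratr (f i))) npow_coord//; case: ifP => _; ring.
rewrite E; apply: (le_lt_trans (hnormD _ _)).
have h1 : hnorm (npow r v - proj N (npow r v)) <= e / 4.
  by rewrite hnormBC; have := hN N (leqnn _); rewrite normr_hnorm_sub0.
have h2 : hnorm (\sum_(i < N) (lam i `^ r * (ip (en i) v - ratr (f i))) *: en i) <= e / 4.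
  apply: (le_trans (hnorm_sum _ (fun i => (lam i `^ r * (ip (en i) v - ratr (f i))) *: en i))).
  apply: (@le_trans _ _ (\sum_(i < N) e / (4 * N.+1%:R))).
    apply: ler_sum => i _; rewrite hnormZ hnorm_en mulr1 normrM gtr0_norm ?powR_gt0 ?lam_gt0//.
    by rewrite mulrC -ler_pdivlMr ?powR_gt0 ?lam_gt0.
  rewrite sumr_const card_ord -[_ *+ N]mulr_natr invfM mulrA -[leLHS]mulrA ler_piMr ?(ltW e4)//.
  by rewrite mulrC ler_pdivrMr ?ltr0n// mul1r ler_nat.
move: h1 h2 e0; clear; lra.
Qed.

Lemma random_element_coord d (X : measurableType d) (D : set H) (N : H -> R) (Y : X -> H) k C : 0 < C ->
  (forall v w, D v -> D w -> `|ip (en k) (w - v)| <= C * N (w - v)) ->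
  random_element D N Y -> measurable_fun setT (fun w => ip (en k) (Y w)).
Proof.
move=> C0 hC [DY hY] _; apply: (measurability _ (RGenOInfty.measurableE R)) => //.
move=> _ [_ [c ->] <-]; rewrite setTI.
have -> : (fun w => ip (en k) (Y w)) @^-1` `]c, +oo[ = Y @^-1` [set v | D v /\ c < ip (en k) v].
  apply/seteqP; split => w /=; rewrite in_itv/= andbT; last by case.
  by move=> h; split.
apply: hY; split=> [v []//|v [Dv cv]]; exists ((ip (en k) v - c) / C); first by rewrite divr_gt0// subr_gt0.
move=> w Dw; rewrite ltr_pdivlMr// mulrC => h; split=> //.
have := le_lt_trans (hC v w Dv Dw) h; rewrite ipBr ltr_norml => /andP[h1 h2].
by move: h1; clear; lra.
Qed.

(** Norms are measurable as limits of coordinate sums, hence so are preimages of balls; by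
    separability an open set is a countable union of balls with centres [ratvec q] and radii 1 / (n
    + 1). *)
Lemma coord_random_element d (X : measurableType d) r (Y : X -> H) : (forall w, Hdom r (Y w)) ->
  (forall k, measurable_fun setT (fun w => ip (en k) (Y w))) -> random_element (Hdom r) (Hnorm r) Y.
Proof.
move=> dY mY; split=> // U [UD Uo].
(* Selects the balls contained in U; the union below runs over these only. *)
pose gd (q : seq rat) (n : nat) := `[< forall v, Hdom r v -> Hnorm r (v - ratvec q) < n.+1%:R^-1 -> U v >].
pose B (q : seq rat) (n : nat) : set X := if gd q n then [set w | Hnorm r (Y w - ratvec q) < n.+1%:R^-1] else set0.
have dB v q : Hdom r v -> Hdom r (v - ratvec q) by move=> dv; apply: Hdom_add => //; exact/Hdom_opp/Hdom_ratvec.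
have mB q n : measurable (B q n).
  rewrite /B; case: (gd q n) => //.
  have mN : measurable_fun setT (fun w => Hnorm r (Y w - ratvec q)).
    apply: Hnorm_measurable => // [w _|k]; first exact: dB.
    by under eq_fun do rewrite ipBr; exact: measurable_funB.
  have := mN measurableT _ (measurable_itv `]-oo, n.+1%:R^-1[); rewrite setTI.
  by congr measurable; apply/seteqP; split => w /=; rewrite in_itv.
have [pk [upk upkK]] : exists (pk : seq rat -> nat) (upk : nat -> option (seq rat)), forall q, upk (pk q) = Some q.
  by exists pickle, unpickle; exact: pickleK.
have -> : Y @^-1` U = \bigcup_i \bigcup_n (if upk i is Some q then B q n else set0).
  apply/seteqP; split => [w /= Uw|w [i _ [n _]]]; last first.
    case: (upk i) => [q|//]; rewrite /B; case: ifP => // /asboolP h /= hw.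
    exact: h (dY w) hw.
  have [e e0 he] := Uo _ Uw; pose n := Num.bound (2 / e).
  have ne : 2 * n.+1%:R^-1 < e.
    rewrite ltr_pdivrMr// -ltr_pdivrMl// mulrC.
    apply: lt_le_trans (archi_boundP _) _; first by rewrite divr_ge0// ltW.
    by rewrite ler_nat.
  have n0 : 0 < n.+1%:R^-1 :> R by rewrite invr_gt0 ltr0n.
  have [q hq] := ratvec_dense (dY w) n0.
  exists (pk q) => //; exists n => //; rewrite upkK /B ifT//.
  apply/asboolP => v dv hv; apply: he; first exact: dv.
  have dq : Hdom r (ratvec q - Y w) by rewrite -opprB; exact/Hdom_opp/dB.
  have [d1 d2] := Hnorm_dist (dB v q dv) dq.
  apply: (le_lt_trans d2); have := Hnorm_opp (dB _ q (dY w)).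
  move: hq hv ne; move: (Hnorm r (v - ratvec q)) (Hnorm r (Y w - ratvec q)) (Hnorm r (ratvec q - Y w)) n.+1%:R^-1.
  by clear; move=> a b c z; lra.
apply: bigcup_measurable => i _; apply: bigcup_measurable => n _.
by case: (upk i).
Qed.

Lemma Hdom0 : Hdom 0 = setT :> set H.
Proof.
apply/seteqP; split=> // v _.
have [] // := @l2le_Hnorm _ 0 v (hnorm v).
by apply: l2le_mono (hnorm_l2le v) => k; rewrite powRr0 mul1r.
Qed.

Lemma Hnorm0 (v : H) : Hnorm 0 v = hnorm v.
Proof.
have dv : Hdom 0 v by rewrite Hdom0.
by rewrite /Hnorm; congr hnorm; apply: L2_coord_eq => k; rewrite npow_coord// powRr0 mul1r.
Qed.

Lemma random_elementP d (X : measurableType d) (Y : X -> H) :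
  random_element setT (@hnorm R) Y <-> forall k, measurable_fun setT (fun w => ip (en k) (Y w)).
Proof.
split=> [h k|h].
  apply: (random_element_coord (C := 1)) h => // v w _ _.
  by apply: (le_trans (ip_CS _ _)); rewrite hnorm_en.
have := @coord_random_element _ _ 0 Y; rewrite Hdom0 (_ : Hnorm 0 = @hnorm R); last by apply/funext => v; exact: Hnorm0.
exact.
Qed.

End Measurability.

(** * Coordinates of a given stochastic integral *)

Section LimitZero.
Context {R : realType} d (Omega : measurableType d) (P : probability Omega R).

(** Fatou's lemma makes the limes inferior of the squares vanish almost everywhere, which settles
    any pointwise limit without choosing a subsequence. *)
Lemma ae_limit0 (f : nat -> Omega -> R) (eps : nat -> R) : (forall n, measurable_fun setT (f n)) ->
  (forall n, (\int[P]_w (f n w ^+ 2)%:E <= (eps n)%:E)%E) -> eps @ \oo --> (0 : R) ->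
  {ae P, forall w, forall l, f n w @[n --> \oo] --> l -> l = 0}.
Proof.
move=> mf fe e0.
have mf2 n : measurable_fun setT (fun w => (f n w ^+ 2)%:E).
  by apply/measurable_EFinP; apply: measurable_funX.
have f20 n (w : Omega) : setT w -> (0 <= (f n w ^+ 2)%:E)%E by move=> _; rewrite lee_fin sqr_ge0.
pose g w := limn_einf (fun n => (f n w ^+ 2)%:E).
have g0 w : (0 <= g w)%E.
  rewrite /g limn_einf_lim; apply: lime_ge; first exact: is_cvg_einfs.
  by apply: nearW => n; apply: le_ereal_inf_tmp => _ [m /= nm <-]; exact: f20.
have mg : measurable_fun setT g.
  rewrite /g /limn_einf; apply: measurableT_comp => //.
  by apply: measurable_fun_limn_esup => n; apply: measurableT_comp.
have ig : (\int[P]_w `|g w| = 0)%E.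
  apply/eqP; rewrite eq_le; apply/andP; split; last exact: integral_ge0.
  rewrite (eq_integral g); last by move=> w _; rewrite gee0_abs.
  apply: (le_trans (fatou _ measurableT mf2 f20)).
  apply: (@le_trans _ _ (limn_einf (EFin \o eps))).
    rewrite !limn_einf_lim; apply: lee_lim; [exact: is_cvg_einfs|exact: is_cvg_einfs|].
    apply: nearW => n; apply: le_ereal_inf_tmp => _ [m /= nm <-].
    by apply: le_trans (fe m); apply: ereal_inf_lbound; exists m.
  have ce : (EFin \o eps) @ \oo --> 0%:E by apply: cvg_EFin; [exact: nearW|exact: e0].
  by rewrite is_cvg_limn_einfE ?(cvg_lim _ ce)//; apply/cvg_ex; exists 0%:E.
have /(ae_eq_integral_abs _ measurableT mg) := ig; apply: aeS => w /(_ Logic.I) gw l fl.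
have ce : (f n w ^+ 2)%:E @[n --> \oo] --> (l ^+ 2)%:E.
  by apply: cvg_EFin; [exact: nearW|rewrite expr2; under eq_fun do rewrite /= expr2; exact: cvgM].
have : g w = (l ^+ 2)%:E.
  by rewrite /g is_cvg_limn_einfE ?(cvg_lim _ ce)//; apply/cvg_ex; exists (l ^+ 2)%:E.
by rewrite gw => -[] /esym/eqP; rewrite sqrf_eq0 => /eqP.
Qed.

End LimitZero.

Section RiemannOu.
Context {R : realType}.

Lemma sqrD_le (p q r u : R) : q ^+ 2 <= r -> p ^+ 2 <= u -> (q + p) ^+ 2 <= 2 * r + 2 * u.
Proof. by have := sqr_ge0 (p - q); nra. Qed.

(** In one step the old error is multiplied by exp(- l dl) and the new one enters with weight 1 -
    exp(- l dl); this convex combination keeps the bound independent of the number of steps. *)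
Lemma riemann_ou (l al M dl : R) (b : R -> R) : 0 < l -> 0 < al <= 1 -> 0 <= M -> 0 <= dl ->
  (forall s t, `|b t - b s| <= M * `|t - s| `^ al) -> b 0 = 0 -> (forall t, t <= 0 -> b t = 0) ->
  forall m, `|ou l b (m%:R * dl) - \sum_(j < m) expR (- (l * (m%:R * dl - j%:R * dl))) * (b (j.+1%:R * dl) - b (j%:R * dl))| <= M * dl `^ al.
Proof.
move=> l0 al01 M0 d0 hb b0 bn; elim=> [|m IH].
  by rewrite big_ord0 mul0r subr0 ou0// normr0 mulr_ge0 ?powR_ge0.
have m0 : 0 <= m%:R * dl by rewrite mulr_ge0.
have mm : m%:R * dl <= m.+1%:R * dl by rewrite ler_wpM2r// ler_nat.
have st := @ou_step R b M al al01 hb l (m%:R * dl) (m.+1%:R * dl) m0 mm l0.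
have dE : m.+1%:R * dl - m%:R * dl = dl by rewrite -mulrBl -natr1 addrAC subrr add0r mul1r.
rewrite dE in st.
have sE : \sum_(j < m.+1) expR (- (l * (m.+1%:R * dl - j%:R * dl))) * (b (j.+1%:R * dl) - b (j%:R * dl)) =
  expR (- (l * dl)) * (\sum_(j < m) expR (- (l * (m%:R * dl - j%:R * dl))) * (b (j.+1%:R * dl) - b (j%:R * dl)) + (b (m.+1%:R * dl) - b (m%:R * dl))).
  rewrite big_ord_recr/= dE [in RHS]mulrDr [in RHS]mulr_sumr; congr (_ + _).
  apply: eq_bigr => j _; rewrite mulrA -expRD; congr (expR _ * _).
  by rewrite -[in m.+1%:R]natr1; ring.
rewrite sE; set S := \sum_(j < m) _ in IH *.
have -> : ou l b (m.+1%:R * dl) - expR (- (l * dl)) * (S + (b (m.+1%:R * dl) - b (m%:R * dl))) =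
  expR (- (l * dl)) * (ou l b (m%:R * dl) - S) + l * Vint l (fun u => b (m.+1%:R * dl) - b u) (m%:R * dl) (m.+1%:R * dl).
  by move/eqP: st; rewrite subr_eq => /eqP ->; ring.
apply: (le_trans (ler_normD _ _)); rewrite !normrM (gtr0_norm l0) ger0_norm ?expR_ge0//.
have hV : l * `|Vint l (fun u => b (m.+1%:R * dl) - b u) (m%:R * dl) (m.+1%:R * dl)| <= (1 - expR (- (l * dl))) * (M * dl `^ al).
  have cb := hoelder_continuous al01 hb.
  have h : `|Vint l (fun u => b (m.+1%:R * dl) - b u) (m%:R * dl) (m.+1%:R * dl)| <= Vint l (fun _ => M * dl `^ al) (m%:R * dl) (m.+1%:R * dl).
    apply: (@normr_Vint_le _ _ _ _ _ _ (M * dl `^ al)) => //.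
    - apply: continuous_measurable_itv => x; apply: cvgB; [exact: cvg_cst|exact: cb].
    - by move=> x; exact: cvg_cst.
    - move=> s /andP[s1 s2]; apply: (le_trans (hb _ _)); rewrite ler_wpM2l//.
      have /andP[a0 _] := al01; apply: ge0_powR_le; rewrite ?(ltW a0)//.
      by rewrite ger0_norm ?subr_ge0// -[leRHS]dE lerD2l lerN2.
  apply: (le_trans (ler_wpM2l (ltW l0) h)); rewrite Vint_cst// dE.
  by apply: eq_ler; field; rewrite gt_eqF.
apply: (le_trans (lerD (ler_wpM2l (expR_ge0 _) IH) hV)).
by rewrite -mulrDl addrC subrK mul1r.
Qed.

End RiemannOu.

Section StochCoord.
Context {R : realType} d (Omega : measurableType d) (P : probability Omega R).
Local Notation H := (L2 R).
Context (T : R) (W : R -> H -> Omega -> R) (e : nat -> H)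
  (T0 : 0 < T) (hW : cylindrical_wiener P T W) (eE : forall k, e k.+1 = en k).

Lemma cvg_cst_harmonic (c : R) : (fun N : nat => c * N.+1%:R^-1) @ \oo --> (0 : R).
Proof. by rewrite -[X in _ --> X](mulr0 c); apply: cvgM; [exact: cvg_cst|exact: cvg_harmonic]. Qed.

Lemma normr_expRN_sub1 (u : R) : 0 <= u -> `|expR (- u) - 1| <= u.
Proof.
move=> u0; rewrite distrC ger0_norm; last by rewrite subr_ge0 -[leRHS]expR0 ler_expR oppr_le0.
by have := expR_ge1Dx (- u); lra.
Qed.

Lemma lebesgue_measure0t (t : R) : 0 <= t -> leb `[0, t]%classic = t%:E.
Proof.
move=> t0; rewrite lebesgue_measure_itv/= lte_fin; case: ltP => [_|h]; first by rewrite -EFinB subr0.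
by congr EFin; apply/eqP; rewrite eq_le t0 h.
Qed.

Lemma ereal_cvg0_le (u : nat -> \bar R) (c : R) : u @ \oo --> 0%E -> 0 < c -> exists N, forall n, (N <= n)%N -> (u n <= c%:E)%E.
Proof.
move=> /fine_cvgP[[N1 _ fu] /cvg_epsP cu] c0; have [N hN] := cu c c0.
exists (maxn N1 N) => n; rewrite geq_max => /andP[n1 n2].
rewrite -(fineK (fu n n1)) lee_fin; have := hN n n2; rewrite /= subr0.
exact: le_trans (ler_norm _).
Qed.

Lemma wie_diff s t v w : wie W t v w - wie W s v w = W t v w - W s v w.
Proof. by rewrite /wie opprB addrA subrK. Qed.

Definition inc_pts n (c lo hi : nat -> R) (v : nat -> H) : seq (R * R * H) :=
  flatten [seq [:: (c i, hi i, v i); (- c i, lo i, v i)] | i <- iota 0 n].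

Lemma wsum_inc n c lo hi v w : wsum W (inc_pts n c lo hi v) w =
  \sum_(i < n) c i * (wie W (hi i) (v i) w - wie W (lo i) (v i) w).
Proof.
rewrite /wsum /inc_pts big_flatten big_map (_ : iota 0 n = index_iota 0 n) ?big_mkord; last by rewrite /index_iota subn0.
by apply: eq_bigr => i _; rewrite !big_cons big_nil/=; ring.
Qed.

Lemma wfun_inc n c lo hi v x : wfun (inc_pts n c lo hi v) x =
  \sum_(i < n) (c i * (((x <= hi i)%R)%:R - ((x <= lo i)%R)%:R)) *: v i.
Proof.
rewrite /wfun /inc_pts big_flatten big_map (_ : iota 0 n = index_iota 0 n) ?big_mkord; last by rewrite /index_iota subn0.
apply: eq_bigr => i _; rewrite !big_cons big_nil/= addr0 -scalerDl; congr (_ *: _).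
by case: (x <= hi i); case: (x <= lo i); rewrite /=; ring.
Qed.

Lemma inc_in t n c lo hi v : (forall i, (i < n)%N -> 0 <= lo i <= t /\ 0 <= hi i <= t) -> pts_in t (inc_pts n c lo hi v).
Proof.
move=> h p /flattenP[l /mapP[i]]; rewrite mem_iota add0n => /andP[_ /h[h1 h2]] ->.
by rewrite !inE => /orP[] /eqP ->.
Qed.

Definition opp_pts (pts : seq (R * R * H)) : seq (R * R * H) := [seq (- p.1.1, p.1.2, p.2) | p <- pts].

Lemma wsum_opp pts w : wsum W (opp_pts pts) w = - wsum W pts w.
Proof. by rewrite /wsum big_map -sumrN; apply: eq_bigr => p _; rewrite mulNr. Qed.

Lemma wfun_opp pts (x : R) : wfun (opp_pts pts) x = - wfun pts x.
Proof.
rewrite /wfun big_map -sumrN; apply: eq_bigr => p _ /=.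
by case: ifP => _; rewrite ?scaleNr// scale0r oppr0.
Qed.

Lemma opp_in t pts : pts_in t pts -> pts_in t (opp_pts pts).
Proof. by move=> h p /mapP[q /h hq ->]. Qed.

Definition so_pts t (s : step_operator t) (k : nat) :=
  inc_pts (so_size s) (fun i => ip (en k) (so_out s i)) (so_lo s) (so_hi s) (so_arg s).

Lemma so_in t (s : step_operator t) k : pts_in t (so_pts s k).
Proof.
apply: inc_in => i _; have [h1 [h2 h3]] := so_bounds s i.
by rewrite h1 h3 (le_trans h2)// (le_trans h1).
Qed.

Lemma wsum_so t (s : step_operator t) k w : wsum W (so_pts s k) w = ip (en k) (so_integral s W w).
Proof.
rewrite wsum_inc /so_integral ip_sumr; apply: eq_bigr => i _.
by rewrite ipZr wie_diff mulrC.
Qed.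

(** The integrand behind the k-th coordinate of the integral is the adjoint of the step operator
    applied to [en k], that is, its k-th row. *)
Lemma wfun_so t (s : step_operator t) k j x : ip (en j) (wfun (so_pts s k) x) = ip (en k) (so_op s x (en j)).
Proof.
rewrite wfun_inc /so_op !ip_sumr; apply: eq_bigr => i _; rewrite !ipZr (ipC (en j)).
have [_ [h _]] := so_bounds s i.
have -> : \1_(`]so_lo s i, so_hi s i]) x = ((x <= so_hi s i)%R)%:R - ((x <= so_lo s i)%R)%:R :> R.
  rewrite indicE mem_setE in_itv/=; case: (leP x (so_lo s i)) => h1 /=.
    by rewrite (le_trans h1 h) subrr.
  by rewrite subr0.
ring.
Qed.

Section OneCoord.
Context (t : R) (k : nat) (Phi : R -> H -> H) (Y : Omega -> H) (tT : 0 <= t <= T)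
  (Phik : forall x v, 0 <= x <= t -> ip (en k) (Phi x v) = expR (- (lam k * (t - x))) * ip (en k) v).

Let t0 : 0 <= t. Proof. by case/andP: tT. Qed.
Let l0 : 0 < lam k :> R. Proof. exact: lam_gt0. Qed.
Let g (N : nat) (j : nat) : R := expR (- (lam k * (t - j%:R * (t / N%:R)))).

(** The leading point at time 0 adds nothing to the random variable; it gives the integrand its
    correct value at x = 0, which the half-open cells omit. *)
Definition grid_pts N : seq (R * R * H) := (expR (- (lam k * t)), 0, en k) ::
  inc_pts N (g N) (fun j => j%:R * (t / N%:R)) (fun j => j.+1%:R * (t / N%:R)) (fun=> en k).

Lemma grid_le N j : (0 < N)%N -> (j <= N)%N -> 0 <= j%:R * (t / N%:R) <= t.
Proof.
move=> N0 jN; rewrite mulr_ge0 ?divr_ge0//=.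
by rewrite mulrCA ler_piMr// ler_pdivrMr ?ltr0n// mul1r ler_nat.
Qed.

Lemma grid_in N : (0 < N)%N -> pts_in t (grid_pts N).
Proof.
move=> N0 p; rewrite inE => /orP[/eqP ->/=|]; first by rewrite lexx.
by apply: inc_in => i iN; split; apply: grid_le => //; exact: ltnW.
Qed.

Lemma wsum_grid N w : wsum W (grid_pts N) w =
  \sum_(j < N) g N j * (wie W (j.+1%:R * (t / N%:R)) (en k) w - wie W (j%:R * (t / N%:R)) (en k) w).
Proof. by rewrite /wsum big_cons/= wie0 mulr0 add0r -/(wsum W _ w) wsum_inc. Qed.

Lemma wfun_grid N x : (0 < N)%N -> 0 <= x <= t -> exists2 c, wfun (grid_pts N) x = c *: en k &
  `|c - expR (- (lam k * (t - x)))| <= lam k * (t / N%:R).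
Proof.
move=> N0 /andP[x0 xt]; set dl := t / N%:R; have d0 : 0 <= dl by rewrite divr_ge0.
pose c m := (if x <= 0 then expR (- (lam k * t)) else 0) + \sum_(j < m) g N j * (((x <= j.+1%:R * dl)%R)%:R - ((x <= j%:R * dl)%R)%:R).
have cE m : (m <= N)%N -> if x <= m%:R * dl then `|c m - expR (- (lam k * (t - x)))| <= lam k * dl else c m == 0.
  elim: m => [|m IH] mN.
    rewrite mul0r /c big_ord0 addr0; case: (leP x 0) => [x0'|_]; last exact: eqxx.
    have -> : x = 0 by apply/eqP; rewrite eq_le x0 x0'.
    by rewrite subr0 subrr normr0 mulr_ge0// ltW.
  have := IH (ltnW mN); rewrite /c big_ord_recr/= addrA -/(c m).
  have mm : m%:R * dl <= m.+1%:R * dl by rewrite ler_wpM2r// ler_nat.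
  case: (leP x (m%:R * dl)) => h1.
    by rewrite (le_trans h1 mm) subrr mulr0 addr0.
  move=> /eqP ->; case: (leP x (m.+1%:R * dl)) => h2 /=; last by rewrite subrr mulr0 addr0.
  rewrite subr0 mulr1 add0r /g -/dl.
  have -> : expR (- (lam k * (t - m%:R * dl))) = expR (- (lam k * (t - x))) * expR (- (lam k * (x - m%:R * dl))).
    by rewrite -expRD; congr expR; ring.
  rewrite -[X in _ - X]mulr1 -mulrBr normrM ger0_norm ?expR_ge0//.
  have u0 : 0 <= lam k * (x - m%:R * dl) by rewrite mulr_ge0 ?(ltW l0)// subr_ge0 ltW.
  apply: (@le_trans _ _ (1 * (lam k * (x - m%:R * dl)))).
    apply: ler_pM; rewrite ?expR_ge0//.
      by rewrite -expR0 ler_expR oppr_le0 mulr_ge0 ?(ltW l0)// subr_ge0.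
    exact: normr_expRN_sub1.
  rewrite mul1r ler_wpM2l ?(ltW l0)// lerBlDr (le_trans h2)//.
  by rewrite -natr1 mulrDl mul1r addrC.
exists (c N).
  rewrite /wfun big_cons/= -/(wfun _ x) wfun_inc -scaler_suml -scalerDl; congr (_ *: _).
have := cE N (leqnn N); rewrite ifT// /dl mulrCA divff ?mulr1// pnatr_eq0 -lt0n//.
Qed.

Lemma cwie_ge0 : 0 <= cwie P T W.
Proof. by rewrite divr_ge0 ?(ltW T0)//; apply: Rintegral_ge0 => w _; exact: sqr_ge0. Qed.

(** The norm of one row of [Phi] minus the step operator is at most the Hilbert-Schmidt norm;
    replacing the exact row by its grid version adds the first summand. *)
Lemma hs_dist (s : step_operator t) N x : (0 < N)%N -> 0 <= x <= t ->
  ((hnorm (wfun (grid_pts N) x - wfun (so_pts s k) x) ^+ 2)%:E <=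
   (2 * (lam k * (t / N%:R)) ^+ 2)%:E + 2%:E * hs_norm2 e (fun v => (Phi x v - so_op s x v)%R))%E.
Proof.
move=> N0 xt; have [c -> hc] := wfun_grid N0 xt.
set E := hs_norm2 e _; set l := expR (- (lam k * (t - x))) in hc *.
have E0 : (0 <= E)%E by apply: nneseries_ge0 => j _ _; rewrite lee_fin sqr_ge0.
have [Ef|Ei] := boolP (E < +oo)%E; last first.
  by move: Ei; rewrite -leNgt leye_eq => /eqP ->; rewrite gt0_muley ?lte_fin// addey// leey.
have hE : hnorm (l *: en k - wfun (so_pts s k) x) ^+ 2 <= fine E.
  rewrite -[leRHS]sqr_sqrtr ?fine_ge0// lerXn2r ?nnegrE ?sqrtr_ge0//.
  apply: hnorm_le_coord; rewrite// => M; rewrite sqr_sqrtr ?fine_ge0//.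
  rewrite -lee_fin fineK ?ge0_fin_numE// -sumEFin.
  apply: (@le_trans _ _ (\sum_(1 <= j < M.+1) (hnorm (Phi x (e j) - so_op s x (e j)) ^+ 2)%:E)%E).
    rewrite big_add1/= big_mkord; apply: lee_sum => j _; rewrite lee_fin eE.
    rewrite ipBr wfun_so ipZr en_orth.
    have -> : l * ((j : nat) == k)%:R = ip (en k) (Phi x (en j)).
      by rewrite Phik// en_orth eq_sym.
    rewrite -ipBr -[leLHS]real_normK ?num_real// lerXn2r ?nnegrE ?hnorm_ge0//.
    by apply: (le_trans (ip_CS _ _)); rewrite hnorm_en mul1r.
  by apply: nneseries_lim_ge => j _ _; rewrite lee_fin sqr_ge0.
rewrite -(fineK (_ : E \is a fin_num)) ?ge0_fin_numE// -EFinM -EFinD lee_fin.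
have -> : c *: en k - wfun (so_pts s k) x = (c - l) *: en k + (l *: en k - wfun (so_pts s k) x).
  by rewrite scalerBl addrA subrK.
have h1 := hnormD ((c - l) *: en k) (l *: en k - wfun (so_pts s k) x).
rewrite hnormZ hnorm_en mulr1 in h1.
have h2 : hnorm ((c - l) *: en k + (l *: en k - wfun (so_pts s k) x)) ^+ 2 <= (`|c - l| + hnorm (l *: en k - wfun (so_pts s k) x)) ^+ 2.
  by rewrite lerXn2r ?nnegrE ?hnorm_ge0// addr_ge0// hnorm_ge0.
have h3 : `|c - l| ^+ 2 <= (lam k * (t / N%:R)) ^+ 2 by rewrite lerXn2r ?nnegrE// (le_trans _ hc).
apply: (le_trans h2); move: hE h3; move: (hnorm (l *: _ - _)) `|c - l| ((lam k * _) ^+ 2) (fine E) => p q r u.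
by move=> pu qr; exact: sqrD_le.
Qed.

(** Riemann sums on finer grids approach the coordinate of Y in mean square, by the isometry, and
    approach the pathwise process [ou] on every path with a noise bound, by [riemann_ou]. The two
    limits agree almost surely, with a null set independent of K. *)
Lemma stoch_coord al ga : 0 < al <= 1 -> is_stochastic_integral P e W t Phi Y ->
  {ae P, forall w K, noise al ga K (bm T W w) -> ip (en k) (Y w) = ou (lam k) (bm T W w k) t}.
Proof.
move=> al01 [/random_elementP mY [s [merr cerr cY]]].
have tT2 : t <= T by case/andP: tT.
have inT pts : pts_in t pts -> pts_in T pts by move=> h p /h /andP[-> h2]; rewrite (le_trans h2).
have mW pts : pts_in t pts -> measurable_fun setT (wsum W pts).
  by move=> /inT h; have [] := wsum_l2P T0 hW h.
pose f N w := wsum W (grid_pts N.+1) w - ip (en k) (Y w).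
have mf N : measurable_fun setT (f N) by apply: measurable_funB => //; apply: mW; exact: grid_in.
pose eps N := 4 * cwie P T W * ((lam k * (t / N.+1%:R)) ^+ 2 * t + N.+1%:R^-1) + 2 * N.+1%:R^-1.
have hf N : (\int[P]_w (f N w ^+ 2)%:E <= (eps N)%:E)%E.
  have n0 : 0 < N.+1%:R^-1 :> R by rewrite invr_gt0 ltr0n.
  have [n1 h1] := ereal_cvg0_le cerr n0; have [n2 h2] := ereal_cvg0_le cY n0.
  pose n := maxn n1 n2; have {}h1 := h1 n (leq_maxl _ _); have {}h2 := h2 n (leq_maxr _ _).
  (* The difference of the grid sum and of the coordinate of the step integral is again of the form
     [wsum], so one isometry covers it. *)
  pose pts := grid_pts N.+1 ++ opp_pts (so_pts (s n) k).
  have inp : pts_in t pts.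
    by move=> p; rewrite mem_cat => /orP[/(grid_in (ltn0Sn N))//|/(opp_in (@so_in _ _ _))].
  have wsE w : wsum W pts w = wsum W (grid_pts N.+1) w - ip (en k) (so_integral (s n) W w).
    by rewrite /wsum big_cat/= -/(wsum W _ w) -/(wsum W _ w) wsum_opp wsum_so.
  have wfE x : wfun pts x = wfun (grid_pts N.+1) x - wfun (so_pts (s n) k) x.
    by rewrite /wfun big_cat/= -/(wfun _ x) -/(wfun _ x) wfun_opp.
  have iso := wsum_isometry T0 hW tT2 inp.
  have [iw _] := integral_wfun inp.
  have b1 : \int[leb]_(x in `[0, t]) (hnorm (wfun pts x) ^+ 2) <= 2 * (lam k * (t / N.+1%:R)) ^+ 2 * t + 2 * N.+1%:R^-1.
    rewrite -lee_fin /Rintegral fineK; last exact: integrable_fin_num.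
    apply: (@le_trans _ _ (\int[leb]_(x in `[0%R, t]) ((2 * (lam k * (t / N.+1%:R)) ^+ 2)%:E + 2%:E * hs_norm2 e (fun v => (Phi x v - so_op (s n) x v)%R)))%E).
      apply: ge0_le_integral => //.
      - by move=> x _; rewrite lee_fin sqr_ge0.
      - by case/integrableP: iw.
      - apply: emeasurable_funD => //; apply: emeasurable_funM => //; exact: merr.
      - by move=> x xt; rewrite wfE; apply: hs_dist => //; move: xt; rewrite /= in_itv.
    have hs0 x : (0 <= hs_norm2 e (fun v => (Phi x v - so_op (s n) x v)%R))%E.
      by apply: nneseries_ge0 => j _ _; rewrite lee_fin sqr_ge0.
    rewrite ge0_integralD//; last 3 first.
    - by move=> x _; rewrite lee_fin mulr_ge0// sqr_ge0.
    - by move=> x _; rewrite mule_ge0// lee_fin.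
    - by apply: emeasurable_funM => //; exact: merr.
    rewrite integral_cst//= lebesgue_measure0t// ge0_integralZl//; last exact: merr.
    by rewrite [leRHS]EFinD; apply: leeD; [rewrite -EFinM|rewrite EFinM lee_wpmul2l// lee_fin].
  have l2w := wsum_l2P T0 hW (inT _ inp).
  pose F w := (2 * wsum W pts w ^+ 2)%:E; pose G w := (2%:E * (hnorm (so_integral (s n) W w - Y w) ^+ 2)%:E)%E.
  have mso j : measurable_fun setT (fun w => ip (en j) (so_integral (s n) W w)).
    by apply: (eq_measurable_fun (wsum W (so_pts (s n) j))) => [w _|]; [exact: wsum_so|apply: mW; exact: so_in].
  have mh : measurable_fun setT (fun w => hnorm (so_integral (s n) W w - Y w)).
    apply: hnorm_measurable => // j; under eq_fun do rewrite ipBr.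
    by apply: measurable_funB; [exact: mso|exact: mY].
  have mF : measurable_fun setT F.
    by apply/measurable_EFinP; apply: measurable_funM => //; apply: measurable_funX; exact: l2w.1.
  have mh2 : measurable_fun setT (fun w => (hnorm (so_integral (s n) W w - Y w) ^+ 2)%:E).
    by apply/measurable_EFinP; exact: measurable_funX.
  have mG : measurable_fun setT G by apply: emeasurable_funM.
  have F0 w : (0 <= F w)%E by rewrite lee_fin mulr_ge0// sqr_ge0.
  have G0 w : (0 <= G w)%E by rewrite mule_ge0// lee_fin ?sqr_ge0.
  apply: (@le_trans _ _ (\int[P]_w (F w + G w))%E).
    apply: ge0_le_integral => //.
    - by move=> w _; rewrite lee_fin sqr_ge0.
    - by apply/measurable_EFinP; exact: measurable_funX.
    - exact: emeasurable_funD.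
    move=> w _; rewrite /F /G -EFinM -EFinD lee_fin wsE /f.
    have := ip_CS (en k) (so_integral (s n) W w - Y w); rewrite hnorm_en mul1r ipBr.
    move: (wsum W _ w) (ip (en k) (so_integral _ W w)) (ip (en k) (Y w)) (hnorm _) => a b c h hb.
    have : (b - c) ^+ 2 <= h ^+ 2.
      by rewrite -[leLHS]real_normK ?num_real// lerXn2r ?nnegrE// (le_trans _ hb).
    move=> bc; have := sqrD_le (lexx ((a - b) ^+ 2)) bc.
    by rewrite addrA subrK.
  rewrite ge0_integralD// /eps EFinD; apply: leeD; last first.
    rewrite /G ge0_integralZl//; last by move=> w _; rewrite lee_fin sqr_ge0.
    by rewrite [leRHS]EFinM lee_wpmul2l ?lee_fin.
  have -> : (\int[P]_w F w = (2 * \int[P]_w (wsum W pts w ^+ 2))%:E)%E.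
    rewrite /F; under eq_integral do rewrite EFinM.
    rewrite ge0_integralZl// ?EFinM ?fineK_l2P//; last first.
      by move=> w _; rewrite lee_fin sqr_ge0.
    by apply/measurable_EFinP; apply: measurable_funX; exact: l2w.1.
  rewrite lee_fin iso; have c0 := cwie_ge0.
  apply: (le_trans (ler_wpM2l _ (ler_wpM2l c0 b1))) => //.
  by apply: eq_ler; ring.
have eps0 : eps @ \oo --> (0 : R).
  have c0 := cwie_ge0; pose D := 4 * cwie P T W * ((lam k * t) ^+ 2 * t + 1) + 2.
  have h0 : (fun N : nat => D * N.+1%:R^-1) @ \oo --> (0 : R).
    exact: cvg_cst_harmonic.
  apply: cvg0_squeeze h0 => N; rewrite /eps.
  have i0 : 0 <= N.+1%:R^-1 :> R by rewrite invr_ge0.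
  have i1 : N.+1%:R^-1 <= 1 :> R by rewrite invf_le1// ler1n.
  move: c0 i0 i1 (ltW l0) t0; rewrite /D; clear; move: (cwie P T W) N.+1%:R^-1 (lam k) => c z y c0 z0 z1 y0 t0.
  have E0 : 0 <= (y * t) ^+ 2 * t by rewrite mulr_ge0// sqr_ge0.
  have -> : (y * (t * z)) ^+ 2 * t = (y * t) ^+ 2 * t * z * z by ring.
  move: ((y * t) ^+ 2 * t) E0 => E E0.
  have Ez : E * z * z <= E * z by rewrite ler_piMr// mulr_ge0.
  have Ez0 : 0 <= E * z * z by rewrite !mulr_ge0.
  have h1 : 4 * c * (E * z * z + z) <= 4 * c * (E * z + z) by rewrite ler_wpM2l ?mulr_ge0// lerD2r.
  have h2 : 0 <= 4 * c * (E * z * z + z) by rewrite !mulr_ge0// addr_ge0.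
  by apply/andP; split; lra.
apply: aeS (ae_limit0 mf hf eps0) => w lw K [M [b0 bH _]].
have /andP[a0 a1] := al01.
have M0 := hoelder_cst_ge0 (bH k).
suff : f N w @[N --> \oo] --> ou (lam k) (bm T W w k) t - ip (en k) (Y w).
  by move=> /lw /eqP; rewrite subr_eq0 => /eqP.
apply: cvgB; last exact: cvg_cst.
apply/cvg_epsP => c c0.
have c1 : 0 < c / (M k + 1) by rewrite divr_gt0// ltr_wpDl.
have r0 : 0 < (c / (M k + 1)) `^ al^-1 by rewrite powR_gt0.
have h0 : (fun N : nat => t * N.+1%:R^-1) @ \oo --> (0 : R).
  exact: cvg_cst_harmonic.
have /cvg_epsP/(_ _ r0)[N hN] := h0.
exists N => n /hN; rewrite subr0 ger0_norm ?mulr_ge0// => hn.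
have dn : 0 <= t / n.+1%:R by rewrite divr_ge0.
have := riemann_ou l0 al01 M0 dn (bH k) (b0 k 0 (lexx _)) (b0 k) n.+1.
have tE : n.+1%:R * (t / n.+1%:R) = t by rewrite mulrCA divff ?mulr1// pnatr_eq0.
rewrite tE distrC wsum_grid.
have -> : \sum_(j < n.+1) expR (- (lam k * (t - j%:R * (t / n.+1%:R)))) *
    (bm T W w k (j.+1%:R * (t / n.+1%:R)) - bm T W w k (j%:R * (t / n.+1%:R))) =
    \sum_(j < n.+1) g n.+1 j * (wie W (j.+1%:R * (t / n.+1%:R)) (en k) w - wie W (j%:R * (t / n.+1%:R)) (en k) w).
  have cl j : (j <= n.+1)%N -> Num.min (Num.max (j%:R * (t / n.+1%:R)) 0) T = j%:R * (t / n.+1%:R).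
    by move=> jn; apply: clamp_id; have /andP[-> h] := grid_le (ltn0Sn n) jn; rewrite (le_trans h).
  apply: eq_bigr => j _; rewrite /bm cl; last by case: j.
  by rewrite cl// ltnW.
move=> h; apply: (le_trans h).
apply: (@le_trans _ _ (M k * (c / (M k + 1)))).
  by rewrite ler_wpM2l//; apply: powR_root_le => //; exact: ltW.
by rewrite mulrCA ler_piMr ?(ltW c0)// ler_pdivrMr ?mul1r ?ltr_wpDl// lerDl.
Qed.

End OneCoord.
End StochCoord.

(** * Construction of the stochastic convolution *)

Section Existence.
Context {R : realType} d (Omega : measurableType d) (P : probability Omega R).
Local Notation H := (L2 R).
Context (T : R) (W : R -> H -> Omega -> R) (e : nat -> H)
  (T0 : 0 < T) (hW : cylindrical_wiener P T W) (eE : forall k, e k.+1 = en k).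

Lemma en_orth0 i k : i != k -> ip (en i) (en k) = 0 :> R.
Proof. by move=> ik; rewrite en_orth (negbTE ik). Qed.

Lemma hs_norm2E (L : H -> H) : hs_norm2 e L = (\sum_(k <oo) (hnorm (L (en k)) ^+ 2)%:E)%E.
Proof.
have f0 i : (0 <= (hnorm (L (e i)) ^+ 2)%:E)%E by rewrite lee_fin sqr_ge0.
have h := @nneseries_addn R (fun j => (hnorm (L (e j)) ^+ 2)%:E) 1 f0.
by rewrite /hs_norm2 -h; apply: eq_eseriesr => k _; rewrite addn1 eE.
Qed.

Lemma big_divmod (V : zmodType) (n m : nat) (F : nat -> nat -> V) : (0 < n)%N ->
  \sum_(i < n * m) F (i %/ n)%N (i %% n)%N = \sum_(j < m) \sum_(k < n) F j k.
Proof.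
move=> n0; elim: m => [|m IH]; first by rewrite muln0 !big_ord0.
rewrite mulnSr big_split_ord/= IH big_ord_recr/=; congr (_ + _).
apply: eq_bigr => k _; rewrite mulnC divnMDl// divn_small// addn0.
by rewrite modnMDl modn_small.
Qed.

Lemma so_op_measurable (t : R) (s : step_operator t) k j (D : set R) : measurable D ->
  measurable_fun D (fun x => ip (en j) (so_op s x (en k))).
Proof.
move=> mD; rewrite /so_op; under eq_fun do rewrite ip_sumr.
apply: measurable_sum => i; under eq_fun do rewrite ipZr.
by apply: measurable_funM => //; apply: measurable_funM => //; exact: measurable_indic.
Qed.

Lemma semigroup_measurable (t : R) (v : H) j :
  measurable_fun `[0, t] (fun x => ip (en j) (semigroup (t - x) v)).
Proof.
pose f x := expR (- ((t - x) * lam j)) * ip (en j) v.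
have mf : measurable_fun `[0, t] f.
  apply: measurable_funM => //; apply: continuous_measurable_itv => x.
  apply: (@continuous_comp _ _ _ (fun x : R => - ((t - x) * lam j)) expR); last exact: continuous_expR.
  by apply: cvgN; apply: cvgM; [apply: cvgB; [exact: cvg_cst|exact: cvg_id]|exact: cvg_cst].
apply: eq_measurable_fun mf => x /set_mem; rewrite /= in_itv/= => /andP[x0 xt].
by rewrite semigroup_coord// subr_ge0.
Qed.

Section OneTime.
Context (t : R).
Hypothesis tT : 0 <= t <= T.
Let t0 : 0 <= t. Proof. by case/andP: tT. Qed.

Let g (M k j : nat) : R := expR (- (lam k * (t - j%:R * (t / M.+1%:R)))).

(** The record [step_operator] asks for bounds at all indices; those outside the sum receive the
    empty interval ]0, 0]. *)
Lemma so_grid_bounds n M i : let j := (i %/ n.+1)%N in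
  let ok := (i < n.+1 * M.+1)%N in
  0 <= (if ok then j%:R * (t / M.+1%:R) else 0) /\
  (if ok then j%:R * (t / M.+1%:R) else 0) <= (if ok then j.+1%:R * (t / M.+1%:R) else 0) /\
  (if ok then j.+1%:R * (t / M.+1%:R) else 0) <= t.
Proof.
move=> /=; case: ltnP => h; last by rewrite !lexx.
have jM : (i %/ n.+1 < M.+1)%N by rewrite ltn_divLR// mulnC.
have /andP[h1 _] := grid_le tT (ltn0Sn M) (ltnW jM); have /andP[_ h2] := grid_le tT (ltn0Sn M) jM.
split=> //; split=> //; rewrite ler_wpM2r ?ler_nat// divr_ge0//.
Qed.

(* Modes [0, ..., n] on a uniform grid with [M + 1] cells; the pair (time cell, mode) is encoded by division. *)
Definition so_grid n M : step_operator t := @StepOperator R t (n.+1 * M.+1)%N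
  (fun i => if (i < n.+1 * M.+1)%N then (i %/ n.+1)%:R * (t / M.+1%:R) else 0)
  (fun i => if (i < n.+1 * M.+1)%N then (i %/ n.+1).+1%:R * (t / M.+1%:R) else 0)
  (fun i => en (i %% n.+1)%N)
  (fun i => g M (i %% n.+1)%N (i %/ n.+1)%N *: en (i %% n.+1)%N)
  (so_grid_bounds n M).

Lemma so_grid_integral n M w k : ip (en k) (so_integral (so_grid n M) W w) =
  if (k <= n)%N then \sum_(j < M.+1) g M k j * (wie W (j.+1%:R * (t / M.+1%:R)) (en k) w - wie W (j%:R * (t / M.+1%:R)) (en k) w) else 0.
Proof.
rewrite /so_integral ip_sumr/=.
pose F j i := ip (en k) ((W (j.+1%:R * (t / M.+1%:R)) (en i) w - W (j%:R * (t / M.+1%:R)) (en i) w) *: (g M i j *: en i)).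
rewrite (eq_bigr (fun i : 'I_(n.+1 * M.+1) => F (i %/ n.+1)%N (i %% n.+1)%N)); last by move=> i _; rewrite ltn_ord.
rewrite (big_divmod _ F)//.
have e1 j : \sum_(i < n.+1) F j i = if (k <= n)%N then g M k j * (wie W (j.+1%:R * (t / M.+1%:R)) (en k) w - wie W (j%:R * (t / M.+1%:R)) (en k) w) else 0.
  rewrite /F; case: leqP => kn.
    rewrite (bigD1 (Ordinal (kn : k < n.+1)%N))//= big1 ?addr0 => [|i ik].
      by rewrite !ipZr en_orth eqxx mulr1 wie_diff mulrC.
    rewrite !ipZr en_orth0 ?mulr0//; apply: contra ik => /eqP ik; exact/eqP/val_inj.
  by rewrite big1// => i _; rewrite !ipZr en_orth gtn_eqF ?mulr0// (leq_trans (ltn_ord i)).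
by rewrite (eq_bigr _ (fun (j : 'I_M.+1) _ => e1 j)); case: leqP => // _; rewrite big1.
Qed.

Lemma so_grid_op n M x k : 0 < x <= t -> exists2 c, so_op (so_grid n M) x (en k) = c *: en k &
  if (k <= n)%N then `|c - expR (- (lam k * (t - x)))| <= lam k * (t / M.+1%:R) else c == 0.
Proof.
move=> /andP[x0 xt]; rewrite /so_op/=.
pose F j i := (\1_(`]j%:R * (t / M.+1%:R), j.+1%:R * (t / M.+1%:R)]) x * ip (en i) (en k)) *: (g M i j *: en i) : H.
rewrite (eq_bigr (fun i : 'I_(n.+1 * M.+1) => F (i %/ n.+1)%N (i %% n.+1)%N)); last by move=> i _; rewrite ltn_ord.
rewrite (big_divmod _ F)//.
have e1 j : \sum_(i < n.+1) F j i = if (k <= n)%N then (g M k j * (((x <= j.+1%:R * (t / M.+1%:R))%R)%:R - ((x <= j%:R * (t / M.+1%:R))%R)%:R)) *: en k else 0.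
  rewrite /F; case: leqP => kn; last first.
    by rewrite big1// => i _; rewrite en_orth ltn_eqF ?mulr0 ?scale0r// (leq_trans (ltn_ord i)).
  rewrite (bigD1 (Ordinal (kn : k < n.+1)%N))//= big1 ?addr0 => [|i ik]; last first.
    rewrite en_orth0 ?mulr0 ?scale0r//; apply: contra ik => /eqP ik; exact/eqP/val_inj.
  rewrite en_orth eqxx mulr1 scalerA mulrC; congr ((_ * _) *: _).
  rewrite indicE mem_setE in_itv/=; case: (leP x (j%:R * (t / M.+1%:R))) => h1 /=.
    by rewrite (le_trans h1) ?subrr// ler_wpM2r ?divr_ge0// ler_nat.
  by rewrite subr0.
rewrite (eq_bigr _ (fun (j : 'I_M.+1) _ => e1 j)).
case: leqP => kn; last by exists 0; rewrite ?eqxx// big1// scale0r.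
have xt' : 0 <= x <= t by rewrite ltW.
have [c cE hc] := wfun_grid k tT (ltn0Sn M) xt'.
exists c => //; rewrite -cE /wfun big_cons/= -/(wfun _ x) wfun_inc leNgt x0/= scale0r add0r.
by apply: eq_bigr => j _.
Qed.

Lemma lam_le j n : (j <= n)%N -> lam j <= lam n :> R.
Proof.
move=> jn; rewrite /lam lerXn2r ?nnegrE ?(ltW (kp_gt0 _))//.
by rewrite /kp ler_wpM2r ?pi_ge0// ler_nat.
Qed.

(** The mesh is adapted to the highest mode n: the first inequality serves the pathwise Riemann
    error, the second the error of the operator. *)
Lemma fine_mesh (al ga : R) n : 0 < al -> exists M,
  lam n `^ ga * (t / M.+1%:R) `^ al <= n.+1%:R^-1 /\ lam n * (t / M.+1%:R) <= n.+1%:R^-1.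
Proof.
move=> al0; have l0 : 0 < lam n :> R by exact: lam_gt0.
pose c := Num.min ((n.+1%:R^-1 / lam n `^ ga) `^ al^-1) (n.+1%:R^-1 / lam n).
have c0 : 0 < c by rewrite lt_min powR_gt0 ?divr_gt0// powR_gt0.
exists (Num.bound (t / c)); set M := Num.bound _.
have h : t / M.+1%:R <= c.
  rewrite ler_pdivrMr// mulrC -ler_pdivrMr//; apply: ltW.
  apply: lt_le_trans (archi_boundP _) _; first by rewrite divr_ge0// ltW.
  by rewrite ler_nat.
have d0 : 0 <= t / M.+1%:R by rewrite divr_ge0.
split.
  rewrite mulrC -ler_pdivlMr ?powR_gt0//; apply: powR_root_le => //.
    by rewrite divr_ge0 ?powR_ge0// ltW.
  by rewrite (le_trans h)// ge_min lexx.
by rewrite mulrC -ler_pdivlMr// (le_trans h)// ge_min lexx orbT.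
Qed.

(** Each of the n + 1 treated modes contributes at most t / (n + 1)^2. An omitted mode contributes
    at most 1 / lam k, split into a small factor lam^(-1/4) and the summable lam^(-3/4). *)
Lemma integral_err n M : lam n * (t / M.+1%:R) <= n.+1%:R^-1 ->
  let err x := hs_norm2 e (fun v => semigroup (t - x) v - so_op (so_grid n M) x v) in
  measurable_fun `[0, t] err /\
  forall C, (forall N, \sum_(i < N) lam i `^ (- (3 / 4)) <= C) ->
  (\int[leb]_(x in `[0%R, t]) err x <= (t / n.+1%:R + lam n.+1 `^ (- (1 / 4)) * C)%:E)%E.
Proof.
move=> hM err; have l0 k : 0 < lam k :> R by exact: lam_gt0.
pose u (k : nat) (x : R) : \bar R := (hnorm (semigroup (t - x) (en k) - so_op (so_grid n M) x (en k))%R ^+ 2)%:E.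
have errE x : err x = (\sum_(k <oo) u k x)%E.
  exact: hs_norm2E.
have u0 k x : (0 <= u k x)%E by rewrite lee_fin sqr_ge0.
have mu k : measurable_fun `[0, t] (u k).
  apply/measurable_EFinP; apply: measurable_funX; apply: hnorm_measurable => // j.
  have := measurable_funB (@semigroup_measurable t (en k) j) (so_op_measurable (so_grid n M) k j (measurable_itv `[0, t])).
  by congr measurable_fun; apply/funext => x; rewrite ipBr.
have merr : measurable_fun `[0, t] err.
  rewrite (_ : err = (fun x => \sum_(k <oo) u k x)%E); last exact/funext.
  by apply: ge0_emeasurable_sum.
split=> // C hC.
rewrite (_ : err = (fun x => \sum_(k <oo) u k x)%E); last exact/funext.
rewrite integral_nneseries//.
apply: nneseries_le_bound => [k|N]; first by apply: integral_ge0.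
have mu' k : measurable_fun `]0, t] (u k).
  apply: measurable_funS (mu k) => //; by apply: subset_itvr; rewrite bnd_simp.
pose bd k := (if (k < n.+1)%N then t / n.+1%:R ^+ 2 else 0) + lam n.+1 `^ (- (1 / 4)) * lam k `^ (- (3 / 4)).
have uk k : (\int[leb]_(x in `[0%R, t]) u k x <= (bd k)%:E)%E.
  have seE x : 0 <= x <= t -> semigroup (t - x) (en k : H) = expR (- (lam k * (t - x))) *: en k.
    move=> /andP[x0 xt]; apply: L2_coord_eq => j; rewrite semigroup_coord ?subr_ge0// ipZr en_orth.
    by case: eqP => [->|_]; rewrite ?mulr0// [(t - x) * _]mulrC.
  rewrite /bd; case: ltnP => kn.
    apply: (@le_trans _ _ (t / n.+1%:R ^+ 2)%:E); last by rewrite lee_fin lerDl mulr_ge0 ?powR_ge0.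
    rewrite -(integral_itv_obnd_cbnd (mu' k)).
    apply: (@le_trans _ _ (\int[leb]_(x in `]0%R, t]) (n.+1%:R^-1 ^+ 2)%:E)%E).
      apply: ge0_le_integral => //; first exact: mu'.
      move=> x; rewrite /= in_itv/= => xt.
      have [c cE] := so_grid_op n M k xt; rewrite -ltnS kn => hc.
      have [x0 xt'] := andP xt; rewrite /u cE seE ?(ltW x0)// lee_fin -scalerBl hnormZ hnorm_en mulr1.
      rewrite lerXn2r ?nnegrE// distrC (le_trans hc)// (le_trans _ hM)//.
      by rewrite ler_wpM2r ?divr_ge0// lam_le.
    rewrite (integral_itv_obnd_cbnd (f := fun=> _))//= integral_cst//= lebesgue_measure0t//.
    by rewrite -EFinM lee_fin exprVn mulrC.
  rewrite add0r -(integral_itv_obnd_cbnd (mu' k)).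
  apply: (@le_trans _ _ (\int[leb]_(x in `]0%R, t]) (expR (- (lam k * (t - x))) * 1)%:E)%E).
    apply: ge0_le_integral => //.
    - exact: mu'.
    - apply/measurable_EFinP; apply: measurable_funM => //; apply: measurable_funTS; apply: continuous_measurable_fun => x.
      exact: continuous_expRV.
    move=> x; rewrite /= in_itv/= => xt; have [c cE] := so_grid_op n M k xt.
    rewrite leqNgt kn/= => /eqP c0; have [x0 xt'] := andP xt.
    rewrite /u cE c0 seE ?(ltW x0)// scale0r subr0 lee_fin hnormZ hnorm_en mulr1 mulr1 ger0_norm ?expR_ge0//.
    rewrite expr2 ler_piMr ?expR_ge0// -[leRHS]expR0 ler_expR oppr_le0 mulr_ge0 ?(ltW (l0 _))// subr_ge0//.
  rewrite integral_itv_obnd_cbnd; last first.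
    apply/measurable_EFinP; apply: measurable_funM => //; apply: measurable_funTS; apply: continuous_measurable_fun => x.
    exact: continuous_expRV.
  have iE : leb.-integrable `[0, t] (EFin \o (fun x => expR (- (lam k * (t - x))) * 1)).
    by apply: (@integrable_expM R (lam k) t 0 t 1) => // s _; rewrite normr1.
  have -> : (\int[leb]_(x in `[0%R, t]) (expR (- (lam k * (t - x))) * 1)%:E = (Vint (lam k) (fun _ => 1) 0 t)%:E)%E.
    by rewrite /Vint /Rintegral fineK//; exact: integrable_fin_num.
  rewrite lee_fin Vint_cst// mul1r subr0.
  apply: (@le_trans _ _ (lam k)^-1); first by rewrite ler_piMl ?invr_ge0 ?(ltW (l0 _))// gerBl expR_ge0.
  have -> : (lam k)^-1 = lam k `^ (- (1 / 4)) * lam k `^ (- (3 / 4)) :> R.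
    rewrite -powRDp// (_ : - (1 / 4) + - (3 / 4) = - 1 :> R); last by field.
    by rewrite powR_inv1// ltW.
  rewrite ler_wpM2r ?powR_ge0// !powRN lef_pV2 ?posrE ?powR_gt0//.
  by apply: ge0_powR_le; rewrite ?(ltW (l0 _))// lam_le.
apply: (@le_trans _ _ (\sum_(k < N) (bd k)%:E)%E); first by apply: lee_sum => k _; exact: uk.
rewrite sumEFin lee_fin /bd big_split/= -mulr_sumr; apply: lerD; last by rewrite ler_wpM2l ?powR_ge0//; exact: hC.
have cnt m (a : R) : \sum_(k < N) (if (k < m)%N then a else 0) = (minn N m)%:R * a.
  elim: N => [|j IH]; first by rewrite big_ord0 min0n mul0r.
  rewrite big_ord_recr/= IH; case: ltnP => h.
    by rewrite !(minn_idPl _)// ?(ltnW h)// -natr1 mulrDl mul1r.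
  by rewrite !(minn_idPr _)// ?addr0// (leq_trans h).
rewrite cnt; apply: (@le_trans _ _ (n.+1%:R * (t / n.+1%:R ^+ 2))).
  by rewrite ler_wpM2r ?divr_ge0 ?exprn_ge0// ler_nat geq_minr.
by apply: eq_ler; field; rewrite addrC natr1 pnatr_eq0.
Qed.

(* Pathwise, the integral of the [n]-th step operator misses the convolution by at most K * eta n with eta n --> 0. *)
Lemma stoch_exists (al ga : R) (Z : Omega -> H) (B : Omega -> R) (b : R) :
  0 < al <= 1 -> 0 <= ga -> ga < al -> (forall k, measurable_fun setT (fun w => ip (en k) (Z w))) ->
  measurable_fun setT B -> (forall w, 0 <= B w) -> (\int[P]_w (B w)%:E <= b%:E)%E ->
  {ae P, forall w, exists K, [/\ noise al ga K (bm T W w), K ^+ 2 <= B w &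
    forall k, ip (en k) (Z w) = ou (lam k) (bm T W w k) t]} ->
  is_stochastic_integral P e W t (fun s => semigroup (t - s)) Z.
Proof.
move=> al01 ga0 gaal mZ mB B0 hB hZ; have /andP[a0 a1] := al01.
split; first exact/random_elementP.
have /choice[M hM] := fun n => @fine_mesh al ga n a0.
exists (fun n => so_grid n (M n)) => err.
have [|C C0 hC] := @lam_series R (- (3 / 4)); first by lra.
split.
- by move=> n; case: (integral_err (hM n).2).
- apply: (@squeeze_cvge _ _ _ _ (fun _ => 0%E) _ (fun n => (t / n.+1%:R + lam n.+1 `^ (- (1 / 4)) * C)%:E)).
  + apply: nearW => n; apply/andP; split.
      by apply: integral_ge0 => x _; rewrite /err hs_norm2E; apply: nneseries_ge0 => k _ _; rewrite lee_fin sqr_ge0.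
    exact: (integral_err (hM n).2).2.
  + exact: cvg_cst.
  + apply: cvg_EFin; first exact: nearW.
    have h1 := @cvg_cst_harmonic R t.
    have q0 : 0 < (1 / 4 : R) by lra.
    have h2 : lam n.+1 `^ (- (1 / 4)) @[n --> \oo] --> (0 : R).
      by have := @lam_powR_cvg0 R _ q0; rewrite -(cvg_shiftn 1); under eq_fun do rewrite addn1.
    rewrite (_ : 0 = 0 + 0 * C); last by rewrite mul0r addr0.
    by apply: cvgD => //; apply: cvgM => //; exact: cvg_cst.
have r0 : 0 < al - ga by rewrite subr_gt0.
pose eta n := n.+1%:R^-1 + 3 * lam n.+1 `^ (- (al - ga)).
have eta0 n : 0 <= eta n by rewrite addr_ge0// mulr_ge0// powR_ge0.
have eta_cvg : eta @ \oo --> (0 : R).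
  have h2 : lam n.+1 `^ (- (al - ga)) @[n --> \oo] --> (0 : R).
    by have := @lam_powR_cvg0 R _ r0; rewrite -(cvg_shiftn 1); under eq_fun do rewrite addn1.
  rewrite (_ : 0 = 0 + 3 * 0 :> R); last by rewrite mulr0 addr0.
  by apply: cvgD; [exact: cvg_harmonic|apply: cvgM => //; exact: cvg_cst].
have main n : {ae P, forall w, hnorm (so_integral (so_grid n (M n)) W w - Z w) ^+ 2 <= eta n ^+ 2 * B w}.
  apply: aeS hZ => w [K [nK KB Zk]]; have [Mk [b0 bH lK]] := nK.
  have K0 := l2le_ge0 lK.
  set dl := t / (M n).+1%:R; have d0 : 0 <= dl by rewrite divr_ge0.
  pose a1' k := if (k < n.+1)%N then ip (en k) (so_integral (so_grid n (M n)) W w) - ou (lam k) (bm T W w k) t else 0.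
  pose a2 k := if (n.+1 <= k)%N then ou (lam k) (bm T W w k) t else 0.
  have l1 : l2le a1' (n.+1%:R^-1 * K).
    rewrite -[n.+1%:R^-1]ger0_norm//; apply: l2le_mono (l2leZ n.+1%:R^-1 lK) => k.
    rewrite /a1'; case: ltnP => kn; last by rewrite normr0.
    have M0 := hoelder_cst_ge0 (bH k).
    rewrite so_grid_integral -ltnS kn.
    have := riemann_ou (lam_gt0 k) al01 M0 d0 (bH k) (b0 k 0 (lexx _)) (b0 k) (M n).+1.
    have tE : (M n).+1%:R * dl = t by rewrite mulrCA divff ?mulr1// pnatr_eq0.
    rewrite tE distrC.
    have -> : \sum_(j < (M n).+1) expR (- (lam k * (t - j%:R * dl))) * (bm T W w k (j.+1%:R * dl) - bm T W w k (j%:R * dl)) =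
      \sum_(j < (M n).+1) g (M n) k j * (wie W (j.+1%:R * dl) (en k) w - wie W (j%:R * dl) (en k) w).
      have cl j : (j <= (M n).+1)%N -> Num.min (Num.max (j%:R * dl) 0) T = j%:R * dl.
        move=> jn; apply: clamp_id; have /andP[-> h] := grid_le tT (ltn0Sn (M n)) jn.
        by rewrite (le_trans h)//; case/andP: tT.
      apply: eq_bigr => j _; rewrite /bm cl; last by case: j.
      by rewrite cl// ltnW.
    move=> h; apply: (le_trans h).
    have lk0 : 0 < lam k `^ (- ga) by rewrite powR_gt0// lam_gt0.
    rewrite [leRHS]ger0_norm; last by rewrite !mulr_ge0 ?invr_ge0// ltW.
    rewrite [leRHS]mulrCA ler_wpM2l// powRN ler_pdivlMr ?powR_gt0 ?lam_gt0//.
    apply: le_trans (hM n).1; rewrite [leLHS]mulrC -/dl ler_wpM2r ?powR_ge0//.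
    by apply: ge0_powR_le; rewrite ?(ltW (lam_gt0 _))// lam_le.
  have l2 : l2le a2 (lam n.+1 `^ (- (al - ga)) * (3 * K)).
    apply: l2le_tail; first exact: ltW.
    by apply: noise_ou_le => //; case/andP: tT.
  have hn : hnorm (so_integral (so_grid n (M n)) W w - Z w) <= eta n * K.
    rewrite /eta mulrDl -[3 * _ * K]mulrA [3 * (_ * K)]mulrCA.
    apply: l2le_hnorm; apply: l2le_mono (l2leD l1 l2) => k.
    rewrite /a1' /a2 ipBr Zk ltnNge; case: ltnP => kn /=; last by rewrite addr0.
    by rewrite so_grid_integral leqNgt kn/= sub0r add0r normrN.
  rewrite (@le_trans _ _ (eta n ^+ 2 * K ^+ 2))//; last by rewrite ler_wpM2l// sqr_ge0.
  by rewrite -exprMn lerXn2r ?nnegrE ?hnorm_ge0// mulr_ge0.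
apply: (@squeeze_cvge _ _ _ _ (fun _ => 0%E) _ (fun n => (eta n ^+ 2 * b)%:E)).
- apply: nearW => n; apply/andP; split; first by apply: integral_ge0 => w _; rewrite lee_fin sqr_ge0.
  have mso k : measurable_fun setT (fun w => ip (en k) (so_integral (so_grid n (M n)) W w)).
    apply: (eq_measurable_fun (wsum W (so_pts (so_grid n (M n)) k))) => [w _|]; first exact: wsum_so.
    have hp : pts_in T (so_pts (so_grid n (M n)) k).
      by move=> p /so_in /andP[-> h]; rewrite (le_trans h)//; case/andP: tT.
    by have [] := wsum_l2P T0 hW hp.
  apply: (@le_trans _ _ (\int[P]_w ((eta n ^+ 2)%:E * (B w)%:E))%E).
    apply: ae_ge0_le_integral => //.
    + by move=> w _; rewrite lee_fin sqr_ge0.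
    + apply/measurable_EFinP; apply: measurable_funX; apply: hnorm_measurable => // k.
      by under eq_fun do rewrite ipBr; exact: measurable_funB.
    + by move=> w _; rewrite mule_ge0// lee_fin ?sqr_ge0.
    + by apply: emeasurable_funM => //; exact/measurable_EFinP.
    + by apply: aeS (main n) => w h _; rewrite -EFinM lee_fin.
  rewrite ge0_integralZl; [|exact: measurableT|exact/measurable_EFinP|by move=> w _; rewrite lee_fin|by rewrite lee_fin sqr_ge0].
  by rewrite [leRHS]EFinM lee_wpmul2l// lee_fin sqr_ge0.
- exact: cvg_cst.
- apply: cvg_EFin; first exact: nearW.
  rewrite (_ : 0 = 0 * b); last by rewrite mul0r.
  apply: cvgM; last exact: cvg_cst.
  rewrite (_ : 0 = 0 * 0 :> R); last by rewrite mulr0.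
  by under eq_fun do rewrite expr2; exact: cvgM.
Qed.

End OneTime.
End Existence.

(** * Bochner integrals of the drift *)

Section Bochner.
Context {R : realType}.
Local Notation H := (L2 R).

Lemma sf_integral_coord (t : R) (s : simple_function R) (k : nat) : 0 <= t ->
  leb.-integrable `[0, t] (EFin \o (fun x => ip (en k) (sf_fun s x))) /\
  ip (en k) (sf_integral `[0, t] s) = \int[leb]_(x in `[0, t]) ip (en k) (sf_fun s x).
Proof.
move=> t0; pose F i x := ip (en k) (sf_val s i) * \1_(sf_set s i) x.
have iF i : leb.-integrable `[0, t] (EFin \o F i).
  apply: (@integrable_bdd R 0 t `|ip (en k) (sf_val s i)|).
    by apply: measurable_funM => //; apply: measurable_indic; exact: sf_measurable.
  move=> x _; rewrite normrM ler_piMr// indicE normr_nat -[X in _ <= X]/(1%:R) ler_nat.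
  by case: (x \in _).
have [h1 h2] := @Rint_sum R _ _ leb `[0, t]%classic _ (index_iota 0 (sf_size s)) F (measurable_itv _) iF.
have e : (fun x => ip (en k) (sf_fun s x)) = (fun x => \sum_(i <- index_iota 0 (sf_size s)) F i x).
  apply/funext => x; rewrite /sf_fun ip_sumr big_mkord; apply: eq_bigr => i _.
  by rewrite ipZr mulrC.
rewrite e; split=> //; rewrite h2 /sf_integral ip_sumr big_mkord; apply: eq_bigr => i _.
rewrite ipZr /F RintegralZl//; last first.
  apply: (@integrable_bdd R 0 t 1); first by apply: measurable_indic; exact: sf_measurable.
  move=> x _; rewrite indicE normr_nat -[X in _ <= X]/(1%:R) ler_nat.
  by case: (x \in _).
by rewrite /Rintegral integral_indic//; [rewrite mulrC|exact: sf_measurable].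
Qed.

Lemma ae_lt (t : R) (Q : R -> Prop) : (forall s, 0 <= s < t -> Q s) ->
  {ae leb, forall s, `[0, t]%classic s -> Q s}.
Proof.
move=> h; exists [set t]; split; [exact: measurable_set1|exact: lebesgue_measure_set1|].
move=> s /= hs; apply: contrapT => st; apply: hs; rewrite in_itv/= => /andP[s0 st'].
by apply: h; rewrite s0 lt_neqAle st' andbT; exact/eqP.
Qed.

(** Coordinates commute with the integral of simple functions and pass to the limit. The integrand
    is prescribed for s < t only, where the extended semigroup has a positive time. *)
Lemma bochner_coord (t : R) (f : R -> H) (I : H) k (c : R -> R) : 0 <= t ->
  (forall s, 0 <= s < t -> ip (en k) (f s) = c s) -> leb.-integrable `[0, t] (EFin \o c) ->
  is_bochner_integral `[0, t] f I -> ip (en k) I = \int[leb]_(s in `[0, t]) c s.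
Proof.
move=> t0 fc ic [s [ms cs cI]].
pose g n x := ip (en k) (sf_fun (s n) x).
have ig n := (sf_integral_coord (s n) k t0).1.
have est n : (`|\int[leb]_(x in `[0, t]) c x - ip (en k) (sf_integral `[0, t] (s n))|%:E <=
    \int[leb]_(x in `[0%R, t]) (hnorm (f x - sf_fun (s n) x)%R)%:E)%E.
  rewrite (sf_integral_coord (s n) k t0).2 -RintegralB; [|exact: measurable_itv|exact: ic|exact: (ig n)].
  have icg : leb.-integrable `[0, t] (EFin \o (fun x => c x - g n x)) by exact: (integrableB _ ic (ig n)).
  apply: (@le_trans _ _ (\int[leb]_(x in `[0, t]) `|c x - g n x|)%:E).
    by rewrite lee_fin; exact: le_normr_Rintegral.
  have ia := integrable_norm icg.
  rewrite /Rintegral fineK; last exact: integrable_fin_num.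
  apply: ae_ge0_le_integral => //.
  - by case/integrableP: ia.
  - by move=> x _; rewrite lee_fin hnorm_ge0.
  - by apply/measurable_EFinP; exact: ms.
  - apply: ae_lt => x xt; rewrite lee_fin -fc// /g -ipBr.
    by apply: (le_trans (ip_CS _ _)); rewrite hnorm_en mul1r.
have c1 : ip (en k) (sf_integral `[0, t] (s n)) @[n --> \oo] --> ip (en k) I.
  exact: (@ip_cvg R _ _ cI (en k)).
apply/eqP; rewrite -subr_eq0 -normr_le0; apply/ler_addgt0Pr => e e0; rewrite add0r.
have e2 : 0 < e / 2 by rewrite divr_gt0.
have [N1 h1] := ereal_cvg0_le cs e2.
move/cvg_epsP : c1 => /(_ _ e2)[N2 h2].
have {}h1 := le_trans (est _) (h1 (maxn N1 N2) (leq_maxl _ _)).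
have {}h2 := h2 (maxn N1 N2) (leq_maxr _ _).
rewrite lee_fin in h1; rewrite distrC in h1; rewrite distrC in h2.
apply: (le_trans (ler_distD (ip (en k) (sf_integral `[0, t] (s (maxn N1 N2)))) _ _)).
by rewrite [leRHS](splitr e) addrC; apply: lerD; rewrite // distrC.
Qed.

Lemma measurable_lt_itv (t : R) (f g : R -> R) : 0 <= t -> measurable_fun `[0, t] g ->
  (forall s, 0 <= s < t -> f s = g s) -> measurable_fun `[0, t] f.
Proof.
move=> t0 mg fg.
have -> : `[0, t]%classic = `[0, t[%classic `|` [set t].
  by rewrite setUitv1// bnd_simp.
apply/measurable_funU => //; split; last exact: measurable_fun_set1.
apply: (eq_measurable_fun g); first by move=> s /set_mem; rewrite /= in_itv/= => /fg.
by apply: measurable_funS mg => //; apply: subset_itvl; rewrite bnd_simp.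
Qed.

Let q (j : nat) : R := 2 ^+ j * pi.

Lemma q_gt0 j : 0 < q j. Proof. by rewrite mulr_gt0 ?pi_gt0// exprn_gt0. Qed.

(** An integrable majorant for all high modes at once. The sum of kp k exp(- lam k u) over all modes
    has a time integral like the harmonic series; over powers of two the integrals form a geometric
    series. *)
Definition heat_tail (J : nat) (u : R) : \bar R := (\sum_(i <oo) (2 * q (J + i)%N * expR (- (q (J + i)%N ^+ 2 * u)))%:E)%E.

(* Each mode [k] is compared with the largest power of two below [k + 1]. *)
Lemma heat_tail_ge J k u : 0 <= u -> (2 ^ J <= k.+1)%N -> ((kp k * expR (- (lam k * u)))%:E <= heat_tail J u)%E.
Proof.
move=> u0 Jk; have k0 : (0 < k.+1)%N by [].
pose j := trunc_log 2 k.+1; have /andP[j1 j2] := trunc_log_bounds (ltnSn 1) k0.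
rewrite -/j in j1 j2.
have Jj : (J <= j)%N by rewrite /j trunc_log_max.
apply: (@le_trans _ _ (2 * q j * expR (- (q j ^+ 2 * u)))%:E).
  have qk : q j <= kp k by rewrite /kp ler_wpM2r ?pi_ge0// -natrX ler_nat.
  rewrite lee_fin; apply: ler_pM; rewrite ?expR_ge0 ?(ltW (kp_gt0 _))//.
    by rewrite /kp /q mulrA -exprS ler_wpM2r ?pi_ge0// -natrX ler_nat ltnW.
  by rewrite ler_expR lerN2 ler_wpM2r// lerXn2r ?nnegrE ?(ltW (q_gt0 _))// (le_trans (ltW (q_gt0 _)) qk).
have := @nneseries_ge_term R (fun i => (2 * q (J + i)%N * expR (- (q (J + i)%N ^+ 2 * u)))%:E) (j - J)%N.
by rewrite subnKC//; apply => i; rewrite lee_fin mulr_ge0 ?expR_ge0// mulr_ge0// ltW// q_gt0.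
Qed.

Lemma heat_tail_integral J (t : R) : 0 <= t ->
  measurable_fun `[0, t] (fun s => heat_tail J (t - s)) /\
  (\int[leb]_(s in `[0%R, t]) heat_tail J (t - s) <= (4 * 2^-1 ^+ J)%:E)%E.
Proof.
move=> t0; pose F i s := (2 * q (J + i)%N * expR (- (q (J + i)%N ^+ 2 * (t - s))))%:E.
have F0 i s : (0 <= F i s)%E by rewrite lee_fin mulr_ge0// mulr_ge0// ltW// q_gt0.
have mF i : measurable_fun `[0, t] (F i).
  apply/measurable_EFinP; apply: measurable_funM => //; apply: continuous_measurable_itv => x.
  exact: continuous_expRV.
split.
  rewrite [X in measurable_fun _ X](_ : _ = (fun s => \sum_(i <oo) F i s)%E)//.
  by apply: ge0_emeasurable_sum => [i s _ _|i _]; [exact: F0|exact: mF].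
rewrite integral_nneseries//; last by move=> i s _; exact: F0.
apply: nneseries_le_bound => [i|N]; first by apply: integral_ge0 => s _; exact: F0.
have Fi i : (\int[leb]_(s in `[0%R, t]) F i s <= (2 * 2^-1 ^+ J * 2^-1 ^+ i)%:E)%E.
  have q0 := q_gt0 (J + i)%N; have q20 : 0 < q (J + i)%N ^+ 2 by rewrite exprn_gt0.
  have -> : (\int[leb]_(s in `[0%R, t]) F i s = (Vint (q (J + i)%N ^+ 2) (fun _ => 2 * q (J + i)%N) 0 t)%:E)%E.
    rewrite /Vint /Rintegral fineK; last first.
      apply: integrable_fin_num => //.
      by apply: (@integrable_expM R _ t 0 t (2 * q (J + i)%N)) => // s _; rewrite ger0_norm// mulr_ge0// ltW.
    by apply: eq_integral => s _; rewrite /F mulrC.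
  rewrite Vint_cst// lee_fin subr0.
  apply: (@le_trans _ _ (2 * q (J + i)%N / q (J + i)%N ^+ 2)).
    apply: ler_wpM2r; first by rewrite invr_ge0 ltW.
    by apply: ler_piMr; [apply: mulr_ge0 => //; exact: ltW|rewrite gerBl expR_ge0].
  rewrite (_ : 2 * q (J + i)%N / q (J + i)%N ^+ 2 = 2 * (2^-1 ^+ J * 2^-1 ^+ i) / pi); last first.
    rewrite /q exprD !exprVn; move: (pi_gt0 R); move: (pi : R) => p p0; field.
    by rewrite gt_eqF// !expf_neq0.
  rewrite -mulrA -[leRHS]mulrA ler_wpM2l// ler_piMr ?mulr_ge0 ?exprn_ge0 ?invr_ge0//.
  by rewrite invf_le1 ?pi_gt0// (le_trans _ (pi_ge2 R))// ler1n.
apply: (@le_trans _ _ (\sum_(i < N) (2 * 2^-1 ^+ J * 2^-1 ^+ i)%:E)%E); first by apply: lee_sum => i _; exact: Fi.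
rewrite sumEFin lee_fin -mulr_sumr.
have -> : \sum_(i < N) 2^-1 ^+ i = 2 - 2 * 2^-1 ^+ N :> R.
  elim: N => [|N IH]; first by rewrite big_ord0 expr0; lra.
  by rewrite big_ord_recr/= IH exprS; lra.
have : 2 * 2^-1 ^+ J * (2 - 2 * 2^-1 ^+ N) <= 2 * 2^-1 ^+ J * 2 :> R.
  by rewrite ler_wpM2l ?mulr_ge0// gerBl mulr_ge0.
by lra.
Qed.

Section Exists.
(** The assumption [lg] says that f s is the semigroup at time t - s applied to an element of
    H_(-1/2) of norm at most D; [ug] is uniform continuity of each coordinate. *)
Context (t D : R) (f : R -> H) (g : nat -> R -> R) (I : H)
  (t0 : 0 <= t) (D0 : 0 <= D) (fg : forall k s, 0 <= s < t -> ip (en k) (f s) = g k s)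
  (mg : forall k, leb.-integrable `[0, t] (EFin \o g k))
  (ug : forall k e, 0 < e -> exists2 dl, 0 < dl & forall s s', 0 <= s <= t -> 0 <= s' <= t ->
  `|s - s'| <= dl -> `|g k s - g k s'| <= e)
  (lg : forall s, 0 <= s < t -> l2le (fun k => g k s * expR (lam k * (t - s)) / kp k) D)
  (Ig : forall k, ip (en k) I = \int[leb]_(s in `[0, t]) g k s).

Lemma tail_le J s : 0 <= s < t ->
  ((hnorm (f s - proj (2 ^ J).-1 (f s)))%:E <= D%:E * heat_tail J (t - s))%E.
Proof.
move=> st; have /andP[s0 st'] := st; have u0 : 0 <= t - s by rewrite subr_ge0 ltW.
have G0 : (0 <= heat_tail J (t - s))%E.
  by apply: nneseries_ge0 => i _ _; rewrite lee_fin mulr_ge0 ?expR_ge0// mulr_ge0// ltW// q_gt0.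
(* An infinite majorant makes the claim trivial unless D = 0, where the product is 0 and f s
   vanishes itself. *)
have [Gf|] := boolP (heat_tail J (t - s) < +oo)%E; last first.
  rewrite -leNgt leye_eq => /eqP Gi; rewrite Gi.
  move: D0; rewrite le_eqVlt => /predU1P[D0'|D0']; last by rewrite gt0_muley ?lte_fin// leey.
  have : hnorm (f s - proj (2 ^ J).-1 (f s)) <= 0.
    have := lg st; rewrite -D0' => lz; apply: l2le_hnorm; split=> // N.
    rewrite expr0n big1// => k _.
    have gz i : g i s = 0.
      have := l2le_le i lz; rewrite normr_le0 => /eqP h.
      have := congr1 (fun z => z * kp i / expR (lam i * (t - s))) h.
      by rewrite !mul0r divfK ?mulfK// gt_eqF ?kp_gt0 ?expR_gt0.
    rewrite ipBr projE ip_sumr fg// gz sub0r big1 ?oppr0 ?expr0n// => i _.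
    by rewrite ipZr fg// gz mul0r.
  by rewrite -D0' mul0e lee_fin.
pose G := fine (heat_tail J (t - s)); have GE : heat_tail J (t - s) = G%:E.
  by rewrite fineK// ge0_fin_numE.
have G0' : 0 <= G by rewrite fine_ge0.
rewrite GE -EFinM lee_fin mulrC; apply: l2le_hnorm.
rewrite -[G]ger0_norm//; apply: l2le_mono (l2leZ G (lg st)) => k.
rewrite ipBr projE ip_sumr fg//.
have [kJ|Jk] := ltnP k (2 ^ J).-1.
  rewrite (bigD1 (Ordinal kJ))//= ipZr en_orth eqxx mulr1 big1 ?addr0 => [|i ik]; last first.
    rewrite ipZr en_orth0 ?mulr0//; apply: contra ik => /eqP ik; exact/eqP/val_inj.
  by rewrite fg// subrr normr0.
rewrite big1 ?subr0 => [|i _]; last by rewrite ipZr en_orth0 ?mulr0// gtn_eqF// (leq_trans (ltn_ord i)).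
have Jk' : (2 ^ J <= k.+1)%N by rewrite -(prednK (expn_gt0 2 J : 0 < 2 ^ J)%N) ltnS.
have := heat_tail_ge u0 Jk'; rewrite GE lee_fin => hG.
have k0 := @kp_gt0 R k.
have e1 : expR (lam k * (t - s)) * expR (- (lam k * (t - s))) = 1 by rewrite -expRD subrr expR0.
have gE : g k s = (kp k * expR (- (lam k * (t - s)))) * (g k s * expR (lam k * (t - s)) / kp k).
  rewrite -[LHS]mulr1 -e1; move: (expR _) (expR _) => x y; field.
  by rewrite gt_eqF.
rewrite {1}gE; move: (g k s * _ / _) hG; move: (expR (- _)) (expR_ge0 (- (lam k * (t - s)))) => x x0 z hG.
rewrite normrM [leRHS]normrM ler_wpM2r// ger0_norm; last by rewrite mulr_ge0// ltW.
by rewrite [leRHS]ger0_norm.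
Qed.

Lemma common_mesh N e : 0 < e -> exists M : nat, forall k s s', (k < N)%N -> 0 <= s <= t -> 0 <= s' <= t ->
  `|s - s'| <= t / M.+1%:R -> `|g k s - g k s'| <= e.
Proof.
move=> e0; have [dl d0 hd] : exists2 dl, 0 < dl & forall k s s', (k < N)%N -> 0 <= s <= t -> 0 <= s' <= t ->
    `|s - s'| <= dl -> `|g k s - g k s'| <= e.
  elim: N => [|N [d1 d10 h1]]; first by exists 1.
  have [d2 d20 h2] := ug N e0; exists (Num.min d1 d2); first by rewrite lt_min d10.
  move=> k s s'; rewrite ltnS leq_eqVlt le_min => /predU1P[->|kN] hs hs' /andP[l1 l2].
    exact: h2.
  exact: h1.
exists (Num.bound (t / dl)) => k s s' kN hs hs' h; apply: hd => //; apply: (le_trans h).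
rewrite ler_pdivrMr// mulrC -ler_pdivrMr//; apply: ltW.
apply: lt_le_trans (archi_boundP _) _; first by rewrite divr_ge0// ltW.
by rewrite ler_nat.
Qed.

Definition step_sf (N M : nat) : simple_function R := @SimpleFunction R M.+1
  (fun m => `[m%:R * (t / M.+1%:R), m.+1%:R * (t / M.+1%:R)[%classic)
  (fun m => \sum_(k < N) g k (m%:R * (t / M.+1%:R)) *: en k)
  (fun m => measurable_itv _).

Lemma step_sf_fun N M s : 0 <= s < t -> exists m, [/\ 0 <= m%:R * (t / M.+1%:R) <= t,
  `|s - m%:R * (t / M.+1%:R)| <= t / M.+1%:R &
  sf_fun (step_sf N M) s = \sum_(k < N) g k (m%:R * (t / M.+1%:R)) *: en k].
Proof.
move=> /andP[s0 st]; have tp : 0 < t by rewrite (le_lt_trans s0).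
set dl := t / M.+1%:R; have d0 : 0 < dl by rewrite divr_gt0.
have [m [_ m1 m2]] := gfl_le d0 s0; exists m.
have tE : M.+1%:R * dl = t by rewrite mulrCA divff ?mulr1// pnatr_eq0.
have mM : (m < M.+1)%N by rewrite -(ltr_nat R) -(ltr_pM2r d0) tE (le_lt_trans m1).
split.
- by rewrite mulr_ge0 ?(ltW d0)//= (le_trans m1)// ltW.
- by rewrite ger0_norm ?subr_ge0// lerBlDr (le_trans (ltW m2))// -natr1 mulrDl mul1r addrC.
- rewrite /sf_fun/= (bigD1 (Ordinal mM))//= -/dl indicE mem_set ?scale1r; last by rewrite /= in_itv/= m1 m2.
  rewrite [X in _ + X]big1 ?addr0// => i im; rewrite indicE memNset ?scale0r//= in_itv/= => /andP[i1 i2].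
  move: im; rewrite -(inj_eq val_inj)/= => /eqP; apply.
  have a1 : (i < m.+1)%N by rewrite -(ltr_nat R) -(ltr_pM2r d0) (le_lt_trans i1 m2).
  have a2 : (m < i.+1)%N by rewrite -(ltr_nat R) -(ltr_pM2r d0) (le_lt_trans m1 i2).
  by apply/eqP; rewrite eqn_leq -ltnS a1 -ltnS a2.
Qed.

(** The J-th simple function samples the first 2^J - 1 coordinates on a grid fine enough for a total
    error 2^(-J); the omitted coordinates are controlled in time integral by
    [heat_tail_integral]. *)
Lemma bochner_exists : is_bochner_integral `[0, t] f I.
Proof.
pose N J := (2 ^ J).-1.
have e0 J : 0 < 2^-1 ^+ J / (N J).+1%:R :> R by rewrite divr_gt0// exprn_gt0 ?invr_gt0.
have /choice[M hM] := fun J => common_mesh (N J) (e0 J).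
pose S J := step_sf (N J) (M J).
have sN J (F : nat -> R) : (forall k, (k < N J)%N -> `|F k| <= 2^-1 ^+ J / (N J).+1%:R) -> \sum_(k < N J) `|F k| <= 2^-1 ^+ J.
  move=> hF; apply: (@le_trans _ _ (\sum_(k < N J) (2^-1 ^+ J / (N J).+1%:R))).
    by apply: ler_sum => k _; exact: hF.
  rewrite sumr_const card_ord -[_ *+ N J]mulr_natr -mulrA ler_piMr ?exprn_ge0 ?invr_ge0//.
  by rewrite mulrC ler_pdivrMr ?ltr0n// mul1r ler_nat.
have near_proj J s : 0 <= s < t -> hnorm (proj (N J) (f s) - sf_fun (S J) s) <= 2^-1 ^+ J.
  move=> st; have [m [m0 ms ->]] := step_sf_fun (N J) (M J) st.
  rewrite projE -sumrB.
  rewrite (eq_bigr (fun k : 'I_(N J) => (g k s - g k (m%:R * (t / (M J).+1%:R))) *: en k)); last first.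
    by move=> k _; rewrite fg// scalerBl.
  apply: (le_trans (hnorm_sum _ (fun k => (g k s - g k (m%:R * (t / (M J).+1%:R))) *: en k))).
  under eq_bigr do rewrite hnormZ hnorm_en mulr1.
  apply: (sN J (fun k => g k s - g k (m%:R * (t / (M J).+1%:R)))) => k kN.
  by apply: hM => //; have /andP[-> /ltW ->] := st.
have mS J : measurable_fun `[0, t] (fun x => hnorm (f x - sf_fun (S J) x)).
  apply: hnorm_measurable => // k.
  apply: (@measurable_lt_itv t _ (fun s => g k s - ip (en k) (sf_fun (S J) s))) => //.
    apply: measurable_funB.
      by have /integrableP[/measurable_EFinP] := mg k.
    by have [/integrableP[/measurable_EFinP]] := sf_integral_coord (S J) k t0.
  by move=> s st; rewrite ipBr fg.
have z0 : (fun J => (2^-1 : R) ^+ J) @ \oo --> (0 : R).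
  by apply: cvg_expr; rewrite ger0_norm ?invr_ge0// invf_lt1// ltr1n.
exists S; split=> //.
- apply: (@squeeze_cvge _ _ _ _ (fun _ => 0%E) _ (fun J => (t * 2^-1 ^+ J + D * (4 * 2^-1 ^+ J))%:E)).
  + apply: nearW => J; apply/andP; split; first by apply: integral_ge0 => x _; rewrite lee_fin hnorm_ge0.
    have [mG iG] := heat_tail_integral J t0.
    have G0 s : (0 <= heat_tail J (t - s))%E.
      by apply: nneseries_ge0 => i _ _; rewrite lee_fin mulr_ge0 ?expR_ge0// mulr_ge0// ltW// q_gt0.
    apply: (@le_trans _ _ (\int[leb]_(x in `[0%R, t]) ((2^-1 ^+ J)%:E + D%:E * heat_tail J (t - x)))%E).
      apply: ae_ge0_le_integral => //.
      * by move=> x _; rewrite lee_fin hnorm_ge0.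
      * by apply/measurable_EFinP; exact: mS.
      * by move=> x _; rewrite adde_ge0 ?mule_ge0.
      * by apply: emeasurable_funD => //; exact: emeasurable_funM.
      * apply: ae_lt => s st; apply: le_trans (_ : ((2^-1 ^+ J)%:E + (hnorm (f s - proj (N J) (f s)))%:E <= _)%E); last first.
          by apply: leeD => //; exact: tail_le.
        have h1 := hnorm_dist (f s) (proj (N J) (f s)) (sf_fun (S J) s).
        have h2 := near_proj J s st; rewrite -EFinD lee_fin [leRHS]addrC.
        by apply: (le_trans h1); rewrite lerD2l.
    rewrite ge0_integralD//; last 2 first.
    * by move=> x _; rewrite mule_ge0.
    * exact: emeasurable_funM.
    rewrite integral_cst//= lebesgue_measure0t// EFinD; apply: leeD; first by rewrite -EFinM mulrC.
    rewrite ge0_integralZl//.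
    by rewrite [leRHS]EFinM lee_wpmul2l ?lee_fin.
  + exact: cvg_cst.
  + apply: cvg_EFin; first exact: nearW.
    rewrite (_ : 0 = t * 0 + D * (4 * 0)); last by rewrite !mulr0 addr0.
    by apply: cvgD; apply: cvgM => //; [exact: cvg_cst|exact: cvg_cst|apply: cvgM => //; exact: cvg_cst].
- have pI : hnorm (proj (N J) I - I) @[J --> \oo] --> (0 : R).
    apply/cvg_epsP => e ep; have /cvg_epsP/(_ e ep)[n hn] := @proj_cvg R I.
    exists n => J nJ; apply: hn; apply: (leq_trans nJ); rewrite -ltnS prednK ?expn_gt0//.
    exact: ltn_expl.
  have tz : (fun J => t * (2^-1 : R) ^+ J) @ \oo --> (0 : R).
    by rewrite -[X in _ --> X](mulr0 t); apply: cvgM => //; exact: cvg_cst.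
  apply: (@cvg0_squeeze R _ (fun J => t * 2^-1 ^+ J + hnorm (proj (N J) I - I))); last first.
    by rewrite -[X in _ --> X]addr0; apply: cvgD.
  move=> J; rewrite hnorm_ge0/=; have h1 := hnorm_dist (sf_integral `[0, t] (S J)) (proj (N J) I) I.
  apply: (le_trans h1); rewrite lerD2r.
  have cS k : ip (en k) (sf_integral `[0, t] (S J)) = if (k < N J)%N then ip (en k) (sf_integral `[0, t] (S J)) else 0.
    case: ltnP => // kN; rewrite /sf_integral ip_sumr big1// => m _.
    rewrite ipZr/= ip_sumr big1 ?mulr0// => i _.
    by rewrite ipZr en_orth0 ?mulr0// gtn_eqF// (leq_trans (ltn_ord i)).
  have -> : sf_integral `[0, t] (S J) - proj (N J) I =
      \sum_(k < N J) (ip (en k) (sf_integral `[0, t] (S J)) - ip (en k) I) *: en k.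
    rewrite projE; under [RHS]eq_bigr do rewrite scalerBl.
    rewrite sumrB; congr (_ - _); move: cS; move: (sf_integral _ _) => V cS; apply: L2_coord_eq => k; rewrite cS ip_sumr.
    case: ltnP => kN.
      rewrite (bigD1 (Ordinal kN))//= ipZr en_orth eqxx mulr1 big1 ?addr0// => i ik.
      rewrite ipZr en_orth0 ?mulr0//; apply: contra ik => /eqP ik; exact/eqP/val_inj.
    by rewrite big1// => i _; rewrite ipZr en_orth0 ?mulr0// gtn_eqF// (leq_trans (ltn_ord i)).
  apply: (le_trans (hnorm_sum _ (fun k => (ip (en k) (sf_integral `[0, t] (S J)) - ip (en k) I) *: en k))).
  under eq_bigr do rewrite hnormZ hnorm_en mulr1.
  have Ek k : (k < N J)%N -> `|ip (en k) (sf_integral `[0, t] (S J)) - ip (en k) I| <= t * (2^-1 ^+ J / (N J).+1%:R).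
    move=> kN; have [iS ->] := sf_integral_coord (S J) k t0; rewrite Ig -RintegralB//.
    have iB : leb.-integrable `[0, t] (EFin \o (fun x => ip (en k) (sf_fun (S J) x) - g k x)) by exact: (integrableB _ iS (mg k)).
    have ia := integrable_norm iB.
    apply: (le_trans (le_normr_Rintegral _ iB)) => //.
    rewrite -lee_fin /Rintegral fineK; last exact: integrable_fin_num.
    apply: (@le_trans _ _ (\int[leb]_(x in `[0%R, t]) (2^-1 ^+ J / (N J).+1%:R)%:E)%E).
      apply: ae_ge0_le_integral => //.
      - by case/integrableP: ia.
      apply: ae_lt => s st; rewrite lee_fin; have [m [m0 ms ->]] := step_sf_fun (N J) (M J) st.
      rewrite ip_sumr (bigD1 (Ordinal kN))//= ipZr en_orth eqxx mulr1 big1 ?addr0 => [|i ik]; last first.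
        rewrite ipZr en_orth0 ?mulr0//; apply: contra ik => /eqP ik; exact/eqP/val_inj.
      by apply: hM => //; [have /andP[-> /ltW ->] := st|rewrite distrC].
    by rewrite integral_cst//= lebesgue_measure0t// -EFinM lee_fin mulrC.
  apply: (@le_trans _ _ (\sum_(k < N J) t * (2^-1 ^+ J / (N J).+1%:R))).
    by apply: ler_sum => k _; exact: Ek.
  rewrite -mulr_sumr ler_wpM2l//.
  have := sN J (fun _ => 2^-1 ^+ J / (N J).+1%:R); under eq_bigr do rewrite (gtr0_norm (e0 J)).
  by apply => k _; rewrite (gtr0_norm (e0 J)).
Qed.

End Exists.
End Bochner.

(** * Continuous paths and a countable dense set of times *)

Section Continuity.
Context {R : realType}.
Local Notation H := (L2 R).

Lemma Hdom_mono (r s : R) (v : H) : r <= s -> Hdom s v -> Hdom r v.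
Proof.
move=> rs dv; apply: (l2le_Hnorm (A := Hnorm s v) _).1.
apply: l2le_mono (Hnorm_l2le dv (lexx _)) => k.
by rewrite !normrM ler_wpM2r// !ger0_norm ?powR_ge0// lam_powR_incr.
Qed.

Lemma hnorm_le_Hnorm (r : R) (v : H) : 0 <= r -> Hdom r v -> hnorm v <= Hnorm r v.
Proof.
move=> r0 dv; apply: l2le_hnorm; apply: l2le_mono (Hnorm_l2le dv (lexx _)) => k.
by rewrite normrM ler_peMl// ger0_norm ?powR_ge0// -(powRr0 (lam k)) lam_powR_incr.
Qed.

(** A countable dense set of times with two free indices; the default 0 keeps every value inside
    [0, T]. *)
Definition tim (T : R) (i j : nat) : R := if (i <= j.+1)%N then T * (i%:R / j.+1%:R) else 0.

Lemma tim_in (T : R) i j : 0 <= T -> 0 <= tim T i j <= T.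
Proof.
move=> T0; rewrite /tim; case: ifP => ij; last by rewrite lexx.
by rewrite mulr_ge0 ?divr_ge0//= ler_piMr// ler_pdivrMr ?ltr0n// mul1r ler_nat.
Qed.

Lemma tim_dense (T t : R) j : 0 < T -> 0 <= t <= T ->
  `|tim T (Num.truncn (j.+1%:R * (t / T))) j - t| <= T * j.+1%:R^-1.
Proof.
move=> T0 /andP[t0 tT]; set x := j.+1%:R * (t / T).
have x0 : 0 <= x by rewrite mulr_ge0// divr_ge0// ltW.
have /andP[h1 h2] := Num.Theory.truncn_itv x0.
have xj : x <= j.+1%:R by rewrite /x ler_piMr// ler_pdivrMr// mul1r.
have ij : (Num.truncn x <= j.+1)%N by rewrite -(ler_nat R) (le_trans h1).
rewrite /tim ij; have tE : t = T * (x / j.+1%:R).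
  by rewrite /x [j.+1%:R * _]mulrC mulfK ?pnatr_eq0// mulrC divfK// gt_eqF.
rewrite {1}tE -mulrBr -mulrBl normrM (gtr0_norm T0) ler_wpM2l ?(ltW T0)//.
rewrite normrM [`|_^-1|]ger0_norm// ler_piMl ?invr_ge0//.
by rewrite distrC ger0_norm ?subr_ge0// lerBlDl natr1 ltW.
Qed.

Definition cont_on (T : R) (f : R -> R) := forall t e, 0 <= t <= T -> 0 < e ->
  exists2 d, 0 < d & forall s, 0 <= s <= T -> `|s - t| < d -> `|f s - f t| <= e.

Lemma cont_on_within (T : R) (f : R -> R) : cont_on T f -> {within `[0, T], continuous f}.
Proof.
move=> cf; apply/subspace_continuousP => t /=; rewrite in_itv/= => tT.
apply/cvgrPdist_le => e e0; have [d d0 hd] := cf t e tT e0.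
rewrite near_withinE; apply/nbhs_ballP; exists d => // s; rewrite -ball_normE/= distrC => st.
by rewrite in_itv/= => sT; rewrite distrC; exact: hd.
Qed.

Lemma cont_on_measurable (T : R) (f : R -> R) : cont_on T f -> measurable_fun `[0, T] f.
Proof. by move=> /cont_on_within cf; apply: subspace_continuous_measurable_fun. Qed.

Lemma cont_on_bounded (T : R) (f : R -> R) : 0 <= T -> cont_on T f ->
  exists2 D, 0 <= D & forall t, 0 <= t <= T -> `|f t| <= D.
Proof.
move=> T0 /cont_on_within cf.
have /compact_bounded[M [Mr hM]] := continuous_compact cf (@segment_compact R 0 T).
exists (`|M| + 1); first by rewrite addr_ge0.
move=> t tT; apply: (hM (`|M| + 1)); first by rewrite (le_lt_trans (ler_norm M))// ltrDl.
by exists t => //=; rewrite in_itv.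
Qed.

Lemma cont_on_eq (T : R) (f : R -> R) : 0 < T -> cont_on T f -> (forall i j, f (tim T i j) = 0) ->
  forall t, 0 <= t <= T -> f t = 0.
Proof.
move=> T0 cf f0 t tT; apply/eqP; rewrite -normr_le0; apply/ler_addgt0Pr => e e0; rewrite add0r.
have [d d0 hd] := cf t e tT e0.
have /cvg_epsP/(_ _ (_ : 0 < d / 2))[|N hN] := @cvg_cst_harmonic R T; first by rewrite divr_gt0.
have := hN N (leqnn N); rewrite subr0 ger0_norm; last by rewrite mulr_ge0 ?invr_ge0// ltW.
move=> h; have := hd _ (tim_in (Num.truncn (N.+1%:R * (t / T))) N (ltW T0)).
rewrite f0 sub0r normrN; apply; apply: (le_lt_trans (tim_dense N T0 tT)); apply: (le_lt_trans h).
by rewrite ltr_pdivrMr// ltr_pMr// ltr1n.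
Qed.

Lemma cont_onB (T : R) (f g : R -> R) : cont_on T f -> cont_on T g -> cont_on T (fun t => f t - g t).
Proof.
move=> cf cg t e tT e0; have e2 : 0 < e / 2 by rewrite divr_gt0.
have [d1 d10 h1] := cf t _ tT e2; have [d2 d20 h2] := cg t _ tT e2.
exists (Num.min d1 d2); first by rewrite lt_min d10.
move=> s sT; rewrite lt_min => /andP[s1 s2].
have -> : f s - g s - (f t - g t) = (f s - f t) - (g s - g t) by ring.
apply: (le_trans (ler_normB _ _)); rewrite [leRHS](splitr e); apply: lerD; [exact: h1|exact: h2].
Qed.

Lemma Vint_lip (T l M s t : R) (f : R -> R) : 0 < l -> 0 <= M -> measurable_fun `[0, T] f ->
  (forall u, 0 <= u <= T -> `|f u| <= M) -> 0 <= s -> s <= t -> t <= T ->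
  `|Vint l f 0 t - Vint l f 0 s| <= 2 * M * (t - s).
Proof.
move=> l0 M0 mf fM s0 st tT.
have mft : measurable_fun `[0, t] f.
  by apply: measurable_funS mf => //; apply: subset_itvl; rewrite bnd_simp.
have mfst : measurable_fun `[s, t] f.
  by apply: measurable_funS mft => //; apply: subset_itvr; rewrite bnd_simp.
have mfs : measurable_fun `[0, s] f.
  by apply: measurable_funS mft => //; apply: subset_itvl; rewrite bnd_simp.
have fMt u : 0 <= u <= t -> `|f u| <= M by move=> /andP[u0 ut]; apply: fM; rewrite u0 (le_trans ut).
rewrite (@Vint_shift R l f 0 s t M)//; last by rewrite s0.
have d0 : 0 <= l * (t - s) by rewrite mulr_ge0 ?(ltW l0)// subr_ge0.
have h1 : `|expR (- (l * (t - s))) - 1| <= l * (t - s) by exact: normr_expRN_sub1.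
have h2 : `|Vint l f 0 s| <= M / l.
  apply: (le_trans (@normr_Vint_cst R l M s f l0 s0 mfs _)).
    by move=> u /andP[u0 us]; apply: fMt; rewrite u0 (le_trans us).
  by rewrite ler_wpM2r ?invr_ge0 ?(ltW l0)// ler_piMr// gerBl expR_ge0.
have h3 : `|Vint l f s t| <= M * (t - s).
  apply: (@le_trans _ _ (Vint l (fun _ => M) s t)).
    apply: (@normr_Vint_le R l f (fun _ => M) s t M) => //; first by move=> u; exact: cvg_cst.
    by move=> u /andP[u1 u2]; apply: fMt; rewrite u2 (le_trans s0).
  rewrite Vint_cst// -mulrA ler_wpM2l// ler_pdivrMr// mulrC [leRHS]mulrC.
  by move: h1; rewrite distrC ger0_norm; [rewrite mulrC|rewrite subr_ge0 -[leRHS]expR0 ler_expR oppr_le0].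
have -> : expR (- (l * (t - s))) * Vint l f 0 s + Vint l f s t - Vint l f 0 s =
  (expR (- (l * (t - s))) - 1) * Vint l f 0 s + Vint l f s t by ring.
apply: (le_trans (ler_normD _ _)); rewrite normrM.
apply: (@le_trans _ _ (l * (t - s) * (M / l) + M * (t - s))).
  by apply: lerD => //; apply: ler_pM.
by apply: eq_ler; field; rewrite gt_eqF.
Qed.

Lemma Vint_cont_on (T l M : R) (f : R -> R) : 0 < l -> 0 <= M -> measurable_fun `[0, T] f ->
  (forall u, 0 <= u <= T -> `|f u| <= M) -> cont_on T (fun t => Vint l f 0 t).
Proof.
move=> l0 M0 mf fM t e /andP[t0 tT] e0.
have M1 : 0 < 2 * M + 1 by rewrite ltr_wpDl// mulr_ge0.
exists (e / (2 * M + 1)); first by rewrite divr_gt0.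
move=> s /andP[s0 sT] st.
have key : `|Vint l f 0 s - Vint l f 0 t| <= 2 * M * `|s - t|.
  have [h|/ltW h] := leP s t.
    by rewrite distrC [`|s - t|]distrC [`|t - s|]ger0_norm ?subr_ge0//; exact: (@Vint_lip T l M).
  by rewrite [`|s - t|]ger0_norm ?subr_ge0//; exact: (@Vint_lip T l M).
apply: (le_trans key); apply: (@le_trans _ _ ((2 * M + 1) * (e / (2 * M + 1)))).
  by apply: ler_pM => //; [rewrite mulr_ge0|rewrite lerDl|exact: ltW].
by rewrite mulrC divfK// gt_eqF.
Qed.

Definition cont_path (T rho : R) (Y : R -> H) := (forall t, 0 <= t <= T -> Hdom rho (Y t)) /\
  forall t, 0 <= t <= T -> Hnorm rho (Y s - Y t) @[s --> within `[0, T] (nbhs t)] --> (0 : R).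

Lemma cont_path_hnorm (T rho : R) (Y : R -> H) : 0 <= rho -> cont_path T rho Y ->
  forall t e, 0 <= t <= T -> 0 < e -> exists2 d, 0 < d & forall s, 0 <= s <= T -> `|s - t| < d -> hnorm (Y s - Y t) <= e.
Proof.
move=> r0 [dY cY] t e tT e0; have := cY t tT => /cvgrPdist_le/(_ e e0).
rewrite near_withinE => /nbhs_ballP[d /= d0 hd]; exists d => // s sT st.
have := hd s; rewrite -ball_normE/= distrC in_itv/= => /(_ st sT).
rewrite sub0r normrN ger0_norm; last exact: hnorm_ge0.
by apply: le_trans; apply: hnorm_le_Hnorm => //; apply: Hdom_add; [exact: dY|exact/Hdom_opp/dY].
Qed.

Lemma cont_path_props (T rho : R) (Y : R -> H) : 0 <= T -> 0 <= rho -> cont_path T rho Y ->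
  exists2 D, 0 <= D & [/\ forall t, 0 <= t <= T -> hnorm (Y t) <= D,
    forall k, cont_on T (fun t => ip (en k) (Y t)) & forall k, cont_on T (fun t => Bq k (Y t))].
Proof.
move=> T0 r0 cY; have hY := cont_path_hnorm r0 cY.
have [|D D0 hD] := @cont_on_bounded T (fun t => hnorm (Y t)) T0.
  move=> t e tT e0; have [d d0 hd] := hY t e tT e0; exists d => // s sT st.
  by apply: (le_trans (hnorm_tri_abs _ _)); exact: hd.
have YD t : 0 <= t <= T -> hnorm (Y t) <= D.
  by move=> /hD; rewrite ger0_norm ?hnorm_ge0.
exists D => //; split=> // k t e tT e0.
  have [d d0 hd] := hY t e tT e0; exists d => // s sT st.
  by rewrite -ipBr; apply: (le_trans (ip_CS _ _)); rewrite hnorm_en mul1r; exact: hd.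
have [z zE] : exists z, z = kp k * (2 * D) by exists (kp k * (2 * D)).
have z0 : 0 <= z by rewrite zE; apply: mulr_ge0; [exact/ltW/kp_gt0|rewrite mulr_ge0].
have c0 : 0 < z + 1 by rewrite ltr_wpDl.
have [d d0 hd] := hY t _ tT (divr_gt0 e0 c0); exists d => // s sT st.
apply: (le_trans (Bq_lip _ _ _)).
apply: (@le_trans _ _ (kp k * (e / (z + 1) * (2 * D)))).
  rewrite ler_wpM2l ?(ltW (kp_gt0 _))//; apply: ler_pM; rewrite ?hnorm_ge0 ?addr_ge0 ?hnorm_ge0//.
    exact: hd.
  by rewrite mulr_natl mulr2n lerD// YD.
rewrite (_ : kp k * (e / (z + 1) * (2 * D)) = e * (z / (z + 1))); last first.
  by rewrite {2}zE; move: (kp k) (z + 1)^-1 => x y; ring.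
by rewrite ler_piMr ?(ltW e0)// ler_pdivrMr// mul1r lerDl.
Qed.

End Continuity.

(** * From Bochner integrals to Volterra equations and back *)

Section Bridge.
Context {R : realType}.
Local Notation H := (L2 R).
Context (Hneg : R -> completeNormedModType R) (emb : forall r : R, {linear H -> Hneg r}).
Hypothesis HnegP : negative_interpolation_spaces emb.
Context (F : H -> Hneg (- 2^-1)).
Hypothesis F_def : forall v, Hdom 8^-1 v -> F v = - (2^-1 *: distr_deriv emb (sqrL2 v)).
Context (T rho : R) (xi : H) (T0 : 0 < T) (rho8 : 8^-1 < rho).

Let rho0 : 0 <= rho. Proof. by apply: le_trans (ltW rho8); rewrite invr_ge0. Qed.

Lemma ext_coord u v k : 0 < u -> Hdom rho v -> ip (en k) (semigroup_ext emb u (F v)) = expR (- (u * lam k)) * Bq k v.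
Proof.
move=> u0 dv; rewrite F_def; last exact: Hdom_mono (ltW rho8) dv.
apply: semigroup_ext_F => //; have [C C0 hC] := L4_embedding rho8.
by have /HdomP[B hB] := dv; have [] := hC v B hB.
Qed.

(** The quotient is half a cosine coefficient of v^2, so Bessel's inequality and the L^4 embedding
    bound the sequence. *)
Lemma drift_l2le (D : R) : exists2 D', 0 <= D' & forall v, l2le (fun k => lam k `^ rho * ip (en k) v) D ->
  l2le (fun k => Bq k v / kp k) D'.
Proof.
have [C C0 hC] := L4_embedding rho8; exists (C * D ^+ 2); first by rewrite mulr_ge0 ?sqr_ge0// ltW.
move=> v [D0 hv]; have [sv nv] := hC v _ hv.
apply: l2le_wid nv _; split; first exact: hnorm_ge0.
move=> N; apply: le_trans (bessel (@cn_orth R) (sqrL2 v) N); apply: ler_sum => k _.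
rewrite Bq_sqrL2// (ipC (sqrL2 v)); have k0 := @kp_gt0 R k.
rewrite (_ : 2^-1 * kp k * ip (cn k) (sqrL2 v) / kp k = 2^-1 * ip (cn k) (sqrL2 v)); last first.
  by move: (ip _ _) => z; field; rewrite gt_eqF.
by rewrite exprMn ler_piMl ?sqr_ge0// exprn_ile1 ?invr_ge0// invf_le1// ler1n.
Qed.

Lemma bochner_solution (D : R) (X : R -> H) (t : R) (I : H) : 0 <= t <= T -> 0 <= D ->
  (forall s, 0 <= s <= T -> l2le (fun k => lam k `^ rho * ip (en k) (X s)) D) ->
  (forall s, 0 <= s <= T -> hnorm (X s) <= D) ->
  (forall r s, 0 <= r -> r <= s -> s <= T -> hnorm (X s - X r) <= D * (s - r) `^ 8^-1) ->
  (forall k, ip (en k) I = Vint (lam k) (fun s => Bq k (X s)) 0 t) ->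
  is_bochner_integral `[0, t] (fun s => semigroup_ext emb (t - s) (F (X s))) I.
Proof.
move=> /andP[t0 tT] D0 lX XD Xc hI; have [D' D'0 hD'] := drift_l2le D.
have sT s : 0 <= s <= t -> 0 <= s <= T by move=> /andP[-> st]; rewrite (le_trans st).
have dX s : 0 <= s <= T -> Hdom rho (X s) by move=> /lX /l2le_Hnorm[].
pose g k s := expR (- (lam k * (t - s))) * Bq k (X s).
have B2 k s : 0 <= s <= t -> `|Bq k (X s)| <= kp k * D ^+ 2.
  move=> st; apply: (le_trans (Bq_le _ _)); rewrite ler_wpM2l ?(ltW (kp_gt0 _))//.
  by rewrite lerXn2r ?nnegrE ?hnorm_ge0// XD// sT.
apply: (@bochner_exists R t D' _ g) => //.
- move=> k s /andP[s0 st]; rewrite ext_coord ?subr_gt0//; last by apply: dX; rewrite s0 (le_trans (ltW st)).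
  by rewrite [(t - s) * _]mulrC.
- move=> k; apply: (@integrable_expM R (lam k) t 0 t (kp k * D ^+ 2)) => //; last exact: B2.
  have mB := @Bq_measurable R T T0 D X k D0 XD Xc.
  by apply: measurable_funS mB => //; apply: subset_itvl; rewrite bnd_simp.
(* The coordinate is a Lipschitz exponential times a Hoelder continuous drift; for times at distance
   at most 1 both changes are of order 1/8. *)
- move=> k e e0; have l0 := @lam_gt0 R k; have k0 := @kp_gt0 R k.
  have [C [C0 C1 C2]] : exists C, [/\ 0 <= C, lam k * (kp k * D ^+ 2) <= C & kp k * (D * (2 * D)) <= C].
    exists (lam k * (kp k * D ^+ 2) + kp k * (D * (2 * D))).
    have a1 : 0 <= lam k * (kp k * D ^+ 2) by rewrite (mulr_ge0 (ltW l0))// (mulr_ge0 (ltW k0))// sqr_ge0.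
    have a2 : 0 <= kp k * (D * (2 * D)) by rewrite (mulr_ge0 (ltW k0))// !mulr_ge0.
    by rewrite addr_ge0// lerDl lerDr.
  have key s s' : 0 <= s -> s <= s' -> s' <= t -> s' - s <= 1 -> `|g k s' - g k s| <= (2 * C) * (s' - s) `^ 8^-1.
    move=> s0 ss st d1; have s0' := le_trans s0 ss; have d0 : 0 <= s' - s by rewrite subr_ge0.
    have u1 : 0 <= s <= t by rewrite s0 (le_trans ss).
    have u2 : 0 <= s' <= t by rewrite s0'.
    have dp : s' - s <= (s' - s) `^ 8^-1.
      move: d0; rewrite le_eqVlt => /predU1P[<-|d0]; first exact: powR_ge0.
      rewrite -[leLHS](powRr1 (ltW d0)); apply: powR_le1_decr => //.
      by rewrite invf_le1// ler1n.
    have eE : expR (- (lam k * (t - s))) = expR (- (lam k * (t - s'))) * expR (- (lam k * (s' - s))).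
      by rewrite -expRD; congr expR; ring.
    have x1 : expR (- (lam k * (t - s'))) <= 1 by rewrite -[leRHS]expR0 ler_expR oppr_le0 mulr_ge0 ?(ltW l0)// subr_ge0.
    have y1 : `|expR (- (lam k * (s' - s))) - 1| <= lam k * (s' - s).
      by apply: normr_expRN_sub1; rewrite mulr_ge0// ltW.
    have b1 := B2 k s u1.
    have b2 : `|Bq k (X s') - Bq k (X s)| <= kp k * (D * (2 * D)) * (s' - s) `^ 8^-1.
      apply: (le_trans (Bq_lip _ _ _)); rewrite -[leRHS]mulrA ler_wpM2l ?(ltW k0)// -[leRHS]mulrA [2 * D * _]mulrC mulrA.
      apply: ler_pM; rewrite ?hnorm_ge0 ?addr_ge0 ?hnorm_ge0//.
        by apply: Xc => //; exact: le_trans st tT.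
      by rewrite mulr_natl mulr2n lerD// XD// sT.
    rewrite /g eE; have := expR_ge0 (- (lam k * (t - s'))).
    move: x1 y1 b1 b2; move: (expR (- (lam k * (t - s')))) (expR (- (lam k * (s' - s)))) (Bq k (X s')) (Bq k (X s)) => x y b' b x1 y1 b1 b2 x0.
    have -> : x * b' - x * y * b = x * ((b' - b) - (y - 1) * b) by ring.
    rewrite normrM ger0_norm//; apply: (@le_trans _ _ (1 * (C * (s' - s) `^ 8^-1 + C * (s' - s) `^ 8^-1))); last by rewrite mul1r; lra.
    apply: ler_pM => //; apply: (le_trans (ler_normB _ _)); apply: lerD.
      by apply: (le_trans b2); rewrite ler_wpM2r// powR_ge0.
    rewrite normrM; apply: (@le_trans _ _ (lam k * (s' - s) * (kp k * D ^+ 2))); first exact: ler_pM.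
    rewrite mulrAC; apply: ler_pM => //.
    by rewrite (mulr_ge0 (ltW l0))// (mulr_ge0 (ltW k0))// sqr_ge0.
  have c0 : 0 < 2 * C + 1 by rewrite ltr_wpDl// mulr_ge0.
  exists (Num.min 1 ((e / (2 * C + 1)) `^ 8^-1^-1)).
    by rewrite lt_min ltr01 powR_gt0// divr_gt0.
  have fin s s' : 0 <= s -> s <= s' -> s' <= t -> s' - s <= Num.min 1 ((e / (2 * C + 1)) `^ 8^-1^-1) -> `|g k s' - g k s| <= e.
    move=> s0 ss st; rewrite le_min => /andP[h1 h2]; apply: (le_trans (key s s' s0 ss st h1)).
    apply: (@le_trans _ _ (2 * C * (e / (2 * C + 1)))).
      rewrite ler_wpM2l ?mulr_ge0//; apply: powR_root_le => //; first by rewrite divr_ge0// ltW.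
      by rewrite subr_ge0.
    by rewrite mulrCA ler_piMr ?(ltW e0)// ler_pdivrMr// mul1r lerDl.
  move=> s s' /andP[s0 st] /andP[s0' st']; have [h|/ltW h] := leP s s'.
    by rewrite distrC [`|g k s - _|]distrC ger0_norm ?subr_ge0//; exact: fin.
  by rewrite ger0_norm ?subr_ge0//; exact: fin.
- move=> s /andP[s0 st]; have sT' : 0 <= s <= T by rewrite s0 (le_trans (ltW st)).
  apply: l2le_mono (hD' _ (lX s sT')) => k; rewrite /g [_ * Bq _ _ * _]mulrAC -expRD addNr expR0 mul1r.
  by [].
Qed.

Lemma coord_of_bochner (Y : R -> H) (t D : R) (I Z : H) k : 0 <= t <= T ->
  (forall s, 0 <= s <= T -> Hdom rho (Y s)) -> measurable_fun `[0, T] (fun s => Bq k (Y s)) ->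
  (forall s, 0 <= s <= T -> hnorm (Y s) <= D) ->
  is_bochner_integral `[0, t] (fun s => semigroup_ext emb (t - s) (F (Y s))) I ->
  Y t = semigroup t xi + I + Z ->
  ip (en k) (Y t) = expR (- (lam k * t)) * ip (en k) xi + Vint (lam k) (fun s => Bq k (Y s)) 0 t + ip (en k) Z.
Proof.
move=> /andP[t0 tT] dY mY YD hI ->; rewrite 2!ipDr semigroup_coord// [t * _]mulrC; congr (_ + _ + _).
have sT s : 0 <= s <= t -> 0 <= s <= T by move=> /andP[-> st]; rewrite (le_trans st).
apply: (bochner_coord t0 _ _ hI).
  move=> s /andP[s0 st]; rewrite ext_coord ?subr_gt0//; last by apply: dY; rewrite s0 (le_trans (ltW st)).
  by rewrite [(t - s) * _]mulrC.
apply: (@integrable_expM R (lam k) t 0 t (kp k * D ^+ 2)).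
  by apply: measurable_funS mY => //; apply: subset_itvl; rewrite bnd_simp.
move=> s st; apply: (le_trans (Bq_le _ _)); rewrite ler_wpM2l ?(ltW (kp_gt0 _))//.
have := YD s (sT s st) => h; rewrite lerXn2r ?nnegrE ?hnorm_ge0//.
exact: le_trans (hnorm_ge0 _) h.
Qed.

End Bridge.

(** * Reconstruction of the scheme as a path *)

Section SchemePath.
Context {R : realType}.
Local Notation H := (L2 R).
Context (Hneg : R -> completeNormedModType R) (emb : forall r : R, {linear H -> Hneg r}).
Hypothesis HnegP : negative_interpolation_spaces emb.
Context (F : H -> Hneg (- 2^-1)).
Hypothesis F_def : forall v, Hdom 8^-1 v -> F v = - (2^-1 *: distr_deriv emb (sqrL2 v)).
Context (T rho chi al ga Axi : R) (xi : H) (h : nat -> R)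
  (T0 : 0 < T) (rho8 : 8^-1 < rho) (rho4 : rho < 4^-1) (al01 : 0 < al <= 1)
  (rag : rho < al - ga) (xiA : l2le (fun k => lam k `^ 2^-1 * ip (en k) xi) Axi)
  (n : nat) (Pn : H -> H) (b : nat -> R -> R) (XN ON : R -> H) (n0 : (0 < n)%N) (h0 : 0 < h n)
  (Pn_coord : forall v k, ip (en k) (Pn v) = if (k < n)%N then ip (en k) v else 0)
  (XNr : forall t, 0 <= t <= T -> range Pn (XN t)) (ONr : forall t, 0 <= t <= T -> range Pn (ON t)).

Lemma floor_grid_gfl (d s : R) : 0 < d -> 0 <= s -> floor_grid d s = gfl d s.
Proof.
move=> d0 s0; have [m [mE m1 m2]] := gfl_le d0 s0; rewrite mE /floor_grid.
have ub : ubound [set x | x <= s /\ exists k : int, x = k%:~R * d] (m%:R * d).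
  move=> x [xs [k kE]]; rewrite kE ler_wpM2r ?(ltW d0)//.
  have : k%:~R < m.+1%:R :> R by rewrite -(ltr_pM2r d0) -kE (le_lt_trans xs).
  by rewrite -[m.+1%:R]/(m.+1%:~R) -[m%:R]/(m%:~R) ltr_int ler_int; clear; lia.
apply/eqP; rewrite eq_le; apply/andP; split.
  by apply: ge_sup => //; exists (m%:R * d); split=> //; exists m.
apply: ub_le_sup; first by exists (m%:R * d).
by split=> //; exists m.
Qed.

Definition taming (r : R) : bool :=
  Hnorm rho (XN r) + Hnorm rho (ON r + Pn (semigroup r xi)) <= `|h n| `^ (- chi).

(** The equation at one time on one path, with the stochastic convolution already replaced by its
    pathwise version. *)
Definition solves_at (t : R) : Prop := (forall k, (k < n)%N -> ip (en k) (ON t) = ou (lam k) (b k) t) /\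
  exists2 I, is_bochner_integral `[0, t] (fun s => let r := floor_grid (h n) s in
     (if taming r then 1 else 0) *: Pn (semigroup_ext emb (t - s) (F (XN r)))) I
  & XN t = Pn (semigroup t xi) + I + ON t.

Lemma range_coord v k : range Pn v -> (n <= k)%N -> ip (en k) v = 0.
Proof. by move=> [u _ <-] nk; rewrite Pn_coord ltnNge nk. Qed.

Lemma range_Hdom r v : range Pn v -> Hdom r v.
Proof.
move=> rv; have -> : v = \sum_(i < n) ip (en i) v *: en i; last exact: (Hdom_finite r n (fun i => ip (en i) v)).
apply: L2_coord_eq => k; rewrite ip_sumr; have [kn|nk] := ltnP k n.
  rewrite (bigD1 (Ordinal kn))//= ipZr en_orth eqxx mulr1 big1 ?addr0// => i ik.
  rewrite ipZr en_orth0 ?mulr0//; apply: contra ik => /eqP ik; exact/eqP/val_inj.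
rewrite (range_coord rv nk) big1// => i _.
by rewrite ipZr en_orth0 ?mulr0// gtn_eqF// (leq_trans (ltn_ord i)).
Qed.

Let formula k t := expR (- (lam k * t)) * ip (en k) xi + Vint (lam k) (drift (h n) taming XN k) 0 t + ou (lam k) (b k) t.

Lemma XN_coord t k : 0 <= t <= T -> solves_at t -> ip (en k) (XN t) = if (k < n)%N then formula k t else 0.
Proof.
move=> /andP[t0 tT] [hO [I hI XE]]; case: ltnP => kn; last first.
  by apply: range_coord kn; apply: XNr; rewrite t0.
rewrite XE 2!ipDr Pn_coord kn semigroup_coord// hO// [t * _]mulrC /formula; congr (_ + _ + _).
have [M hM] := @drift_bounded R (h n) taming XN k T h0.
apply: (bochner_coord t0 _ _ hI); last first.
  apply: (@integrable_expM R (lam k) t 0 t M); first exact: measurable_drift.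
  by move=> s /andP[s0 st]; apply: hM; rewrite s0 (le_trans st).
move=> s /andP[s0 st]; rewrite /= (floor_grid_gfl h0 s0) ipZr Pn_coord kn /drift.
have [i [gE g1 g2]] := gfl_le h0 s0.
have gT : 0 <= gfl (h n) s <= T.
  by rewrite gE mulr_ge0 ?(ltW h0)//= (le_trans g1)// (le_trans (ltW st)).
rewrite (ext_coord HnegP F_def rho8)//; last 2 first.
- by rewrite subr_gt0.
- exact/range_Hdom/XNr.
by rewrite [(t - s) * _]mulrC; case: (taming _); rewrite ?mul1r// mul0r mulr0.
Qed.

(** The process solves its equation at each time off a null set that depends on the time. The
    right-hand side only uses grid values and the noise path, so it defines a path at all times,
    which solves the scheme as soon as the grid times are good. *)
Definition scheme_path (t : R) : H := \sum_(k < n) formula k t *: en k.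

Lemma scheme_path_coord t k : ip (en k) (scheme_path t) = if (k < n)%N then formula k t else 0.
Proof.
rewrite ip_sumr; have [kn|nk] := ltnP k n.
  rewrite (bigD1 (Ordinal kn))//= ipZr en_orth eqxx mulr1 big1 ?addr0// => i ik.
  rewrite ipZr en_orth0 ?mulr0//; apply: contra ik => /eqP ik; exact/eqP/val_inj.
by rewrite big1// => i _; rewrite ipZr en_orth0 ?mulr0// gtn_eqF// (leq_trans (ltn_ord i)).
Qed.

Lemma scheme_pathE t : 0 <= t <= T -> solves_at t -> scheme_path t = XN t.
Proof. by move=> tT st; apply: L2_coord_eq => k; rewrite scheme_path_coord XN_coord. Qed.

Lemma scheme_of_coord (x : R -> H) : (forall t k, ip (en k) (x t) = if (k < n)%N then formula k t else 0) ->
  (forall i, i%:R * h n <= T -> x (i%:R * h n) = XN (i%:R * h n)) -> scheme n (h n) T xi b taming x.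
Proof.
move=> hx gE t /andP[t0 tT] k; rewrite hx; case: (ltnP k n) => kn; last by [].
rewrite /formula (@Vint_ext R (lam k) (drift (h n) taming XN k) (drift (h n) taming x k) 0 t)// => s /andP[s0 st].
rewrite /drift; have [i [-> g1 g2]] := gfl_le h0 s0; rewrite gE//.
by rewrite (le_trans g1)// (le_trans st).
Qed.

Lemma scheme_path_good : (forall i, i%:R * h n <= T -> solves_at (i%:R * h n)) ->
  good al ga rho chi T Axi xi h b n taming scheme_path.
Proof.
move=> hs; have i0 i : 0 <= i%:R * h n by rewrite mulr_ge0// ltW.
have gE i : i%:R * h n <= T -> scheme_path (i%:R * h n) = XN (i%:R * h n).
  by move=> iT; apply: scheme_pathE; rewrite ?i0//; exact: hs.
split.
- exact: scheme_of_coord scheme_path_coord gE.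
- move=> i iT hi; rewrite gE//; have iT' : 0 <= i%:R * h n <= T by rewrite i0.
  apply: Hnorm_l2le; first exact/range_Hdom/XNr.
  move: hi; rewrite /taming gtr0_norm// => hi; apply: le_trans hi.
  by rewrite lerDl hnorm_ge0.
- move=> i B K iT nb; rewrite gE// => lB hBK; have iT' : 0 <= i%:R * h n <= T by rewrite i0.
  rewrite /taming gtr0_norm//; apply: le_trans hBK; rewrite -addrA; apply: lerD.
    by have [] := l2le_Hnorm lB.
  set r := i%:R * h n; have r0 : 0 <= r by exact: i0.
  apply: (l2le_Hnorm _).2.
  have xr : l2le (fun k => lam k `^ rho * ip (en k) xi) Axi.
    apply: l2le_mono xiA => k; rewrite !normrM ler_wpM2r// !ger0_norm ?powR_ge0//.
    by apply: lam_powR_incr; rewrite (le_trans (ltW rho4))// lef_pV2 ?posrE// ler_nat.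
  have [hO _] := hs i iT.
  have lo := noise_ou_le al01 (ltW rag) nb r0.
  have xe : l2le (fun k => lam k `^ rho * (expR (- (r * lam k)) * ip (en k) xi)) Axi.
    apply: l2le_mono xr => k; rewrite !normrM ler_wpM2l// ler_piMl// ger0_norm ?expR_ge0//.
    by rewrite -expR0 ler_expR oppr_le0 mulr_ge0// ltW// lam_gt0.
  apply: l2le_mono (l2leD lo xe) => k.
  rewrite ipDr Pn_coord; case: ltnP => kn; last by rewrite (range_coord (ONr iT') kn) addr0 mulr0 normr0.
  by rewrite hO// semigroup_coord// mulrDr.
Qed.

End SchemePath.

Section Limsup.
Context {R : realType}.

Lemma limsup_le (h : nat -> R) : limn_esup (fun m => (h m)%:E) = 0%E ->
  forall e, 0 < e -> exists N, forall n, (N <= n)%N -> h n <= e.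
Proof.
move=> hl e e0; apply: contrapT => hN.
have : (e%:E <= limn_esup (fun m => (h m)%:E))%E; last by rewrite hl lee_fin leNgt e0.
rewrite limn_esup_lim (cvg_lim _ (@cvg_esups_inf R _))//.
apply: le_ereal_inf_tmp => _ [N _ <-]; apply: contrapT => /negP; rewrite -ltNge => lt; apply: hN.
exists N => n Nn; rewrite -lee_fin; apply: le_trans (ltW lt).
by apply: ereal_sup_ubound; exists n.
Qed.

Lemma limn_esup_eq0 (u : nat -> \bar R) (N0 : nat) : (forall n, (N0 <= n)%N -> (0 <= u n)%E) ->
  (forall e, 0 < e -> exists N, forall n, (N <= n)%N -> (u n <= e%:E)%E) -> limn_esup u = 0%E.
Proof.
move=> u0 hu; rewrite limn_esup_lim (cvg_lim _ (@cvg_esups_inf R u))//.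
apply/eqP; rewrite eq_le; apply/andP; split.
  apply/lee_addgt0Pr => e e0; rewrite add0e; have [N hN] := hu e e0.
  apply: (@le_trans _ _ (esups u N)); first by apply: ereal_inf_lbound; exists N.
  by apply: ge_ereal_sup => _ [n /= Nn <-]; exact: hN.
apply: le_ereal_inf_tmp => _ [N _ <-].
apply: (@le_trans _ _ (u (maxn N N0))); first by apply: u0; rewrite leq_maxr.
by apply: ereal_sup_ubound; exists (maxn N N0) => //=; rewrite leq_maxl.
Qed.

Lemma exprD1_le (K : R) n : 0 <= K -> (1 + K) ^+ n <= 2 ^+ n * (1 + K ^+ n).
Proof.
move=> K0.
have [K1|K1] := leP K 1.
  apply: (@le_trans _ _ (2 ^+ n)); first by rewrite lerXn2r ?nnegrE ?addr_ge0//; lra.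
  by rewrite ler_peMr// lerDl exprn_ge0.
apply: (@le_trans _ _ (2 ^+ n * K ^+ n)); last by rewrite ler_wpM2l// lerDr.
by rewrite -exprMn lerXn2r ?nnegrE ?addr_ge0 ?mulr_ge0//; lra.
Qed.

Lemma sub_shift0 (a u v o : R) : a + u + o - u - (a + v + o - v) = 0.
Proof. by ring. Qed.

Lemma sub_shift_eq (y a u v o : R) : y - u - (a + v + o - v) = 0 -> y = a + u + o.
Proof. by move=> h; rewrite -[y]subr0 -h; ring. Qed.

Lemma noise_wid (al ga K L : R) b : K <= L -> noise al ga K b -> noise al ga L b.
Proof. by move=> KL [M [h0 h1 h2]]; exists M; split=> //; exact: l2le_wid h2. Qed.

End Limsup.

(** * The limit process: existence, uniqueness and moments *)

Section Main.
Context {R : realType} (T rho chi : R).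
Local Notation H := (L2 R).
Context (T0 : 0 < T) (rho8 : 8^-1 < rho) (rho4 : rho < 4^-1)
  (Hneg : R -> completeNormedModType R) (emb : forall r : R, {linear H -> Hneg r}).
Hypothesis HnegP : negative_interpolation_spaces emb.
Context (xi : H) (F : H -> Hneg (- 2^-1)) (e : nat -> H) (Pn : nat -> {linear H -> H}) (h : nat -> R)
  (F_def : forall v, Hdom 8^-1 v -> F v = - (2^-1 *: distr_deriv emb (sqrL2 v)))
  (eE : forall k, e k.+1 = en k)
  (Pn_coord : forall n v k, (0 < n)%N -> ip (en k) (Pn n v) = if (k < n)%N then ip (en k) v else 0)
  (h_gt0 : forall n, (0 < n)%N -> 0 < h n)
  (h_cvg : forall e, 0 < e -> exists N, forall n, (N <= n)%N -> h n <= e)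
  d (Omega : measurableType d) (P : probability Omega R) (W : R -> H -> Omega -> R).
Hypothesis hW : cylindrical_wiener P T W.
Context (Xn On : nat -> R -> Omega -> H)
  (XnP : forall n t, (0 < n)%N -> 0 <= t <= T -> random_element (range (Pn n)) (@hnorm R) (Xn n t))
  (OnP : forall n t, (0 < n)%N -> 0 <= t <= T -> random_element (range (Pn n)) (@hnorm R) (On n t))
  (On_def : forall n t, (0 < n)%N -> 0 <= t <= T ->
  is_stochastic_integral P e W t (fun s v => Pn n (semigroup (t - s) v)) (On n t))
  (Xn_def : forall n t, (0 < n)%N -> 0 <= t <= T ->
  {ae P, forall w, exists2 I, is_bochner_integral `[0, t]
      (fun s => let r := floor_grid (h n) s in
         (if taming rho chi xi h n (Pn n) (Xn n ^~ w) (On n ^~ w) r then 1 else 0)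
         *: Pn n (semigroup_ext emb (t - s) (F (Xn n r w)))) I
    & Xn n t w = Pn n (semigroup t xi) + I + On n t w}) (al ga bb p2 Axi : R)
  (al0 : 0 < al) (al2 : al < 2^-1) (ga4 : 4^-1 < ga) (bb8 : 8^-1 < bb) (bbr : bb < rho - chi)
  (chi0 : 0 < chi) (p201 : 0 <= p2 <= 1) (bp2 : bb + p2 < 4^-1) (chip2 : 2 * chi < p2) (p3 : R)
  (p30 : 0 < p3) (p38 : p3 <= 8^-1) (rp34 : rho + p3 < 4^-1) (rpag : rho + p3 <= al - ga)
  (xiA : l2le (fun k => lam k `^ 2^-1 * ip (en k) xi) Axi).

Let al01 : 0 < al <= 1. Proof. by move: al0 al2; lra. Qed.
Let ga0 : 0 <= ga. Proof. by move: ga4; lra. Qed.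
Let rag : rho < al - ga. Proof. by move: rpag p30; lra. Qed.
Let gaal : ga < al. Proof. by move: rag rho8; lra. Qed.
Let rho0 : 0 <= rho. Proof. by move: rho8; lra. Qed.
Let bW := bm T W.
Let S n (w : Omega) t := solves_at emb F rho chi xi h n (Pn n) (bW w) (Xn n ^~ w) (On n ^~ w) t.

Lemma solves_ae n t : (0 < n)%N -> 0 <= t <= T -> {ae P, forall w, (exists K, noise al ga K (bW w)) -> S n w t}.
Proof.
move=> n0 tT.
have hO k : {ae P, forall w, (k < n)%N -> forall K, noise al ga K (bW w) -> ip (en k) (On n t w) = ou (lam k) (bW w k) t}.
  have [kn|nk] := ltnP k n; last by apply: aeW.
  have Ph x v : 0 <= x <= t -> ip (en k) (Pn n (semigroup (t - x) v)) = expR (- (lam k * (t - x))) * ip (en k) v.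
    by move=> /andP[x0 xt]; rewrite Pn_coord// kn semigroup_coord ?subr_ge0// [(t - x) * _]mulrC.
  by apply: aeS (stoch_coord T0 hW eE tT Ph ga al01 (On_def n0 tT)) => w hw _; exact: hw.
apply: aeS2 (ae_foralln hO) (Xn_def n0 tT) => w h1 h2 [K nK].
by split=> [k kn|]; [exact: h1 kn K nK|exact: h2].
Qed.

(** The bound K exists path by path, with no measurability; a measurable majorant B with finite mean
    stands in for its moments. *)
Lemma noise_moment m : (0 < m)%N -> 2 <= m%:R * (1 - 2 * al) -> exists (B : Omega -> R) (b : R),
  [/\ measurable_fun setT B, forall w, 0 <= B w, (\int[P]_w (B w)%:E <= b%:E)%E &
  {ae P, forall w, exists K, [/\ 0 <= K, noise al ga K (bW w) & (1 + K) ^+ (2 * m) <= B w]}].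
Proof.
move=> m0 mal; have [C [C0 hC]] := @bm_noise R d Omega T W al ga m T0 al0 ga4 m0.
have [b hb] := roughness_integral T0 hW ga4 mal.
have mr := roughness_measurable al ga m T0 hW.
have r0 w := roughness_ge0 T W al ga m w.
pose A w := fine (roughness T W al ga m w).
have A0 w : 0 <= A w by rewrite fine_ge0.
pose c : R := 2 ^+ (2 * m); have c0 : 0 < c by rewrite exprn_gt0.
have mA : measurable_fun setT A.
  by apply: measurableT_comp mr; exact: fine_measurable.
exists (fun w => c * (1 + C) + c * C * A w), (c * (1 + C) + c * C * b); split.
- by apply: measurable_funD => //; exact: measurable_funM.
- by move=> w; rewrite addr_ge0// !mulr_ge0 ?addr_ge0// ltW.
- have k1 : 0 <= c * (1 + C) by rewrite mulr_ge0 ?addr_ge0// ltW.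
  have k2 : 0 <= c * C by rewrite mulr_ge0// ltW.
  under eq_integral do rewrite EFinD.
  rewrite ge0_integralD//; last 2 first.
  + by move=> w _; rewrite lee_fin mulr_ge0.
  + by apply/measurable_EFinP; exact: measurable_funM.
  rewrite integral_cst// [X in (_ * X)%E]probability_setT mule1 EFinD leeD2l//.
  under eq_integral do rewrite EFinM.
  rewrite ge0_integralZl//; last 2 first.
  + exact/measurable_EFinP.
  + by move=> w _; rewrite lee_fin.
  rewrite [leRHS]EFinM lee_wpmul2l//; apply: le_trans hb.
  apply: ge0_le_integral => //; first by move=> w _; rewrite lee_fin.
    exact/measurable_EFinP.
  move=> w _; rewrite /A; have := r0 w; case: (roughness T W al ga m w) => [r| |]//= _.
have cw : {ae P, forall w k, {within `[0, T], continuous (fun t => W t (en k) w)}}.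
  by apply: ae_foralln => k; exact: cw_continuous hW (en k).
apply: aeS2 (roughness_fin T0 hW ga4 mal) cw => w fw cw'.
have [K [K0 nK hK]] := hC w fw cw'; exists K; split=> //.
apply: (le_trans (exprD1_le _ K0)); rewrite -/c.
rewrite -/(A w) in hK; rewrite -mulrA -mulrDr ler_wpM2l ?(ltW c0)//.
by rewrite -addrA lerD2l (le_trans hK)// mulrDr mulr1.
Qed.

Lemma large_moment : exists m, (0 < m)%N /\ 2 <= m%:R * (1 - 2 * al).
Proof.
have a1 : 0 < 1 - 2 * al by move: al2; lra.
exists (Num.bound (2 / (1 - 2 * al))).+1; split=> //.
rewrite -ler_pdivrMr//; apply: ltW; apply: lt_le_trans (archi_boundP _) _; first by rewrite divr_ge0// ltW.
by rewrite ler_nat.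
Qed.

Lemma ae_set (Q : Omega -> Prop) : {ae P, forall w, Q w} ->
  exists G : set Omega, [/\ measurable G, {ae P, forall w, G w} & forall w, G w -> Q w].
Proof.
move=> [A [mA PA QA]]; exists (~` A); split; first exact: measurableC.
  by exists A; split=> // w /= /contrapT.
by move=> w Aw; apply: contrapT => Qw; apply: Aw; exact: QA.
Qed.

Lemma ae_noise : {ae P, forall w, exists K, 0 <= K /\ noise al ga K (bW w)}.
Proof.
have [m [m0 mal]] := large_moment; have [B [b [_ _ _ hB]]] := noise_moment m0 mal.
by apply: aeS hB => w [K [K0 nK _]]; exists K.
Qed.

(** Only the grid times of all schemes and the times [tim] are required, a countable family, so a
    single event of full measure suffices. *)
Lemma good_set : exists G : set Omega, [/\ measurable G, {ae P, forall w, G w} &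
  forall w, G w -> (exists K, 0 <= K /\ noise al ga K (bW w)) /\
   (forall n, (0 < n)%N -> (forall i, i%:R * h n <= T -> S n w (i%:R * h n)) /\ forall i j, S n w (tim T i j))].
Proof.
apply: ae_set.
have g1 n i : {ae P, forall w, (0 < n)%N -> i%:R * h n <= T -> (exists K, noise al ga K (bW w)) -> S n w (i%:R * h n)}.
  have [n0|] := boolP (0 < n)%N; last by move=> _; apply: aeW.
  have [iT|] := boolP (i%:R * h n <= T); last by move=> _; apply: aeW.
  by apply: aeS (solves_ae n0 (_ : 0 <= i%:R * h n <= T)) => [w hw _ _|]//; rewrite iT mulr_ge0// ltW// h_gt0.
have g2 n i j : {ae P, forall w, (0 < n)%N -> (exists K, noise al ga K (bW w)) -> S n w (tim T i j)}.
  have [n0|] := boolP (0 < n)%N; last by move=> _; apply: aeW.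
  by apply: aeS (solves_ae n0 (tim_in i j (ltW T0))) => w hw _.
have {}g1 := ae_foralln (fun n => ae_foralln (g1 n)).
have {}g2 := ae_foralln (fun n => ae_foralln (fun i => ae_foralln (g2 n i))).
apply: aeS2 ae_noise (aeI g1 g2) => w hK [h1 h2]; split=> // n n0.
have nK : exists K, noise al ga K (bW w) by have [K []] := hK; exists K.
by split=> [i iT|i j]; [exact: h1|exact: h2].
Qed.

Definition app (w : Omega) n (t : R) : H := scheme_path rho chi xi h n (Pn n) (bW w) (Xn n ^~ w) (On n ^~ w) t.

Let ind (w : Omega) n := taming rho chi xi h n (Pn n) (Xn n ^~ w) (On n ^~ w).

Lemma XnR n t w : (0 < n)%N -> 0 <= t <= T -> range (Pn n) (Xn n t w).
Proof. by move=> n0 tT; have [] := XnP n0 tT. Qed.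

Lemma OnR n t w : (0 < n)%N -> 0 <= t <= T -> range (Pn n) (On n t w).
Proof. by move=> n0 tT; have [] := OnP n0 tT. Qed.

Lemma appE w n t : (0 < n)%N -> 0 <= t <= T -> S n w t -> app w n t = Xn n t w.
Proof.
move=> n0 tT st; apply: (scheme_pathE HnegP F_def rho8 (h_gt0 n0) _ _ tT st).
- by move=> v k; exact: Pn_coord.
- by move=> s sT; exact: XnR.
Qed.

Lemma goods_app w : (forall n, (0 < n)%N -> forall i, i%:R * h n <= T -> S n w (i%:R * h n)) ->
  goods al ga rho chi T Axi xi h (bW w) (ind w) (app w).
Proof.
move=> hs n n0; apply: (scheme_path_good HnegP F_def rho8 rho4 al01 rag xiA (h_gt0 n0)).
- by move=> v k; exact: Pn_coord.
- by move=> s sT; exact: XnR.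
- by move=> s sT; exact: OnR.
- exact: hs.
Qed.

Section Solution.
Context (G : set Omega) (mG : measurable G) (aG : {ae P, forall w, G w})
  (GP : forall w, G w -> (exists K, 0 <= K /\ noise al ga K (bW w)) /\
   (forall n, (0 < n)%N -> (forall i, i%:R * h n <= T -> S n w (i%:R * h n)) /\ forall i j, S n w (tim T i j))).

Lemma G_noise w : G w -> exists K, noise al ga K (bW w).
Proof. by move=> /GP[[K [_ nK]] _]; exists K. Qed.

Lemma G_goods w : G w -> goods al ga rho chi T Axi xi h (bW w) (ind w) (app w).
Proof. by move=> /GP[_ hs]; apply: goods_app => n n0; exact: (hs n n0).1. Qed.

(** Off the good event the path is set to zero, which keeps continuity and values in H_rho valid for
    every outcome. *)
Lemma solution_exists : exists X : Omega -> R -> H, forall w,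
  (G w -> limit_of T (app w) (X w)) /\ (~ G w -> X w = fun=> 0).
Proof.
suff /choice[X hX] : forall w, exists X : R -> H, (G w -> limit_of T (app w) X) /\ (~ G w -> X = fun=> 0) by exists X.
move=> w; have [Gw|Gw] := pselect (G w); last by exists (fun=> 0); split.
have [K nK] := G_noise Gw.
have [X hX] := limit_exists al01 ga0 bb8 bbr chi0 p201 bp2 chip2 rho4 rag T0 xiA h_gt0 h_cvg nK (G_goods Gw).
by exists X.
Qed.

Context (X : Omega -> R -> H).
Hypothesis XP : forall w, (G w -> limit_of T (app w) (X w)) /\ (~ G w -> X w = fun=> 0).

Lemma solution_path w : cont_path T rho (X w).
Proof.
have [Gw|Gw] := pselect (G w); last first.
  rewrite ((XP w).2 Gw); have z0 : Hnorm rho (0 - 0 : H) = 0.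
    apply/eqP; rewrite eq_le hnorm_ge0 andbT; apply: (l2le_Hnorm _).2.
    by apply: l2le_mono (@l2le0 R) => k; rewrite subr0 ip0r mulr0.
  split=> t tT; last by rewrite z0; exact: cvg_cst.
  apply: (l2le_Hnorm (A := 0) _).1.
  by apply: l2le_mono (@l2le0 R) => k; rewrite ip0r mulr0.
have [K nK] := G_noise Gw; have gG := G_goods Gw; have lX := (XP w).1 Gw.
split=> t tT.
  have [D D0 hD] := limit_bound_r al01 ga0 bb8 bbr chi0 p201 bp2 chip2 rho4 rag T0 xiA h_gt0 K rho4 (ltW rag).
  by have [] := l2le_Hnorm (hD _ _ _ _ nK gG lX t tT).
have [D D0 hD] := limit_incr al01 ga0 bb8 bbr chi0 p201 bp2 chip2 rho4 rag T0 xiA h_gt0 K p30 p38 rp34 rpag rho0.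
have key s : 0 <= s <= T -> Hnorm rho (X w s - X w t) <= D * `|s - t| `^ p3.
  move=> /andP[s0 sT]; have /andP[t0 tT'] := tT; apply: (l2le_Hnorm _).2.
  have [st|/ltW ts] := leP s t.
    rewrite distrC ger0_norm ?subr_ge0//; apply: l2le_mono (hD _ _ _ _ nK gG lX s t s0 st tT') => k.
    by rewrite ipBr !normrM [`|ip _ (X w s) - _|]distrC.
  rewrite ger0_norm ?subr_ge0//; apply: l2le_mono (hD _ _ _ _ nK gG lX t s t0 ts sT) => k.
  by rewrite ipBr.
apply/cvgrPdist_le => c c0; rewrite near_withinE; apply/nbhs_ballP.
have cD : 0 < c / D by rewrite divr_gt0.
exists ((c / D) `^ p3^-1); first by rewrite /= powR_gt0.
move=> s; rewrite -ball_normE/= in_itv/= => st sT.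
rewrite sub0r normrN ger0_norm; last exact: hnorm_ge0.
apply: (le_trans (key s sT)); rewrite mulrC -ler_pdivlMr//.
by apply: powR_root_le => //; [exact: ltW|rewrite distrC; exact: ltW].
Qed.

Lemma Xn_coord_measurable n t k : (0 < n)%N -> 0 <= t <= T -> measurable_fun setT (fun w => ip (en k) (Xn n t w)).
Proof.
move=> n0 tT; apply: (random_element_coord (C := 1)) (XnP n0 tT) => // v w _ _.
by apply: (le_trans (ip_CS _ _)); rewrite hnorm_en.
Qed.

Lemma On_coord_measurable n t k : (0 < n)%N -> 0 <= t <= T -> measurable_fun setT (fun w => ip (en k) (On n t w)).
Proof.
move=> n0 tT; apply: (random_element_coord (C := 1)) (OnP n0 tT) => // v w _ _.
by apply: (le_trans (ip_CS _ _)); rewrite hnorm_en.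
Qed.

(** At the countably many times [tim] the limit is taken along the scheme itself, whose coordinates
    are measurable and which agrees there with the rebuilt path; continuity of X reaches the other
    times. *)
Lemma solution_measurable t k : 0 <= t <= T -> measurable_fun setT (fun w => ip (en k) (X w t)).
Proof.
move=> tT.
have mq i j : measurable_fun setT (fun w => ip (en k) (X w (tim T i j))).
  have qT := tim_in i j (ltW T0).
  apply: (@measurable_fun_cvg _ _ _ setT (fun n w => \1_G w * ip (en k) (Xn n.+1 (tim T i j) w))) => [n|w _].
    by apply: measurable_funM; [exact: measurable_indic|exact: Xn_coord_measurable].
  have [Gw|Gw] := pselect (G w); last first.
    rewrite ((XP w).2 Gw) ip0r indicE memNset//; under eq_fun do rewrite mul0r.
    exact: cvg_cst.
  rewrite indicE mem_set//; under eq_fun do rewrite mul1r.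
  have c1 := @ip_cvg R _ _ ((XP w).1 Gw _ qT) (en k).
  rewrite (_ : (fun n => _) = (fun n => ip (en k) (app w n.+1 (tim T i j)))); last first.
    apply/funext => n; congr ip; apply/esym/appE => //.
    by have [_ /(_ n.+1 isT)[]] := GP Gw.
  by move: c1; rewrite -(cvg_shiftn 1); under eq_fun do rewrite addn1.
apply: (@measurable_fun_cvg _ _ _ setT (fun j w => ip (en k) (X w (tim T (Num.truncn (j.+1%:R * (t / T))) j)))) => [j|w _].
  exact: mq.
have [D D0 [_ cc _]] := cont_path_props (ltW T0) rho0 (solution_path w).
apply/cvg_epsP => c c0; have [dl dl0 hd] := cc k t c tT c0.
have dl2 : 0 < dl / 2 by rewrite divr_gt0.
have /cvg_epsP/(_ _ dl2)[N hN] := @cvg_cst_harmonic R T.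
exists N => j /hN; rewrite subr0 ger0_norm ?mulr_ge0 ?(ltW T0)// => hj.
apply: hd; first exact: tim_in (ltW T0).
apply: (le_lt_trans (tim_dense j T0 tT)); apply: (le_lt_trans hj).
by rewrite ltr_pdivrMr// ltr_pMr// ltr1n.
Qed.

Let gaal0 : 0 <= al - ga. Proof. by rewrite subr_ge0 ltW. Qed.

Lemma solution_mild : mild_solution P emb e W F T rho xi (fun t w => X w t).
Proof.
split=> [t tT|w t tT|t tT].
- apply: coord_random_element => [w|k]; first exact: (solution_path w).1.
  exact: solution_measurable.
- exact: (solution_path w).2.
have [m [m0 mal]] := large_moment; have [B [b [mB B0 hb hB]]] := noise_moment m0 mal.
have /andP[t0 _] := tT.
(* The k-th coordinate of the convolution is read off from index k + 1, the first projection
   containing that mode; this also provides its measurability. *)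
have hOU : {ae P, forall w k, ip (en k) (On k.+1 t w) = ou (lam k) (bW w k) t}.
  apply: ae_foralln => k; apply: aeS2 (solves_ae (ltn0Sn k) tT) ae_noise => w hs [K [_ nK]].
  have nK' : exists K, noise al ga K (bW w) by exists K.
  by have [h1 _] := hs nK'; exact: h1.
have [G' [mG' aG' GP']] := ae_set (aeI hOU aG).
have hZ w : exists Z : H, forall k, ip (en k) Z = \1_G' w * ip (en k) (On k.+1 t w).
  have [G'w|G'w] := pselect (G' w); last by exists 0 => k; rewrite ip0r indicE memNset// mul0r.
  have [hO Gw] := GP' w G'w; have [K nK] := G_noise Gw.
  have /l2le_lam0/L2_of_l2le[Z hZ] := noise_ou_le al01 gaal0 nK t0.
  by exists Z => k; rewrite hZ hO indicE mem_set// mul1r.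
have {hZ}/choice[Z hZ] := hZ.
have hZo w k : G' w -> ip (en k) (Z w) = ou (lam k) (bW w k) t.
  by move=> G'w; have [hO _] := GP' w G'w; rewrite hZ hO indicE mem_set// mul1r.
exists Z.
  apply: (stoch_exists T0 hW eE tT al01 ga0 gaal _ mB B0 hb).
    move=> k; under eq_fun do rewrite hZ; apply: measurable_funM; first exact: measurable_indic.
    exact: On_coord_measurable.
  apply: aeS2 hB aG' => w [K [K0 nK KB]] G'w; exists K; split=> //; last by move=> k; exact: hZo.
  apply: le_trans KB; apply: (@le_trans _ _ ((1 + K) ^+ 2)).
    by rewrite lerXn2r ?nnegrE ?addr_ge0// lerDr.
  by rewrite ler_weXn2l ?lerDl// leq_pmulr.
apply: aeS aG' => w G'w; have [hO Gw] := GP' w G'w; have [K nK] := G_noise Gw.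
have gG := G_goods Gw; have lX := (XP w).1 Gw.
(* The equation forces this candidate for the drift integral; its coordinates are Volterra integrals
   by [limit_mild], and [bochner_solution] then applies. *)
exists (X w t - semigroup t xi - Z w); last by rewrite -addrA subrK addrC subrK.
have [D1 D10 h1] := limit_bound_r al01 ga0 bb8 bbr chi0 p201 bp2 chip2 rho4 rag T0 xiA h_gt0 K rho4 (ltW rag).
have [D2 D20 h2] := limit_continuous al01 ga0 bb8 bbr chi0 p201 bp2 chip2 rho4 rag T0 xiA h_gt0 K.
have {}h2 := h2 _ _ _ _ nK gG lX.
apply: (bochner_solution HnegP F_def T0 rho8 tT (addr_ge0 (ltW D10) (ltW D20))).
- by move=> s sT; apply: l2le_wid (h1 _ _ _ _ nK gG lX s sT); rewrite lerDl ltW.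
- by move=> s sT; apply: (le_trans (h2.1 s sT)); rewrite lerDr ltW.
- move=> r s r0 rs sT; apply: (le_trans (h2.2 r s r0 rs sT)).
  by rewrite ler_wpM2r ?powR_ge0// lerDr ltW.
move=> k; have := limit_mild al01 ga0 bb8 bbr chi0 p201 bp2 chip2 rho4 rag T0 xiA h_gt0 h_cvg nK gG lX tT k.
rewrite 2!ipBr hZo// semigroup_coord// [t * _]mulrC => ->.
by rewrite addrAC addrK addrAC subrr add0r.
Qed.

Lemma solution_unique Y : mild_solution P emb e W F T rho xi Y ->
  {ae P, forall w t, 0 <= t <= T -> Y t w = X w t}.
Proof.
move=> [YE Yc Ym].
have cY w : cont_path T rho (Y ^~ w) by split=> t tT; [exact: (YE t tT).1|exact: Yc].
(* A competing solution satisfies the coordinate equations almost surely at each dense time;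
   continuity extends them to all times on one event. *)
have hq i j : {ae P, forall w, (exists K, noise al ga K (bW w)) -> forall k,
    ip (en k) (Y (tim T i j) w) = expR (- (lam k * tim T i j)) * ip (en k) xi
      + Vint (lam k) (fun s => Bq k (Y s w)) 0 (tim T i j) + ou (lam k) (bW w k) (tim T i j)}.
  have qT := tim_in i j (ltW T0); have [Z hZ hY] := Ym _ qT.
  have hO : {ae P, forall w k K, noise al ga K (bW w) -> ip (en k) (Z w) = ou (lam k) (bW w k) (tim T i j)}.
    apply: ae_foralln => k; apply: (stoch_coord T0 hW eE qT _ ga al01 hZ) => x v /andP[_ xq].
    by rewrite semigroup_coord ?subr_ge0// [(_ - x) * _]mulrC.
  apply: aeS2 hO hY => w hO [I hI eY] [K nK] k.
  have [D D0 [YD _ cB]] := cont_path_props (ltW T0) rho0 (cY w).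
  have mB := cont_on_measurable (cB k).
  by rewrite (coord_of_bochner HnegP F_def rho8 qT (cY w).1 mB YD hI eY) (hO k K nK).
apply: aeS2 aG (ae_foralln (fun i => ae_foralln (hq i))) => w Gw hY t tT.
have [K nK] := G_noise Gw; have nK' : exists K, noise al ga K (bW w) by exists K.
have mX := limit_mild al01 ga0 bb8 bbr chi0 p201 bp2 chip2 rho4 rag T0 xiA h_gt0 h_cvg nK (G_goods Gw) ((XP w).1 Gw).
have [D1 D10 [YD cYk cYB]] := cont_path_props (ltW T0) rho0 (cY w).
have [D2 D20 [XD cXk cXB]] := cont_path_props (ltW T0) rho0 (solution_path w).
have cV f k : cont_on T f -> cont_on T (fun s => Vint (lam k) f 0 s).
  move=> cf; have [M M0 fM] := cont_on_bounded (ltW T0) cf.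
  exact: Vint_cont_on (lam_gt0 k) M0 (cont_on_measurable cf) fM.
(* Subtracting the Volterra integral leaves the same initial and noise terms for both solutions, and
   these differences are continuous, so agreement at the dense times is agreement everywhere. *)
have key k s : 0 <= s <= T -> (ip (en k) (Y s w) - Vint (lam k) (fun u => Bq k (Y u w)) 0 s)
    - (ip (en k) (X w s) - Vint (lam k) (fun u => Bq k (X w u)) 0 s) = 0.
  apply: (@cont_on_eq _ _ (fun s => (ip (en k) (Y s w) - Vint (lam k) (fun u => Bq k (Y u w)) 0 s)
    - (ip (en k) (X w s) - Vint (lam k) (fun u => Bq k (X w u)) 0 s)) T0).
    by apply: cont_onB; apply: cont_onB => //; exact: cV.
  move=> i j; rewrite (hY i j nK' k) (mX _ (tim_in i j (ltW T0)) k)/=.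
  exact: sub_shift0.
have mY : mild_path xpredT T xi (bW w) (fun k s => Bq k (Y s w)) (Y ^~ w).
  move=> s sT k /=; have := key k s sT; rewrite (mX s sT k)/=; exact: sub_shift_eq.
apply: (mild_unique T0 mY mX (D := D1 + D2)) => //.
- by move=> s sT; apply: (le_trans (YD s sT)); rewrite lerDl.
- by move=> s sT; apply: (le_trans (XD s sT)); rewrite lerDr.
- by move=> k; exact: cont_on_measurable.
- by move=> k; exact: cont_on_measurable.
Qed.

(** Split at a noise level L: below it convergence is uniform; above it the polynomial bound is
    multiplied by (1 + K) / (1 + L) >= 1, so its mean is at most a constant over 1 + L. *)
Lemma solution_converges p : 0 < p ->
  limn_esup (fun n => ereal_sup [set ('E_P[fun w => (hnorm (X w t - Xn n t w) `^ p)%R])%E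
    | t in [set t : R | 0 <= t <= T]]) = 0%E.
Proof.
move=> p0; have [C0 [q [C00 hC]]] := limit_bound_H Axi xi al01 ga0 bb8 bbr chi0 p201 bp2 chip2 rho4 rag T0 h_gt0.
pose C := 1 + C0; have C1 : 1 <= C by rewrite lerDl ltW.
pose p' := (Num.bound p).+1.
have pp' : p <= p'%:R by apply: ltW; apply: lt_le_trans (archi_boundP (ltW p0)) _; rewrite ler_nat.
(* The exponent 2 m must cover q p' for the p'-th power of the polynomial bound, plus one for the
   factor gained above the level L. *)
have [m1 [m10 mal1]] := large_moment; pose m := (m1 + (q * p').+1)%N.
have m0 : (0 < m)%N by rewrite ltn_addr.
have mal : 2 <= m%:R * (1 - 2 * al).
  apply: (le_trans mal1); rewrite ler_wpM2r//; first by move: al2; lra.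
  by rewrite ler_nat leq_addr.
have [B [b [mB B0 hb hB]]] := noise_moment m0 mal.
have b0 : 0 <= b.
  by rewrite -lee_fin; apply: le_trans hb; apply: integral_ge0 => w _; rewrite lee_fin.
have mE n t : (0 < n)%N -> 0 <= t <= T -> measurable_fun setT (fun w => hnorm (X w t - Xn n t w) `^ p).
  move=> n0 tT; apply: (measurableT_comp (measurable_powR p)); apply: hnorm_measurable => // k.
  under eq_fun do rewrite ipBr.
  by apply: measurable_funB; [exact: solution_measurable|exact: Xn_coord_measurable].
apply: (@limn_esup_eq0 _ _ 1) => [n n0|eps eps0].
  have tT : 0 <= (0 : R) <= T by rewrite lexx ltW.
  apply: (@le_trans _ _ ('E_P[fun w => (hnorm (X w 0 - Xn n 0 w) `^ p)%R])%E).
    by rewrite unlock; apply: integral_ge0 => w _; rewrite lee_fin powR_ge0.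
  by apply: ereal_sup_ubound; exists 0.
have eps2 : 0 < eps / 2 by rewrite divr_gt0.
pose c := C ^+ p'; have c0 : 0 <= c by rewrite exprn_ge0// (le_trans _ C1).
(* With this level the part above L contributes c b / (1 + L) <= eps / 2. *)
pose L := c * b / (eps / 2); have L0 : 0 <= L by apply: divr_ge0; [exact: mulr_ge0|exact: ltW].
have L1 : 0 < 1 + L by rewrite ltr_pwDl.
have e10 : 0 < (eps / 2) `^ p^-1 by rewrite powR_gt0.
have [N hN] := limit_unif al01 ga0 bb8 bbr chi0 p201 bp2 chip2 rho4 rag T0 xiA h_gt0 h_cvg L e10.
exists (maxn N 1) => n; rewrite geq_max => /andP[Nn n0].
apply: ge_ereal_sup => _ [t tT <-].
have bound : {ae P, forall w, setT w -> ((hnorm (X w t - Xn n t w) `^ p)%:E <= (eps / 2 + c / (1 + L) * B w)%:E)%E}.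
  apply: aeS2 hB (aeI aG (solves_ae n0 tT)) => w [K [K0 nK KB]] [Gw hs] _.
  have nK' : exists K, noise al ga K (bW w) by exists K.
  rewrite -(appE n0 tT (hs nK')) lee_fin -hnormN opprB.
  have gG := G_goods Gw; have lX := (XP w).1 Gw.
  have cB : 0 <= c / (1 + L) * B w by rewrite mulr_ge0// divr_ge0// ltW.
  have [KL|/ltW LK] := leP K L.
    apply: (@le_trans _ _ (eps / 2)); last by rewrite lerDl.
    apply: powR_root_le => //; [exact: ltW|exact: hnorm_ge0|].
    exact: hN (noise_wid KL nK) gG lX n Nn n0 t tT.
  have K1 : 1 <= 1 + K by rewrite lerDl.
  have hx := hC _ _ _ _ _ nK gG lX n t n0 tT.
  have y1 : 1 <= C * (1 + K) ^+ q by rewrite (le_trans C1)// ler_peMr ?exprn_ege1// (le_trans _ C1).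
  apply: (@le_trans _ _ ((C * (1 + K) ^+ q) `^ p)).
    apply: ge0_ler_powR; [exact: ltW|by rewrite nnegrE hnorm_ge0|by rewrite nnegrE (le_trans _ y1)|].
    by apply: (le_trans hx); rewrite ler_wpM2r ?exprn_ge0 ?(le_trans _ K1)// lerDr.
  apply: (@le_trans _ _ ((C * (1 + K) ^+ q) ^+ p')).
    by rewrite -[leRHS]powR_mulrn ?(le_trans _ y1)// ler_powR.
  rewrite exprMn -/c; apply: (@le_trans _ _ (c / (1 + L) * B w)); last by rewrite lerDr ltW.
  rewrite -mulrA ler_wpM2l// mulrC ler_pdivlMr//; apply: le_trans KB.
  apply: (@le_trans _ _ ((1 + K) ^+ (q * p').+1)).
    by rewrite exprSr exprM ler_wpM2l ?lerD2l// !exprn_ge0// (le_trans _ K1).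
  by rewrite ler_weXn2l// /m mulnDr; apply: leq_trans (leq_addl _ _); rewrite leq_pmull.
rewrite unlock.
apply: (@le_trans _ _ (\int[P]_w (eps / 2 + c / (1 + L) * B w)%:E)%E).
  apply: ae_ge0_le_integral bound => //.
  - by move=> w _; rewrite lee_fin powR_ge0.
  - exact/measurable_EFinP/mE.
  - by move=> w _; rewrite lee_fin addr_ge0 ?(ltW eps2)// mulr_ge0// divr_ge0// ltW.
  - by apply/measurable_EFinP/measurable_funD => //; exact: measurable_funM.
have cL0 : 0 <= c / (1 + L) by rewrite divr_ge0// ltW.
under eq_integral do rewrite EFinD.
rewrite ge0_integralD//; last 3 first.
- by move=> w _; rewrite lee_fin ltW.
- by move=> w _; rewrite lee_fin mulr_ge0.
- by apply/measurable_EFinP; exact: measurable_funM.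
rewrite integral_cst// [X in (_ * X)%E]probability_setT mule1.
under eq_integral do rewrite EFinM.
rewrite ge0_integralZl//; last 2 first.
- exact/measurable_EFinP.
- by move=> w _; rewrite lee_fin.
apply: (@le_trans _ _ ((eps / 2)%:E + (c / (1 + L))%:E * b%:E)%E).
  by rewrite leeD2l// lee_wpmul2l ?lee_fin.
rewrite -EFinM -EFinD lee_fin [leRHS](splitr eps) lerD2l mulrAC ler_pdivrMr//.
have -> : c * b = L * (eps / 2) by rewrite /L divfK// gt_eqF.
by rewrite mulrC ler_wpM2l ?(ltW eps2)// lerDr.
Qed.

End Solution.

Lemma mild_solution_limit : exists X : R -> Omega -> H,
  [/\ mild_solution P emb e W F T rho xi X,
      forall Y, mild_solution P emb e W F T rho xi Y -> {ae P, forall w t, 0 <= t <= T -> Y t w = X t w}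
    & forall p : R, 0 < p ->
        limn_esup (fun n => ereal_sup [set ('E_P[fun w => (hnorm (X t w - Xn n t w) `^ p)%R])%E
          | t in [set t : R | 0 <= t <= T]]) = 0%E].
Proof.
have [G [mG aG GP]] := good_set; have [X XP] := solution_exists GP.
exists (fun t w => X w t); split.
- exact: (solution_mild mG aG GP XP).
- by move=> Y hY; exact: (solution_unique aG GP XP hY).
- by move=> p p0; exact: (solution_converges mG aG GP XP p0).
Qed.

End Main.

Theorem theorem1p1 (R : realType)
  (T rho chi : R)
  (T_gt0 : 0 < T)
  (rho_bounds : 8^-1 < rho /\ rho < 4^-1)
  (chi_bounds : 0 < chi /\ chi <= rho / 2 - 16^-1)
  (Hneg : R -> completeNormedModType R)
  (emb : forall r : R, {linear L2 R -> Hneg r})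
  (Hneg_interpolation : negative_interpolation_spaces emb)
  (xi : L2 R)
  (xi_dom : Hdom 2^-1 xi)
  (F : L2 R -> Hneg (- 2^-1))
  (e : nat -> L2 R)
  (Pn : nat -> {linear L2 R -> L2 R})
  (h : nat -> R)
  (F_def : forall v, Hdom 8^-1 v ->
     F v = - (2^-1 *: distr_deriv emb (sqrL2 v)))
  (e_def : forall n, (0 < n)%N ->
     e n = toL2 (fun x : R => Num.sqrt 2 * sin (n%:R * pi * x)))
  (Pn_def : forall n v, (0 < n)%N ->
     Pn n v = \sum_(1 <= k < n.+1) ip (e k) v *: e k)
  (h_bounds : forall n, (0 < n)%N -> 0 < h n /\ h n <= T)
  (h_limsup : limn_esup (fun m => (h m)%:E) = 0%E)
  (d : measure_display) (Omega : measurableType d) (P : probability Omega R)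
  (W : R -> L2 R -> Omega -> R)
  (W_wiener : cylindrical_wiener P T W)
  (Xn On : nat -> R -> Omega -> L2 R)
  (Xn_process : forall n t, (0 < n)%N -> 0 <= t <= T ->
     random_element (range (Pn n)) (@hnorm R) (Xn n t))
  (On_process : forall n t, (0 < n)%N -> 0 <= t <= T ->
     random_element (range (Pn n)) (@hnorm R) (On n t))
  (On_def : forall n t, (0 < n)%N -> 0 <= t <= T ->
     is_stochastic_integral P e W t
       (fun s v => Pn n (semigroup (t - s) v)) (On n t))
  (Xn_def : forall n t, (0 < n)%N -> 0 <= t <= T ->
     {ae P, forall w, exists2 I,
        is_bochner_integral `[0, t]
          (fun s => let r := floor_grid (h n) s in
             (if Hnorm rho (Xn n r w)
                 + Hnorm rho (On n r w + Pn n (semigroup r xi))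
                 <= `|h n| `^ (- chi) then 1 else 0)
             *: Pn n (semigroup_ext emb (t - s) (F (Xn n r w)))) I
        & Xn n t w = Pn n (semigroup t xi) + I + On n t w}) :
  exists X : R -> Omega -> L2 R,
    [/\ mild_solution P emb e W F T rho xi X,
        forall Y, mild_solution P emb e W F T rho xi Y ->
          {ae P, forall w t, 0 <= t <= T -> Y t w = X t w}
      & forall p : R, 0 < p ->
          limn_esup (fun n => ereal_sup
            [set ('E_P[fun w => (hnorm (X t w - Xn n t w) `^ p)%R])%E
               | t in [set t : R | 0 <= t <= T]]) = 0%E].
Proof.
have [rho8 rho4] := rho_bounds; have [chi0 chi2] := chi_bounds.
have eE k : e k.+1 = en k by rewrite e_def.
have Pn_coord n v k : (0 < n)%N -> ip (en k) (Pn n v) = if (k < n)%N then ip (en k) v else 0.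
  move=> n0; rewrite Pn_def// big_add1/= big_mkord ip_sumr.
  have [kn|nk] := ltnP k n.
    rewrite (bigD1 (Ordinal kn))//= eE ipZr en_orth eqxx mulr1 big1 ?addr0// => i ik.
    by rewrite eE ipZr en_orth0 ?mulr0// eq_sym.
  by rewrite big1// => i _; rewrite eE ipZr en_orth0 ?mulr0// neq_ltn (leq_trans (ltn_ord i) nk) orbT.
(* The second bound gives bb < rho - chi, as chi <= rho/2 - 1/16; the third leaves room for an
   exponent between rho - 1/8 >= 2 chi and 1/4 - bb. *)
have [bb [bb8 bbr bb3]] : exists bb : R, [/\ 8^-1 < bb, bb < rho / 2 + 16^-1 & bb < 3 * 8^-1 - rho].
  exists (8^-1 + Num.min ((rho - 8^-1) / 4) ((4^-1 - rho) / 2)).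
  have d0 : 0 < Num.min ((rho - 8^-1) / 4) ((4^-1 - rho) / 2).
    by rewrite lt_min !divr_gt0 ?subr_gt0.
  have d1 : Num.min ((rho - 8^-1) / 4) ((4^-1 - rho) / 2) <= (rho - 8^-1) / 4 by rewrite ge_min lexx.
  have d2 : Num.min ((rho - 8^-1) / 4) ((4^-1 - rho) / 2) <= (4^-1 - rho) / 2 by rewrite ge_min lexx orbT.
  by split; lra.
have xiA := Hnorm_l2le xi_dom (lexx _).
(* With delta = (1/4 - rho) / 4 the noise exponents are al = 1/2 - delta and ga = 1/4 + delta, so al
   - ga = rho + 2 delta and the time regularity p3 = delta fits. The exponent p2 is the midpoint of
   rho - 1/8 and 1/4 - bb. *)
apply: (@mild_solution_limit _ T rho chi T_gt0 rho8 rho4 Hneg emb Hneg_interpolation xi F e Pn h F_def eE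
  Pn_coord (fun n n0 => (h_bounds n n0).1) (limsup_le h_limsup) d Omega P W W_wiener Xn On Xn_process
  On_process On_def Xn_def (2^-1 - (4^-1 - rho) / 4) (4^-1 + (4^-1 - rho) / 4) bb ((rho + 8^-1 - bb) / 2)
  (Hnorm 2^-1 xi) _ _ _ _ _ _ _ _ _ ((4^-1 - rho) / 4)) => //; try lra.
Qed.
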